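(* Let $N\in\{2,3\}$, let $\Omega=\mathcal{T}^N$ be the flat torus, and let $p\in C^1(0,\infty)\cap C[0,\infty)$ satisfy $p'(\varrho)>0$ whenever $\varrho>0$. Let $\overline{\varrho}>0$ be a constant and let $\mathbf{v}_0\in W^{k,2}(\mathcal{T}^N;\mathbb{R}^N)$ with $k>\frac N2+1$ and $\mathrm{div}_x\mathbf{v}_0=0$. Let $T_{\max}\in(0,\infty]$ be the life span of the solution $\mathbf{v}$ of the incompressible Euler system with initial datum $\mathbf{v}_0$ (see context), and let $0<T<T_{\max}$. For each $\varepsilon>0$ let $\{Y^\varepsilon_{t,x}\}_{t\in[0,T],\,x\in\mathcal{T}^N}$, with dissipation defect $\mathcal{D}^\varepsilon$, be a dissipative measure-valued (DMV) solution on $(0,T)\times\mathcal{T}^N$ of the rescaled compressible Euler system $$\partial_t\varrho+\mathrm{div}_x(\varrho\mathbf{u})=0,\qquad \partial_t(\varrho\mathbf{u})+\mathrm{div}_x(\varrho\mathbf{u}\otimes\mathbf{u})+\frac1{\varepsilon^2}\nabla_xp(\varrho)=0,$$ such that the compatibility condition in the definition of DMV solution holds with a function $\xi\in L^1(0,T)$ independent of $\varepsilon$. Suppose that the initial data are well-prepared, i.e. $$\int_{\mathcal{T}^N}\left\langle Y^\varepsilon_{0,x};\ \frac12\varrho\left|\frac{\mathbf{m}}{\varrho}-\mathbf{v}_0(x)\right|^2+\frac1{\varepsilon^2}\Big(P(\varrho)-P'(\overline{\varrho})(\varrho-\overline{\varrho})-P(\overline{\varrho})\Big)\right\rangle dx\to0\quad\text{as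 }\varepsilon\to0.$$ Then, as $\varepsilon\to0$, $$\mathcal{D}^\varepsilon\to0\ \text{ in }L^\infty(0,T)$$ and $$\operatorname*{ess\,sup}_{t\in(0,T)}\int_{\mathcal{T}^N}\left\langle Y^\varepsilon_{t,x};\ \frac12\varrho\left|\frac{\mathbf{m}}{\varrho}-\mathbf{v}(t,x)\right|^2+\frac1{\varepsilon^2}\Big(P(\varrho)-P'(\overline{\varrho})(\varrho-\overline{\varrho})-P(\overline{\varrho})\Big)\right\rangle dx\to0.$$
   Context: **Domain and notation.** $\mathcal{T}^N=([-1,1]|_{\{-1,1\}})^N$ is the flat torus (periodic boundary conditions). $W^{k,2}$ are the usual $L^2$-based Sobolev spaces of order $k$. The phase space is $\mathcal{Q}=\{[\varrho,\mathbf{m}]:\varrho\in[0,\infty),\ \mathbf{m}\in\mathbb{R}^N\}$ ($\mathbf{m}$ plays the role of the momentum $\varrho\mathbf{u}$). $\mathcal{P}(\mathcal{Q})$ is the set of Borel probability measures on $\mathcal{Q}$, $\mathcal{M}$ denotes spaces of finite signed (vector- or matrix-valued) Radon measures, $|\mu|$ is the total variation measure, and $\langle Y;F(\varrho,\mathbf{m})\rangle=\int_{\mathcal{Q}}F\,dY$ for a probability measure $Y$ on $\mathcal{Q}$. **Pressure potential.** $P(\varrho)=\varrho\int_1^\varrho\frac{p(z)}{z^2}\,dz$ for $\varrho>0$, extended continuously to $\varrho=0$. **Vacuum convention.** $\frac{|\mathbf{m}|^2}{\varrho}=0$ if $\varrho\ge0$ and $\mathbf{m}=0$, and $\frac{|\mathbf{m}|^2}{\varrho}=\infty$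 if $\varrho=0$ and $\mathbf{m}\neq0$; likewise $\frac{\mathbf{m}\otimes\mathbf{m}}{\varrho}=0$ if $\mathbf{m}=0$. The expression $\frac12\varrho|\frac{\mathbf{m}}{\varrho}-\mathbf{U}|^2$ is understood as $\frac12\frac{|\mathbf{m}|^2}{\varrho}-\mathbf{m}\cdot\mathbf{U}+\frac12\varrho|\mathbf{U}|^2$. **DMV solution of the rescaled system (Mach number $\varepsilon$), $\Omega=\mathcal{T}^N$.** It consists of a parameterized family of probability measures $Y^\varepsilon_{t,x}$, $Y^\varepsilon\in L^\infty_{\mathrm{weak}-( * )}((0,T)\times\Omega;\mathcal{P}(\mathcal{Q}))$, together with initial measures $Y^\varepsilon_{0,x}\in\mathcal{P}(\mathcal{Q})$, $x\in\Omega$, a non-negative function $\mathcal{D}^\varepsilon\in L^\infty(0,T)$ (the dissipation defect), and signed measures $\mu^{C,\varepsilon}_D\in\mathcal{M}([0,T]\times\Omega;\mathbb{R}^N)$, $\mu^{M,\varepsilon}_D\in\mathcal{M}([0,T]\times\Omega;\mathbb{R}^{N\times N})$ (the concentration defects), such that (all integrals below being well defined): 1. (Continuity) For all $\varphi\in C_c^\infty([0,T)\times\Omega)$, $$\int_0^T\!\!\int_\Omega\big[\langle Y^\varepsilon_{t,x};\varrho\rangle\partial_t\varphi+\langle Y^\varepsilon_{t,x};\mathbf{m}\rangle\cdot\nabla_x\varphi\big]dx\,dt=-\int_\Omega\langle Y^\varepsilon_{0,x};\varrho\rangle\varphi(0,\cdot)\,dx-\int_{[0,T]\times\Omega}\nabla_x\varphi\cdot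 d\mu^{C,\varepsilon}_D.$$ 2. (Momentum) For all $\boldsymbol{\varphi}\in C_c^\infty([0,T)\times\Omega;\mathbb{R}^N)$, $$\int_0^T\!\!\int_\Omega\Big[\langle Y^\varepsilon_{t,x};\mathbf{m}\rangle\cdot\partial_t\boldsymbol{\varphi}+\Big\langle Y^\varepsilon_{t,x};\frac{\mathbf{m}\otimes\mathbf{m}}{\varrho}\Big\rangle:\nabla_x\boldsymbol{\varphi}+\frac1{\varepsilon^2}\langle Y^\varepsilon_{t,x};p(\varrho)\rangle\,\mathrm{div}_x\boldsymbol{\varphi}\Big]dx\,dt=-\int_\Omega\langle Y^\varepsilon_{0,x};\mathbf{m}\rangle\cdot\boldsymbol{\varphi}(0,\cdot)\,dx-\int_{[0,T]\times\Omega}\nabla_x\boldsymbol{\varphi}:d\mu^{M,\varepsilon}_D.$$ 3. (Energy inequality) For a.a. $\tau\in(0,T)$, $$\int_\Omega\Big\langle Y^\varepsilon_{\tau,x};\tfrac12\tfrac{|\mathbf{m}|^2}{\varrho}+\tfrac1{\varepsilon^2}\big(P(\varrho)-P'(\overline\varrho)(\varrho-\overline\varrho)-P(\overline\varrho)\big)\Big\rangle dx+\mathcal{D}^\varepsilon(\tau)\le\int_\Omega\Big\langle Y^\varepsilon_{0,x};\tfrac12\tfrac{|\mathbf{m}|^2}{\varrho}+\tfrac1{\varepsilon^2}\big(P(\varrho)-P'(\overline\varrho)(\varrho-\overline\varrho)-P(\overline\varrho)\big)\Big\rangle dx.$$ (On the torus the constant $\overline\varrho>0$ in this inequality can be taken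 arbitrary.) 4. (Compatibility condition) There is $\xi\in L^1(0,T)$ such that for a.a. $\tau\in[0,T]$, $$|\mu^{C,\varepsilon}_D|([0,\tau]\times\Omega)+|\mu^{M,\varepsilon}_D|([0,\tau]\times\Omega)\le\int_0^\tau\xi(t)\mathcal{D}^\varepsilon(t)\,dt.$$ **Incompressible Euler system.** $\mathrm{div}_x\mathbf{v}=0$, $\partial_t\mathbf{v}+\mathbf{v}\cdot\nabla_x\mathbf{v}+\nabla_x\Pi=0$, $\mathbf{v}(0,\cdot)=\mathbf{v}_0$. By Kato's classical result, for $\mathbf{v}_0\in W^{k,2}(\Omega;\mathbb{R}^N)$, $k>\frac N2+1$, $\mathrm{div}_x\mathbf{v}_0=0$, there is a solution, unique in the class $\mathbf{v}\in C([0,T_{\max});W^{k,2}(\Omega;\mathbb{R}^N))$, $\partial_t\mathbf{v},\partial_t\Pi,\nabla_x\Pi\in C([0,T_{\max});W^{k-1,2})$, for some $T_{\max}>0$ ($T_{\max}=\infty$ if $N=2$); $\mathbf{v}$ and its life span $T_{\max}$ refer to this solution. *)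

(* Defs.v *)
From HB Require Import structures.
From mathcomp Require Import all_boot all_order all_algebra.
From mathcomp Require Import all_classical all_reals all_analysis.
From mathcomp Require Import ess_sup_inf.

Set Implicit Arguments.
Unset Strict Implicit.
Unset Printing Implicit Defensive.

Import Order.TTheory GRing.Theory Num.Theory.
Import numFieldNormedType.Exports.

Local Open Scope classical_set_scope.
Local Open Scope ring_scope.

(* The Borel sigma-algebra of R^n, generated by the coordinate functions. *)
Definition measure_rV_display : measure_display -> measure_display.
Proof. exact. Qed.

Section measurable_rV.
Context {R : realType}.
Variable n : nat.

Let coor (i : 'I_n) (x : 'rV[R]_n) : R := x ord0 i.

Let rV_set0 : g_sigma_preimage coor set0.
Proof. exact: sigma_algebra0. Qed.

Let rV_setC A : g_sigma_preimage coor A -> g_sigma_preimage coor (~` A).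
Proof. exact: sigma_algebraC. Qed.

Let rV_bigcup (F : (set 'rV[R]_n)^nat) : (forall i, g_sigma_preimage coor (F i)) ->
  g_sigma_preimage coor (\bigcup_i (F i)).
Proof. exact: sigma_algebra_bigcup. Qed.

HB.instance Definition _ := @isMeasurable.Build (measure_rV_display default_measure_display)
  'rV[R]_n (g_sigma_preimage coor) rV_set0 rV_setC rV_bigcup.

End measurable_rV.

Lemma measurable_coord {R : realType} n (i : 'I_n) :
  measurable_fun [set: 'rV[R]_n] (fun x => x ord0 i).
Proof.
move=> _ Y mY; rewrite setTI; apply: sub_sigma_algebra => /=.
rewrite -bigcup_seq/=; exists i => /=; first by rewrite mem_index_enum.
by exists Y => //; rewrite setTI.
Qed.

Lemma measurable_fun_rVP {R : realType} d (T : measurableType d) n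
    (f : T -> 'rV[R]_n) :
  (forall i, measurable_fun [set: T] (fun z => f z ord0 i)) ->
  measurable_fun [set: T] f.
Proof.
move=> mf _ A mA.
suff : g_sigma_preimage (fun (i : 'I_n) (x : 'rV[R]_n) => x ord0 i) `<=`
       [set B | measurable ([set: T] `&` f @^-1` B)] by apply.
apply: smallest_sub.
  split=> /=.
  - by rewrite preimage_set0 setI0.
  - move=> B; rewrite !setTI setTD preimage_setC; exact: measurableC.
  - move=> F mF; rewrite setTI preimage_bigcup; apply: bigcupT_measurable => k.
    by have := mF k; rewrite setTI.
rewrite -bigcup_seq => B [i _ [C mC <-]] /=.
rewrite [X in _ `&` (_ @^-1` X)]setTI -comp_preimage.
exact: mf.
Qed.

Section lebesgue_rV.
Context {R : realType}.

Definition cons_rV n (z : measurableTypeR R * 'rV[R]_n) : 'rV[R]_n.+1 :=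
  \row_j oapp (z.2 ord0) z.1 (unlift ord0 j).

Lemma measurable_cons_rV n : measurable_fun setT (@cons_rV n).
Proof.
apply: measurable_fun_rVP => i; rewrite /cons_rV.
have [j ->|->] := unliftP ord0 i; last first.
  by under eq_fun do rewrite mxE unlift_none/=; exact: measurable_fst.
under eq_fun do rewrite mxE liftK/=.
apply: (@measurableT_comp _ _ _ _ _ _ (fun x : 'rV[R]_n => x ord0 j)) => //.
exact: measurable_coord.
Qed.

Section cons_measure.
Variables (n : nat) (m : {sigma_finite_measure set 'rV[R]_n -> \bar R}).

Definition cons_measure : set 'rV[R]_n.+1 -> \bar R :=
  pushforward (@lebesgue_measure R \x m)%E (@cons_rV n).

HB.instance Definition _ := Measure.copy cons_measure
  (@measure_function_pushforward__canonical__measure_function_Measure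
    _ _ _ _ _ (lebesgue_measure \x m)%E _ (@measurable_cons_rV n)).

Let uncons (x : 'rV[R]_n.+1) : measurableTypeR R * 'rV[R]_n :=
  (x ord0 ord0, \row_j x ord0 (lift ord0 j)).

Let measurable_uncons : measurable_fun setT uncons.
Proof.
apply/measurable_fun_pairP; split; first exact: measurable_coord.
apply: measurable_fun_rVP => i; rewrite /uncons/=.
under eq_fun do rewrite mxE.
exact: measurable_coord.
Qed.

Let cons_rVK : cancel (@cons_rV n) uncons.
Proof.
move=> [t x]; rewrite /uncons /cons_rV mxE unlift_none/=; congr (_, _).
by apply/rowP => j; rewrite !mxE liftK.
Qed.

Let cons_measure_sigma_finite : sigma_finite setT cons_measure.
Proof.
have /sigma_finiteP[F [TF ndF Foo]] := sigma_finiteT (@lebesgue_measure R).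
have /sigma_finiteP[G [TG ndG Goo]] := sigma_finiteT m.
exists (fun k => uncons @^-1` (F k `*` G k)).
  apply/esym; rewrite -preimage_bigcup -subTset => x _ /=.
  have /=[k _ Fk] : (\bigcup_i F i) (uncons x).1 by rewrite -TF.
  have /=[l _ Gl] : (\bigcup_i G i) (uncons x).2 by rewrite -TG.
  exists (maxn k l) => //; split.
  - by move: Fk; exact/subsetPset/ndF/leq_maxl.
  - by move: Gl; exact/subsetPset/ndG/leq_maxr.
move=> k; have [? ?] := Foo k; have [? ?] := Goo k; split.
  rewrite -[X in measurable X]setTI.
  by apply: measurable_uncons => //; exact: measurableX.
rewrite /cons_measure /pushforward -comp_preimage.
rewrite (_ : uncons \o _ = id); last by apply/funext => z /=; rewrite cons_rVK.
by rewrite preimage_id product_measure1E// lte_mul_pinfty// ge0_fin_numE.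
Qed.

HB.instance Definition _ :=
  Measure_isSigmaFinite.Build _ _ _ cons_measure cons_measure_sigma_finite.

End cons_measure.

(* n-dimensional Lebesgue measure, as the iterated product
   lebesgue_measure \x (lebesgue_measure \x ...). *)
Fixpoint lebesgue_rV (n : nat) : {sigma_finite_measure set 'rV[R]_n -> \bar R} :=
  if n is n'.+1 then cons_measure (lebesgue_rV n') else \d_(0 : 'rV[R]_0).

End lebesgue_rV.
Arguments lebesgue_rV R n : clear implicits.

Section torus_calculus.
Context {R : realType}.

(* Iterated directional derivative along the list [vs]. *)
Definition Diter {V : normedModType R} (vs : seq V) (f : V -> R) : V -> R :=
  foldr (fun v g => 'D_v g) f vs.

Definition smooth {V : normedModType R} (f : V -> R) : Prop :=
  forall vs : seq V,
    continuous (Diter vs f) /\ forall x v, derivable (Diter vs f) x v.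

Variable N : nat.

Definition unitv (i : 'I_N) : 'rV[R]_N := delta_mx ord0 i.

Definition dotv (a b : 'rV[R]_N) : R := \sum_i a ord0 i * b ord0 i.

(* The torus ([-1,1]|_{-1,1})^N is represented by its fundamental domain
   [-1,1)^N.  A function on the torus is a function on R^N of which only the
   values on this domain matter; test functions are required to be periodic. *)
Definition torus : set 'rV[R]_N := [set x | forall i, -1 <= x ord0 i < 1].

Definition periodic (f : 'rV[R]_N -> R) : Prop :=
  forall i x, f (x + 2 *: unitv i) = f x.

Definition cylinder (T : R) : set (measurableTypeR R * 'rV[R]_N) :=
  `]0, T[ `*` torus.

Definition ccylinder (T : R) : set (measurableTypeR R * 'rV[R]_N) :=
  `[0, T] `*` torus.

Definition dxdt : set (measurableTypeR R * 'rV[R]_N) -> \bar R :=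
  (@lebesgue_measure R \x lebesgue_rV R N)%E.
HB.instance Definition _ := Measure.on dxdt.

Definition test_torus : set ('rV[R]_N -> R) :=
  [set phi | smooth phi /\ periodic phi].

(* C_c^oo([0,T) x torus): restrictions to t >= 0 of functions that are smooth
   on the whole of R x torus. *)
Definition test_cylinder (T : R) : set (R * 'rV[R]_N -> R) :=
  [set phi | [/\ smooth phi, (forall t, periodic (fun x => phi (t, x))) &
    exists2 T', T' < T & forall t x, T' <= t -> phi (t, x) = 0]].

Definition dt (phi : R * 'rV[R]_N -> R) : R * 'rV[R]_N -> R :=
  'D_((1, 0) : R * 'rV[R]_N) phi.

Definition dx (i : 'I_N) (phi : R * 'rV[R]_N -> R) : R * 'rV[R]_N -> R :=
  'D_((0, unitv i) : R * 'rV[R]_N) phi.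

End torus_calculus.

Arguments torus {R} N.
Arguments dxdt {R} N.
Arguments cylinder {R} N T.
Arguments ccylinder {R} N T.
Arguments test_torus {R} N.
Arguments test_cylinder {R} N T.
Arguments unitv {R N} i.

Section sobolev.
Context {R : realType} {N : nat}.
Implicit Types (f g : 'rV[R]_N -> R) (I : set R) (u w : R -> 'rV[R]_N -> R).

Definition L2 f : Prop :=
  measurable_fun (torus N) f /\
  (\int[lebesgue_rV R N]_(x in torus N) (f x ^+ 2)%:E < +oo)%E.

Definition L2norm f : R :=
  Num.sqrt (\int[lebesgue_rV R N]_(x in torus N) (f x ^+ 2)).

(* [g] is the weak derivative of [f] along the list of coordinates [al]. *)
Definition is_weak_deriv (al : seq 'I_N) f g : Prop :=
  [/\ L2 f, L2 g & forall phi, test_torus N phi ->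
    \int[lebesgue_rV R N]_(x in torus N) (f x * Diter (map unitv al) phi x) =
    (-1) ^+ size al * \int[lebesgue_rV R N]_(x in torus N) (g x * phi x)].

Definition weak_deriv (al : seq 'I_N) f : 'rV[R]_N -> R :=
  xget (cst 0) [set g | is_weak_deriv al f g].

(* W^{k,2}.  Mixed derivatives are indexed by lists of coordinates instead of
   multi-indices, so that in the norm each of them is counted with its
   multiplicity. *)
Definition sobolev (k : nat) f : Prop :=
  forall al : seq 'I_N, (size al <= k)%N -> exists g, is_weak_deriv al f g.

Definition sobolev_norm (k : nat) f : R :=
  Num.sqrt (\sum_(j < k.+1) \sum_(al : j.-tuple 'I_N)
    L2norm (weak_deriv al f) ^+ 2).

(* u \in C(I; W^{k,2}) *)
Definition C_sobolev I (k : nat) u : Prop :=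
  (forall t, I t -> sobolev k (u t)) /\
  (forall t, I t ->
    sobolev_norm k (fun x => u s x - u t x) @[s --> within I (nbhs t)] --> (0 : R)).

(* w = \partial_t u on I; the difference quotients converge in L^2. *)
Definition is_time_deriv I u w : Prop :=
  forall t, I t ->
    L2norm (fun x => (u s x - u t x) / (s - t) - w t x)
      @[s --> within I (dnbhs t)] --> (0 : R).

Definition divfree (v : 'rV[R]_N -> 'rV[R]_N) : Prop :=
  {ae lebesgue_rV R N, forall x, torus N x ->
    \sum_i weak_deriv [:: i] (fun y => v y ord0 i) x = 0}.

End sobolev.

Section euler.
Context {R : realType} {N : nat}.

(* Solutions on [0, S) in the class of Kato's theorem, with pressure [Pi],
   [vt] = \partial_t v and [Pit] = \partial_t Pi. *)
Definition kato_solution (k : nat) (v0 : 'rV[R]_N -> 'rV[R]_N) (S : \bar R)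
    (v : R -> 'rV[R]_N -> 'rV[R]_N) : Prop :=
  let I := [set t : R | 0 <= t /\ (t%:E < S)%E] in
  exists (Pi Pit : R -> 'rV[R]_N -> R) (vt : 'I_N -> R -> 'rV[R]_N -> R),
  [/\ (forall i, C_sobolev I k (fun t x => v t x ord0 i)),
      (forall i, is_time_deriv I (fun t x => v t x ord0 i) (vt i) /\
                 C_sobolev I k.-1 (vt i)),
      is_time_deriv I Pi Pit /\ C_sobolev I k.-1 Pit,
      (forall t, I t -> sobolev 1 (Pi t)) /\
      (forall i, C_sobolev I k.-1 (fun t => weak_deriv [:: i] (Pi t))) &
   [/\ (forall t, I t -> divfree (v t)),
      (forall t, I t -> forall i,
        {ae lebesgue_rV R N, forall x, torus N x ->
          vt i t x
          + \sum_j v t x ord0 j * weak_deriv [:: j] (fun y => v t y ord0 i) x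
          + weak_deriv [:: i] (Pi t) x = 0}) &
      {ae lebesgue_rV R N, forall x, torus N x -> v 0 x = v0 x}]].

(* [v] is the solution with datum [v0] and [Tmax] is its life span. *)
Definition maximal_kato_solution (k : nat) (v0 : 'rV[R]_N -> 'rV[R]_N)
    (Tmax : \bar R) (v : R -> 'rV[R]_N -> 'rV[R]_N) : Prop :=
  [/\ (0 < Tmax)%E, kato_solution k v0 Tmax v &
      forall S v', (Tmax < S)%E -> ~ kato_solution k v0 S v'].

End euler.

Section pressure.
Context {R : realType}.
Variable p : R -> R.

Definition pressure_law : Prop :=
  [/\ (forall r, 0 < r -> derivable p r 1),
      (forall r, 0 < r -> {for r, continuous (derive1 p)}),
      {within `[0, +oo[%classic, continuous p} &
      forall r, 0 < r -> 0 < derive1 p r].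

Definition pressure_potential_pos (r : R) : R :=
  r * (if 1 <= r
       then \int[lebesgue_measure]_(z in `[1, r]) (p z / z ^+ 2)
       else - \int[lebesgue_measure]_(z in `[r, 1]) (p z / z ^+ 2)).

Definition pressure_potential (r : R) : R :=
  if 0 < r then pressure_potential_pos r
  else lim (pressure_potential_pos s @[s --> 0^'+]).

(* P(rho) - P'(rhob)(rho - rhob) - P(rhob) *)
Definition rel_potential (rhob rho : R) : R :=
  pressure_potential rho - derive1 pressure_potential rhob * (rho - rhob)
  - pressure_potential rhob.

End pressure.

Section phase_space.
Context {R : realType} {N : nat}.
Implicit Types (q : R * 'rV[R]_N) (U : 'rV[R]_N).

Definition phase : set (R * 'rV[R]_N) := [set q | 0 <= q.1].

(* |m|^2/rho with the vacuum convention *)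
Definition m2_over_rho q : \bar R :=
  if q.2 == 0 then 0%E else if q.1 == 0 then +oo%E
  else (dotv q.2 q.2 / q.1)%:E.

(* Component (i,j) of (m (x) m)/rho.  It is 0 for m = 0; its value for rho = 0,
   m <> 0 has no meaning, that set is negligible whenever m2_over_rho is
   integrable. *)
Definition mm_over_rho (i j : 'I_N) q : R :=
  q.2 ord0 i * q.2 ord0 j / q.1.

Definition energy (p : R -> R) (rhob eps : R) q : \bar R :=
  ((2^-1)%:E * m2_over_rho q + (eps ^- 2 * rel_potential p rhob q.1)%:E)%E.

(* 1/2 rho |m/rho - U|^2 + eps^-2 (P(rho) - P'(rhob)(rho - rhob) - P(rhob)) *)
Definition rel_energy (p : R -> R) (rhob eps : R) U q : \bar R :=
  ((2^-1)%:E * m2_over_rho q + (- dotv q.2 U + 2^-1 * q.1 * dotv U U)%:E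
   + (eps ^- 2 * rel_potential p rhob q.1)%:E)%E.

(* <Y; F> for real-valued F *)
Definition moment (Y : probability (R * 'rV[R]_N)%type R)
    (F : R * 'rV[R]_N -> R) : R :=
  \int[Y]_(q in phase) F q.

Definition C0_phase : set (R * 'rV[R]_N -> R) :=
  [set f | {within phase, continuous f} /\
    forall e, 0 < e -> exists M, forall q, phase q -> M < `|q| -> `|f q| < e].

End phase_space.
Arguments phase {R} N.

Section defect_measures.
Context {d : measure_display} {X : measurableType d} {R : realType}.

Lemma Hahn_decomposition_pair (nu : {charge set X -> \bar R}) :
  exists PN : set X * set X, hahn_decomposition nu PN.1 PN.2.
Proof. by have [P [Q h]] := Hahn_decomposition nu; exists (P, Q). Qed.

(* \int_A f dnu for a signed measure nu, through its Jordan decomposition *)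
Definition charge_integral (nu : {charge set X -> \bar R}) (A : set X)
    (f : X -> R) : R :=
  let PN := projT2 (cid (Hahn_decomposition_pair nu)) in
  \int[jordan_pos PN]_(x in A) f x - \int[jordan_neg PN]_(x in A) f x.

(* |mu|(A) for a vector measure mu = (mu_i)_i, with respect to the Euclidean
   norm (Frobenius norm when [I] indexes the entries of a matrix) *)
Definition total_variation {I : finType} (mu : I -> {charge set X -> \bar R})
    (A : set X) : \bar R :=
  ereal_sup [set s | exists n (E : 'I_n -> set X),
    [/\ forall k, measurable (E k) /\ E k `<=` A,
        trivIset [set: 'I_n] E &
        s = (\sum_(k < n) Num.sqrt (\sum_i fine (mu i (E k)) ^+ 2))%:E]].

End defect_measures.

Section dmv_types.
Variables (R : realType) (N : nat).

(* t and x stand for points of (0,T) and of the torus *)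
Definition young := R -> 'rV[R]_N -> probability (R * 'rV[R]_N)%type R.
Definition young0 := 'rV[R]_N -> probability (R * 'rV[R]_N)%type R.
Definition defect := {charge set (measurableTypeR R * 'rV[R]_N)%type -> \bar R}.

End dmv_types.

Section dmv.
Context {R : realType} {N : nat}.
Local Notation young := (young R N).
Local Notation young0 := (young0 R N).
Local Notation defect := (defect R N).

(* Y \in L^oo_{weak-*}((0,T) x torus; P(Q)) *)
Definition weak_star_measurable (T : R) (Y : young) : Prop :=
  (forall t x, t \in `]0, T[ -> torus N x -> Y t x (phase N) = 1%E) /\
  (forall f, C0_phase f ->
    measurable_fun (cylinder N T) (fun z => moment (Y z.1 z.2) f)).

Definition weak_star_measurable0 (Y0 : young0) : Prop :=
  (forall x, torus N x -> Y0 x (phase N) = 1%E) /\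
  (forall f, C0_phase f ->
    measurable_fun (torus N) (fun x => moment (Y0 x) f)).

(* <Y; F> is well defined and locally integrable in [0,T) x torus, i.e.
   integrable against all test functions *)
Definition moment_L1loc (T : R) (Y : young) (F : R * 'rV[R]_N -> R) : Prop :=
  {ae dxdt N, forall z, cylinder N T z ->
    (Y z.1 z.2).-integrable (phase N) (EFin \o F)} /\
  (forall T', 0 < T' -> T' < T -> (dxdt N).-integrable (cylinder N T')
    (fun z => (moment (Y z.1 z.2) F)%:E)).

Definition moment_L1 (Y0 : young0) (F : R * 'rV[R]_N -> R) : Prop :=
  {ae lebesgue_rV R N, forall x, torus N x ->
    (Y0 x).-integrable (phase N) (EFin \o F)} /\
  (lebesgue_rV R N).-integrable (torus N) (fun x => (moment (Y0 x) F)%:E).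

Definition well_defined_moments (p : R -> R) (T : R) (Y : young) (Y0 : young0) :=
  [/\ moment_L1loc T Y fst /\ moment_L1 Y0 fst,
      forall i, moment_L1loc T Y (fun q => q.2 ord0 i) /\
                moment_L1 Y0 (fun q => q.2 ord0 i),
      forall i j, moment_L1loc T Y (mm_over_rho i j),
      {ae dxdt N, forall z, cylinder N T z ->
        (Y z.1 z.2).-integrable (phase N) m2_over_rho} &
      moment_L1loc T Y (fun q => p q.1)].

Definition continuity_equation (T : R) (Y : young) (Y0 : young0)
    (muC : 'I_N -> defect) : Prop :=
  forall phi, test_cylinder N T phi ->
    \int[dxdt N]_(z in cylinder N T)
      (moment (Y z.1 z.2) fst * dt phi z
       + \sum_i moment (Y z.1 z.2) (fun q => q.2 ord0 i) * dx i phi z)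
    = - \int[lebesgue_rV R N]_(x in torus N) (moment (Y0 x) fst * phi (0, x))
      - \sum_i charge_integral (muC i) (ccylinder N T) (dx i phi).

Definition momentum_equation (p : R -> R) (eps T : R) (Y : young) (Y0 : young0)
    (muM : 'I_N * 'I_N -> defect) : Prop :=
  forall phi : 'I_N -> R * 'rV[R]_N -> R, (forall i, test_cylinder N T (phi i)) ->
    \int[dxdt N]_(z in cylinder N T)
      (\sum_i moment (Y z.1 z.2) (fun q => q.2 ord0 i) * dt (phi i) z
       + \sum_i \sum_j moment (Y z.1 z.2) (mm_over_rho i j) * dx j (phi i) z
       + eps ^- 2 * moment (Y z.1 z.2) (fun q => p q.1) * \sum_i dx i (phi i) z)
    = - \int[lebesgue_rV R N]_(x in torus N)
          (\sum_i moment (Y0 x) (fun q => q.2 ord0 i) * phi i (0, x))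
      - \sum_i \sum_j
          charge_integral (muM (i, j)) (ccylinder N T) (dx j (phi i)).

Definition energy_inequality (p : R -> R) (rhob eps T : R) (Y : young)
    (Y0 : young0) (D : R -> R) : Prop :=
  {ae lebesgue_measure, forall tau : R, tau \in `]0, T[ ->
    (\int[lebesgue_rV R N]_(x in torus N)
        \int[Y tau x]_(q in phase N) energy p rhob eps q + (D tau)%:E <=
     \int[lebesgue_rV R N]_(x in torus N)
        \int[Y0 x]_(q in phase N) energy p rhob eps q)%E}.

Definition L1_interval (T : R) (xi : R -> R) : Prop :=
  lebesgue_measure.-integrable `]0, T[ (EFin \o xi).

(* Lebesgue measure on (0,T) *)
Definition lebesgue_itv (T : R) : {measure set (measurableTypeR R) -> \bar R} :=
  mrestr lebesgue_measure (measurable_itv (`]0, T[ : interval R)).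

Definition Linfty_norm (T : R) (f : R -> \bar R) : \bar R :=
  Lnorm (lebesgue_itv T) +oo%E f.

Definition ess_sup_itv (T : R) (f : R -> \bar R) : \bar R :=
  ess_sup (lebesgue_itv T) f.

Definition compatibility (T : R) (xi D : R -> R) (muC : 'I_N -> defect)
    (muM : 'I_N * 'I_N -> defect) : Prop :=
  {ae lebesgue_measure, forall tau : R, tau \in `[0, T] ->
    (total_variation muC (ccylinder N tau) + total_variation muM (ccylinder N tau)
     <= \int[lebesgue_measure]_(t in `]0%R, tau[) (xi t * D t)%:E)%E}.

Record dmv_solution (p : R -> R) (rhob T eps : R) (Y : young) (Y0 : young0)
    (D : R -> R) (muC : 'I_N -> defect) (muM : 'I_N * 'I_N -> defect) : Prop := {
  dmv_young : weak_star_measurable T Y;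
  dmv_young0 : weak_star_measurable0 Y0;
  dmv_defect_measurable : measurable_fun `]0, T[ D;
  dmv_defect_bounded : (Linfty_norm T (EFin \o D) < +oo)%E;
  dmv_defect_ge0 :
    {ae lebesgue_measure, forall t : R, t \in `]0, T[ -> 0 <= D t};
  dmv_well_defined : well_defined_moments p T Y Y0;
  dmv_continuity : continuity_equation T Y Y0 muC;
  dmv_momentum : momentum_equation p eps T Y Y0 muM;
  dmv_energy : energy_inequality p rhob eps T Y Y0 D;
  dmv_compatibility : exists2 xi, L1_interval T xi & compatibility T xi D muC muM
}.

End dmv.

(* Main.v *)
(* The Euler solution v is smooth enough (H^3 in dimension at most 3) for its
   Fourier sums to converge uniformly together with the first derivatives.
   Approximating the Fourier coefficients in time by polynomials gives smooth
   divergence-free fields U and pressures Pi that solve the Euler system up to a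
   uniformly small residual, with |U|, |DU|, |D Pi| <= M independently of the
   accuracy; these are admissible as test functions.

   Testing the momentum equation with U and the continuity equation with
   |U|^2/2 - Pi, cut off in time at a Lebesgue point, and adding the energy
   inequality, one controls X = (relative energy with respect to U) + D by
     X(t) <= A + int_0^t kap X,   kap = 2 N M + C_M |xi|.
   Indeed the flux (m - rho U) (x) (m - rho U) / rho : DU is dominated by the
   relative energy, the defect measures by int |xi| D, and the pressure Pi and
   U . D Pi + dt Pi have zero mean, so that they only see rho - rhob, which the
   potential energy makes small: |rho - rhob| <= d + C_d (P(rho) - P'(rhob)
   (rho - rhob) - P(rhob)).  Gronwall's inequality gives X <= C A with C
   independent of the approximation.  One first chooses the accuracy of U, then
   d, and then eps. *)

Require Import Defs.
From HB Require Import structures.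
From mathcomp Require Import all_boot all_order all_algebra.
From mathcomp Require Import all_classical all_reals all_analysis.
From mathcomp Require Import measurable_realfun ess_sup_inf ring lra zify.

Set Implicit Arguments.
Unset Strict Implicit.
Unset Printing Implicit Defensive.

Import Order.TTheory GRing.Theory Num.Theory.
Import numFieldNormedType.Exports.

Local Open Scope classical_set_scope.
Local Open Scope ring_scope.

(** * Trigonometric functions and Fourier sums on the torus *)

(** The singular term of the momentum equation is [eps ^- 2 * p(rho) * div U]. It disappears only
    for an exactly divergence-free test field, and this shapes the approximation: truncation to a
    box of frequencies keeps the relation [k . a_k = 0], and so does the Bernstein operator in time,
    which is linear and samples at points of [[0, T]]. The Bernstein polynomials replace the
    coefficients of the time derivative of v, and U is built from their primitives, so that dt U is
    close as well. Since [k > N/2 + 1] with [N = 2, 3] means [k >= 3], the velocity, its gradient,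
    its time derivative and the pressure gradient all lie in H^2. This suffices because the squares
    of [1 / (1 + |pi k|^2)] are summable for [N <= 3]. The Young measures are measurable only
    through moments of [C0_phase] functions, so the relative energy against v is not known to be
    measurable in x. It is compared with measurable quantities by the monotonicity of the integral
    of nonnegative functions, which holds without measurability. *)

Section torus_measure.
Context {R : realType}.

Lemma lebesgue_measure_co11 :
  lebesgue_measure (`[(-1 : R), 1[%classic : set (measurableTypeR R)) = 2%:E.
Proof.
rewrite lebesgue_measure_itv/= lte_fin (_ : (-1 < 1) = true); last first.
  by apply/idP; lra.
by rewrite -EFinB opprK.
Qed.

Lemma torus_eq (n : nat) : torus n = \bigcap_(i in [set: 'I_n])
  ((fun x : 'rV[R]_n => x ord0 i) @^-1` `[(-1 : R), 1[%classic).
Proof.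
apply/seteqP; split=> x /=.
  by move=> h i _ /=; rewrite in_itv/=; exact: h.
by move=> h i; have := h i I; rewrite /= in_itv.
Qed.

Lemma measurable_torus (n : nat) : measurable (torus n : set 'rV[R]_n).
Proof.
rewrite torus_eq; apply: fin_bigcap_measurable; first exact: finite_finset.
move=> i _; rewrite -[X in measurable X]setTI; apply: measurable_coord => //.
Qed.

Lemma torus_cons (n : nat) :
  @cons_rV R n @^-1` torus n.+1 = `[(-1 : R), 1[%classic `*` torus n.
Proof.
apply/seteqP; split=> [[t x]|[t x]] /=; rewrite /torus /cons_rV /=.
  move=> h; split=> /=.
    by have := h ord0; rewrite mxE unlift_none/= in_itv.
  by move=> i; have := h (lift ord0 i); rewrite mxE liftK.
rewrite in_itv/= => -[ht hx] i; rewrite mxE.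
by case: (unliftP ord0 i) => [j _|_] /=; [exact: hx|].
Qed.

Lemma lebesgue_rV_torus (n : nat) :
  lebesgue_rV R n (torus n) = (2 ^+ n)%:E.
Proof.
elim: n => [|n IH] /=.
  rewrite expr0 diracE mem_set//= => i; by case: i.
rewrite /cons_measure /pushforward torus_cons.
transitivity (lebesgue_measure (`[(-1 : R)%R, 1%R[%classic : set (measurableTypeR R)) *
    lebesgue_rV R n (torus n))%E.
  by apply: product_measure1E => //; exact: measurable_torus.
by rewrite IH lebesgue_measure_co11 exprS EFinM.
Qed.

Lemma torus_fin (n : nat) : (lebesgue_rV R n (torus n) < +oo)%E.
Proof. by rewrite lebesgue_rV_torus ltry. Qed.

Lemma bounded_integrable_torus (n : nat) (f : 'rV[R]_n -> R) (M : R) :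
  measurable_fun (torus n) f -> (forall x, torus n x -> `|f x| <= M) ->
  (lebesgue_rV R n).-integrable (torus n) (EFin \o f).
Proof.
move=> mf fM; apply: measurable_bounded_integrable => //.
- exact: measurable_torus.
- exact: torus_fin.
- exists M; split; first exact: num_real.
  by move=> y My x tx; apply: (le_trans (fM x tx)); exact: ltW.
Qed.

(** Base case of the induction on the dimension: ['rV_0] is a single point, so every function on it
    is measurable and the Dirac mass evaluates it. *)
Lemma Rintegral_torus0 (f : 'rV[R]_0 -> R) :
  \int[lebesgue_rV R 0]_(x in torus 0) f x = f 0.
Proof.
rewrite /Rintegral /=.
have t0 : torus 0 = [set: 'rV[R]_0].
  by apply/seteqP; split=> // x _ i; case: i.
have mf : measurable_fun [set: 'rV[R]_0] f.
  move=> _ B mB; rewrite setTI.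
  have [hB|hB] := pselect (B (f 0)).
    rewrite (_ : _ @^-1` _ = setT)//; apply/seteqP; split=> // x _ /=.
    by rewrite (_ : x = 0)//; apply/rowP; case.
  rewrite (_ : _ @^-1` _ = set0)//; apply/seteqP; split=> // x /=.
  by rewrite (_ : x = 0)//; apply/rowP; case.
rewrite integral_dirac//; last 2 first.
- exact: measurable_torus.
- by rewrite t0; exact/measurable_EFinP.
have -> : (\d_(0%R : 'rV[R]_0) (torus 0) = 1 :> \bar R)%E by rewrite diracE t0 mem_set.
by rewrite mul1e.
Qed.

(** Fubini after pulling back along [cons_rV]; a bounded function is integrable on the torus and on
    each of its slices because these have finite measure. *)
Lemma Rintegral_torusS (n : nat) (f : 'rV[R]_n.+1 -> R) (M : R) :
  measurable_fun setT f -> (forall x, `|f x| <= M) ->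
  \int[lebesgue_rV R n.+1]_(x in torus n.+1) f x =
  \int[lebesgue_measure]_(t in `[(-1 : R), 1[)
     \int[lebesgue_rV R n]_(x in torus n) f (cons_rV (t, x)).
Proof.
move=> mf fM.
have mfc : measurable_fun setT (f \o @cons_rV R n).
  by apply: measurableT_comp => //; exact: measurable_cons_rV.
have mI : measurable (`[(-1 : R), 1[%classic : set (measurableTypeR R)) by [].
have mIT : measurable (`[(-1 : R), 1[%classic `*` torus n :
    set (measurableTypeR R * 'rV[R]_n)).
  by apply: measurableX => //; exact: measurable_torus.
have intf : (lebesgue_measure \x lebesgue_rV R n)%E.-integrable
    (`[(-1 : R), 1[ `*` torus n) (EFin \o (f \o @cons_rV R n)).
  apply: measurable_bounded_integrable => //.
  - have := lebesgue_rV_torus n.+1.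
    rewrite [X in X = _]/= /cons_measure /pushforward torus_cons => h.
    by apply: (@le_lt_trans _ _ (2 ^+ n.+1)%:E); rewrite ?ltry// -h.
  - exact: measurable_funTS.
  - exists M; split; first exact: num_real.
    by move=> y My x tx; apply: (le_trans (fM _)); exact: ltW.
rewrite /Rintegral; congr fine.
rewrite [LHS](@integral_pushforward _ _ _ _ _ _ (@measurable_cons_rV R n)
  (lebesgue_measure \x lebesgue_rV R n)%E); last 3 first.
- exact/measurable_EFinP.
- by rewrite torus_cons.
- exact: measurable_torus.
rewrite torus_cons integral_mkcond -integral12_prod_meas1//=; last first.
  by apply/(integrable_mkcond _ mIT).
rewrite [RHS]integral_mkcond; apply: eq_integral => t _.
rewrite patchE; case: ifPn => [|] ht.
  rewrite fineK; last first.
    apply: integrable_fin_num; first exact: measurable_torus.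
    apply: (@bounded_integrable_torus _ _ M) => //.
    apply: measurable_funTS; apply: (measurableT_comp mfc).
    exact: pair1_measurable.
  rewrite [RHS]integral_mkcond; apply: eq_integral => x _.
  rewrite !patchE; move: ht; rewrite inE => ht.
  case: ifPn => [|]; rewrite ?(inE, notin_setE)/=; first by move=> [_ tx]; rewrite mem_set.
  by move=> h; rewrite memNset// => tx; apply: h; split.
rewrite /fubini_F integral0_eq// => x _; rewrite patchE; case: ifPn => //.
by rewrite inE/= => -[h _]; move: ht; rewrite notin_setE.
Qed.

End torus_measure.

(** * Cosines with a phase *)

Section trig.
Context {R : realType}.

Lemma sin_piMz (m : int) : sin (pi * m%:~R) = 0 :> R.
Proof.
have nat_case (j : nat) : sin (pi * j%:R) = 0 :> R.
  elim: j => [|j IH]; first by rewrite mulr0 sin0.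
  by rewrite -natr1 mulrDr mulr1 sinDpi IH oppr0.
case: m => j; first exact: nat_case.
by rewrite NegzE mulrNz mulrN sinN -[X in sin (pi * X)]/(j.+1%:R) nat_case oppr0.
Qed.

Lemma is_derive_continuous (f : R -> R) (x df : R) :
  is_derive x 1 f df -> f y @[y --> x] --> f x.
Proof.
by move=> -[dv _]; apply: differentiable_continuous; rewrite -derivable1_diffP.
Qed.

Lemma continuous_cosM (a b : R) : continuous (fun t : R => cos (a * t + b)).
Proof.
move=> t; apply: (@continuous_comp _ _ _ (fun t => a * t + b) cos).
  apply: cvgD; last exact: cvg_cst.
  by apply: cvgMr; exact: cvg_id.
exact: continuous_cos.
Qed.

Lemma integrable_cosM (a b : R) : lebesgue_measure.-integrable `[(-1 : R), 1[
  (EFin \o (fun t => cos (a * t + b))).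
Proof.
have intc : lebesgue_measure.-integrable `[(-1 : R), 1]
    (EFin \o (fun t => cos (a * t + b))).
  apply: continuous_compact_integrable; first exact: segment_compact.
  by apply: continuous_subspaceT; exact: continuous_cosM.
by apply: integrableS intc => //; exact: subset_itv_co_cc.
Qed.

Lemma Rintegral_cos_pi (m : int) (th : R) :
  \int[lebesgue_measure]_(t in `[(-1 : R), 1[) cos (pi * m%:~R * t + th) =
  if m == 0 then 2 * cos th else 0.
Proof.
have [->|m0] := eqVneq m 0.
  under eq_Rintegral do rewrite mulr0 mul0r add0r.
  by rewrite Rintegral_cst//= lebesgue_measure_co11 mulrC.
have pim : pi * m%:~R != 0 :> R by rewrite mulf_neq0 ?intr_eq0// gt_eqF// pi_gt0.
set c := pi * m%:~R in pim *.
have ct : {within `[(-1 : R), 1], continuous (fun t => cos (c * t + th))}.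
  by apply: continuous_subspaceT; exact: continuous_cosM.
rewrite Rintegral_itv_bndo_bndc; last exact: integrable_cosM.
have dF (t : R) : is_derive t 1 (fun t => c^-1 * sin (c * t + th)) (cos (c * t + th)).
  have d1 : is_derive t (1 : R) (fun t => c * t + th) c.
    apply: is_derive_eq; by rewrite /= !(scaler0, addr0) /GRing.scale /= mulr1.
  have d2 := @is_derive1_comp _ sin (fun t => c * t + th) t _ _
    (is_derive_sin (c * t + th)) d1.
  have d3 : is_derive t 1 (fun t => c^-1 * sin (c * t + th)) _ := is_deriveZ c^-1 d2.
  apply: (is_derive_eq d3).
  by rewrite /GRing.scale/= mulrCA mulVf// mulr1.
rewrite /Rintegral (@continuous_FTC2 _ _ (fun t => c^-1 * sin (c * t + th)))//.
- rewrite mulr1 mulrN1 -EFinB/= -mulrBr !sinD sinN cosN /c sin_piMz.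
  by rewrite oppr0 !mul0r !add0r subrr mulr0.
- split.
  + by move=> x _; have := dF x => -[].
  + by apply: cvg_at_right_filter; exact: is_derive_continuous (dF _).
  + by apply: cvg_at_left_filter; exact: is_derive_continuous (dF _).
- by move=> x _; rewrite derive1E; have := dF x => -[].
Qed.

(** The factor [pi] fits the period 2 of the torus. *)
Definition fdot n (k : 'rV[int]_n) (x : 'rV[R]_n) : R :=
  pi * \sum_i (k ord0 i)%:~R * x ord0 i.

(** The free phase puts sines and cosines in one family ([th = - (pi / 2)] is the sine).
    Differentiation shifts the phase by [pi / 2], and a product is a half sum of two members. *)
Definition ct n (k : 'rV[int]_n) (th : R) (x : 'rV[R]_n) : R := cos (fdot k x + th).

Lemma fdotDl n (k l : 'rV[int]_n) x : fdot (k + l) x = fdot k x + fdot l x.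
Proof.
rewrite /fdot -mulrDr -big_split/=; congr (_ * _); apply: eq_bigr => i _.
by rewrite mxE intrD mulrDl.
Qed.

Lemma fdotNl n (k : 'rV[int]_n) x : fdot (- k) x = - fdot k x.
Proof.
rewrite /fdot -mulrN -sumrN; congr (_ * _); apply: eq_bigr => i _.
by rewrite mxE mulrNz mulNr.
Qed.

Lemma fdotBl n (k l : 'rV[int]_n) x : fdot (k - l) x = fdot k x - fdot l x.
Proof. by rewrite fdotDl fdotNl. Qed.

Lemma fdot0l n (x : 'rV[R]_n) : fdot 0 x = 0.
Proof. by rewrite -(subrr 0) fdotBl subrr. Qed.

Lemma fdotDr n (k : 'rV[int]_n) x y : fdot k (x + y) = fdot k x + fdot k y.
Proof.
rewrite /fdot -mulrDr -big_split/=; congr (_ * _); apply: eq_bigr => i _.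
by rewrite mxE mulrDr.
Qed.

Lemma fdotZr n (k : 'rV[int]_n) a x : fdot k (a *: x) = a * fdot k x.
Proof.
rewrite /fdot mulrCA; congr (_ * _); rewrite mulr_sumr; apply: eq_bigr => i _.
by rewrite mxE mulrCA.
Qed.

Lemma fdot_unitv n (k : 'rV[int]_n) i : fdot k (unitv i) = pi * (k ord0 i)%:~R.
Proof.
rewrite /fdot (bigD1 i)//= big1 ?addr0 => [|j ji].
  by rewrite mxE !eqxx mulr1.
by rewrite mxE (negbTE ji) andbF mulr0.
Qed.

Lemma measurable_fdot n (k : 'rV[int]_n) : measurable_fun setT (fdot k).
Proof.
apply: measurable_funM => //; apply: measurable_sum => i.
by apply: measurable_funM => //; exact: measurable_coord.
Qed.

Lemma measurable_ct n (k : 'rV[int]_n) th : measurable_fun setT (ct k th).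
Proof.
apply: (@measurableT_comp _ _ _ _ _ _ cos).
  by apply: continuous_measurable_fun; exact: continuous_cos.
by apply: measurable_funD => //; exact: measurable_fdot.
Qed.

Lemma ct_le1 n (k : 'rV[int]_n) th x : `|ct k th x| <= 1.
Proof. exact: cos_max. Qed.

Lemma ctN n (k : 'rV[int]_n) th x : ct (- k) th x = ct k (- th) x.
Proof. by rewrite /ct fdotNl -cosN opprD opprK. Qed.

Lemma ct_expand n (k : 'rV[int]_n) th x :
  ct k th x = cos th * ct k 0 x - sin th * ct k (- (pi / 2)) x.
Proof. by rewrite /ct addr0 cosBpihalf cosD mulrC [X in _ - X]mulrC. Qed.

Lemma ctM n (k l : 'rV[int]_n) th th' x :
  ct k th x * ct l th' x = 2^-1 * (ct (k + l) (th + th') x + ct (k - l) (th - th') x).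
Proof.
rewrite /ct fdotDl fdotBl.
have -> : fdot k x + fdot l x + (th + th') = (fdot k x + th) + (fdot l x + th') by ring.
have -> : fdot k x - fdot l x + (th - th') = (fdot k x + th) - (fdot l x + th') by ring.
by rewrite [X in _ * (X + _)]cosD cosB; field.
Qed.

Definition rtail n (k : 'rV[int]_n.+1) : 'rV[int]_n := \row_i k ord0 (lift ord0 i).

Lemma fdot_cons n (k : 'rV[int]_n.+1) t x :
  fdot k (cons_rV (t, x)) = pi * (k ord0 ord0)%:~R * t + fdot (rtail k) x.
Proof.
rewrite /fdot big_ord_recl mxE unlift_none/= mulrDr mulrA; congr (_ + _ * _).
by apply: eq_bigr => i _; rewrite !mxE liftK.
Qed.

Lemma rtail_eq0 n (k : 'rV[int]_n.+1) :
  (k == 0) = (k ord0 ord0 == 0) && (rtail k == 0).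
Proof.
apply/idP/andP => [/eqP ->|[/eqP k0 /eqP k1]].
  by split; [rewrite mxE | apply/eqP/rowP => i; rewrite !mxE].
apply/eqP/rowP => i; rewrite mxE; case: (unliftP ord0 i) => [j ->|->//].
by have := congr1 (fun v : 'rV_n => v ord0 j) k1; rewrite !mxE.
Qed.

Lemma Rintegral_ct n (k : 'rV[int]_n) th :
  \int[lebesgue_rV R n]_(x in torus n) ct k th x =
  if k == 0 then 2 ^+ n * cos th else 0.
Proof.
elim: n => [|n IH] in k th *.
  rewrite Rintegral_torus0 /ct /fdot big_ord0 mulr0 add0r expr0 mul1r.
  by rewrite (_ : k = 0) ?eqxx//; apply/rowP; case.
rewrite (@Rintegral_torusS _ _ _ 1); [|exact: measurable_ct|by move=> x; exact: ct_le1].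
(* For a fixed first coordinate, the cosine is one in the remaining variables with a shifted
   phase. *)
have E t : \int[lebesgue_rV R n]_(x in torus n) ct k th (cons_rV (t, x)) =
    if rtail k == 0 then 2 ^+ n * cos (pi * (k ord0 ord0)%:~R * t + th) else 0.
  rewrite -IH; apply: eq_Rintegral => x _.
  by rewrite /ct fdot_cons; congr cos; ring.
under eq_Rintegral do rewrite E.
rewrite rtail_eq0; have [k1|k1] := eqVneq (rtail k) 0; last first.
  by rewrite andbF Rintegral_cst// mul0r.
rewrite andbT RintegralZl//; last exact: integrable_cosM.
rewrite Rintegral_cos_pi; case: ifP => _; last by rewrite mulr0.
by rewrite exprSr mulrA.
Qed.

End trig.

(** * Real-valued integrals and the Cauchy-Schwarz inequality *)

Section real_integrals.
Context d (T : measurableType d) (R : realType) (mu : {measure set T -> \bar R}).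
Variables (D : set T) (mD : measurable D).
Implicit Types f g : T -> R.
Local Notation intble f := (mu.-integrable D (EFin \o f)).

Lemma integrableRD f g : intble f -> intble g -> intble (fun x => f x + g x).
Proof. exact: integrableD. Qed.

Lemma integrableRB f g : intble f -> intble g -> intble (fun x => f x - g x).
Proof. exact: integrableB. Qed.

Lemma integrableRZl a f : intble f -> intble (fun x => a * f x).
Proof. exact: integrableZl. Qed.

Lemma integrableRN f : intble f -> intble (fun x => - f x).
Proof. exact: integrableN. Qed.

Lemma integrableR0 : intble (fun=> 0).
Proof. exact: integrable0. Qed.

Lemma integrableR_sum (I : Type) (s : seq I) (F : I -> T -> R) :
  (forall i, intble (F i)) -> intble (fun x => \sum_(i <- s) F i x).
Proof.
move=> iF; elim: s => [|i s IH].
  by under eq_fun do rewrite big_nil; exact: integrableR0.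
by under eq_fun do rewrite big_cons; exact: integrableRD.
Qed.

Lemma Rintegral_sum (I : Type) (s : seq I) (F : I -> T -> R) :
  (forall i, intble (F i)) ->
  \int[mu]_(x in D) (\sum_(i <- s) F i x) = \sum_(i <- s) \int[mu]_(x in D) F i x.
Proof.
move=> iF; elim: s => [|i s IH].
  under eq_Rintegral do rewrite big_nil.
  by rewrite big_nil Rintegral_cst// mul0r.
under eq_Rintegral do rewrite big_cons.
by rewrite big_cons RintegralD ?IH//; exact: integrableR_sum.
Qed.

Lemma RintegralN f : intble f -> \int[mu]_(x in D) (- f x) = - \int[mu]_(x in D) f x.
Proof.
move=> intf; under eq_Rintegral do rewrite -mulN1r.
by rewrite RintegralZl// mulN1r.
Qed.

Lemma le_integrableR f g : measurable_fun D f -> (forall x, D x -> `|f x| <= g x) ->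
  intble g -> intble f.
Proof.
move=> mf fg ig; apply: (le_integrable mD _ _ ig); first exact/measurable_EFinP.
move=> x Dx /=; rewrite lee_fin; apply: (le_trans (fg _ Dx)); exact: ler_norm.
Qed.

Lemma measurable_intR f : intble f -> measurable_fun D f.
Proof. by move=> /measurable_int/measurable_EFinP. Qed.

Lemma integrableR_norm f : intble f -> intble (fun x => `|f x|).
Proof. exact: integrable_norm. Qed.

Lemma integrableR_bounded_mul f g M : intble f -> measurable_fun D g ->
  (forall x, D x -> `|g x| <= M) -> intble (fun x => f x * g x).
Proof.
move=> intf mg gM; apply: (@le_integrableR _ (fun x => M * `|f x|)).
- by apply: measurable_funM => //; exact: measurable_intR.
- by move=> x Dx; rewrite normrM mulrC ler_wpM2r//; exact: gM.
- exact/integrableRZl/integrableR_norm.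
Qed.

Lemma integrable_sqr_mul f g : measurable_fun D f -> measurable_fun D g ->
  intble (fun x => f x ^+ 2) -> intble (fun x => g x ^+ 2) ->
  intble (fun x => f x * g x).
Proof.
move=> mf mg f2 g2; apply: (@le_integrableR _ (fun x => f x ^+ 2 + g x ^+ 2)).
- exact: measurable_funM.
- move=> x _; rewrite normrM -(real_normK (num_real (f x))) -(real_normK (num_real (g x))).
  have := normr_ge0 (f x); have := normr_ge0 (g x); nra.
- exact: integrableRD.
Qed.

Lemma Rintegral_cauchy_schwarz f g : measurable_fun D f -> measurable_fun D g ->
  intble (fun x => f x ^+ 2) -> intble (fun x => g x ^+ 2) ->
  `|\int[mu]_(x in D) (f x * g x)| <=
  Num.sqrt (\int[mu]_(x in D) (f x ^+ 2)) * Num.sqrt (\int[mu]_(x in D) (g x ^+ 2)).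
Proof.
move=> mf mg f2 g2.
have fg := integrable_sqr_mul mf mg f2 g2.
set a := \int[mu]_(x in D) (f x ^+ 2); set b := \int[mu]_(x in D) (g x ^+ 2).
set c := \int[mu]_(x in D) (f x * g x).
(* The form is the integral of [(s f + t g)^2]; what follows is the discriminant condition for
   it. *)
have quad s t : 0 <= s ^+ 2 * a + 2 * s * t * c + t ^+ 2 * b.
  have -> : s ^+ 2 * a + 2 * s * t * c + t ^+ 2 * b =
      \int[mu]_(x in D) ((s * f x + t * g x) ^+ 2).
    rewrite -!RintegralZl// -!RintegralD//; first last.
    all: try by [exact: integrableRZl | apply: integrableRD; exact: integrableRZl].
    by apply: eq_Rintegral => x _; ring.
  by apply: Rintegral_ge0 => x _; exact: sqr_ge0.
have a0 : 0 <= a by apply: Rintegral_ge0 => x _; exact: sqr_ge0.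
have b0 : 0 <= b by apply: Rintegral_ge0 => x _; exact: sqr_ge0.
rewrite -(sqr_sqrtr a0) -(sqr_sqrtr b0) in quad.
have A0 := sqrtr_ge0 a; have B0 := sqrtr_ge0 b.
move: (Num.sqrt a) (Num.sqrt b) quad A0 B0 => A B quad A0 B0.
have [AB|AB] := ltP 0 (A * B).
  rewrite ler_norml; apply/andP; split.
    have := quad B A; nra.
  have := quad B (- A); nra.
(* Degenerate case: one square term drops out, so the form is affine in one variable and stays
   nonnegative only if [c = 0]. The values substituted below would make it equal to -1. *)
have AB0 : A * B = 0 by apply/eqP; rewrite eq_le AB mulr_ge0.
rewrite AB0 normr_le0; apply/eqP; apply: contrapT => /eqP c0.
move: AB0 => /eqP; rewrite mulf_eq0 => /orP[]/eqP h0.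
  have := quad (- (B ^+ 2 + 1) / (2 * c)) 1; rewrite h0.
  have -> : 2 * (- (B ^+ 2 + 1) / (2 * c)) * 1 * c = - (B ^+ 2 + 1) by field.
  by lra.
have := quad 1 (- (A ^+ 2 + 1) / (2 * c)); rewrite h0.
have -> : 2 * 1 * (- (A ^+ 2 + 1) / (2 * c)) * c = - (A ^+ 2 + 1) by field.
by lra.
Qed.

End real_integrals.

(** * Real Fourier sums and the truncated inverse of 1 - Laplacian *)

Section fourier_sums.
Context {R : realType} {n : nat}.
Implicit Types (f g : 'rV[R]_n -> R) (k l : 'rV[int]_n) (s : seq 'rV[int]_n).
Local Notation mu := (lebesgue_rV R n).
Local Notation intble f := (mu.-integrable (torus n) (EFin \o f)).
Let mT : measurable (torus n : set 'rV[R]_n) := @measurable_torus R n.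

Lemma L2_sqr_integrable f : L2 f -> intble (fun x => f x ^+ 2).
Proof.
move=> [mf foo]; apply/integrableP; split.
  by apply/measurable_EFinP; exact: measurable_funX.
by under eq_integral do rewrite /= ger0_norm ?sqr_ge0//.
Qed.

Lemma L2_integrable f : L2 f -> intble f.
Proof.
move=> Lf; have [mf _] := Lf.
apply: (@le_integrableR _ _ _ _ _ mT _ (fun x => 1 + f x ^+ 2)) => //.
- move=> x _; rewrite -(real_normK (num_real (f x))).
  have := normr_ge0 (f x); nra.
- apply: integrableRD => //; last exact: L2_sqr_integrable.
  apply: (@bounded_integrable_torus _ _ _ 1) => // x _ /=.
  by rewrite normr1.
Qed.

Lemma sqr_integrable_L2 f : measurable_fun (torus n) f ->
  intble (fun x => f x ^+ 2) -> L2 f.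
Proof.
move=> mf /integrableP[_ h]; split => //.
by move: h; under eq_integral do rewrite /= ger0_norm ?sqr_ge0//.
Qed.

Lemma L2_bounded f M : measurable_fun (torus n) f ->
  (forall x, torus n x -> `|f x| <= M) -> L2 f.
Proof.
move=> mf fM; apply: sqr_integrable_L2 => //.
apply: (@bounded_integrable_torus _ _ _ (M ^+ 2)); first exact: measurable_funX.
move=> x tx; rewrite normrX lerXn2r ?nnegrE//; last exact: fM.
exact: le_trans (fM x tx).
Qed.

Lemma L2_integrableM f g : L2 f -> L2 g -> intble (fun x => f x * g x).
Proof.
move=> Lf Lg; apply: integrable_sqr_mul => //; try exact: L2_sqr_integrable.
- by case: Lf.
- by case: Lg.
Qed.

Lemma L2D f g : L2 f -> L2 g -> L2 (fun x => f x + g x).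
Proof.
move=> Lf Lg; have [mf _] := Lf; have [mg _] := Lg.
apply: sqr_integrable_L2; first exact: measurable_funD.
under eq_fun do rewrite sqrrD.
apply: integrableRD => //; last exact: L2_sqr_integrable.
apply: integrableRD => //; first exact: L2_sqr_integrable.
under eq_fun do rewrite -mulr_natl.
by apply: integrableRZl => //; exact: L2_integrableM.
Qed.

Lemma L2Z a f : L2 f -> L2 (fun x => a * f x).
Proof.
move=> Lf; have [mf _] := Lf.
apply: sqr_integrable_L2; first exact: measurable_funM.
under eq_fun do rewrite exprMn.
by apply: integrableRZl => //; exact: L2_sqr_integrable.
Qed.

Lemma L2B f g : L2 f -> L2 g -> L2 (fun x => f x - g x).
Proof.
move=> Lf Lg; under eq_fun do rewrite -mulN1r.
by apply: L2D => //; exact: L2Z.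
Qed.

Lemma L2_ct k th : L2 (ct k th : 'rV[R]_n -> R).
Proof.
apply: (@L2_bounded _ 1); first by apply: measurable_funTS; exact: measurable_ct.
by move=> x _; exact: ct_le1.
Qed.

Lemma L2_cauchy_schwarz f g : L2 f -> L2 g ->
  `|\int[mu]_(x in torus n) (f x * g x)| <= L2norm f * L2norm g.
Proof.
move=> Lf Lg; apply: Rintegral_cauchy_schwarz => //.
- by case: Lf.
- by case: Lg.
- exact: L2_sqr_integrable.
- exact: L2_sqr_integrable.
Qed.

(** Unnormalized coefficient. Keeping the phase as an argument gives cosine, sine and translated
    coefficients at once. *)
Definition fcoef f k (th : R) : R := \int[mu]_(x in torus n) (f x * ct k th x).

Lemma fcoef_integrable f k th : intble f -> intble (fun x => f x * ct k th x).
Proof.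
move=> intf; apply: (@integrableR_bounded_mul _ _ _ _ _ mT _ _ 1) => //.
  by apply: measurable_funTS; exact: measurable_ct.
by move=> x _; exact: ct_le1.
Qed.

Lemma fcoefB f g k th : intble f -> intble g ->
  fcoef (fun x => f x - g x) k th = fcoef f k th - fcoef g k th.
Proof.
move=> intf intg; rewrite /fcoef -RintegralB//; try exact: fcoef_integrable.
by apply: eq_Rintegral => x _; ring.
Qed.

Lemma fcoefN f k th : fcoef f (- k) th = fcoef f k (- th).
Proof. by apply: eq_Rintegral => x _; rewrite ctN. Qed.

Lemma fcoef_expand f k th : intble f ->
  fcoef f k th = cos th * fcoef f k 0 - sin th * fcoef f k (- (pi / 2)).
Proof.
move=> intf; have i0 := fcoef_integrable k 0 intf.
have i1 := fcoef_integrable k (- (pi / 2)) intf.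
rewrite /fcoef -!RintegralZl// -RintegralB//; try exact: integrableRZl.
by apply: eq_Rintegral => x _; rewrite [X in _ * X]ct_expand; ring.
Qed.

Lemma Rintegral_ctM k l th th' :
  \int[mu]_(x in torus n) (ct k th x * ct l th' x) =
  2^-1 * ((if k == - l then 2 ^+ n * cos (th + th') else 0) +
          (if k == l then 2 ^+ n * cos (th - th') else 0)).
Proof.
under eq_Rintegral do rewrite ctM.
have ic j t : intble (ct j t) by exact/L2_integrable/L2_ct.
rewrite RintegralZl//; last exact: integrableRD.
by rewrite RintegralD// !Rintegral_ct addr_eq0 subr_eq0.
Qed.

(** With the phase [- fdot k x] each term is the integral of [f y * cos (k . (y - x))]: the sum is
    the convolution of [f] with a Dirichlet kernel, free of complex exponentials. *)
Definition fsum s f (x : 'rV[R]_n) : R :=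
  (2 ^+ n)^-1 * \sum_(k <- s) fcoef f k (- fdot k x).

Lemma fsumE s f x : intble f -> fsum s f x =
  \sum_(k <- s) (2 ^+ n)^-1 * (fcoef f k 0 * ct k 0 x +
     fcoef f k (- (pi / 2)) * ct k (- (pi / 2)) x).
Proof.
move=> intf; rewrite /fsum mulr_sumr; apply: eq_bigr => k _; congr (_ * _).
by rewrite fcoef_expand// /ct addr0 cosBpihalf cosN sinN; ring.
Qed.

(** The Fourier symbol of the inverse of [1 - Laplacian]. *)
Definition hw k : R := (1 + \sum_i (pi * (k ord0 i)%:~R) ^+ 2)^-1.

Lemma hw_den_gt0 k : 0 < 1 + \sum_i (pi * (k ord0 i)%:~R) ^+ 2 :> R.
Proof.
by rewrite ltr_pwDl// sumr_ge0// => i _; exact: sqr_ge0.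
Qed.

Lemma hw_gt0 k : 0 < hw k.
Proof. by rewrite invr_gt0 hw_den_gt0. Qed.

Lemma hwN k : hw (- k) = hw k.
Proof.
rewrite /hw; congr (_^-1); congr (_ + _); apply: eq_bigr => i _.
by rewrite mxE mulrNz mulrN sqrrN.
Qed.

(** Kernel of the inverse of [1 - Laplacian], truncated to the frequencies in [s]. *)
Definition gker s (x y : 'rV[R]_n) : R :=
  (2 ^+ n)^-1 * \sum_(k <- s) hw k * ct k (- fdot k x) y.

Lemma measurable_gker s x : measurable_fun setT (gker s x).
Proof.
apply: measurable_funM => //; apply: measurable_sum => k.
by apply: measurable_funM => //; exact: measurable_ct.
Qed.

Lemma L2_gker s x : L2 (gker s x).
Proof.
apply: (@L2_bounded _ ((2 ^+ n)^-1 * \sum_(k <- s) hw k)).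
  by apply: measurable_funTS; exact: measurable_gker.
move=> y _; rewrite normrM ger0_norm ?invr_ge0 ?exprn_ge0// ler_wpM2l//.
apply: (le_trans (ler_norm_sum _ _ _)); apply: ler_sum => k _.
by rewrite normrM gtr0_norm ?hw_gt0// ler_piMr ?ct_le1// ltW// hw_gt0.
Qed.

(** Orthogonality, but only as an inequality: [s] need not be symmetric and [ct k] pairs with [ct l]
    for both [l = k] and [l = - k]. Each of the two diagonals contributes at most half of the
    right-hand side. *)
Lemma L2norm_gker s x : uniq s ->
  L2norm (gker s x) <= Num.sqrt ((2 ^+ n)^-1 * \sum_(k <- s) hw k ^+ 2).
Proof.
move=> us; rewrite ler_wsqrtr//.
have ic k l t t' : intble (fun x => ct k t x * ct l t' x).
  by apply: L2_integrableM; exact: L2_ct.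
pose c := ((2 ^+ n)^-1 : R).
have c0 : 0 < c by rewrite invr_gt0 exprn_gt0.
have E y : gker s x y ^+ 2 = \sum_(k <- s) \sum_(l <- s) (c ^+ 2 * (hw k * hw l)) *
    (ct k (- fdot k x) y * ct l (- fdot l x) y).
  rewrite /gker exprMn [X in _ * X = _]expr2 mulr_suml mulr_sumr; apply: eq_bigr => k _.
  by rewrite mulr_sumr mulr_sumr; apply: eq_bigr => l _; rewrite -/c; ring.
under eq_Rintegral do rewrite E.
rewrite Rintegral_sum//; last first.
  by move=> k; apply: integrableR_sum => // l; exact: integrableRZl.
rewrite mulr_sumr big_seq [leRHS]big_seq; apply: ler_sum => k ks.
rewrite Rintegral_sum//; last by move=> l; exact: integrableRZl.
have pick (j : 'rV[int]_n) : hw j = hw k ->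
    \sum_(l <- s) hw l * (l == j)%:R <= hw k.
  move=> hj; have [js|js] := boolP (j \in s).
    rewrite (bigD1_seq j)//= eqxx mulr1 big1 ?addr0 ?hj// => l /negbTE ->.
    by rewrite mulr0.
  rewrite big1_seq ?ltW ?hw_gt0// => l /andP[_ ls].
  by case: eqP => [lj|_]; rewrite ?mulr0//; move: js; rewrite -lj ls.
apply: (@le_trans _ _ (c * hw k * 2^-1 * (\sum_(l <- s) hw l * (l == - k)%:R +
    \sum_(l <- s) hw l * (l == k)%:R))); last first.
  have := pick (- k) (hwN k); have := pick k erefl.
  move=> h1 h2; rewrite -/c expr2 -[leRHS]mulr1 -mulrA -[leRHS]mulrA.
  rewrite -!mulrA ler_pM2l// ler_pM2l ?hw_gt0//; lra.
rewrite -big_split mulr_sumr; apply: ler_sum => l _.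
rewrite RintegralZl// Rintegral_ctM.
have [e1 e2] : (k == - l) = (l == - k) /\ (k == l) = (l == k).
  by split; rewrite ?[k == l]eq_sym// -eqr_oppLR eq_sym.
rewrite e1 e2.
have h t (b : bool) : (if b then 2 ^+ n * cos t else 0) <= 2 ^+ n * b%:R :> R.
  by case: b; rewrite ?mulr0// ler_wpM2l ?exprn_ge0// cos_le1.
apply: (@le_trans _ _ (c ^+ 2 * (hw k * hw l) * (2^-1 * (2 ^+ n * (l == - k)%:R +
   2 ^+ n * (l == k)%:R)))).
  rewrite ler_wpM2l//; first by rewrite !mulr_ge0// ?sqr_ge0 ?ltW ?hw_gt0.
  by rewrite ler_wpM2l// lerD.
have -> : 2 ^+ n = c^-1 :> R by rewrite invrK.
by rewrite /= le_eqVlt; apply/orP; left; apply/eqP; field; rewrite gt_eqF.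
Qed.

(* The coefficients of [\sum_a g a] are those of [(1 - Laplacian) f], so the
   Fourier sum of [f] is the convolution of that function with [gker s]. *)
Lemma fsum_bound m s f (g : 'I_m -> 'rV[R]_n -> R) x : uniq s ->
  L2 f -> (forall a, L2 (g a)) ->
  (forall k th, \sum_a fcoef (g a) k th = (hw k)^-1 * fcoef f k th) ->
  `|fsum s f x| <= (\sum_a L2norm (g a)) *
     Num.sqrt ((2 ^+ n)^-1 * \sum_(k <- s) hw k ^+ 2).
Proof.
move=> us Lf Lg gf.
have -> : fsum s f x = \sum_a \int[mu]_(y in torus n) (g a y * gker s x y).
  transitivity (\sum_a \sum_(k <- s) (2 ^+ n)^-1 * (hw k * fcoef (g a) k (- fdot k x))).
    rewrite exchange_big /fsum mulr_sumr; apply: eq_bigr => k _ /=.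
    rewrite -mulr_sumr; congr (_ * _).
    by rewrite -mulr_sumr gf mulrA mulfV ?mul1r// gt_eqF ?hw_gt0.
  apply: eq_bigr => a _.
  have ig k : intble (fun y => g a y * ct k (- fdot k x) y).
    exact/fcoef_integrable/L2_integrable.
  transitivity (\sum_(k <- s) \int[mu]_(y in torus n)
      ((2 ^+ n)^-1 * hw k * (g a y * ct k (- fdot k x) y))).
    by apply: eq_bigr => k _; rewrite mulrA RintegralZl.
  rewrite -Rintegral_sum//; last by move=> k; exact: integrableRZl.
  apply: eq_Rintegral => y _; rewrite /gker mulrCA !mulr_sumr.
  by apply: eq_bigr => k _; ring.
apply: (le_trans (ler_norm_sum _ _ _)); rewrite mulr_suml; apply: ler_sum => a _.
apply: (le_trans (L2_cauchy_schwarz (Lg a) (L2_gker s x))).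
by rewrite ler_wpM2l ?L2norm_gker// sqrtr_ge0.
Qed.

End fourier_sums.
(** * Completeness of the trigonometric system *)

Section bernstein.
Context {R : realType}.
Implicit Types (f : R -> R) (x M e dl : R).

Definition bern (n j : nat) (x : R) : R := 'C(n, j)%:R * x ^+ j * (1 - x) ^+ (n - j).

Lemma bern_ge0 n j x : 0 <= x <= 1 -> 0 <= bern n j x.
Proof.
by move=> /andP[x0 x1]; rewrite !mulr_ge0// exprn_ge0// subr_ge0.
Qed.

Lemma bern_sum n x : \sum_(j < n.+1) bern n j x = 1.
Proof.
have := exprDn (1 - x) x n; rewrite subrK expr1n => ->.
by apply: eq_bigr => j _; rewrite /bern -mulr_natl; ring.
Qed.

Lemma bern_shift n j x : j.+1%:R * bern n.+1 j.+1 x = n.+1%:R * x * bern n j x.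
Proof.
rewrite /bern subSS exprS !mulrA -natrM -mul_bin_diag natrM; ring.
Qed.

Lemma bern_sum1 n x : \sum_(j < n.+1) j%:R * bern n j x = n%:R * x.
Proof.
case: n => [|n]; first by rewrite big_ord1 !mul0r.
rewrite big_ord_recl mul0r add0r.
under eq_bigr do rewrite bern_shift.
by rewrite -mulr_sumr bern_sum mulr1.
Qed.

(** The variance of the binomial law. *)
Lemma bern_sum2 n x :
  \sum_(j < n.+1) (j%:R - n%:R * x) ^+ 2 * bern n j x = n%:R * x * (1 - x).
Proof.
have S2 : \sum_(j < n.+1) j%:R ^+ 2 * bern n j x = n%:R * x * (1 + (n%:R - 1) * x).
  case: n => [|n]; first by rewrite big_ord1 expr2 !mul0r.
  rewrite big_ord_recl expr2 !mul0r add0r.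
  have E (j : 'I_n.+1) : (bump 0 j)%:R ^+ 2 * bern n.+1 (bump 0 j) x =
      n.+1%:R * x * (j%:R * bern n j x + bern n j x).
    rewrite [bump 0 j]add1n expr2 -mulrA bern_shift -natr1; ring.
  under eq_bigr do rewrite E.
  by rewrite -mulr_sumr big_split/= bern_sum1 bern_sum -natr1; ring.
have E (j : 'I_n.+1) : (j%:R - n%:R * x) ^+ 2 * bern n j x =
    j%:R ^+ 2 * bern n j x - 2 * n%:R * x * (j%:R * bern n j x)
    + (n%:R * x) ^+ 2 * bern n j x by ring.
under eq_bigr do rewrite E.
by rewrite big_split sumrB -!mulr_sumr /= S2 bern_sum1 bern_sum; ring.
Qed.

Definition bernstein (n : nat) f (x : R) : R := \sum_(j < n.+1) f (j%:R / n%:R) * bern n j x.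

Lemma bernsteinE n f : {P : {poly R} | forall x, P.[x] = bernstein n f x}.
Proof.
exists (\sum_(j < n.+1) (f (j%:R / n%:R) * 'C(n, j)%:R) *: ('X ^+ j * (1 - 'X) ^+ (n - j))).
move=> x; rewrite horner_sum; apply: eq_bigr => j _.
by rewrite hornerZ hornerM !horner_exp !hornerE /bern; ring.
Qed.

Lemma unit_ratio (n j : nat) : (j <= n.+1)%N -> 0 <= (j%:R / n.+1%:R : R) <= 1.
Proof.
by move=> jn; rewrite divr_ge0//= ler_pdivrMr ?ltr0n// mul1r ler_nat.
Qed.

Lemma bernstein_le n f M x : (forall y : R, 0 <= y <= 1 -> `|f y| <= M) ->
  0 <= x <= 1 -> `|bernstein n.+1 f x| <= M.
Proof.
move=> fM x01; apply: (le_trans (ler_norm_sum _ _ _)).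
rewrite -[leRHS]mulr1 -[X in _ * X](bern_sum n.+1 x) mulr_sumr; apply: ler_sum => j _.
rewrite normrM [X in _ * X]ger0_norm ?bern_ge0// ler_wpM2r ?bern_ge0//.
by apply/fM/unit_ratio; rewrite -ltnS.
Qed.

(* Chebyshev's argument: nodes further than [dl] from [x] carry Bernstein mass
   at most 1 / (4 n dl^2). *)
Lemma bernstein_dist n f M dl e x : 0 < dl -> 0 <= M ->
  (forall y : R, 0 <= y <= 1 -> `|f y| <= M) ->
  (forall y z : R, 0 <= y <= 1 -> 0 <= z <= 1 -> `|y - z| < dl -> `|f y - f z| <= e) ->
  0 <= x <= 1 ->
  `|bernstein n.+1 f x - f x| <= e + 2 * M / (dl ^+ 2 * n.+1%:R).
Proof.
move=> dl0 M0 fM fe x01.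
have e0 : 0 <= e.
  by have := fe x x x01 x01; rewrite !subrr normr0; apply.
have -> : bernstein n.+1 f x - f x =
    \sum_(j < n.+2) (f (j%:R / n.+1%:R) - f x) * bern n.+1 j x.
  under eq_bigr do rewrite mulrBl.
  by rewrite sumrB -mulr_sumr bern_sum mulr1.
apply: (le_trans (ler_norm_sum _ _ _)).
set N : R := n.+1%:R.
have N0 : 0 < N by rewrite ltr0n.
(* Chosen so that [c * (j - N x)^2 >= 2 * M] at the nodes further than [dl] from [x]. *)
pose c := 2 * M / (dl * N) ^+ 2.
have c0 : 0 <= c by apply: divr_ge0; [exact: mulr_ge0|exact: sqr_ge0].
apply: (@le_trans _ _ (\sum_(j < n.+2)
    (e * bern n.+1 j x + c * ((j%:R - N * x) ^+ 2 * bern n.+1 j x)))).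
  apply: ler_sum => j _; rewrite normrM [X in _ * X]ger0_norm ?bern_ge0//.
  rewrite [leRHS](_ : _ = (e + c * (j%:R - N * x) ^+ 2) * bern n.+1 j x); last by ring.
  rewrite ler_wpM2r ?bern_ge0//.
  have jn : 0 <= (j%:R / N : R) <= 1 by apply: unit_ratio; rewrite -ltnS.
  have [close|far] := ltP `|j%:R / N - x| dl.
    by apply: (le_trans (fe _ _ jn x01 close)); rewrite lerDl mulr_ge0// sqr_ge0.
  apply: (@le_trans _ _ (2 * M)).
    apply: (le_trans (ler_normB _ _)); have := fM _ jn; have := fM _ x01; lra.
  rewrite -[leLHS]add0r lerD// /c -mulrA ler_peMr ?mulr_ge0//.
  rewrite mulrC ler_pdivlMr ?exprn_gt0 ?mulr_gt0// mul1r.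
  have -> : j%:R - N * x = N * (j%:R / N - x) by field; rewrite gt_eqF.
  rewrite mulrC !exprMn ler_wpM2l ?sqr_ge0// -[leRHS](real_normK (num_real _)).
  by rewrite lerXn2r ?nnegrE// ltW.
rewrite big_split -!mulr_sumr /= bern_sum bern_sum2 mulr1 lerD2l /c.
have -> : 2 * M / (dl * N) ^+ 2 * (N * x * (1 - x)) =
    2 * M / (dl ^+ 2 * N) * (x * (1 - x)) by field; rewrite !gt_eqF.
have D0 : 0 < dl ^+ 2 * N by rewrite mulr_gt0 ?exprn_gt0.
apply: ler_piMr; first by rewrite divr_ge0 ?(ltW D0)// mulr_ge0.
by move/andP : x01 => [x0 x1]; nra.
Qed.

Lemma segment_unif_continuous f (a b : R) : {within `[a, b], continuous f} ->
  forall e, 0 < e -> exists2 dl : R, 0 < dl & forall y z : R, a <= y <= b -> a <= z <= b ->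
    `|y - z| < dl -> `|f y - f z| <= e.
Proof.
move=> cf e e0.
(* [P dl y] says that [dl] is an admissible modulus at [y]. It holds near each point for all small
   [dl], and compactness makes [dl] uniform. *)
pose P (dl y : R) := a <= y <= b -> forall z, a <= z <= b ->
  `|y - z| < dl -> `|f y - f z| <= e.
have : \forall dl \near 0^'+, `[a, b]%classic `<=` P dl.
  have nc := (compact_near_coveringP `[a, b]%classic).1 (@segment_compact R a b).
  apply: (nc R (0^'+) P) => x xab.
  move/subspace_continuousP : cf => /(_ x xab)/cvgrPdist_lt/(_ _ (divr_gt0 e0 (ltr0Sn R 1))).
  rewrite /prop_near1 /within/= => -[r /= r0 hr].
  have h u : a <= u <= b -> `|x - u| < r -> `|f x - f u| < e / 2.
    by move=> uab xu; apply: (hr u) => //=; rewrite in_itv.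
  near=> x' dl => /= x'ab z zab x'z.
  have xx' : `|x - x'| < r / 2.
    near: x'; apply: nbhsx_ballx; exact: divr_gt0.
  have dlr : dl < r / 2 by near: dl; apply: nbhs_right_lt; exact: divr_gt0.
  have h1 : `|f x - f x'| < e / 2 by apply: h => //; apply: (lt_trans xx'); lra.
  have h2 : `|f x - f z| < e / 2.
    by apply: h => //; apply: (le_lt_trans (ler_distD x' _ _)); lra.
  by apply: (le_trans (ler_distD (f x) _ _)); rewrite distrC; lra.
move=> H; near (0 : R)^'+ => dl.
exists dl => //.
move=> y z yab zab yz.
have Py : P dl y by apply: (near H dl) => //=; rewrite in_itv.
exact: Py.
Unshelve. all: by end_near.
Qed.

Lemma bernstein_approx f : {within `[0, 1], continuous f} ->
  forall e : R, 0 < e -> \forall n \near \oo, forall x, 0 <= x <= 1 ->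
    `|bernstein n f x - f x| <= e.
Proof.
move=> cf e e0.
have [M [M0 fM]] : exists M : R, 0 <= M /\ forall y : R, 0 <= y <= 1 -> `|f y| <= M.
  have [M [_ hM]] := compact_bounded (continuous_compact cf (@segment_compact R 0 1)).
  exists (`|M| + 1); split; first by rewrite addr_ge0.
  move=> y y01; apply: (hM (`|M| + 1)); last by exists y => //=; rewrite in_itv.
  by rewrite ltr_pwDr// ler_norm.
have [dl dl0 fe] : exists2 dl : R, 0 < dl & forall y z : R, 0 <= y <= 1 -> 0 <= z <= 1 ->
    `|y - z| < dl -> `|f y - f z| <= e / 2.
  by apply: segment_unif_continuous => //; exact: divr_gt0.
near=> n.
have n0 : (0 < n)%N by near: n; exact: nbhs_infty_gt.
rewrite -(prednK n0) => x x01.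
apply: (le_trans (bernstein_dist _ dl0 M0 fM fe x01)).
rewrite prednK// -lerBrDl (_ : e - e / 2 = e / 2); last by field.
rewrite ler_pdivrMr; last by rewrite mulr_gt0 ?exprn_gt0// ltr0n.
rewrite mulrA -ler_pdivrMl; last by rewrite mulr_gt0 ?exprn_gt0// divr_gt0.
near: n; exact: nbhs_infty_ger.
Unshelve. all: by end_near.
Qed.

End bernstein.

(** * Dominated convergence for real integrals *)

Section dominated.
Context d (T : measurableType d) (R : realType) (mu : {measure set T -> \bar R}).
Variables (D : set T) (mD : measurable D).

Lemma Rintegral_dominated (f_ : (T -> R)^nat) (f g : T -> R) :
  (forall n, measurable_fun D (f_ n)) -> measurable_fun D f ->
  (forall x, D x -> f_ n x @[n --> \oo] --> f x) ->
  mu.-integrable D (EFin \o g) ->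
  (forall n x, D x -> `|f_ n x| <= g x) ->
  \int[mu]_(x in D) f_ n x @[n --> \oo] --> \int[mu]_(x in D) f x.
Proof.
move=> mf_ mf ff ig fg.
have mf_E n : measurable_fun D (EFin \o f_ n) by exact/measurable_EFinP.
have mfE : measurable_fun D (EFin \o f) by exact/measurable_EFinP.
have cE : {ae mu, forall x, D x -> (EFin \o f_ n) x @[n --> \oo] --> (EFin \o f) x}.
  by apply: aeW => x Dx; apply/fine_cvgP; split; [exact: nearW|exact: ff].
have dE : {ae mu, forall x n, D x -> (`|(EFin \o f_ n) x| <= (EFin \o g) x)%E}.
  by apply: aeW => x n Dx; rewrite lee_fin; exact: fg.
have [intf _ H] := dominated_convergence mD mf_E mfE cE ig dE.
apply: (@fine_cvg _ _ _ _ (fun n => \int[mu]_(x in D) (f_ n x)%:E)%E).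
rewrite fineK//; exact: (integrable_fin_num mD intf).
Qed.

End dominated.

(** * Uniqueness of Fourier coefficients *)

Section completeness.
Context {R : realType} {n : nat}.
Local Notation mu := (lebesgue_rV R n).
Local Notation intble f := (mu.-integrable (torus n) (EFin \o f)).
Let mT : measurable (torus n : set 'rV[R]_n) := @measurable_torus R n.
Variables (f : 'rV[R]_n -> R) (intf : intble f)
  (f0 : forall (k : 'rV[int]_n) th, fcoef f k th = 0).
Implicit Types (g h : 'rV[R]_n -> R).

Definition bounded_measurable g :=
  measurable_fun (torus n) g /\ exists M, forall x, torus n x -> `|g x| <= M.

Definition annihilated h := bounded_measurable h /\
  forall (k : 'rV[int]_n) th, \int[mu]_(x in torus n) (f x * h x * ct k th x) = 0.

(** [annihilated] asks that [f h] still have zero coefficients, a condition with no evident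
    stability under products. Its multipliers do form an algebra, stable under bounded pointwise
    limits, and they are annihilated because 1 is. *)
Definition multiplier g :=
  bounded_measurable g /\ forall h, annihilated h -> annihilated (fun x => g x * h x).

Lemma bounded_measurableM g h : bounded_measurable g -> bounded_measurable h ->
  bounded_measurable (fun x => g x * h x).
Proof.
move=> [mg [M gM]] [mh [M' hM]]; split; first exact: measurable_funM.
by exists (M * M') => x tx; rewrite normrM ler_pM ?gM ?hM.
Qed.

Lemma bounded_measurable_ct (k : 'rV[int]_n) th : bounded_measurable (ct k th).
Proof.
split; first by apply: measurable_funTS; exact: measurable_ct.
by exists 1 => x _; exact: ct_le1.
Qed.

Lemma bounded_measurable_lin a g h : bounded_measurable g -> bounded_measurable h ->
  bounded_measurable (fun x => a * g x + h x).
Proof.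
move=> [mg [M gM]] [mh [M' hM]]; split.
  by apply: measurable_funD => //; exact: measurable_funM.
exists (`|a| * M + M') => x tx; apply: (le_trans (ler_normD _ _)).
by rewrite normrM lerD ?ler_wpM2l ?gM ?hM.
Qed.

Lemma bounded_measurable_int h : bounded_measurable h -> intble (fun x => f x * h x).
Proof. by move=> [mh [M hM]]; exact: (@integrableR_bounded_mul _ _ _ _ _ mT _ _ M). Qed.

Lemma annihilated1 : annihilated (cst 1).
Proof.
split; first by split => //; exists 1 => x _; rewrite normr1.
by move=> k th; under eq_Rintegral do rewrite mulr1; exact: f0.
Qed.

Lemma annihilated_lin a g h : annihilated g -> annihilated h ->
  annihilated (fun x => a * g x + h x).
Proof.
move=> [bg g0] [bh h0]; split; first exact: bounded_measurable_lin.
move=> k th.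
have ig : intble (fun x => f x * g x * ct k th x).
  exact/fcoef_integrable/bounded_measurable_int.
have ih : intble (fun x => f x * h x * ct k th x).
  exact/fcoef_integrable/bounded_measurable_int.
transitivity (\int[mu]_(x in torus n)
    (a * (f x * g x * ct k th x) + f x * h x * ct k th x)).
  by apply: eq_Rintegral => x _; ring.
rewrite RintegralD//; last exact: integrableRZl.
by rewrite RintegralZl// g0 h0 mulr0 addr0.
Qed.

Lemma annihilated_ct (k : 'rV[int]_n) th h : annihilated h ->
  annihilated (fun x => ct k th x * h x).
Proof.
move=> [bh h0]; split.
  by apply: bounded_measurableM => //; exact: bounded_measurable_ct.
move=> l th'.
have ih j t : intble (fun x => f x * h x * ct j t x).
  exact/fcoef_integrable/bounded_measurable_int.
transitivity (\int[mu]_(x in torus n)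
    (2^-1 * (f x * h x * ct (k + l) (th + th') x + f x * h x * ct (k - l) (th - th') x))).
  apply: eq_Rintegral => x _.
  rewrite -mulrDr [RHS]mulrCA -ctM; ring.
rewrite RintegralZl//; last exact: integrableRD.
by rewrite RintegralD// !h0 addr0 mulr0.
Qed.

Lemma annihilated_lim (h_ : nat -> 'rV[R]_n -> R) h (M : R) :
  (forall m, annihilated (h_ m)) -> (forall m x, torus n x -> `|h_ m x| <= M) ->
  bounded_measurable h -> (forall x, torus n x -> h_ m x @[m --> \oo] --> h x) ->
  annihilated h.
Proof.
move=> ah hM bh hh; split => // k th.
suff H : \int[mu]_(x in torus n) (f x * h_ m x * ct k th x) @[m --> \oo] -->
    \int[mu]_(x in torus n) (f x * h x * ct k th x).
  apply/esym/(cvg_unique _ _ H) => //.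
  rewrite (_ : (fun m : nat => _) = cst 0); first exact: cvg_cst.
  by apply/funext => m; exact: (ah m).2.
have mf : measurable_fun (torus n) f by exact: measurable_intR intf.
have mc : measurable_fun (torus n) (ct k th).
  by apply: measurable_funTS; exact: measurable_ct.
apply: (@Rintegral_dominated _ _ _ _ _ mT _ _ (fun x => M * `|f x|)).
- move=> m; apply: measurable_funM => //; apply: measurable_funM => //.
  by have [[]] := ah m.
- by apply: measurable_funM => //; apply: measurable_funM => //; case: bh.
- move=> x tx; apply: cvgMl; apply: cvgMr; exact: hh.
- exact/integrableRZl/integrableR_norm.
- move=> m x tx; rewrite !normrM.
  have h1 := ct_le1 k th x; have h2 := hM m x tx.
  have fh0 : 0 <= `|f x| * `|h_ m x| by exact: mulr_ge0.
  apply: (@le_trans _ _ (`|f x| * `|h_ m x|)); first exact: ler_piMr.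
  by rewrite mulrC ler_wpM2r.
Qed.

Lemma eq_bounded_measurable g h : (forall x, torus n x -> g x = h x) ->
  bounded_measurable g -> bounded_measurable h.
Proof.
move=> gh [mg [M gM]]; split.
  by apply: eq_measurable_fun mg => x; rewrite inE => /gh.
by exists M => x tx; rewrite -gh// gM.
Qed.

Lemma eq_annihilated g h : (forall x, torus n x -> g x = h x) ->
  annihilated g -> annihilated h.
Proof.
move=> gh [bg g0]; split; first exact: eq_bounded_measurable bg.
move=> k th; rewrite -(g0 k th); apply: eq_Rintegral => x.
by rewrite inE => /gh ->.
Qed.

Lemma eq_multiplier g h : (forall x, torus n x -> g x = h x) ->
  multiplier g -> multiplier h.
Proof.
move=> gh [bg mg]; split; first exact: eq_bounded_measurable bg.
by move=> u /mg; apply: eq_annihilated => x /gh ->.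
Qed.

Lemma multiplier_annihilated g : multiplier g -> annihilated g.
Proof.
by move=> [_ /(_ _ annihilated1)]; apply: eq_annihilated => x _; rewrite /= mulr1.
Qed.

Lemma multiplier1 : multiplier (cst 1).
Proof.
split; first by case: annihilated1.
by move=> h; apply: eq_annihilated => x _; rewrite mul1r.
Qed.

Lemma multiplier_ct (k : 'rV[int]_n) th : multiplier (ct k th).
Proof. by split=> [|h]; [exact: bounded_measurable_ct|exact: annihilated_ct]. Qed.

Lemma multiplier_lin a g h : multiplier g -> multiplier h ->
  multiplier (fun x => a * g x + h x).
Proof.
move=> [bg mg] [bh mh]; split; first exact: bounded_measurable_lin.
move=> u au; apply: eq_annihilated (annihilated_lin a (mg _ au) (mh _ au)) => x _.
by rewrite mulrDl mulrA.
Qed.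

Lemma multiplierM g h : multiplier g -> multiplier h ->
  multiplier (fun x => g x * h x).
Proof.
move=> [bg mg] [bh mh]; split; first exact: bounded_measurableM.
by move=> u /mh /mg; apply: eq_annihilated => x _; rewrite mulrA.
Qed.

Lemma multiplier_cst a : multiplier (fun=> a).
Proof.
have := multiplier_lin (a - 1) multiplier1 multiplier1.
by apply: eq_multiplier => x _ /=; ring.
Qed.

Lemma multiplier_lim (h_ : nat -> 'rV[R]_n -> R) h (M : R) :
  (forall m, multiplier (h_ m)) -> (forall m x, torus n x -> `|h_ m x| <= M) ->
  (forall x, torus n x -> h_ m x @[m --> \oo] --> h x) ->
  multiplier h.
Proof.
move=> mh hM hh.
have bh : bounded_measurable h.
  split.
    by apply: (@measurable_fun_cvg _ _ _ _ h_) => // m; have [[]] := mh m.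
  exists M => x tx; apply: (cvgr_to_le (cvg_norm (hh _ tx))).
  by apply: nearW => m; exact: hM.
split => // u [bu u0]; have [_ [K uK]] := bu.
have au : annihilated u by split.
apply: (@annihilated_lim (fun m x => h_ m x * u x) _ (M * K)).
- by move=> m; apply: (mh m).2.
- by move=> m x tx; rewrite normrM ler_pM ?hM ?uK.
- exact: bounded_measurableM.
- by move=> x tx; apply: cvgMl; exact: hh.
Qed.

Lemma multiplier_horner (P : {poly R}) g : multiplier g -> multiplier (fun x => P.[g x]).
Proof.
move=> mg; elim/poly_ind: P => [|P c IH].
  by apply: eq_multiplier (multiplier_cst 0) => x _; rewrite horner0.
apply: eq_multiplier (multiplier_lin 1 (multiplierM IH mg) (multiplier_cst c)) => x _.
by rewrite hornerMXaddC mul1r.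
Qed.

(** Polynomials in [g] are multipliers, and the Bernstein polynomials of [phi] converge on [[0, 1]]
    with a common bound. *)
Lemma multiplier_continuous (phi : R -> R) g : continuous phi -> multiplier g ->
  (forall x, torus n x -> 0 <= g x <= 1) -> multiplier (fun x => phi (g x)).
Proof.
move=> cphi mg g01.
have cphi' : {within `[0, 1], continuous phi} by exact: continuous_subspaceT.
have [M hM] : exists M : R, forall y : R, 0 <= y <= 1 -> `|phi y| <= M.
  have [M [_ hM]] := compact_bounded (continuous_compact cphi' (@segment_compact R 0 1)).
  exists (`|M| + 1) => y y01; apply: (hM (`|M| + 1)); last by exists y => //=; rewrite in_itv.
  by rewrite ltr_pwDr// ler_norm.
apply: (@multiplier_lim (fun m x => bernstein m.+1 phi (g x)) _ M).
- move=> m; have [P PE] := bernsteinE m.+1 phi.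
  by apply: eq_multiplier (multiplier_horner P mg) => x _; rewrite PE.
- by move=> m x tx; apply: bernstein_le => //; exact: g01.
- move=> x tx; apply/cvgrPdist_le => e e0.
  have [K _ hK] := bernstein_approx cphi' e0.
  exists K => // m /= Km; rewrite distrC; apply: hK => /=; last exact: g01.
  exact: leqW.
Qed.

(** Continuous ramps that tend to the indicator of [y > c]; they turn superlevel sets of multipliers
    into multipliers. *)
Definition step (c : R) (m : nat) (y : R) : R :=
  Num.min 1 (m%:R * Num.max 0 (y - c)).

Lemma continuous_step c m : continuous (step c m).
Proof.
move=> y; apply: (@continuous_min _ _ (cst 1) (fun y => m%:R * Num.max 0 (y - c))).
  exact: cvg_cst.
apply: cvgMr; apply: (@continuous_max _ _ (cst 0) (fun y => y - c)).
  exact: cvg_cst.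
by apply: cvgB; [exact: cvg_id|exact: cvg_cst].
Qed.

Lemma step_bound c m y : `|step c m y| <= 1.
Proof.
rewrite /step ger0_norm; first by rewrite ge_min lexx.
by rewrite le_min ler01/= mulr_ge0// le_max lexx.
Qed.

Lemma step_cvg c y : step c m y @[m --> \oo] --> ((c < y)%R%:R : R).
Proof.
have [cy|yc] := ltP c y; last first.
  rewrite (_ : (fun m : nat => _) = cst 0); first exact: cvg_cst.
  apply/funext => m; rewrite /step (_ : Num.max 0 (y - c) = 0) ?mulr0.
    by rewrite min_r.
  by rewrite max_l// subr_le0.
apply: cvg_near_cst; near=> m.
rewrite /step max_r ?subr_ge0 ?ltW// min_l//.
rewrite -ler_pdivrMr ?subr_gt0// mul1r.
by near: m; exact: nbhs_infty_ger.
Unshelve. all: by end_near.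
Qed.

Definition mult_set (A : set 'rV[R]_n) := multiplier (\1_A : _ -> R).

Lemma mult_set_gt g c : multiplier g -> (forall x, torus n x -> 0 <= g x <= 1) ->
  mult_set [set x | c < g x].
Proof.
move=> mg g01; apply: (@multiplier_lim (fun m x => step c m (g x)) _ 1).
- by move=> m; apply: multiplier_continuous => //; exact: continuous_step.
- by move=> m x _; exact: step_bound.
- move=> x _; rewrite indicE mem_setE; exact: step_cvg.
Qed.

Lemma eq_mult_set A B : (forall x, torus n x -> A x <-> B x) -> mult_set A -> mult_set B.
Proof.
move=> AB; apply: eq_multiplier => x /AB xAB.
by rewrite !indicE; congr (_ %:R); congr nat_of_bool; apply/idP/idP; rewrite !inE; apply xAB.
Qed.

Lemma mult_setC A : mult_set A -> mult_set (~` A).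
Proof.
move=> mA; apply: eq_multiplier (multiplier_lin (-1) mA multiplier1) => x _.
by rewrite !indicE in_setC; case: (x \in A) => /=; ring.
Qed.

Lemma mult_setI A B : mult_set A -> mult_set B -> mult_set (A `&` B).
Proof.
move=> mA mB; apply: eq_multiplier (multiplierM mA mB) => x _.
by rewrite indicI.
Qed.

Lemma mult_setU A B : mult_set A -> mult_set B -> mult_set (A `|` B).
Proof.
move=> mA mB; rewrite -[A `|` B]setCK setCU.
by apply: mult_setC; apply: mult_setI; exact: mult_setC.
Qed.

Lemma mult_set0 : mult_set set0.
Proof. by apply: eq_multiplier (multiplier_cst 0) => x _; rewrite indic0. Qed.

Lemma mult_set_bigcup (F : (set 'rV[R]_n)^nat) :
  (forall i, mult_set (F i)) -> mult_set (\bigcup_i F i).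
Proof.
move=> mF.
have mB m : mult_set (\big[setU/set0]_(i < m) F i).
  elim: m => [|m IH]; first by rewrite big_ord0; exact: mult_set0.
  by rewrite big_ord_recr; exact: mult_setU.
apply: (@multiplier_lim (fun m => \1_(\big[setU/set0]_(i < m) F i) : _ -> R) _ 1) => //.
  by move=> m x _; rewrite indicE; case: (_ \in _); rewrite ?normr1 ?normr0.
move=> x _; have [[i _ Fi]|nF] := pselect ((\bigcup_i F i) x).
  apply: cvg_near_cst; exists i.+1 => // m /= im.
  have h1 : (\bigcup_i F i) x by exists i.
  have h2 : (\big[setU/set0]_(i < m) F i) x by rewrite -bigcup_mkord; exists i.
  by rewrite !indicE !mem_set.
rewrite (_ : (fun m : nat => _) = cst 0).
  by rewrite indicE memNset//; exact: cvg_cst.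
apply/funext => m; rewrite indicE memNset//; apply: contra_not nF.
by rewrite -bigcup_mkord => -[i _ Fi]; exists i.
Qed.

Lemma cos_ltE (x y : R) : 0 <= x <= 1 -> 0 <= y <= 1 -> (cos (pi * x) < cos (pi * y)) = (y < x).
Proof.
move=> x01 y01; have pi0 := @pi_gt0 R.
have h (z : R) : 0 <= z <= 1 -> pi * z \in `[0, pi].
  by move=> /andP[z0 z1]; rewrite in_itv/= mulr_ge0 ?(ltW pi0)//= ler_piMr// ltW.
by rewrite ltr_cos ?h// ltr_pM2l.
Qed.

(** On [[-1, 1)] the sign of [sin (pi y)] tells whether [y > 0], and [cos (pi y)] is increasing on
    [[-1, 0]] and decreasing on [[0, 1]]. Half-spaces are thus Boolean combinations of superlevel
    sets of cosines. *)
Lemma mult_set_coord (i : 'I_n) c : mult_set [set x | c < x ord0 i].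
Proof.
pose e : 'rV[int]_n := delta_mx ord0 i.
have eE (x : 'rV[R]_n) : fdot e x = pi * x ord0 i.
  rewrite /fdot (bigD1 i)//= mxE !eqxx mul1r big1 ?addr0// => j ji.
  by rewrite mxE (negbTE ji) andbF mul0r.
(* The affine change moves the range of the cosine from [[-1, 1]] to [[0, 1]], as [mult_set_gt]
   requires. *)
have half_mult th a : mult_set [set x | a < ct e th x].
  have m1 : multiplier (fun x => 2^-1 * ct e th x + 2^-1).
    by apply: multiplier_lin; [exact: multiplier_ct|exact: multiplier_cst].
  have h01 x : torus n x -> 0 <= 2^-1 * ct e th x + 2^-1 <= 1.
    by move=> _; have := ct_le1 e th x; rewrite ler_norml; lra.
  apply: eq_mult_set (mult_set_gt (2^-1 * a + 2^-1) m1 h01) => x _ /=.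
  by split; lra.
have pos : mult_set [set x | 0 < sin (pi * x ord0 i)].
  apply: eq_mult_set (half_mult (- (pi / 2)) 0) => x _ /=.
  by rewrite /ct eE cosBpihalf.
have cosm a : mult_set [set x | a < cos (pi * x ord0 i)].
  by apply: eq_mult_set (half_mult 0 a) => x _ /=; rewrite /ct eE addr0.
have cosm' a : mult_set [set x | cos (pi * x ord0 i) < a].
  apply: eq_mult_set (half_mult pi (- a)) => x _ /=.
  by rewrite /ct eE cosDpi ltrNl opprK.
have sin_pos (y : R) : -1 <= y < 1 -> (0 < sin (pi * y)) = (0 < y).
  move=> /andP[y1 y2]; have pi0 := @pi_gt0 R.
  have [y0|y0] := ltP 0 y.
    by rewrite sin_gt0_pi// mulr_gt0//= gtr_pMr.
  apply/negbTE; rewrite -leNgt -oppr_ge0 -sinN -mulrN.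
  have y0' : 0 <= - y by rewrite oppr_ge0.
  apply: sin_ge0_pi; rewrite mulr_ge0 ?(ltW pi0)//=.
  by rewrite ler_piMr ?(ltW pi0)//; lra.
have [c1|c1] := ltP c (-1).
  apply: eq_mult_set (mult_setC mult_set0) => x tx /=; have := tx i.
  by split => // _; lra.
have cos_neg (y z : R) : -1 <= y <= 0 -> -1 <= z <= 0 ->
    (cos (pi * y) < cos (pi * z)) = (y < z).
  move=> y01 z01; rewrite -(cosN (pi * y)) -(cosN (pi * z)) -!mulrN.
  by rewrite cos_ltE ?ltrN2//; lra.
have [c2|c2] := leP c 0.
  apply: eq_mult_set (mult_setU pos (cosm (cos (pi * c)))) => x tx /=.
  have xi := tx i; rewrite sin_pos//; have [x0|x0] := ltP 0 (x ord0 i).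
    by split => [_|_]; [exact: le_lt_trans x0|left].
  rewrite cos_neg; [|lra|lra].
  by split => [[]//|]; right.
have [c3|c3] := ltP c 1; last first.
  apply: eq_mult_set mult_set0 => x tx /=; have := tx i.
  by split => //; lra.
apply: eq_mult_set (mult_setI pos (cosm' (cos (pi * c)))) => x tx /=.
have xi := tx i; rewrite sin_pos//; have [x0|x0] := ltP 0 (x ord0 i).
  by rewrite cos_ltE; [split => [[]//|]|lra|lra].
by split => [[]//|]; lra.
Qed.

(** The multiplier sets form a sigma-algebra. It contains the coordinate half-spaces, hence the
    preimages of Borel sets by each coordinate, which generate all measurable sets. *)
Lemma mult_set_measurable (A : set 'rV[R]_n) : measurable A -> mult_set A.
Proof.
have coor i (C : set R) : measurable C -> mult_set ((fun x : 'rV[R]_n => x ord0 i) @^-1` C).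
  move=> mC0; have mC : (@RGenOInfty.G R).-sigma.-measurable C.
    by rewrite -RGenOInfty.measurableE.
  suff : (@RGenOInfty.G R).-sigma.-measurable `<=`
      [set B | mult_set ((fun x : 'rV[R]_n => x ord0 i) @^-1` B)] by apply.
  apply: smallest_sub.
    split=> /=.
    - by rewrite preimage_set0; exact: mult_set0.
    - by move=> B; rewrite setTD preimage_setC; exact: mult_setC.
    - by move=> F mF; rewrite preimage_bigcup; exact: mult_set_bigcup.
  move=> _ [c ->] /=; apply: eq_mult_set (mult_set_coord i c) => x _ /=.
  by rewrite in_itv/= andbT.
move=> mA.
suff : g_sigma_preimage (fun (i : 'I_n) (x : 'rV[R]_n) => x ord0 i) `<=` mult_set by apply.
apply: smallest_sub.
  split=> /=.
  - exact: mult_set0.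
  - by move=> B; rewrite setTD; exact: mult_setC.
  - by move=> F; exact: mult_set_bigcup.
rewrite -bigcup_seq => B [i _ [C mC <-]] /=.
by rewrite setTI; exact: coor.
Qed.

(** Indicators of measurable sets are multipliers, hence annihilated; testing them with [k = 0] and
    [th = 0] shows that [f] has integral 0 over every measurable part of the torus. *)
Theorem fourier_uniqueness : {ae mu, forall x, torus n x -> f x = 0}.
Proof.
have := @integral_ae_eq _ _ _ mu (torus n) mT (cst 0%E) (EFin \o f) intf.
move=> /(_ (measurable_cst _)); have H : forall E : set 'rV[R]_n, E `<=` torus n -> measurable E ->
    (\int[mu]_(x in E) (EFin \o f) x = \int[mu]_(x in E) cst 0%E x)%E.
  move=> E ET mE; rewrite [RHS]integral0_eq//.
  have [_ /(_ 0 0)] := multiplier_annihilated (mult_set_measurable mE).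
  move=> h; have : \int[mu]_(x in E) f x = 0.
    rewrite -[RHS]h.
    rewrite -[E in LHS](setIidr ET) Rintegral_mkcondr.
    apply: eq_Rintegral => x _; rewrite patchE indicE /ct fdot0l addr0 cos0 mulr1.
    by case: (x \in E); rewrite ?mulr1 ?mulr0.
  have ifE : mu.-integrable E (EFin \o f) by exact: integrableS intf.
  move=> h0; rewrite -[LHS]fineK; last exact: integrable_fin_num.
  by rewrite -[0%E]/(0%:E) -h0.
move=> /(_ H); apply: filterS => x /= h tx.
by have [] := h tx.
Qed.

End completeness.

(** * Uniform convergence of Fourier sums of H^2 functions *)

Section frequency_box.
Context {R : realType}.

Definition cbrt (m : nat) : R := powR m.+1%:R 3^-1.

Lemma cbrt_ge1 m : 1 <= cbrt m.
Proof. by rewrite /cbrt -{1}(powRr0 m.+1%:R) ler_powR// ?ler1n// invr_ge0. Qed.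

Lemma cbrt_gt0 m : 0 < cbrt m.
Proof. exact: lt_le_trans (cbrt_ge1 m). Qed.

Lemma cbrt3 m : cbrt m ^+ 3 = m.+1%:R.
Proof. by rewrite /cbrt -powR_mulrn ?powR_ge0// -powRrM mulVf// powRr1. Qed.

(** This is [(m + 1)^(-4/3)]: summable since [4/3 > 1], while three such factors have total degree
    -4, which is the decay of [hw k ^+ 2]. Hence the restriction to dimension at most 3. *)
Definition alpha (m : nat) : R := cbrt m ^- 4.

Lemma alpha_ge0 m : 0 <= alpha m.
Proof. by rewrite invr_ge0 exprn_ge0 ?ltW ?cbrt_gt0. Qed.

(* 1/y_m - 1/y_(m+1) >= 1/(3 y_(m+1)^4) since the cubes of the y's differ by 1 *)
Lemma alpha_telescope m : alpha m.+1 <= 3 * ((cbrt m)^-1 - (cbrt m.+1)^-1).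
Proof.
rewrite /alpha; have := cbrt3 m; have := cbrt3 m.+1.
have := cbrt_gt0 m; have := cbrt_gt0 m.+1.
move: (cbrt m) (cbrt m.+1) => x y y0 x0 y3 x3.
have e : y ^+ 3 - x ^+ 3 = 1 by rewrite y3 x3 -[m.+2%:R]natr1; ring.
have xy : x <= y.
  rewrite leNgt; apply/negP => yx; have : y ^+ 3 < x ^+ 3 by rewrite ltrXn2r// ltW.
  by move: e; lra.
have -> : 3 * (x^-1 - y^-1) = 3 * (y - x) / (x * y) by field; rewrite !gt_eqF.
rewrite ler_pdivlMr ?mulr_gt0// mulrC -/(_ / _) ler_pdivrMr ?exprn_gt0//.
have h1 : 1 <= 3 * (y - x) * y ^+ 2.
  have {1}<- : (y - x) * (y ^+ 2 + y * x + x ^+ 2) = 1 by rewrite -e; ring.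
  rewrite (_ : 3 * (y - x) * y ^+ 2 = (y - x) * (3 * y ^+ 2)); last by ring.
  by rewrite ler_wpM2l ?subr_ge0//; nra.
apply: (@le_trans _ _ (y ^+ 2)); first by rewrite expr2 ler_wpM2r// ltW.
rewrite (_ : y ^+ 4 = y ^+ 2 * y ^+ 2); last by ring.
by rewrite mulrA ler_peMl// sqr_ge0.
Qed.

Lemma alpha_sum M : \sum_(0 <= m < M) alpha m <= 4.
Proof.
case: M => [|M]; first by rewrite big_nil.
suff : \sum_(0 <= m < M.+1) alpha m <= 1 + 3 * (1 - (cbrt M)^-1).
  have := cbrt_gt0 M; rewrite -invr_gt0; lra.
elim: M => [|M IH].
  rewrite big_nat1 /alpha (_ : cbrt 0 = 1); last by rewrite /cbrt powR1.
  by rewrite expr1n invr1; lra.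
rewrite big_nat_recr//=; have := alpha_telescope M; lra.
Qed.

Lemma alpha_sum2 K : \sum_(j < K.*2.+1) alpha `|j%:Z - K%:Z|%N <= 8.
Proof.
rewrite -(big_mkord xpredT (fun j => alpha `|j%:Z - K%:Z|%N)).
rewrite (@big_cat_nat _ _ _ K) //=; last by lia.
rewrite (_ : 8 = 4 + 4 :> R); last by ring.
apply: lerD.
  rewrite big_nat_rev /= add0n; apply: (le_trans _ (alpha_sum K.+1)).
  rewrite [leRHS]big_nat_recl//= -[leLHS]add0r lerD ?alpha_ge0//.
  rewrite le_eqVlt; apply/orP; left; apply/eqP; apply: eq_big_nat => j /andP[_ jK].
  by congr alpha; lia.
rewrite -{1}(add0n K) big_addn; apply: (le_trans _ (alpha_sum (K.*2.+1 - K))).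
rewrite le_eqVlt; apply/orP; left; apply/eqP; apply: eq_big_nat => j /andP[_ jK].
by congr alpha; lia.
Qed.

Definition freq n K (a : {ffun 'I_n -> 'I_(K.*2.+1)}) : 'rV[int]_n :=
  \row_i ((a i)%:Z - K%:Z).

(** Enumerated by finite functions so that a sum of products over the coordinates factors through
    [bigA_distr_bigA]. *)
Definition box n K : seq 'rV[int]_n := map (@freq n K) (enum {: {ffun 'I_n -> 'I_(K.*2.+1)}}).

Lemma freq_inj n K : injective (@freq n K).
Proof.
move=> a b ab; apply/ffunP => i; apply/val_inj => /=.
by have /rowP/(_ i) := ab; rewrite !mxE; lia.
Qed.

Lemma box_uniq n K : uniq (box n K).
Proof. by rewrite map_inj_uniq ?enum_uniq//; exact: freq_inj. Qed.

Lemma mem_box n K (k : 'rV[int]_n) :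
  (k \in box n K) = [forall i, (`|k ord0 i| <= K)%N].
Proof.
apply/mapP/forallP => [[a _ ->] i|h].
  by rewrite mxE; case: (a i) => b /= bK; lia.
have lt i : (`|(k ord0 i + K%:Z)%R| < K.*2.+1)%N by have := h i; rewrite -addnn; lia.
exists [ffun i => Ordinal (lt i)]; first by rewrite mem_enum.
apply/matrixP => z i; rewrite mxE ffunE/= (_ : z = ord0); last first.
  by apply/val_inj; case: z => [[]].
by have := h i; lia.
Qed.

Lemma box_sub n K L : (K <= L)%N -> {subset box n K <= box n L}.
Proof.
move=> KL k; rewrite !mem_box => /forallP h; apply/forallP => i.
exact: leq_trans (h i) KL.
Qed.

Lemma box_filter_perm n K L : (K <= L)%N ->
  perm_eq [seq k <- box n L | k \in box n K] (box n K).
Proof.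
move=> KL; apply: uniq_perm; [by rewrite filter_uniq ?box_uniq|exact: box_uniq|] => k.
rewrite mem_filter; case: (boolP (k \in box n K)) => //= kK.
exact: box_sub kK.
Qed.

Lemma oppr_box n K k : k \in box n K -> - k \in box n K.
Proof.
rewrite !mem_box => /forallP h; apply/forallP => i.
by rewrite mxE abszN.
Qed.

Lemma in_box_large n (k : 'rV[int]_n) : exists K, forall L, (K <= L)%N -> k \in box n L.
Proof.
exists (\max_i `|k ord0 i|%N) => L KL; rewrite mem_box; apply/forallP => i.
by apply: leq_trans KL; exact: (@leq_bigmax _ (fun i : 'I_n => `|k ord0 i|%N) i).
Qed.

Definition hsum n K : R := \sum_(k <- box n K) hw k ^+ 2.

(** Cauchy-Schwarz for a sum of at most four terms. *)
Lemma sqr_sum_le n (F : 'I_n -> R) : (n <= 3)%N ->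
  (1 + \sum_i F i) ^+ 2 <= 4 * (1 + \sum_i F i ^+ 2).
Proof.
case: n F => [|[|[|[|//]]]] F _; rewrite ?big_ord_recl ?big_ord0 /=.
- by nra.
- by have := sqr_ge0 (F ord0 - 1); nra.
- have := sqr_ge0 (F ord0 - 1); have := sqr_ge0 (F (lift ord0 ord0) - 1).
  by have := sqr_ge0 (F ord0 - F (lift ord0 ord0)); nra.
- set a := F _; set b := F _; set c := F _.
  have := sqr_ge0 (a - 1); have := sqr_ge0 (b - 1); have := sqr_ge0 (c - 1).
  have := sqr_ge0 (a - b); have := sqr_ge0 (a - c); have := sqr_ge0 (b - c).
  by nra.
Qed.

(** With [Z] the sum of the [|k_i|], the product of at most three factors [cbrt |k_i| ^+ 4] is at
    most [cbrt Z ^+ 12 = (Z + 1)^4]. On the other hand [(Z + 1)^2 <= 4 / hw k], and 16 is the square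
    of this 4. *)
Lemma hw_alpha n (k : 'rV[int]_n) : (n <= 3)%N ->
  hw k ^+ 2 <= 16 * \prod_i alpha `|k ord0 i|%N.
Proof.
move=> n3.
pose Z : nat := \sum_i `|k ord0 i|%N.
have yZ i : cbrt `|k ord0 i|%N <= cbrt Z.
  apply: ge0_ler_powR; rewrite ?nnegrE ?invr_ge0// ler_nat ltnS /Z.
  by rewrite (bigD1 i)//= leq_addr.
have prodZ : \prod_(i < n) cbrt `|k ord0 i|%N ^+ 4 <= Z.+1%:R ^+ 4.
  apply: (@le_trans _ _ (\prod_(i < n) cbrt Z ^+ 4)).
    apply: ler_prod => i _; rewrite exprn_ge0 ?(ltW (cbrt_gt0 _))//=.
    by rewrite lerXn2r ?nnegrE ?(ltW (cbrt_gt0 _)).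
  rewrite prodr_const card_ord -exprM -cbrt3 -exprM.
  by rewrite ler_weXn2l ?cbrt_ge1//; lia.
have Zbound : Z.+1%:R ^+ 2 <= 4 * (hw k)^-1 :> R.
  rewrite /hw invrK.
  have -> : Z.+1%:R = 1 + \sum_i (`|k ord0 i|%N)%:R :> R.
    by rewrite -natr1 addrC natr_sum.
  have h i : (`|k ord0 i|%N)%:R ^+ 2 <= (pi * (k ord0 i)%:~R) ^+ 2 :> R.
    rewrite exprMn (_ : _ ^+ 2 = (k ord0 i)%:~R ^+ 2); last first.
      by rewrite -[RHS](real_normK (num_real _)) -intr_norm natr_absz.
    by rewrite ler_peMl ?sqr_ge0// exprn_ege1// (le_trans _ (@pi_ge2 R))//; lra.
  apply: (@le_trans _ _ (4 * (1 + \sum_i (`|k ord0 i|%N)%:R ^+ 2))); last first.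
    by rewrite ler_wpM2l// lerD2l ler_sum.
  exact: sqr_sum_le.
have h0 := @hw_gt0 R n k.
rewrite /alpha prodfV ler_pdivlMr; last first.
  by apply: prodr_gt0 => i _; rewrite exprn_gt0 ?cbrt_gt0.
apply: (@le_trans _ _ (hw k ^+ 2 * (4 * (hw k)^-1) ^+ 2)).
  rewrite ler_wpM2l ?sqr_ge0//; apply: (le_trans prodZ).
  rewrite (_ : 4 = 2 * 2)%N// exprM lerXn2r ?nnegrE// ?sqr_ge0//.
  by rewrite divr_ge0// ltW.
by rewrite le_eqVlt; apply/orP; left; apply/eqP; field; rewrite gt_eqF.
Qed.

Lemma hsum_le n K : (n <= 3)%N -> hsum n K <= 16 * 8 ^+ n.
Proof.
move=> n3; rewrite /hsum big_map big_enum /=.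
apply: (@le_trans _ _ (\sum_(a : {ffun 'I_n -> 'I_(K.*2.+1)})
    16 * \prod_i alpha `|(a i)%:Z - K%:Z|%N)).
  apply: ler_sum => a _; apply: (le_trans (hw_alpha _ n3)).
  rewrite ler_wpM2l// le_eqVlt; apply/orP; left; apply/eqP.
  by apply: eq_bigr => i _; rewrite mxE.
rewrite -mulr_sumr ler_wpM2l//.
rewrite -(bigA_distr_bigA (fun (i : 'I_n) (j : 'I_(K.*2.+1)) => alpha `|j%:Z - K%:Z|%N)).
rewrite -[n in leRHS]card_ord -prodr_const; apply: ler_prod => i _.
by rewrite alpha_sum2 andbT sumr_ge0// => j _; exact: alpha_ge0.
Qed.

Lemma hsum_diff n K L : (K <= L)%N ->
  \sum_(k <- box n L | k \notin box n K) hw k ^+ 2 = hsum n L - hsum n K.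
Proof.
move=> KL; rewrite /hsum [X in X - _](bigID (fun k => k \in box n K))/=.
rewrite addrC -(big_filter (box n L) (fun k => k \in box n K)).
by rewrite [X in _ + X - _](perm_big _ (box_filter_perm n KL)) addrK.
Qed.

Lemma hsum_nd n : {homo @hsum n : K L / (K <= L)%N >-> K <= L}.
Proof.
move=> K L KL; rewrite -subr_ge0 -hsum_diff// sumr_ge0// => k _; exact: sqr_ge0.
Qed.

(** A bound for the kernel over the frequencies outside the box, hence a rate of uniform convergence
    common to all functions with the same H^2 bound. *)
Definition htail n K : R := Num.sqrt ((2 ^+ n)^-1 * (limn (hsum n) - hsum n K)).

Lemma hsum_cvg n : (n <= 3)%N -> hsum n K @[K --> \oo] --> limn (hsum n).
Proof.
move=> n3; apply: nondecreasing_is_cvgn; first exact: hsum_nd.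
by exists (16 * 8 ^+ n) => _ [K _ <-]; exact: hsum_le.
Qed.

Lemma htail_cvg n : (n <= 3)%N -> htail n K @[K --> \oo] --> 0.
Proof.
move=> n3; rewrite -(sqrtr0 R).
apply: (@cvg_comp _ _ _ (fun K => (2 ^+ n)^-1 * (limn (hsum n) - hsum n K))
  Num.sqrt _ (nbhs 0)); last exact: sqrt_continuous.
rewrite -[0](mulr0 (2 ^+ n)^-1); apply: cvgMr.
rewrite -[0](subrr (limn (hsum n))); apply: cvgB; first exact: cvg_cst.
exact: hsum_cvg.
Qed.

Lemma hsum_diff_htail n K L : (n <= 3)%N -> (K <= L)%N ->
  Num.sqrt ((2 ^+ n)^-1 * \sum_(k <- [seq k <- box n L | k \notin box n K]) hw k ^+ 2)
    <= htail n K.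
Proof.
move=> n3 KL; rewrite big_filter hsum_diff// ler_wsqrtr// ler_wpM2l//.
by rewrite lerD2r; apply: nondecreasing_cvgn_le; [exact: hsum_nd|exact: hsum_cvg].
Qed.

End frequency_box.
Section fourier_approx.
Context {R : realType} {n : nat}.
Implicit Types (f g : 'rV[R]_n -> R) (k l : 'rV[int]_n).
Local Notation mu := (lebesgue_rV R n).
Local Notation intble f := (mu.-integrable (torus n) (EFin \o f)).
Let mT : measurable (torus n : set 'rV[R]_n) := @measurable_torus R n.

Lemma measurable_fsum (s : seq 'rV[int]_n) f : intble f -> measurable_fun setT (fsum s f).
Proof.
move=> intf; rewrite (_ : fsum s f = fun x => \sum_(k <- s) (2 ^+ n)^-1 * (fcoef f k 0 * ct k 0 x +
     fcoef f k (- (pi / 2)) * ct k (- (pi / 2)) x)).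
  apply: measurable_sum => k; apply: measurable_funM => //; apply: measurable_funD.
    by apply: measurable_funM => //; exact: measurable_ct.
  by apply: measurable_funM => //; exact: measurable_ct.
by apply/funext => x; exact: fsumE.
Qed.

(** In a real Fourier sum the frequencies [k] and [- k] carry half of the coefficient each, so both
    must belong to [s]. *)
Lemma fcoef_fsum (s : seq 'rV[int]_n) f k th : intble f -> uniq s -> k \in s -> - k \in s ->
  fcoef (fsum s f) k th = fcoef f k th.
Proof.
move=> intf us ks Nks.
have ic j l t t' : intble (fun x => ct j t x * ct l t' x).
  by apply: L2_integrableM; exact: L2_ct.
pose A l := fcoef f l 0; pose B l := fcoef f l (- (pi / 2)).
have E x : fsum s f x * ct k th x = \sum_(l <- s) (2 ^+ n)^-1 *
    (A l * (ct l 0 x * ct k th x) + B l * (ct l (- (pi / 2)) x * ct k th x)).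
  by rewrite fsumE// mulr_suml; apply: eq_bigr => l _; rewrite /A /B; ring.
rewrite [LHS]/fcoef; under eq_Rintegral do rewrite E.
have iAB l : intble (fun x => A l * (ct l 0 x * ct k th x) +
    B l * (ct l (- (pi / 2)) x * ct k th x)).
  by apply: integrableRD => //; exact: integrableRZl.
rewrite Rintegral_sum//; last by move=> l; exact: integrableRZl.
pose F l t t' := 2^-1 * (A l * cos t + B l * cos t').
have E2 l : \int[mu]_(x in torus n) ((2 ^+ n)^-1 * (A l * (ct l 0 x * ct k th x) +
      B l * (ct l (- (pi / 2)) x * ct k th x))) =
    (if l == - k then F l th (- (pi / 2) + th) else 0) +
    (if l == k then F l th (- (pi / 2) - th) else 0).
  rewrite RintegralZl// RintegralD//; try exact: integrableRZl.
  rewrite !RintegralZl// !Rintegral_ctM add0r sub0r cosN /F.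
  have c0 : 2 ^+ n != 0 :> R by rewrite gt_eqF// exprn_gt0.
  by move: (2 ^+ n) c0 => c c0; case: (l == - k); case: (l == k); field.
under eq_bigr do rewrite E2.
rewrite big_split/= -!big_mkcond.
have pick (G : 'rV[int]_n -> R) j : j \in s -> \sum_(l <- s | l == j) G l = G j.
  by move=> js; rewrite big_mkcond (bigD1_seq j)//= eqxx big1 ?addr0// => l /negbTE ->.
rewrite !pick// /F /A /B.
have -> : fcoef f (- k) 0 = fcoef f k 0 by rewrite fcoefN oppr0.
have -> : fcoef f (- k) (- (pi / 2)) = - fcoef f k (- (pi / 2)).
  rewrite fcoefN opprK (fcoef_expand k (pi / 2) intf) cos_pihalf sin_pihalf; ring.
have -> : cos (- (pi / 2) + th) = sin th by rewrite addrC cosBpihalf.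
have -> : cos (- (pi / 2) - th) = - sin th.
  by rewrite -opprD cosN addrC cosDpihalf.
by rewrite (fcoef_expand k th intf); field.
Qed.

(** All that is kept of an H^2 bound by [A]: it depends on [f] only through its Fourier coefficients
    and is stated for arbitrary finite sets, so it covers differences of box sums. *)
Definition h2_bounded (A : R) f := forall s : seq 'rV[int]_n, uniq s -> forall x,
  `|fsum s f x| <= A * Num.sqrt ((2 ^+ n)^-1 * \sum_(k <- s) hw k ^+ 2).

Lemma fsum_box_dist A f K L x : (n <= 3)%N -> 0 <= A -> h2_bounded A f -> (K <= L)%N ->
  `|fsum (box n L) f x - fsum (box n K) f x| <= A * htail n K.
Proof.
move=> n3 A0 hA KL.
have -> : fsum (box n L) f x - fsum (box n K) f x =
    fsum [seq k <- box n L | k \notin box n K] f x.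
  rewrite -[LHS]/(_ * _ - _ * _) -mulrBr; congr (_ * _).
  rewrite [X in X - _](bigID (fun k => k \in box n K))/= big_filter addrC -(big_filter (box n L)).
  rewrite -[X in _ + X - _]big_filter (perm_big _ (box_filter_perm n KL))/=.
  by rewrite addrK.
apply: (le_trans (hA _ _ _)); first by rewrite filter_uniq// box_uniq.
by rewrite ler_wpM2l// hsum_diff_htail.
Qed.

(** The box sums are uniformly Cauchy. Their limit [w] has the coefficients of [f], so
    [fourier_uniqueness] identifies the two almost everywhere. *)
Lemma fsum_box_approx A f : (n <= 3)%N -> 0 <= A -> L2 f -> h2_bounded A f ->
  {ae mu, forall x, torus n x -> forall K, `|f x - fsum (box n K) f x| <= A * htail n K}.
Proof.
move=> n3 A0 Lf hA.
have intf := L2_integrable Lf.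
have tail0 : A * htail n K @[K --> \oo] --> 0.
  by rewrite -[0](mulr0 A); apply: cvgMr; exact: htail_cvg.
have cS x : cvg (fsum (box n K) f x @[K --> \oo]).
  apply: cauchy_cvg; apply: cauchy_exP => e e0.
  have [K _ hK] : \forall K \near \oo, A * htail n K < e by apply: cvgr_lt tail0 _ e0.
  exists (fsum (box n K) f x), K => // L /= KL.
  rewrite /ball/= distrC; apply: le_lt_trans (hK K (leqnn K)).
  exact: fsum_box_dist.
pose w x := limn (fun K => fsum (box n K) f x).
have wS x K : `|w x - fsum (box n K) f x| <= A * htail n K.
  apply: (@cvgr_to_le _ \oo _ _ (fun L => `|fsum (box n L) f x - fsum (box n K) f x|)).
    by apply: cvg_norm; apply: cvgB; [exact: cS|exact: cvg_cst].
  by exists K => // L /= KL; exact: fsum_box_dist.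
(* Bounds all box sums at once, through their distance to the smallest box; it serves as the
   dominating constant below. *)
pose M := A * htail n 0 + A * Num.sqrt ((2 ^+ n)^-1 * \sum_(k <- box n 0) hw k ^+ 2).
have SM K x : `|fsum (box n K) f x| <= M.
  rewrite -(subrK (fsum (box n 0) f x) (fsum (box n K) f x)).
  apply: (le_trans (ler_normD _ _)); rewrite lerD//; first exact: fsum_box_dist.
  by apply: hA; exact: box_uniq.
have mS K : measurable_fun (torus n) (fsum (box n K) f).
  by apply: measurable_funTS; exact: measurable_fsum.
have mw : measurable_fun (torus n) w.
  by apply: (@measurable_fun_cvg _ _ _ _ (fun K => fsum (box n K) f)) => // x _; exact: cS.
have wM x : `|w x| <= M.
  apply: (cvgr_to_le (cvg_norm (cS x))); exact: nearW.
have Lw : L2 w by exact: L2_bounded mw (fun x _ => wM x).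
have fw k th : fcoef (fun x => f x - w x) k th = 0.
  rewrite fcoefB//; last exact: L2_integrable.
  suff H : fcoef (fsum (box n K) f) k th @[K --> \oo] --> fcoef w k th.
    have [K0 hK0] := in_box_large k.
    have H' : fcoef (fsum (box n K) f) k th @[K --> \oo] --> fcoef f k th.
      apply: cvg_near_cst; exists K0 => // L /= KL.
      by apply: fcoef_fsum => //; [exact: box_uniq|exact: hK0|apply: oppr_box; exact: hK0].
    by apply/eqP; rewrite subr_eq0; apply/eqP; exact: cvg_unique H' H.
  apply: (@Rintegral_dominated _ _ _ _ _ mT _ _ (fun=> M)).
  - by move=> K; apply: measurable_funM => //; apply: measurable_funTS; exact: measurable_ct.
  - by apply: measurable_funM => //; apply: measurable_funTS; exact: measurable_ct.
  - by move=> x _; apply: cvgMl; exact: cS.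
  - by apply: (@bounded_integrable_torus _ _ _ M) => // x _; rewrite ger0_norm// (le_trans _ (SM 0%N x)).
  - move=> K x _; rewrite normrM; apply: (le_trans _ (SM K x)).
    by rewrite ler_piMr// ct_le1.
have := fourier_uniqueness (integrableRB mT intf (L2_integrable Lw)) fw.
apply: filterS => x /= h tx K; have /eqP := h tx.
by rewrite subr_eq0 => /eqP ->.
Qed.

End fourier_approx.
Lemma cvg_sumr (R : realType) (T : Type) (F : set_system T) (FF : Filter F) (I : Type) (s : seq I)
    (f : I -> T -> R) (l : I -> R) :
  (forall i, f i y @[y --> F] --> l i) ->
  (\sum_(i <- s) f i y) @[y --> F] --> \sum_(i <- s) l i.
Proof.
move=> cf; elim: s => [|i s IH].
  by under eq_fun do rewrite big_nil; rewrite big_nil; exact: cvg_cst.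
by under eq_fun do rewrite big_cons; rewrite big_cons; exact: cvgD.
Qed.

(** * Directional derivatives of trigonometric functions *)

Section line_derivative.
Context {R : realType} {V : normedModType R}.

Lemma is_derive_line (f : V -> R) (x v : V) (df : R) :
  is_derive (0 : R) (1 : R) (fun h : R => f (h *: v + x)) df -> is_derive x v f df.
Proof.
have E : (fun h : R => h^-1 *: ((f \o shift x) (h *: v) - f x)) =
    (fun h : R => h^-1 *: (((fun h : R => f (h *: v + x)) \o shift 0) (h *: 1) -
      (fun h : R => f (h *: v + x)) 0)).
  apply/funext => h; congr (_ *: (f _ - f _)) => /=; last by rewrite scale0r add0r.
  by rewrite addr0 (_ : h *: (1 : R^o) = h)//; exact: mulr1.
by move=> -[d1 d2]; split; [rewrite /derivable E|rewrite /derive E].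
Qed.

(** Avoids computing iterated derivatives: stability under a single directional derivative
    propagates along the list [vs]. *)
Lemma smooth_class (P : (V -> R) -> Prop) :
  (forall f, P f -> continuous f) ->
  (forall f v, P f -> exists g, P g /\ forall x, is_derive x v f (g x)) ->
  forall f, P f -> smooth f.
Proof.
move=> Pc Pd f Pf vs.
have PD : P (Diter vs f).
  elim: vs => [//|v vs IH] /=.
  have [g [Pg dg]] := Pd _ v IH.
  rewrite (_ : 'D_v _ = g)//; apply/funext => x.
  by have [] := dg x.
split; first exact: Pc.
by move=> x v; have [g [_ /(_ x)[]]] := Pd _ v PD.
Qed.

End line_derivative.

Section trig_derivative.
Context {R : realType} {n : nat}.
Implicit Types (k : 'rV[int]_n) (th : R).

Lemma is_derive_cosD (a b : R) :
  is_derive (0 : R) (1 : R) (fun h : R => cos (h * a + b)) (a * cos (b + pi / 2)).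
Proof.
have d1 : is_derive (0 : R) (1 : R) (fun h : R => h * a + b) a.
  apply: is_derive_eq; by rewrite /= !(scaler0, addr0, add0r) /GRing.scale /= mulr1.
have d2 := @is_derive1_comp _ cos (fun h => h * a + b) 0 _ _ (is_derive_cos _) d1.
by apply: (is_derive_eq d2); rewrite mul0r add0r cosDpihalf mulrC.
Qed.

Lemma is_derive_ct k th (x v : 'rV[R]_n) :
  is_derive x v (ct k th) (fdot k v * ct k (th + pi / 2) x).
Proof.
apply: is_derive_line; rewrite /ct [fdot k x + _]addrA.
have E : (fun h : R => cos (fdot k (h *: v + x) + th)) =
    (fun h : R => cos (h * fdot k v + (fdot k x + th))).
  by apply/funext => h; rewrite fdotDr fdotZr addrA.
by rewrite E; exact: is_derive_cosD.
Qed.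

Lemma cvg_fdot k (x : 'rV[R]_n) : fdot k y @[y --> x] --> fdot k x.
Proof.
have FF : Filter (nbhs x) by exact: nbhs_filter.
apply: cvgMr.
apply: (@cvg_sumr R _ (nbhs x) FF _ (index_enum 'I_n)
  (fun i (y : 'rV[R]_n) => (k ord0 i)%:~R * y ord0 i) (fun i => (k ord0 i)%:~R * x ord0 i)).
by move=> i; apply: cvgMr; exact: coord_continuous.
Qed.

Lemma cvg_ct k th (x : 'rV[R]_n) : ct k th y @[y --> x] --> ct k th x.
Proof.
have FF : Filter (nbhs x) by exact: nbhs_filter.
have h := @cvgD _ _ _ (nbhs x) FF (fdot k) (cst th) _ _ (@cvg_fdot k x) (cvg_cst th).
exact: (continuous_cvg _ (@continuous_cos R _) (h FF)).
Qed.

Lemma cvgM_ct c k th (x : 'rV[R]_n) : c * ct k th y @[y --> x] --> c * ct k th x.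
Proof.
have FF : Filter (nbhs x) by exact: nbhs_filter.
by apply: cvgMr; exact: cvg_ct.
Qed.

Lemma continuous_ct k th : continuous (ct k th : 'rV[R]_n -> R).
Proof. by move=> x; exact: cvg_ct. Qed.

Lemma smooth_ct k th : smooth (ct k th : 'rV[R]_n -> R).
Proof.
apply: (@smooth_class _ _ (fun f => exists c t, f = fun x => c * ct k t x)).
- by move=> _ [c [t ->]] x; exact: cvgM_ct.
- move=> _ v [c [t ->]]; exists (fun x => c * fdot k v * ct k (t + pi / 2) x); split.
    by exists (c * fdot k v), (t + pi / 2).
  move=> x; have d := is_deriveZ c (is_derive_ct k t x v).
  by apply: (is_derive_eq d); rewrite /GRing.scale/= mulrA.
- by exists 1, th; apply/funext => x; rewrite mul1r.
Qed.

Lemma cos_period (a : R) (m : int) : cos (a + 2 * (pi * m%:~R)) = cos a.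
Proof.
rewrite cosD (_ : 2 * (pi * m%:~R) = (pi * m%:~R) *+ 2); last by rewrite mulr_natl.
rewrite sin_mulr2n cos_mulr2n cos2sin2 sin_piMz.
by rewrite mulr0 mul0rn mulr0 subr0 expr0n/= subr0 mulr2n addrK mulr1.
Qed.

Lemma periodic_ct k th : Defs.periodic (ct k th : 'rV[R]_n -> R).
Proof.
move=> i x; rewrite /ct fdotDr fdotZr fdot_unitv.
by rewrite -addrA [X in _ + X]addrC addrA cos_period.
Qed.

Lemma test_torus_ct k th : test_torus n (ct k th : 'rV[R]_n -> R).
Proof. by split; [exact: smooth_ct|exact: periodic_ct]. Qed.

Definition kfac (al : seq 'I_n) k : R := \prod_(i <- al) (pi * (k ord0 i)%:~R).

Lemma Diter_ct (al : seq 'I_n) k th :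
  Diter (map unitv al) (ct k th : 'rV[R]_n -> R) =
  fun x => kfac al k * ct k (th + (size al)%:R * (pi / 2)) x.
Proof.
elim: al => [|i al IH] /=; apply/funext => x.
  by rewrite /kfac big_nil mul1r mul0r addr0.
rewrite IH /kfac big_cons -fdot_unitv.
have d := is_deriveZ (kfac al k) (is_derive_ct k (th + (size al)%:R * (pi / 2)) x (unitv i)).
have [_ ->] := d.
have -> : th + (size al).+1%:R * (pi / 2) = th + (size al)%:R * (pi / 2) + pi / 2.
  by rewrite -natr1; ring.
by rewrite -[LHS]/(_ * (_ * _)) /kfac; ring.
Qed.

End trig_derivative.

(** * Measurability of continuous functions *)

Section continuous_measurable.
Context {R : realType} {n : nat}.

Lemma rV_norm_le (x : 'rV[R]_n) (e : R) : 0 <= e -> (forall i, `|x ord0 i| <= e) -> `|x| <= e.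
Proof.
move=> e0 xe; rewrite (_ : `|x| = mx_norm x)// mx_normrE; apply: bigmax_le => //= -[i j] _ /=.
by rewrite (_ : i = ord0) ?xe//; apply/val_inj; case: i => [[]].
Qed.

(* Continuous functions are limits of the step functions x |-> f (floor (m x) / m). *)
Definition grid (m : nat) (x : 'rV[R]_n) : 'rV[R]_n :=
  \row_i ((Num.floor (m.+1%:R * x ord0 i))%:~R / m.+1%:R).

Lemma grid_dist m (x : 'rV[R]_n) (i : 'I_n) : `|x ord0 i - grid m x ord0 i| <= m.+1%:R^-1.
Proof.
rewrite mxE; have m0 : 0 < m.+1%:R :> R by rewrite ltr0n.
have -> : x ord0 i - (Num.floor (m.+1%:R * x ord0 i))%:~R / m.+1%:R =
    (m.+1%:R * x ord0 i - (Num.floor (m.+1%:R * x ord0 i))%:~R) / m.+1%:R.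
  by field; rewrite gt_eqF.
rewrite normrM [X in _ * X]gtr0_norm ?invr_gt0// ler_piMl ?invr_ge0 ?ltW//.
have := floor_itv (m.+1%:R * x ord0 i); rewrite intrD ltr_norml; lra.
Qed.

Lemma grid_cvg (x : 'rV[R]_n) : grid m x @[m --> \oo] --> x.
Proof.
apply/cvgrPdist_le => e e0; near=> m.
apply: rV_norm_le; first exact: ltW.
move=> i; rewrite !mxE; have := grid_dist m x i; rewrite mxE => /le_trans; apply.
rewrite -[e]invrK lef_pV2 ?posrE ?invr_gt0// ?ltr0n//.
rewrite -natr1 ler_wpDr//; near: m; exact: nbhs_infty_ger.
Unshelve. all: by end_near.
Qed.

Lemma measurable_grid (f : 'rV[R]_n -> R) m : measurable_fun setT (f \o grid m).
Proof.
move=> _ B mB; rewrite setTI.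
(* [grid m] has countable range, so the preimage is a countable union of cells [S k], whatever [f]
   is. *)
pose G (k : 'rV[int]_n) : 'rV[R]_n := \row_i ((k ord0 i)%:~R / m.+1%:R).
pose S (k : 'rV[int]_n) : set 'rV[R]_n := \bigcap_(i in [set: 'I_n])
  ((fun x : 'rV[R]_n => Num.floor (m.+1%:R * x ord0 i)) @^-1` [set k ord0 i]).
have mS k : measurable (S k).
  apply: fin_bigcap_measurable; first exact: finite_finset.
  move=> i _; rewrite -[X in measurable X]setTI.
  have mfl : measurable_fun setT (fun x : 'rV[R]_n => m.+1%:R * x ord0 i).
    by apply: measurable_funM => //; exact: measurable_coord.
  rewrite (_ : _ @^-1` _ = (fun x : 'rV[R]_n => m.+1%:R * x ord0 i) @^-1`
     `[(k ord0 i)%:~R, (k ord0 i + 1)%:~R[%classic).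
    exact: mfl.
  apply/seteqP; split=> x /=; rewrite in_itv/=.
    by move=> <-; exact: floor_itv.
  by move=> h; apply: floor_def.
rewrite (_ : _ @^-1` _ = \bigcup_k (if `[< B (f (G k)) >] then S k else set0)).
  apply: countable_bigcupT_measurable; first exact: countableP.
  by move=> k; case: ifP.
apply/seteqP; split=> [x /= Bx|x /= [k _]].
  exists (\row_i Num.floor (m.+1%:R * x ord0 i)) => //.
  rewrite asboolT; first by move=> i _ /=; rewrite mxE.
  rewrite (_ : G _ = grid m x)//; apply/rowP => i; by rewrite !mxE.
case: ifP => // /asboolP BG Sk; rewrite (_ : grid m x = G k)//.
apply/rowP => i; rewrite !mxE; congr (_%:~R / _).
have := Sk i I => /= e; rewrite -[in RHS]/(fun_of_matrix k ord0 i) -e.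
by [].
Qed.

Lemma continuous_measurable_rV (f : 'rV[R]_n -> R) : continuous f -> measurable_fun setT f.
Proof.
move=> cf; apply: (@measurable_fun_cvg _ _ _ _ (fun m => f \o grid m)).
  by move=> m; exact: measurable_grid.
move=> x _; exact: (continuous_cvg _ (cf x) (@grid_cvg x)).
Qed.

Lemma continuous_bounded_torus (f : 'rV[R]_n -> R) : continuous f ->
  exists M, forall x, torus n x -> `|f x| <= M.
Proof.
move=> cf.
have cK : compact [set v : 'rV[R]_n | forall i, `[(-1 : R), 1]%classic (v ord0 i)].
  by apply: (@rV_compact R n (fun=> `[(-1 : R), 1]%classic)) => i; exact: segment_compact.
have cf' : {within [set v : 'rV[R]_n | forall i, `[(-1 : R), 1]%classic (v ord0 i)], continuous f}.
  exact: continuous_subspaceT.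
have [M [_ hM]] := compact_bounded (continuous_compact cf' cK).
exists (`|M| + 1) => x tx; apply: (hM (`|M| + 1)).
  by rewrite ltr_pwDr// ler_norm.
exists x => //= i; rewrite in_itv/=; have /andP[-> h] := tx i.
exact: ltW.
Qed.

Lemma L2_continuous (f : 'rV[R]_n -> R) : continuous f -> L2 f.
Proof.
move=> cf; have [M fM] := continuous_bounded_torus cf.
apply: (@L2_bounded _ _ _ M) => //; apply: measurable_funTS.
exact: continuous_measurable_rV.
Qed.

End continuous_measurable.

(** * Fourier coefficients of weak derivatives *)

Section weak_derivatives.
Context {R : realType} {n : nat}.
Implicit Types (f g : 'rV[R]_n -> R) (k : 'rV[int]_n) (al be : seq 'I_n).
Local Notation mu := (lebesgue_rV R n).
Let mT : measurable (torus n : set 'rV[R]_n) := @measurable_torus R n.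

Lemma sobolev_weak_deriv m al f : sobolev m f -> (size al <= m)%N ->
  is_weak_deriv al f (weak_deriv al f).
Proof. by move=> sf /sf; rewrite /weak_deriv => /cid[g hg]; apply: xgetPex; exists g. Qed.

Lemma sobolev_L2 m f : sobolev m f -> L2 f.
Proof. by move=> /(_ [::] (leq0n _))[g []]. Qed.

Lemma is_weak_derivB al f f' g g' : is_weak_deriv al f g -> is_weak_deriv al f' g' ->
  is_weak_deriv al (fun x => f x - f' x) (fun x => g x - g' x).
Proof.
move=> [Lf Lg fg] [Lf' Lg' fg']; split; [exact: L2B|exact: L2B|] => phi tphi.
have [sphi _] := tphi.
have Lphi : L2 phi by apply: L2_continuous; have [] := sphi [::].
have LD : L2 (Diter (map unitv al) phi).
  by apply: L2_continuous; have [] := sphi (map unitv al).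
transitivity (\int[mu]_(x in torus n) (f x * Diter (map unitv al) phi x) -
    \int[mu]_(x in torus n) (f' x * Diter (map unitv al) phi x)).
  rewrite -RintegralB//; try exact: L2_integrableM.
  by apply: eq_Rintegral => x _; ring.
rewrite fg// fg'// -mulrBr -RintegralB//; try exact: L2_integrableM.
by congr (_ * _); apply: eq_Rintegral => x _; ring.
Qed.

Lemma sobolevB m f g : sobolev m f -> sobolev m g -> sobolev m (fun x => f x - g x).
Proof.
move=> sf sg al hal; have [f' hf] := sf al hal; have [g' hg] := sg al hal.
by exists (fun x => f' x - g' x); exact: is_weak_derivB.
Qed.

(** The cosine itself is an admissible test function in the definition of the weak derivative. *)
Lemma fcoef_weak al f g k th : is_weak_deriv al f g ->
  fcoef g k th = (-1) ^+ size al * kfac al k * fcoef f k (th + (size al)%:R * (pi / 2)).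
Proof.
move=> [Lf Lg fg].
have := fg _ (test_torus_ct k th); rewrite Diter_ct => h.
have h2 : \int[mu]_(x in torus n) (g x * ct k th x) = (-1) ^+ size al *
    \int[mu]_(x in torus n) (f x * (kfac al k * ct k (th + (size al)%:R * (pi / 2)) x)).
  by rewrite h mulrA -expr2 sqrr_sign mul1r.
rewrite [LHS]h2 -mulrA; congr (_ * _).
rewrite /fcoef -RintegralZl//; last exact/fcoef_integrable/L2_integrable.
by apply: eq_Rintegral => x _; ring.
Qed.

Lemma fcoef_weak_deriv m al f k th : sobolev m f -> (size al <= m)%N ->
  fcoef (weak_deriv al f) k th =
  (-1) ^+ size al * kfac al k * fcoef f k (th + (size al)%:R * (pi / 2)).
Proof. by move=> sf hal; apply: fcoef_weak; exact: sobolev_weak_deriv sf hal. Qed.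

Lemma L2norm_sobolev_norm m al f : (size al <= m)%N ->
  L2norm (weak_deriv al f) <= sobolev_norm m f.
Proof.
move=> hal; rewrite -[leLHS]ger0_norm ?sqrtr_ge0// -sqrtr_sqr ler_wsqrtr//.
have hm : (size al < m.+1)%N by [].
rewrite (bigD1 (Ordinal hm))//= (bigD1 (in_tuple al))//= -addrA ler_wpDr//.
rewrite addr_ge0//; first by apply: sumr_ge0 => t _; exact: sqr_ge0.
by apply: sumr_ge0 => j _; apply: sumr_ge0 => t _; exact: sqr_ge0.
Qed.

Lemma sobolev_norm_ge0 m f : 0 <= sobolev_norm m f.
Proof. exact: sqrtr_ge0. Qed.

Lemma fcoef_shift_pi f k th : L2 f -> fcoef f k (th + pi) = - fcoef f k th.
Proof.
move=> Lf; rewrite /fcoef -mulN1r -RintegralZl//; last exact/fcoef_integrable/L2_integrable.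
by apply: eq_Rintegral => x _; rewrite /ct addrA cosDpi; ring.
Qed.

(** For [w = weak_deriv al f], these are [w] and the [n] functions [- d_i d_i w], whose sum plays
    the role of [(1 - Laplacian) w]. *)
Definition h2_data al f (a : 'I_n.+1) : 'rV[R]_n -> R :=
  if unlift ord0 a is Some i then (fun x => - weak_deriv (i :: i :: al) f x)
  else weak_deriv al f.

Lemma L2norm_h2_data m al f a : sobolev m f -> (size al + 2 <= m)%N ->
  L2 (h2_data al f a) /\ L2norm (h2_data al f a) <= sobolev_norm m f.
Proof.
move=> sf hal; rewrite /h2_data; case: unliftP => [i _|_].
  have sz : (size [:: i, i & al] <= m)%N by rewrite /= -addn2.
  have [_ Lg _] := sobolev_weak_deriv sf sz.
  split; first by under eq_fun do rewrite -mulN1r; exact: L2Z.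
  rewrite /L2norm; under eq_Rintegral do rewrite sqrrN.
  exact: L2norm_sobolev_norm.
have sz : (size al <= m)%N by apply: leq_trans hal; rewrite leq_addr.
have [_ Lg _] := sobolev_weak_deriv sf sz.
by split=> //; exact: L2norm_sobolev_norm.
Qed.

Lemma h2_bounded_weak_deriv m al f : sobolev m f -> (size al + 2 <= m)%N ->
  h2_bounded (n.+1%:R * sobolev_norm m f) (weak_deriv al f).
Proof.
move=> sf hal s us x.
have sz : (size al <= m)%N by apply: leq_trans hal; rewrite leq_addr.
have [Lf Lg _] := sobolev_weak_deriv sf sz.
have gE k th : \sum_a fcoef (h2_data al f a) k th = (hw k)^-1 * fcoef (weak_deriv al f) k th.
  rewrite big_ord_recl /h2_data unlift_none /hw invrK mulrDl mul1r; congr (_ + _).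
  rewrite mulr_suml; apply: eq_bigr => i _; rewrite liftK.
  have szi : (size [:: i, i & al] <= m)%N by rewrite /= -addn2.
  have [_ Lgi _] := sobolev_weak_deriv sf szi.
  transitivity (- fcoef (weak_deriv [:: i, i & al] f) k th).
    rewrite /fcoef -mulN1r -RintegralZl//; last exact/fcoef_integrable/L2_integrable.
    by apply: eq_Rintegral => y _; ring.
  rewrite (fcoef_weak_deriv k th sf szi) (fcoef_weak_deriv k th sf sz) /=.
  rewrite /kfac !big_cons.
  have -> : th + (size al).+2%:R * (pi / 2) = th + (size al)%:R * (pi / 2) + pi.
    by rewrite -addn2 natrD; field.
  by rewrite fcoef_shift_pi// !exprS; ring.
have Lh a := (L2norm_h2_data a sf hal).1.
apply: (le_trans (fsum_bound x us Lg Lh gE)).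
rewrite ler_wpM2r ?sqrtr_ge0// -[n.+1 in leRHS]card_ord mulr_natl -sumr_const ler_sum// => a _.
exact: (L2norm_h2_data a sf hal).2.
Qed.

Lemma fcoef_le_sobolev m f k th : sobolev m f ->
  `|fcoef f k th| <= sobolev_norm m f * L2norm (ct k th : 'rV[R]_n -> R).
Proof.
move=> sf; have := fcoef_weak_deriv k th sf (leq0n m : (size [::] <= m)%N).
rewrite /kfac big_nil expr0 !mul1r mul0r addr0 => <-.
have [_ Lg _] := sobolev_weak_deriv sf (leq0n m : (size [::] <= m)%N).
apply: (le_trans (L2_cauchy_schwarz Lg (L2_ct k th))).
by rewrite ler_wpM2r ?sqrtr_ge0// L2norm_sobolev_norm.
Qed.

End weak_derivatives.

(** * Sobolev-continuous functions of time *)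

Section time_dependence.
Context {R : realType} {n : nat}.
Implicit Types (u w : R -> 'rV[R]_n -> R) (k : 'rV[int]_n) (al : seq 'I_n).
Local Notation mu := (lebesgue_rV R n).
Let mT : measurable (torus n : set 'rV[R]_n) := @measurable_torus R n.

Lemma fsum_weak_derivB m al (f g : 'rV[R]_n -> R) s x : sobolev m f -> sobolev m g ->
  (size al <= m)%N ->
  fsum s (weak_deriv al (fun x => f x - g x)) x =
  fsum s (weak_deriv al f) x - fsum s (weak_deriv al g) x.
Proof.
move=> sf sg hal; rewrite /fsum -mulrBr -sumrB; congr (_ * _).
apply: eq_bigr => k _; rewrite !(@fcoef_weak_deriv _ _ m)//; last exact: sobolevB.
rewrite fcoefB ?mulrBr//.
  by apply: L2_integrable; exact: sobolev_L2 sf.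
by apply: L2_integrable; exact: sobolev_L2 sg.
Qed.

(** Near [t0] the norm of [u t - u t0] is below 1, so the constant of [u t0] enlarged by that of a
    unit norm works there; compactness of the segment makes it uniform. *)
Lemma h2_bounded_segment m al u (S : \bar R) (a b : R) :
  C_sobolev [set t : R | 0 <= t /\ (t%:E < S)%E] m u -> (size al + 2 <= m)%N ->
  0 <= a -> (b%:E < S)%E ->
  exists2 A, 0 <= A & forall t, a <= t <= b -> h2_bounded A (weak_deriv al (u t)).
Proof.
move=> [su cu] hal a0 bS.
have sz : (size al <= m)%N by apply: leq_trans hal; rewrite leq_addr.
have It t : a <= t <= b -> 0 <= t /\ (t%:E < S)%E.
  move=> /andP[at_ tb]; split; first exact: le_trans at_.
  by apply: le_lt_trans bS; rewrite lee_fin.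
pose P (A t : R) := a <= t <= b -> h2_bounded A (weak_deriv al (u t)).
have nc := (compact_near_coveringP `[a, b]%classic).1 (@segment_compact R a b).
have H : \forall A \near +oo, `[a, b]%classic `<=` P A.
  apply: (nc R +oo P) => t0; rewrite /= in_itv/= => t0ab.
  have [t00 t0S] := It _ t0ab.
  have /cvgrPdist_lt/(_ _ ltr01) := cu _ (It _ t0ab).
  rewrite /prop_near1 /within/= => hnear.
  near=> t A => /= tab s us x.
  have [t0' tS] := It _ tab.
  have h1 : sobolev_norm m (fun x => u t x - u t0 x) < 1.
    have : (fun t : R => 0 <= t /\ (t%:E < S)%E -> `|0 - sobolev_norm m (fun x => u t x - u t0 x)| < 1) t.
      by near: t.
    by rewrite sub0r normrN ger0_norm ?sobolev_norm_ge0//; apply.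
  have -> : fsum s (weak_deriv al (u t)) x =
      fsum s (weak_deriv al (fun x => u t x - u t0 x)) x + fsum s (weak_deriv al (u t0)) x.
    by rewrite (@fsum_weak_derivB m) ?subrK//; exact: su.
  apply: (le_trans (ler_normD _ _)).
  have sB : sobolev m (fun x => u t x - u t0 x) by apply: sobolevB; exact: su.
  have b1 := h2_bounded_weak_deriv sB hal us x.
  have b2 := h2_bounded_weak_deriv (su _ (It _ t0ab)) hal us x.
  apply: (le_trans (lerD b1 b2)); rewrite -mulrDl ler_wpM2r ?sqrtr_ge0//.
  rewrite -mulrDr.
  have : n.+1%:R * (1 + sobolev_norm m (u t0)) <= A.
    by near: A; apply: nbhs_pinfty_ge; exact: num_real.
  by apply: le_trans; rewrite ler_wpM2l// lerD2r ltW.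
near +oo_R => A.
exists A; first by near: A; apply: nbhs_pinfty_ge; exact: num_real.
move=> t tab; apply: (near H A) => //=; by rewrite in_itv.
Unshelve. all: by end_near.
Qed.

Lemma fcoef_continuous m u (I : set R) k th t : C_sobolev I m u -> I t ->
  fcoef (u s) k th @[s --> within I (nbhs t)] --> fcoef (u t) k th.
Proof.
move=> [su cu] It.
have h : sobolev_norm m (fun x => u s x - u t x) * L2norm (ct k th : 'rV[R]_n -> R)
    @[s --> within I (nbhs t)] --> (0 : R).
  by rewrite -(mul0r (L2norm (ct k th : 'rV[R]_n -> R))); apply: cvgMl; exact: cu.
apply/cvgrPdist_lt => e e0.
have /cvgrPdist_lt/(_ _ e0) := h.
move=> hn; near=> s; have Is : I s by near: s; exact: withinT.
have hs : `|0 - sobolev_norm m (fun x => u s x - u t x) *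
    L2norm (ct k th : 'rV[R]_n -> R)| < e by near: s.
rewrite distrC; apply: le_lt_trans hs; rewrite sub0r normrN.
rewrite -fcoefB; [|exact: L2_integrable (sobolev_L2 (su _ _))..].
apply: le_trans (ler_norm _); apply: fcoef_le_sobolev.
by apply: sobolevB; exact: su.
Unshelve. all: by end_near.
Qed.

Lemma fcoef_time_deriv m m' u w (I : set R) k th t : C_sobolev I m u -> C_sobolev I m' w ->
  is_time_deriv I u w -> I t ->
  (fcoef (u s) k th - fcoef (u t) k th) / (s - t) @[s --> within I (dnbhs t)] -->
  fcoef (w t) k th.
Proof.
move=> [su cu] [sw cw] dw It.
have h : L2norm (fun x => (u s x - u t x) / (s - t) - w t x) * L2norm (ct k th : 'rV[R]_n -> R)
    @[s --> within I (dnbhs t)] --> (0 : R).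
  by rewrite -(mul0r (L2norm (ct k th : 'rV[R]_n -> R))); apply: cvgMl; exact: dw.
apply/cvgrPdist_lt => e e0.
have /cvgrPdist_lt/(_ _ e0) := h.
move=> hn; near=> s; have Is : I s by near: s; exact: withinT.
have hs : `|0 - L2norm (fun x => (u s x - u t x) / (s - t) - w t x) *
    L2norm (ct k th : 'rV[R]_n -> R)| < e by near: s.
rewrite distrC; apply: le_lt_trans hs; rewrite sub0r normrN.
have Ls := sobolev_L2 (su _ Is); have Lt := sobolev_L2 (su _ It).
have Lw := sobolev_L2 (sw _ It).
have LB : L2 (fun x => (u s x - u t x) / (s - t)).
  by under eq_fun do rewrite mulrC; apply: L2Z; exact: L2B.
have -> : (fcoef (u s) k th - fcoef (u t) k th) / (s - t) - fcoef (w t) k th =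
    fcoef (fun x => (u s x - u t x) / (s - t) - w t x) k th.
  rewrite fcoefB; [|exact: L2_integrable..]; congr (_ - _).
  rewrite -fcoefB; [|exact: L2_integrable..]; rewrite /fcoef mulrC -RintegralZl//.
    by apply: eq_Rintegral => x _; ring.
  by apply: fcoef_integrable; apply: L2_integrable; exact: L2B.
apply: le_trans (ler_norm _); apply: L2_cauchy_schwarz; last exact: L2_ct.
exact: L2B.
Unshelve. all: by end_near.
Qed.

End time_dependence.

(** * Smooth test functions *)

Section flat.
Context {R : realType}.

(* This class is closed under differentiation, at the junction point 0 as well;
   it provides smooth functions of compact support. *)
Definition flat (P : {poly R}) (x : R) : R :=
  if 0 < x then P.[x^-1] * expR (- x^-1) else 0.

Lemma flat_bound P : exists C, forall x, x <= 1 -> `|flat P x| <= C * `|x|.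
Proof.
have mono d : exists C, forall x : R, 0 < x <= 1 -> (x^-1) ^+ d * expR (- x^-1) <= C * x.
  exists ((d.+1)`!)%:R => x /andP[x0 x1].
  have y0 : 0 < x^-1 by rewrite invr_gt0.
  (* With [y = 1 / x], one term of the exponential series beyond [y ^+ d] yields the extra factor
     [x], at the price of [(d + 1)!]. *)
  have := expR_ge1Dxn d (ltW y0).
  set y := x^-1 in y0 *; rewrite (_ : x = y^-1); last by rewrite invrK.
  have f0 : 0 < (d.+1)`!%:R :> R by rewrite ltr0n fact_gt0.
  move=> h; rewrite expRN ler_pdivrMr ?expR_gt0// mulrAC ler_pdivlMr// -exprSr.
  apply: (@le_trans _ _ ((d.+1)`!%:R * (1 + y ^+ d.+1 / (d.+1)`!%:R))).
    by rewrite mulrDr mulr1 mulrCA mulfV ?gt_eqF// mulr1 lerDr ltW.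
  by rewrite ler_pM2l.
suff [C hC] : exists C, forall x : R, 0 < x <= 1 -> `|P.[x^-1] * expR (- x^-1)| <= C * x.
  exists `|C| => x x1; rewrite /flat; case: ifPn => x0; last by rewrite normr0 mulr_ge0.
  apply: (le_trans (hC _ _)); first by rewrite x0.
  by rewrite [`|x|]gtr0_norm// ler_wpM2r ?ler_norm// ltW.
have E (x : R) : P.[x^-1] * expR (- x^-1) =
    \sum_(i < size P) P`_i * ((x^-1) ^+ i * expR (- x^-1)).
  by rewrite horner_coef mulr_suml; apply: eq_bigr => i _; rewrite mulrA.
pose C i := projT1 (cid (mono i)).
exists (\sum_(i < size P) `|P`_i| * C i) => x x01; rewrite E.
apply: (le_trans (ler_norm_sum _ _ _)); rewrite mulr_suml; apply: ler_sum => i _.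
rewrite normrM -mulrA ler_wpM2l// ger0_norm.
  exact: (projT2 (cid (mono i))).
have /andP[x0 _] := x01.
by rewrite mulr_ge0 ?expR_ge0// exprn_ge0// invr_ge0 ltW.
Qed.

(** For [x > 0] this is the chain rule. At 0 the difference quotient of [flat P] is [flat ('X * P)],
    again in the class, and it tends to 0 by [flat_bound]. *)
Lemma is_derive_flat P (x : R) :
  is_derive x 1 (flat P) (flat ('X ^+ 2 * (P - P^`())) x).
Proof.
have [x0|] := ltP 0 x.
  apply: (@near_eq_is_derive _ _ _ (fun x : R => P.[x^-1] * expR (- x^-1))).
    near=> y; rewrite /flat ifT//; near: y; exact: lt_nbhsr.
  have dV : is_derive x 1 (fun y : R => y^-1) (- x ^- 2 *: 1).
    by apply: is_deriveV; rewrite ?gt_eqF.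
  have dNV : is_derive x 1 (fun y : R => - y^-1) (- (- x ^- 2 *: 1)) by exact: is_deriveN.
  have dP := is_derive1_comp (is_derive_poly P x^-1) dV.
  have dE := @is_derive1_comp _ expR (fun y => - y^-1) x _ _ (is_derive_expR (- x^-1)) dNV.
  have dM := is_deriveM dP dE.
  apply: (is_derive_eq dM); rewrite /flat x0 /= !hornerE /GRing.scale/=.
  by field; rewrite gt_eqF.
rewrite le_eqVlt => /predU1P[->|x0].
  have E : (fun h : R => h^-1 *: ((flat P \o shift 0) (h *: (1 : R^o)) - flat P 0)) =
      flat ('X * P).
    apply/funext => h; rewrite /= addr0 (_ : h *: (1 : R^o) = h); last exact: mulr1.
    rewrite {2}/flat ltxx subr0 /flat; case: ifP => h0; last by rewrite scaler0.
    by rewrite hornerM hornerX -mulrA.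
  have cv : (fun h : R => h^-1 *: ((flat P \o shift 0) (h *: (1 : R^o)) - flat P 0)) @ 0^' --> (0 : R).
    rewrite E; have [C hC] := flat_bound ('X * P).
    apply: (@cvg_trans _ (flat ('X * P) @ nbhs (0 : R))).
      by apply: cvg_app; exact: cvg_within.
    apply/cvgrPdist_le => e e0; near=> h; rewrite sub0r normrN.
    apply: (le_trans (hC _ _)).
      by near: h; apply: lt_le_nbhsl; exact: ltr01.
    apply: (@le_trans _ _ ((`|C| + 1) * `|h|)).
      by rewrite ler_wpM2r// (le_trans (ler_norm _))// lerDl.
    rewrite mulrC -ler_pdivlMr ?ltr_wpDl// -[h]subr0 distrC.
    by near: h; apply: cvgr_dist_le; [exact: cvg_id|rewrite divr_gt0// ltr_wpDl].
  split; first by apply/cvg_ex; exists 0.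
  by rewrite /flat ltxx; apply: cvg_lim.
apply: (@near_eq_is_derive _ _ _ (cst 0)).
  near=> y; rewrite /flat ifF//; apply/negbTE; rewrite -leNgt ltW//.
  near: y; exact: lt_nbhsl.
by rewrite /flat ifF; [exact: is_derive_cst|apply/negbTE; rewrite -leNgt ltW].
Unshelve. all: by end_near.
Qed.

End flat.

(** * Smooth functions of time and cut-offs *)

Section smooth_time.
Context {R : realType}.

(** A syntactic class whose stability under differentiation is an induction. [smooth1_prim] admits
    primitives, as the cut-offs in time are primitives of bumps. *)
Inductive smooth1 : (R -> R) -> Prop :=
| smooth1_poly (P : {poly R}) : smooth1 (horner P)
| smooth1_flat P (a b : R) : smooth1 (fun t => flat P (a * t + b))
| smooth1_add f g : smooth1 f -> smooth1 g -> smooth1 (fun t => f t + g t)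
| smooth1_mul f g : smooth1 f -> smooth1 g -> smooth1 (fun t => f t * g t)
| smooth1_prim f g : smooth1 g -> (forall t : R, is_derive t 1 f (g t)) -> smooth1 f.

Lemma smooth1_cst c : smooth1 (fun=> c).
Proof.
by rewrite (_ : (fun=> c) = horner c%:P); [constructor|apply/funext => t; rewrite hornerC].
Qed.

Lemma is_derive_affine (a b t : R) : is_derive t 1 (fun t : R => a * t + b) a.
Proof. by apply: is_derive_eq; rewrite /= !(scaler0, addr0) /GRing.scale /= mulr1. Qed.

Lemma smooth1_derive f : smooth1 f ->
  exists2 g, smooth1 g & forall t : R, is_derive t 1 f (g t).
Proof.
elim=> {f} [P|P a b|f g _ [f' sf' df] _ [g' sg' dg]|f g sf [f' sf' df] sg [g' sg' dg]|f g sg _ df].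
- exists (horner P^`()) => [|t]; first by constructor.
  exact: is_derive_poly.
- exists (fun t => flat ('X ^+ 2 * (P - P^`())) (a * t + b) * a).
    by apply: smooth1_mul; [constructor|exact: smooth1_cst].
  move=> t; exact: (@is_derive1_comp _ (flat P) (fun t => a * t + b) t _ _
    (is_derive_flat _ _) (is_derive_affine a b t)).
- exists (fun t => f' t + g' t) => [|t]; first by constructor.
  exact: is_deriveD.
- exists (fun t => f t * g' t + g t * f' t) => [|t].
    by apply: smooth1_add; apply: smooth1_mul.
  exact: (is_deriveM (df t) (dg t)).
- by exists g.
Qed.

Lemma smooth1_continuous f : smooth1 f -> continuous f.
Proof. by move=> /smooth1_derive[g _ dg] t; exact: is_derive_continuous (dg t). Qed.

Definition bump (x : R) : R := flat 1 x * flat 1 (1 - x).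

Lemma flat1_bound (x : R) : 0 <= flat 1 x <= 1.
Proof.
rewrite /flat; case: ifP => x0; last by rewrite lexx ler01.
rewrite hornerC mul1r expR_ge0/= -expR0 ler_expR oppr_le0 invr_ge0.
exact: ltW.
Qed.

Lemma bump_bound x : 0 <= bump x <= 1.
Proof.
have /andP[a0 a1] := flat1_bound x; have /andP[b0 b1] := flat1_bound (1 - x).
by rewrite mulr_ge0//= mulr_ile1.
Qed.

Lemma smooth1_bump : smooth1 bump.
Proof.
rewrite /bump; apply: smooth1_mul.
  rewrite (_ : flat 1 = fun x => flat 1 (1 * x + 0)); first by constructor.
  by apply/funext => x; rewrite mul1r addr0.
rewrite (_ : (fun x => _) = fun x => flat 1 (-1 * x + 1)); first by constructor.
by apply/funext => x; rewrite mulN1r addrC.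
Qed.

Lemma bump_out x : x <= 0 \/ 1 <= x -> bump x = 0.
Proof.
rewrite /bump /flat => -[x0|x1].
  by rewrite ifF ?mul0r//; apply/negbTE; rewrite -leNgt.
by rewrite [X in _ * X]ifF ?mulr0//; apply/negbTE; rewrite -leNgt subr_le0.
Qed.

Lemma bump_half : 0 < bump (2^-1).
Proof.
rewrite /bump (_ : 1 - 2^-1 = 2^-1); last by field.
by rewrite /flat ifT ?invr_gt0// hornerC mul1r mulr_gt0 ?expR_gt0.
Qed.

Lemma integrable_bump : lebesgue_measure.-integrable [set: R] (EFin \o bump).
Proof.
have mb : measurable_fun [set: R] bump.
  by apply: continuous_measurable_fun; exact/smooth1_continuous/smooth1_bump.
apply: (@le_integrableR _ _ _ lebesgue_measure setT measurableT bump
  (fun x => \1_(`[(0 : R), 1]%classic) x)) => //.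
  move=> x _; have /andP[b0 b1] := bump_bound x; rewrite ger0_norm// indicE.
  have [x01|x01] := boolP (x \in `[(0:R), 1]%classic); first by [].
  rewrite bump_out//; move: x01; rewrite notin_setE/= in_itv/= => /negP.
  by rewrite negb_and -!ltNge => /orP[]/ltW; [left|right].
exact: integrable_indic_itv.
Qed.

Definition bump_prim (x : R) : R := \int[lebesgue_measure]_(t in `]-oo, x]) bump t.

Lemma is_derive_bump_prim (x : R) : is_derive x 1 bump_prim (bump x).
Proof.
have ib : lebesgue_measure.-integrable [set` `]-oo, x + 1]] (EFin \o bump).
  by apply: integrableS integrable_bump.
have x1 : x < x + 1 by rewrite ltrDl.
have cb : {for x, continuous bump} by exact/smooth1_continuous/smooth1_bump.
have FTC := @continuous_FTC1 _ bump -oo%O x (x + 1) x1 ib.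
have [|//|d1 d2] := FTC; first by rewrite /= ltNyr.
by split; [exact: d1|rewrite -derive1E d2].
Qed.

Lemma bump_prim_nd (x y : R) : x <= y -> bump_prim x <= bump_prim y.
Proof.
rewrite le_eqVlt => /predU1P[->//|xy].
have [z _ e] := MVT xy (fun z _ => is_derive_bump_prim z)
  (continuous_subspaceT (fun z => is_derive_continuous (is_derive_bump_prim z))).
rewrite -subr_ge0 e mulr_ge0 ?subr_ge0 ?(ltW xy)//.
by case/andP: (bump_bound z).
Qed.

Lemma bump_prim_cst (a b : R) : a <= b -> (forall z : R, a < z < b -> bump z = 0) ->
  bump_prim a = bump_prim b.
Proof.
rewrite le_eqVlt => /predU1P[->//|ab] h.
have [z zab e] := MVT ab (fun z _ => is_derive_bump_prim z)
  (continuous_subspaceT (fun z => is_derive_continuous (is_derive_bump_prim z))).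
apply/esym/eqP; rewrite -subr_eq0 e h ?mul0r//.
Qed.

Lemma bump_prim_lt : bump_prim 0 < bump_prim 1.
Proof.
rewrite lt_neqAle bump_prim_nd ?ler01// andbT; apply/eqP => e.
have c (z : R) : 0 <= z <= 1 -> bump_prim z = bump_prim 0.
  move=> /andP[z0 z1]; apply/eqP; rewrite eq_le; apply/andP; split.
    by rewrite e; exact: bump_prim_nd.
  exact: bump_prim_nd.
have h0 : is_derive (2^-1 : R) 1 bump_prim 0.
  have dc : is_derive (2^-1 : R) (1 : R) (cst (bump_prim 0) : R -> R) 0.
    exact: is_derive_cst.
  apply: near_eq_is_derive dc.
  near=> z; rewrite c//; apply/andP; split; near: z.
    by apply: lt_le_nbhsr; rewrite invr_gt0.
  by apply: lt_le_nbhsl; lra.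
have [_ h1] := h0; have [_ h2] := is_derive_bump_prim (2^-1).
by have := bump_half; rewrite -h2 h1 ltxx.
Unshelve. all: by end_near.
Qed.

Lemma cutoff_exists : exists C : R, forall tau h : R, 0 < h -> exists s s' : R -> R,
  [/\ smooth1 s, (forall t : R, is_derive t 1 s (s' t)),
      (forall t, tau <= t -> s t = 0) /\ (forall t, t <= tau - h -> s t = 1),
      (forall t, 0 <= s t <= 1) &
      (continuous s' /\ forall t, - (C / h) <= s' t <= 0) /\
      (forall t, ~ (tau - h < t < tau) -> s' t = 0)].
Proof.
pose Z := bump_prim 1 - bump_prim 0.
have Z0 : 0 < Z by rewrite subr_gt0 bump_prim_lt.
exists Z^-1 => tau h h0.
pose a := h^-1; pose b := (h - tau) / h.
have abE t : a * t + b = (t - (tau - h)) / h by rewrite /a /b; field; rewrite gt_eqF.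
pose s t := Z^-1 * (bump_prim 1 - bump_prim (a * t + b)).
pose s' t := - (Z^-1 * (bump (a * t + b) * a)).
have ds (t : R) : is_derive t 1 s (s' t).
  have d1 := @is_derive1_comp _ bump_prim (fun t => a * t + b) t _ _
    (is_derive_bump_prim _) (is_derive_affine a b t).
  have d2 : is_derive t 1 (fun t => bump_prim 1 - bump_prim (a * t + b)) _ :=
    is_deriveB (is_derive_cst (bump_prim 1) t 1) d1.
  have d3 : is_derive t 1 s _ := is_deriveZ Z^-1 d2.
  by apply: (is_derive_eq d3); rewrite /s' sub0r /GRing.scale/= mulrN.
have sbump : smooth1 (fun t => bump (a * t + b)).
  rewrite /bump; apply: smooth1_mul; first by constructor.
  rewrite (_ : (fun t => _) = (fun t => flat 1 ((- a) * t + (1 - b)))); first by constructor.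
  by apply/funext => t; congr flat; ring.
have ss' : smooth1 s'.
  rewrite (_ : s' = fun t => (- (Z^-1 * a)) * bump (a * t + b)).
    by apply: smooth1_mul => //; exact: smooth1_cst.
  by apply/funext => t; rewrite /s'; ring.
have Bmono (x : R) : bump_prim 0 <= bump_prim x <= bump_prim 1.
  apply/andP; split.
    have [x0|x0] := leP 0 x; first exact: bump_prim_nd.
    rewrite (@bump_prim_cst x 0) ?(ltW x0)// => z /andP[_ z0].
    by rewrite bump_out//; left; exact: ltW.
  have [x1|x1] := leP x 1; first exact: bump_prim_nd.
  rewrite -(@bump_prim_cst 1 x) ?(ltW x1)// => z /andP[z1 _].
  by rewrite bump_out//; right; exact: ltW.
exists s, s'; split => //.
- exact: smooth1_prim ss' ds.
- split=> t ht.
    rewrite /s -(@bump_prim_cst 1 (a * t + b)) ?subrr ?mulr0//.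
      by rewrite abE ler_pdivlMr//; lra.
    by move=> z /andP[z1 _]; rewrite bump_out//; right; exact: ltW.
  rewrite /s (@bump_prim_cst (a * t + b) 0) ?mulVf ?gt_eqF//.
    by rewrite abE pmulr_lle0 ?invr_gt0//; lra.
  by move=> z /andP[_ z1]; rewrite bump_out//; left; exact: ltW.
- move=> t; have /andP[b0 b1] := Bmono (a * t + b).
  rewrite /s mulr_ge0 ?invr_ge0 ?(ltW Z0) ?subr_ge0//=.
  by rewrite ler_pdivrMl// mulr1 lerD2l lerN2.
- split.
    split; first exact: smooth1_continuous.
    move=> t; have /andP[b0 b1] := bump_bound (a * t + b).
    have a0 : 0 < a by rewrite invr_gt0.
    have Z0' : 0 <= Z^-1 by rewrite invr_ge0 ltW.
    rewrite /s' lerN2 oppr_le0; apply/andP; split.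
      by rewrite ler_wpM2l// ler_piMl// ltW.
    by rewrite mulr_ge0// mulr_ge0// ltW.
  move=> t ht; rewrite /s' bump_out ?mul0r ?mulr0 ?oppr0//.
  have [t1|t1] := leP t (tau - h).
    by left; rewrite abE pmulr_lle0 ?invr_gt0//; lra.
  have [t2|t2] := leP tau t; last by exfalso; apply: ht; rewrite t1.
  by right; rewrite abE ler_pdivlMr//; lra.
Qed.

End smooth_time.

(** * Space-time trigonometric test functions *)

Section space_time_trig.
Context {R : realType} {n : nat}.
Implicit Types (f g : R * 'rV[R]_n -> R).

(* Trigonometric polynomials in space with smooth coefficients in time. *)
Inductive tfun : (R * 'rV[R]_n -> R) -> Prop :=
| tfun_time psi : smooth1 psi -> tfun (fun z => psi z.1)
| tfun_ct k th : tfun (fun z => ct k th z.2)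
| tfun_add f g : tfun f -> tfun g -> tfun (fun z => f z + g z)
| tfun_mul f g : tfun f -> tfun g -> tfun (fun z => f z * g z).

Lemma tfun_cst c : tfun (fun=> c).
Proof. exact: (tfun_time (smooth1_cst c)). Qed.

Lemma tfunZ c f : tfun f -> tfun (fun z => c * f z).
Proof. by move=> tf; apply: tfun_mul => //; exact: tfun_cst. Qed.

Lemma tfun_opp f : tfun f -> tfun (fun z => - f z).
Proof. by move=> tf; under eq_fun do rewrite -mulN1r; exact: tfunZ. Qed.

Lemma tfun_sum (I : Type) (s : seq I) (F : I -> R * 'rV[R]_n -> R) :
  (forall i, tfun (F i)) -> tfun (fun z => \sum_(i <- s) F i z).
Proof.
move=> tF; elim: s => [|i s IH].
  by under eq_fun do rewrite big_nil; exact: tfun_cst.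
by under eq_fun do rewrite big_cons; exact: tfun_add.
Qed.

Lemma tfun_derive f (v : R * 'rV[R]_n) : tfun f ->
  exists2 g, tfun g & forall z, is_derive z v f (g z).
Proof.
elim=> {f} [psi sp|k th|f g tf [f' tf' df] tg [g' tg' dg]|f g tf [f' tf' df] tg [g' tg' dg]].
- have [psi' sp' dp] := smooth1_derive sp.
  exists (fun z => psi' z.1 * v.1).
    by apply: tfun_mul; [exact: tfun_time|exact: tfun_cst].
  move=> z; apply: is_derive_line => /=.
  have d1 := is_derive_affine v.1 z.1 0.
  have d2 := @is_derive1_comp _ psi (fun h => v.1 * h + z.1) 0 _ _ (dp _) d1.
  rewrite (_ : (fun h : R => _) = psi \o (fun h => v.1 * h + z.1)).
    by apply: (is_derive_eq d2); rewrite /= mulr0 add0r.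
  by apply/funext => h /=; rewrite mulrC.
- exists (fun z => fdot k v.2 * ct k (th + pi / 2) z.2).
    by apply: tfunZ; exact: tfun_ct.
  move=> z; apply: is_derive_line => /=.
  have E : (fun h : R => ct k th (h *: v.2 + z.2)) =
      (fun h : R => cos (h * fdot k v.2 + (fdot k z.2 + th))).
    by apply/funext => h; rewrite /ct fdotDr fdotZr addrA.
  by rewrite E; apply: (is_derive_eq (is_derive_cosD _ _)); rewrite /ct addrA.
- exists (fun z => f' z + g' z) => [|z]; first exact: tfun_add.
  exact: is_deriveD.
- exists (fun z => f z * g' z + g z * f' z) => [|z].
    by apply: tfun_add; apply: tfun_mul.
  exact: (is_deriveM (df z) (dg z)).
Qed.

Lemma tfun_cvg f (z : R * 'rV[R]_n) : tfun f -> f y @[y --> z] --> f z.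
Proof.
have FF : Filter (nbhs z) by exact: nbhs_filter.
elim=> {f} [psi sp|k th|f g _ IHf _ IHg|f g _ IHf _ IHg].
- have h : y.1 @[y --> z] --> z.1 by case: z FF => a b FF; exact: cvg_fst.
  exact: (@cvg_comp _ _ _ _ psi _ _ _ h (@smooth1_continuous _ _ sp z.1)).
- have h : y.2 @[y --> z] --> z.2 by case: z FF => a b FF; exact: cvg_snd.
  exact: (@cvg_comp _ _ _ _ (ct k th) _ _ _ h (@continuous_ct _ _ k th z.2)).
- exact: cvgD.
- exact: cvgM.
Qed.

Lemma tfun_smooth f : tfun f -> smooth f.
Proof.
apply: smooth_class => [{}f tf z|{}f v tf]; first exact: tfun_cvg.
by have [g tg dg] := tfun_derive v tf; exists g.
Qed.

Lemma tfun_periodic f t : tfun f -> Defs.periodic (fun x => f (t, x)).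
Proof.
elim=> {f} [psi sp|k th|f g _ IHf _ IHg|f g _ IHf _ IHg] i x //=.
- exact: periodic_ct.
- by rewrite IHf IHg.
- by rewrite IHf IHg.
Qed.

Lemma tfun_measurable f : tfun f ->
  measurable_fun [set: measurableTypeR R * 'rV[R]_n] f.
Proof.
elim=> {f} [psi sp|k th|f g _ IHf _ IHg|f g _ IHf _ IHg].
- apply: (@measurableT_comp _ _ _ _ _ _ psi) => //.
  by apply: continuous_measurable_fun; exact: smooth1_continuous.
- by apply: (@measurableT_comp _ _ _ _ _ _ (ct k th)) => //; exact: measurable_ct.
- exact: measurable_funD.
- exact: measurable_funM.
Qed.

Lemma tfun_measurable_slice f t : tfun f -> measurable_fun setT (fun x => f (t, x)).
Proof.
elim=> {f} [psi sp|k th|f g _ IHf _ IHg|f g _ IHf _ IHg] //=.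
- exact: measurable_ct.
- exact: measurable_funD.
- exact: measurable_funM.
Qed.

Lemma tfun_bounded f (a b : R) : tfun f ->
  exists2 M, 0 <= M & forall t x, a <= t <= b -> `|f (t, x)| <= M.
Proof.
elim=> {f} [psi sp|k th|f g _ [M M0 fM] _ [M' M'0 gM]|f g _ [M M0 fM] _ [M' M'0 gM]].
- have [M [_ hM]] := compact_bounded (continuous_compact
    (continuous_subspaceT (smooth1_continuous sp)) (@segment_compact R a b)).
  exists (`|M| + 1) => [|t x tab /=]; first by rewrite addr_ge0.
  apply: (hM (`|M| + 1)); first by rewrite ltr_pwDr// ler_norm.
  by exists t => //=; rewrite in_itv.
- by exists 1 => // t x _; exact: ct_le1.
- exists (M + M') => [|t x tab]; first exact: addr_ge0.
  by apply: (le_trans (ler_normD _ _)); rewrite lerD ?fM ?gM.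
- exists (M * M') => [|t x tab]; first exact: mulr_ge0.
  by rewrite normrM ler_pM ?fM ?gM.
Qed.

Lemma tfun_dt f : tfun f -> tfun (dt f).
Proof.
move=> tf; have [g tg dg] := tfun_derive (1, 0) tf.
by rewrite (_ : dt f = g)//; apply/funext => z; have [_ <-] := dg z.
Qed.

Lemma tfun_dx i f : tfun f -> tfun (dx i f).
Proof.
move=> tf; have [g tg dg] := tfun_derive (0, unitv i) tf.
by rewrite (_ : dx i f = g)//; apply/funext => z; have [_ <-] := dg z.
Qed.

Lemma tfun_is_derive f z v : tfun f -> is_derive z v f ('D_v f z).
Proof.
by move=> tf; have [g _ dg] := tfun_derive v tf; have := dg z; case => d _; exact: derivableP.
Qed.

Lemma tfun_dtD f g z : tfun f -> tfun g -> dt (fun z => f z + g z) z = dt f z + dt g z.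
Proof.
move=> tf tg; rewrite /dt.
by have [_ ->] := is_deriveD (tfun_is_derive z (1, 0) tf) (tfun_is_derive z (1, 0) tg).
Qed.

Lemma tfun_dxD i f g z : tfun f -> tfun g -> dx i (fun z => f z + g z) z = dx i f z + dx i g z.
Proof.
move=> tf tg; rewrite /dx.
by have [_ ->] := is_deriveD (tfun_is_derive z (0, unitv i) tf) (tfun_is_derive z (0, unitv i) tg).
Qed.

Lemma tfun_dtM f g z : tfun f -> tfun g ->
  dt (fun z => f z * g z) z = f z * dt g z + g z * dt f z.
Proof.
move=> tf tg; rewrite /dt.
by have [_ ->] := is_deriveM (tfun_is_derive z (1, 0) tf) (tfun_is_derive z (1, 0) tg).
Qed.

Lemma tfun_dxM i f g z : tfun f -> tfun g ->
  dx i (fun z => f z * g z) z = f z * dx i g z + g z * dx i f z.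
Proof.
move=> tf tg; rewrite /dx.
by have [_ ->] := is_deriveM (tfun_is_derive z (0, unitv i) tf) (tfun_is_derive z (0, unitv i) tg).
Qed.

Lemma dt_time (psi psi' : R -> R) (z : R * 'rV[R]_n) :
  (forall t : R, is_derive t 1 psi (psi' t)) -> dt (fun z => psi z.1) z = psi' z.1.
Proof.
move=> dp; rewrite /dt; suff [_ ->] : is_derive z ((1, 0) : R * 'rV[R]_n) (fun z => psi z.1) (psi' z.1).
  by [].
apply: is_derive_line => /=.
have d2 := @is_derive1_comp _ psi (fun h => 1 * h + z.1) 0 _ _ (dp _) (is_derive_affine 1 z.1 0).
rewrite (_ : (fun h : R => _) = psi \o (fun h => 1 * h + z.1)).
  by apply: (is_derive_eq d2); rewrite /= mulr0 add0r mulr1.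
by apply/funext => h /=; rewrite mulrC.
Qed.

Lemma dx_time i (psi : R -> R) (z : R * 'rV[R]_n) : dx i (fun z => psi z.1) z = 0.
Proof.
rewrite /dx; suff [_ ->] : is_derive z ((0, unitv i) : R * 'rV[R]_n) (fun z => psi z.1) 0 by [].
apply: is_derive_line => /=.
rewrite (_ : (fun h : R => _) = cst (psi z.1)); first exact: is_derive_cst.
by apply/funext => h /=; rewrite scaler0 add0r.
Qed.

Lemma dt_ct k th (z : R * 'rV[R]_n) : dt (fun z => ct k th z.2) z = 0.
Proof.
rewrite /dt; suff [_ ->] : is_derive z ((1, 0) : R * 'rV[R]_n) (fun z => ct k th z.2) 0 by [].
apply: is_derive_line => /=.
rewrite (_ : (fun h : R => _) = cst (ct k th z.2)); first exact: is_derive_cst.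
by apply/funext => h /=; rewrite scaler0 add0r.
Qed.

Lemma dx_ct i k th (z : R * 'rV[R]_n) :
  dx i (fun z => ct k th z.2) z = pi * (k ord0 i)%:~R * ct k (th + pi / 2) z.2.
Proof.
rewrite /dx; suff [_ ->] : is_derive z ((0, unitv i) : R * 'rV[R]_n) (fun z => ct k th z.2)
  (fdot k (unitv i) * ct k (th + pi / 2) z.2) by rewrite fdot_unitv.
apply: is_derive_line => /=.
have E : (fun h : R => ct k th (h *: unitv i + z.2)) =
    (fun h : R => cos (h * fdot k (unitv i) + (fdot k z.2 + th))).
  by apply/funext => h; rewrite /ct fdotDr fdotZr addrA.
by rewrite E; apply: (is_derive_eq (is_derive_cosD _ _)); rewrite /ct addrA.
Qed.

Lemma tfun_test (T T' : R) f : tfun f -> T' < T -> (forall t x, T' <= t -> f (t, x) = 0) ->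
  test_cylinder n T f.
Proof.
move=> tf TT f0; split; [exact: tfun_smooth|by move=> t; exact: tfun_periodic|].
by exists T'.
Qed.

(* Normal form: products of cosines are sums of cosines. *)
Inductive trig_sum : ('rV[R]_n -> R) -> Prop :=
| trig_sum_ct c k th : trig_sum (fun x => c * ct k th x)
| trig_sum_add (f g : 'rV[R]_n -> R) : trig_sum f -> trig_sum g -> trig_sum (fun x => f x + g x).

Lemma trig_sum_cst c : trig_sum (fun=> c).
Proof.
rewrite (_ : (fun=> c) = fun x => c * ct 0 0 x); first by constructor.
by apply/funext => x; rewrite /ct fdot0l addr0 cos0 mulr1.
Qed.

Lemma trig_sumM (f g : 'rV[R]_n -> R) : trig_sum f -> trig_sum g -> trig_sum (fun x => f x * g x).
Proof.
move=> tf; elim: tf g => {f} [c k th|f1 f2 _ IH1 _ IH2] g tg; last first.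
  by under eq_fun do rewrite mulrDl; apply: trig_sum_add; [exact: IH1|exact: IH2].
elim: tg => {g} [d l th'|g1 g2 _ IH1 _ IH2]; last first.
  by under eq_fun do rewrite mulrDr; exact: trig_sum_add.
rewrite (_ : (fun x => _) = fun x => (c * d / 2) * ct (k + l) (th + th') x +
   (c * d / 2) * ct (k - l) (th - th') x); first by apply: trig_sum_add; constructor.
by apply/funext => x; rewrite mulrACA ctM; ring.
Qed.

Lemma tfun_trig_sum f t : tfun f -> trig_sum (fun x => f (t, x)).
Proof.
elim=> {f} [psi sp|k th|f g _ IHf _ IHg|f g _ IHf _ IHg] /=.
- exact: trig_sum_cst.
- by rewrite (_ : (fun x => _) = fun x => 1 * ct k th x); [constructor|
    apply/funext => x; rewrite mul1r].
- exact: trig_sum_add.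
- exact: trig_sumM.
Qed.

Lemma trig_sum_integrable (f : 'rV[R]_n -> R) : trig_sum f ->
  (lebesgue_rV R n).-integrable (torus n) (EFin \o f).
Proof.
have mT := @measurable_torus R n.
elim=> [c k th|g h _ IHg _ IHh]; last exact: integrableRD.
by apply: integrableRZl => //; exact/L2_integrable/L2_ct.
Qed.

Lemma trig_sum_integral_derive (f : 'rV[R]_n -> R) i : trig_sum f -> exists2 g,
  trig_sum g /\ (forall x, is_derive x (unitv i) f (g x)) &
  \int[lebesgue_rV R n]_(x in torus n) g x = 0.
Proof.
have mT := @measurable_torus R n.
elim=> {f} [c k th|f g _ [f' [tf' df] f0] _ [g' [tg' dg] g0]].
  exists (fun x => (c * (pi * (k ord0 i)%:~R)) * ct k (th + pi / 2) x); first split.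
  - by constructor.
  - move=> x; have d : is_derive x (unitv i) (fun x => c * ct k th x) _ :=
      is_deriveZ c (is_derive_ct k th x (unitv i)).
    by apply: (is_derive_eq d); rewrite fdot_unitv -[LHS]/(_ * _); ring.
  - rewrite RintegralZl//; last exact/L2_integrable/L2_ct.
    by rewrite Rintegral_ct; case: eqP => [->|_]; rewrite ?mulr0// mxE mulr0z !(mulr0, mul0r).
exists (fun x => f' x + g' x); first split.
- exact: trig_sum_add.
- by move=> x; exact: is_deriveD.
- by rewrite RintegralD// ?f0 ?g0 ?addr0//; exact: trig_sum_integrable.
Qed.

(** In the normal form [trig_sum] a derivative has no term of frequency 0, and all other cosines
    have mean 0. *)
Lemma tfun_integral_dx f i t : tfun f ->
  \int[lebesgue_rV R n]_(x in torus n) dx i f (t, x) = 0.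
Proof.
move=> tf; have [g [_ dg] g0] := trig_sum_integral_derive i (tfun_trig_sum t tf).
rewrite -[RHS]g0; apply: eq_Rintegral => x _.
have <- : 'D_(unitv i) (fun x => f (t, x)) x = g x by case: (dg x) => _ ->.
have E : (fun h : R => h^-1 *: ((f \o shift (t, x)) (h *: (0, unitv i)) - f (t, x))) =
    (fun h : R => h^-1 *: (((fun x => f (t, x)) \o shift x) (h *: unitv i) - f (t, x))).
  apply/funext => h /=; congr (_ *: (f _ - _)).
  by rewrite [LHS]surjective_pairing /=; congr (_, _); rewrite scaler0 add0r.
by rewrite /dx /derive E.
Qed.

End space_time_trig.

(** * Smooth approximation of the Euler solution *)

Section trig_poly.
Context {R : realType} {n : nat}.
Implicit Types (f : 'rV[R]_n -> R) (k : 'rV[int]_n) (s : seq 'rV[int]_n)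
  (c : 'rV[int]_n -> bool -> R).
Local Notation mu := (lebesgue_rV R n).
Let mT : measurable (torus n : set 'rV[R]_n) := @measurable_torus R n.

(* [b] selects the cosine ([false]) or the sine ([true]) of frequency [k]. *)
Definition tpoly s c (x : 'rV[R]_n) : R :=
  \sum_(k <- s) (2 ^+ n)^-1 * (c k false * ct k 0 x + c k true * ct k (- (pi / 2)) x).

Definition pcoef f k (b : bool) : R := fcoef f k (if b then - (pi / 2) else 0).

(** Coefficients of the derivative in direction [j], which exchanges cosine and sine. *)
Definition dcoef (j : 'I_n) c k (b : bool) : R :=
  pi * (k ord0 j)%:~R * (if b then - c k false else c k true).

Lemma fsum_tpoly s f x : mu.-integrable (torus n) (EFin \o f) ->
  fsum s f x = tpoly s (pcoef f) x.
Proof. exact: fsumE. Qed.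

Lemma pcoef_weak_deriv m j f k b : sobolev m f -> (1 <= m)%N ->
  pcoef (weak_deriv [:: j] f) k b = dcoef j (pcoef f) k b.
Proof.
move=> sf m1; rewrite /pcoef (@fcoef_weak_deriv _ _ m)// /kfac big_seq1 expr1 mul1r /dcoef /pcoef.
case: b; first by rewrite addNr; ring.
rewrite add0r fcoef_expand; last exact/L2_integrable/(sobolev_L2 sf).
by rewrite cos_pihalf sin_pihalf; ring.
Qed.

Lemma tpoly_dist s c c' dl x : (forall k b, k \in s -> `|c k b - c' k b| <= dl) ->
  `|tpoly s c x - tpoly s c' x| <= (size s)%:R * (dl + dl).
Proof.
move=> h; rewrite /tpoly -sumrB.
apply: (le_trans (ler_norm_sum _ _ _)).
have -> : (size s)%:R * (dl + dl) = \sum_(k <- s) (dl + dl).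
  by rewrite big_const_seq count_predT iter_addr_0 mulr_natl.
rewrite big_seq [leRHS]big_seq; apply: ler_sum => k ks.
rewrite -mulrBr normrM ger0_norm ?invr_ge0 ?exprn_ge0//.
rewrite ler_pdivrMl ?exprn_gt0//.
have -> : c k false * ct k 0 x + c k true * ct k (- (pi / 2)) x -
    (c' k false * ct k 0 x + c' k true * ct k (- (pi / 2)) x) =
    (c k false - c' k false) * ct k 0 x + (c k true - c' k true) * ct k (- (pi / 2)) x by ring.
have H b th : `|(c k b - c' k b) * ct k th x| <= dl.
  by rewrite normrM -[leRHS]mulr1 ler_pM ?ct_le1 ?h.
apply: (le_trans (ler_normD _ _)); apply: (@le_trans _ _ (dl + dl)); first exact: lerD.
have dl0 : 0 <= dl by apply: le_trans (H false 0).
by rewrite ler_peMl ?addr_ge0// exprn_ege1// ler1n.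
Qed.

Lemma dcoef_dist j c c' k dl b (K : nat) : k \in box n K ->
  (forall b, `|c k b - c' k b| <= dl) ->
  `|dcoef j c k b - dcoef j c' k b| <= pi * K%:R * dl.
Proof.
rewrite mem_box => /forallP/(_ j) kK h.
have -> : dcoef j c k b - dcoef j c' k b =
    pi * ((k ord0 j)%:~R * (if b then c' k false - c k false else c k true - c' k true)).
  by rewrite /dcoef; case: b; ring.
rewrite normrM ger0_norm ?pi_ge0// -mulrA ler_wpM2l ?pi_ge0// normrM ler_pM//.
  by rewrite -intr_norm pmulrn ler_int -abszE lez_nat.
by case: b; rewrite // distrC.
Qed.

Lemma tfun_derive_sum (I : Type) (s : seq I) (F : I -> R * 'rV[R]_n -> R) v z :
  (forall i, tfun (F i)) ->
  'D_v (fun z => \sum_(i <- s) F i z) z = \sum_(i <- s) 'D_v (F i) z.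
Proof.
move=> tF; elim: s => [|i s IH].
  by under eq_fun do rewrite big_nil; rewrite big_nil derive_cst.
under eq_fun do rewrite big_cons; rewrite big_cons -IH.
have tS : tfun (fun z => \sum_(i <- s) F i z) by exact: tfun_sum.
by have [_ ->] := is_deriveD (tfun_is_derive z v (tF i)) (tfun_is_derive z v tS).
Qed.

Lemma tfun_tpoly s (c : R -> 'rV[int]_n -> bool -> R) :
  (forall k b, smooth1 (fun t => c t k b)) -> tfun (fun z => tpoly s (c z.1) z.2).
Proof.
move=> sc; apply: tfun_sum => k; apply: tfunZ; apply: tfun_add; apply: tfun_mul;
  by [exact: tfun_ct|exact: (tfun_time (sc _ _))].
Qed.

Lemma dx_tpoly s (c : R -> 'rV[int]_n -> bool -> R) j :
  (forall k b, smooth1 (fun t => c t k b)) ->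
  dx j (fun z => tpoly s (c z.1) z.2) = fun z => tpoly s (dcoef j (c z.1)) z.2.
Proof.
move=> sc; apply/funext => z.
have tc k b := tfun_time (n := n) (sc k b).
have tm k b th := tfun_mul (tc k b) (tfun_ct k th).
have td k th th' := tfun_add (tm k false th) (tm k true th').
rewrite {1}/dx tfun_derive_sum; last by move=> k; apply: tfunZ; exact: td.
apply: eq_bigr => k _; rewrite -/(dx j _ z).
rewrite (tfun_dxM j z (tfun_cst _) (td k 0 (- (pi / 2)))) (dx_time j (fun=> _)) mulr0 addr0.
rewrite (tfun_dxD j z (tm k false 0) (tm k true (- (pi / 2)))).
rewrite (tfun_dxM j z (tc k false) (tfun_ct k 0)) (tfun_dxM j z (tc k true) (tfun_ct k _)).
rewrite !(dx_time j (fun t => c t k _)) !dx_ct /dcoef !mulr0 !addr0 add0r addNr.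
by rewrite [ct k (pi / 2) z.2]ct_expand cos_pihalf sin_pihalf; ring.
Qed.

Lemma dt_tpoly s (c c' : R -> 'rV[int]_n -> bool -> R) :
  (forall k b, smooth1 (fun t => c t k b)) ->
  (forall k b (t : R), is_derive t 1 (fun t => c t k b) (c' t k b)) ->
  dt (fun z => tpoly s (c z.1) z.2) = fun z => tpoly s (c' z.1) z.2.
Proof.
move=> sc dc; apply/funext => z.
have tc k b := tfun_time (n := n) (sc k b).
have tm k b th := tfun_mul (tc k b) (tfun_ct k th).
have td k th th' := tfun_add (tm k false th) (tm k true th').
rewrite {1}/dt tfun_derive_sum; last by move=> k; apply: tfunZ; exact: td.
apply: eq_bigr => k _; rewrite -/(dt _ z).
rewrite (tfun_dtM z (tfun_cst _) (td k 0 (- (pi / 2)))).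
have -> : dt (fun=> (2 ^+ n)^-1) z = 0 by rewrite /dt derive_cst.
rewrite mulr0 addr0.
rewrite (tfun_dtD z (tm k false 0) (tm k true (- (pi / 2)))).
rewrite (tfun_dtM z (tc k false) (tfun_ct k 0)) (tfun_dtM z (tc k true) (tfun_ct k _)).
by rewrite !(dt_time z (dc k _)) !dt_ct; ring.
Qed.

Lemma tpoly_integral0 s c : (forall b, c 0 b = 0) ->
  \int[mu]_(x in torus n) tpoly s c x = 0.
Proof.
move=> c0.
have ii k : mu.-integrable (torus n) (EFin \o (fun x => (2 ^+ n)^-1 *
    (c k false * ct k 0 x + c k true * ct k (- (pi / 2)) x))).
  by apply: integrableRZl => //; apply: integrableRD => //; apply: integrableRZl => //;
    exact/L2_integrable/L2_ct.
rewrite /tpoly Rintegral_sum//; apply: big1 => k _.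
rewrite RintegralZl//; last first.
  by apply: integrableRD => //; apply: integrableRZl => //; exact/L2_integrable/L2_ct.
rewrite RintegralD//; try by apply: integrableRZl => //; exact/L2_integrable/L2_ct.
rewrite !RintegralZl//; try exact/L2_integrable/L2_ct.
by rewrite !Rintegral_ct; case: eqP => [->|_]; rewrite ?c0; ring.
Qed.

End trig_poly.

(** * Polynomial approximation of coefficients in time *)

Section polynomial_time.
Context {R : realType}.

Lemma poly_primitive (P : {poly R}) (c : R) : exists F : R -> R,
  [/\ smooth1 F, (forall t : R, is_derive t 1 F P.[t]) & F 0 = c].
Proof.
pose Q : {poly R} := \sum_(i < size P) (P`_i / i.+1%:R) *: 'X^(i.+1) + c%:P.
exists (horner Q); split; first by constructor.
  move=> t; apply: (is_derive_eq (is_derive_poly Q t)).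
  congr (_.[t]); rewrite derivD derivC addr0 -[RHS]coefK poly_def raddf_sum/=.
  apply: eq_bigr => i _; transitivity ((P`_i / i.+1%:R) *: (i.+1%:R *: 'X^i) : {poly R}).
    by rewrite derivZ derivXn scaler_nat.
  by rewrite scalerA -mulrA mulVf ?mulr1// pnatr_eq0.
rewrite hornerD hornerC horner_sum big1 ?add0r// => i _.
by rewrite hornerZ hornerXn expr0n mulr0.
Qed.

Lemma near_seq (I : eqType) (s : seq I) (T : Type) (F : set_system T) {FF : Filter F}
    (P : I -> T -> Prop) :
  (forall i, \forall m \near F, P i m) -> \forall m \near F, forall i, i \in s -> P i m.
Proof.
move=> h; elim: s => [|i s IH]; first by apply: nearW => m i; rewrite in_nil.
apply: filterS2 (h i) IH => m Pi Ps j; rewrite inE => /predU1P[->//|]; exact: Ps.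
Qed.

Definition tbern (T : R) m (F : R -> R) (t : R) : R := bernstein m (fun y => F (T * y)) (t / T).

Lemma tbern_poly (T : R) m F : exists P : {poly R}, forall t, P.[t] = tbern T m F t.
Proof.
have [P hP] := bernsteinE m (fun y => F (T * y)).
by exists (P \Po (T^-1 *: 'X)) => t; rewrite horner_comp hornerZ hornerX hP /tbern mulrC.
Qed.

Lemma tbern_approx (T : R) (F : R -> R) : 0 < T -> {within `[0, T], continuous F} -> forall e, 0 < e ->
  \forall m \near \oo, forall t, 0 <= t <= T -> `|tbern T m F t - F t| <= e.
Proof.
move=> T0 cF e e0.
have cG : {within `[0, 1], continuous (fun y => F (T * y))}.
  apply/subspace_continuousP => y /=; rewrite in_itv/= => /andP[y0 y1].
  have seg z : 0 <= z -> z <= 1 -> `[0, T]%classic (T * z).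
    by move=> z0 z1; rewrite /= in_itv/= mulr_ge0 ?(ltW T0)//= ler_piMr// ltW.
  apply: (cvg_comp (fun z => T * z) F) ((subspace_continuousP _ _).1 cF _ (seg y y0 y1)).
  have c : T * z @[z --> y] --> T * y by apply: cvgMr; exact: cvg_id.
  move=> A /c cA; rewrite /fmap/= /within/=; apply: (@filterS _ _ (nbhs_filter y) _ _ _ cA) => z /= hz.
  by rewrite in_itv/= => /andP[z0 z1]; apply: hz; exact: seg.
apply: filterS (bernstein_approx cG e0) => m h t /andP[t0 tT].
have := h (t / T); rewrite mulrCA divff ?gt_eqF// mulr1; apply.
by rewrite divr_ge0 ?(ltW T0)//= ler_pdivrMr// mul1r.
Qed.

(** The Bernstein operator is linear in [F] and only samples it inside [[0, T]], so a linear
    relation survives exactly. This keeps the approximate velocity divergence free. *)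
Lemma tbern_sum0 (I : finType) (T : R) m (a : I -> R) (F : I -> R -> R) t : 0 < T ->
  (forall t, 0 <= t <= T -> \sum_i a i * F i t = 0) -> \sum_i a i * tbern T m (F i) t = 0.
Proof.
move=> T0 h; rewrite /tbern /bernstein.
under eq_bigr do rewrite mulr_sumr.
rewrite exchange_big/= big1// => j _.
under eq_bigr do rewrite mulrA.
rewrite -mulr_suml h ?mul0r//.
(* For [m = 0] the node [j / 0] is 0 by convention, still a point of the segment. *)
case: m j => [|m] j; first by rewrite invr0 !mulr0 lexx ltW.
have jm : (j <= m.+1)%N by rewrite -ltnS.
rewrite mulr_ge0 ?(ltW T0) ?divr_ge0//=.
by rewrite ler_piMr ?(ltW T0)// ler_pdivrMr// mul1r ler_nat.
Qed.

End polynomial_time.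

(** * Difference quotients in time *)

Section difference_quotient.
Context {R : realType}.

Lemma is_derive_diff_quotient (I : set R) (a : R -> R) (b t : R) :
  (\forall s \near t, I s) ->
  (a s - a t) / (s - t) @[s --> within I (dnbhs t)] --> b -> is_derive t 1 a b.
Proof.
move=> It h.
have cv : (fun h : R => h^-1 *: ((a \o shift t) (h *: (1 : R^o)) - a t)) @ 0^' --> b.
  apply/cvgrPdist_lt => e e0.
  have /cvgrPdist_lt/(_ _ e0) := h; rewrite /within /dnbhs /= => h1.
  have {}h1 : nbhs t (fun s => s != t -> I s -> `|b - (a s - a t) / (s - t)| < e) := h1.
  have {}h1 : nbhs t (fun s => s != t -> `|b - (a s - a t) / (s - t)| < e).
    by apply: filterS2 It h1 => s Is hs st; exact: hs.
  have c : s + t @[s --> (0 : R)] --> t.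
    by rewrite -[X in _ --> X]add0r; apply: cvgD; [exact: cvg_id|exact: cvg_cst].
  have h2 : nbhs (0 : R) (fun s => s + t != t -> `|b - (a (s + t) - a t) / (s + t - t)| < e) :=
    c _ h1.
  suff : nbhs (0 : R) (fun s : R => s != 0 ->
    `|b - s^-1 *: ((a \o shift t) (s *: (1 : R^o)) - a t)| < e) by [].
  apply: filterS h2 => s /= hs s0.
  rewrite [s%:A]mulr1 -[s^-1 *: _]/(s^-1 * _) mulrC.
  by have := hs; rewrite addrK; apply; rewrite -subr_eq0 addrK.
split; first by apply/cvg_ex; exists b.
by apply: cvg_lim.
Unshelve. all: by end_near.
Qed.

(** The interval [[0, S)] contains points to the right of each of its elements, so limits along it
    are unique, also at [t = 0]. *)
Lemma proper_within_dnbhs (S : \bar R) (t : R) : 0 <= t -> (t%:E < S)%E ->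
  ProperFilter (within [set s : R | 0 <= s /\ (s%:E < S)%E] (dnbhs t)).
Proof.
move=> t0 tS.
have sub : within [set s : R | 0 <= s /\ (s%:E < S)%E] (dnbhs t) `<=` t^'+.
  move=> A; rewrite /dnbhs /at_right /within /= => h.
  have nS : \forall s \near t, (s%:E < S)%E.
    case: S tS {h} => [S| |]//= tS; last by near=> s; exact: ltry.
    by near=> s; rewrite lte_fin; near: s; apply: lt_nbhsl; rewrite -lte_fin.
  have {}h : nbhs t (fun s => s != t -> 0 <= s /\ (s%:E < S)%E -> A s) := h.
  suff : nbhs t (fun s => t < s -> A s) by [].
  apply: filterS2 h nS => s hs sS ts; apply: hs; first by rewrite gt_eqF.
  by split; [rewrite (le_trans t0)// ltW|].
apply: Build_ProperFilter_ex => A /sub h.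
exact: (@filter_ex _ t^'+ _ A h).
Unshelve. all: by end_near.
Qed.

Lemma mvt_bound (T c : R) (f f' : R -> R) : {within `[0, T], continuous f} ->
  (forall t : R, 0 < t < T -> is_derive t 1 f (f' t)) ->
  (forall t, 0 <= t <= T -> `|f' t| <= c) -> f 0 = 0 ->
  forall t, 0 <= t <= T -> `|f t| <= c * T.
Proof.
move=> cf df bf f0 t /andP[t0 tT].
have T0 : 0 <= T := le_trans t0 tT.
have c0 : 0 <= c by apply: le_trans (bf 0 _); rewrite // lexx (le_trans t0).
move: t0; rewrite le_eqVlt => /predU1P[<-|t0].
  by rewrite f0 normr0 mulr_ge0.
have sub : `[0, t]%classic `<=` `[0, T]%classic.
  by move=> x /=; rewrite !in_itv/= => /andP[-> xt]; exact: le_trans xt tT.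
rewrite -[f t]subr0 -f0.
have [x|x xt ->] := @MVT R f f' 0 t t0 _ (continuous_subspaceW sub cf).
  by rewrite in_itv/= => /andP[x0 xt]; apply: df; rewrite x0 (lt_le_trans xt).
move: xt; rewrite in_itv/= => /andP[x0 xt].
rewrite !subr0 normrM (gtr0_norm t0) ler_pM// ?(ltW t0)//.
by rewrite bf// (ltW x0)/= ltW// (lt_le_trans xt).
Qed.

End difference_quotient.
Lemma eq_Rintegral_ae d (X : measurableType d) (R : realType) (mu : {measure set X -> \bar R})
    (D : set X) (f g : X -> R) : measurable D -> measurable_fun D f -> measurable_fun D g ->
  {ae mu, forall x, D x -> f x = g x} ->
  \int[mu]_(x in D) f x = \int[mu]_(x in D) g x.
Proof.
move=> mD mf mg fg; rewrite /Rintegral; congr fine; apply: ae_eq_integral => //.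
- exact/measurable_EFinP.
- exact/measurable_EFinP.
- by apply: filterS fg => x h Dx; rewrite h.
Qed.

(** * Fourier description of the Euler solution *)

Section kato.
Context {R : realType} {n : nat}.
Local Notation mu := (lebesgue_rV R n).
Let mT : measurable (torus n : set 'rV[R]_n) := @measurable_torus R n.

(** Bounds every box sum of a function with H^2 constant 1: distance to the box 0, plus the sum over
    that box. *)
Definition fsum_const : R := htail n 0 + Num.sqrt ((2 ^+ n)^-1 * hsum n 0).

Lemma fsum_const_ge0 : 0 <= fsum_const.
Proof. by rewrite addr_ge0// sqrtr_ge0. Qed.

Lemma fsum_box_bound A (f : 'rV[R]_n -> R) K x : (n <= 3)%N -> 0 <= A -> h2_bounded A f ->
  `|fsum (box n K) f x| <= A * fsum_const.
Proof.
move=> n3 A0 hf; rewrite -[fsum _ f x](subrK (fsum (box n 0) f x)).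
apply: (le_trans (ler_normD _ _)); rewrite mulrDr lerD ?fsum_box_dist//.
by apply: hf; exact: box_uniq.
Qed.

Lemma h2_bounded_le A B (f : 'rV[R]_n -> R) : A <= B -> h2_bounded A f -> h2_bounded B f.
Proof.
move=> AB hf s us x; apply: (le_trans (hf s us x)).
by rewrite ler_wpM2r ?sqrtr_ge0.
Qed.

Lemma h2_bounded_sobolev m A (f : 'rV[R]_n -> R) : sobolev m f ->
  h2_bounded A (weak_deriv [::] f) -> h2_bounded A f.
Proof.
move=> sf h s us x; have := h s us x; rewrite /fsum.
under eq_bigr do rewrite (fcoef_weak_deriv _ _ sf)// /kfac big_nil expr0 !mul1r mul0r addr0.
by [].
Qed.

(* [a], [b] and [g] are the Fourier coefficients of v, of its time derivative and
   of the pressure; the mean of the pressure is normalized to 0.  [F], [G], [H]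
   and [E] are v, its gradient, its time derivative and the pressure gradient. *)
Lemma kato_fourier k v0 (S : \bar R) v (T : R) : (n <= 3)%N -> (3 <= k)%N -> 0 < T ->
  (T%:E < S)%E -> kato_solution k v0 S v ->
  exists (A : R) (a b : 'I_n -> 'rV[int]_n -> bool -> R -> R) (g : 'rV[int]_n -> bool -> R -> R)
    (F : 'I_n -> R -> 'rV[R]_n -> R) (G : 'I_n -> 'I_n -> R -> 'rV[R]_n -> R)
    (H E : 'I_n -> R -> 'rV[R]_n -> R),
  [/\ 0 <= A,
    (forall t, 0 <= t <= T -> [/\ (forall i, L2 (F i t) /\ h2_bounded A (F i t)),
      (forall i j, L2 (G i j t) /\ h2_bounded A (G i j t)),
      (forall i, L2 (H i t) /\ h2_bounded A (H i t)) &
      (forall i, L2 (E i t) /\ h2_bounded A (E i t))]),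
    (forall t, 0 <= t <= T -> [/\ (forall i x, F i t x = v t x ord0 i),
       (forall i, {ae mu, forall x, torus n x ->
          H i t x + \sum_j F j t x * G i j t x + E i t x = 0}),
       (forall i k l, pcoef (F i t) k l = a i k l t /\ pcoef (H i t) k l = b i k l t),
       (forall i j k l, pcoef (G i j t) k l = dcoef j (fun k l => a i k l t) k l) &
       (forall i k l, pcoef (E i t) k l = dcoef i (fun k l => g k l t) k l)]),
    (forall (k : 'rV[int]_n) l t, 0 <= t <= T -> \sum_i (k ord0 i)%:~R * a i k l t = 0 /\
       \sum_i (k ord0 i)%:~R * b i k l t = 0) &
    [/\ (forall i k l, {within `[0, T], continuous (a i k l)} /\
         {within `[0, T], continuous (b i k l)}),
      (forall i k l (t : R), 0 < t < T -> is_derive t 1 (a i k l) (b i k l t)),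
      (forall k l, {within `[0, T], continuous (g k l)}) &
      forall l t, g 0 l t = 0] ].
Proof.
move=> n3 k3 T0 TS [Pi [Pit [vt [Cv dv dPi [sPi CPi] [dfv euler v0v]]]]].
pose I := [set t : R | 0 <= t /\ (t%:E < S)%E].
have It t : 0 <= t <= T -> I t.
  by move=> /andP[t0 tT]; split => //; apply: le_lt_trans TS; rewrite lee_fin.
have k1 : (2 <= k.-1)%N by lia.
have k0 : (1 <= k.-1)%N by exact: ltnW.
have kk : (1 <= k)%N by exact: ltnW (ltnW k3).
have hb m (al : seq 'I_n) (u : R -> 'rV[R]_n -> R) : C_sobolev I m u -> (size al + 2 <= m)%N ->
    {A | 0 <= A /\ forall t, 0 <= t <= T -> h2_bounded A (weak_deriv al (u t))}.
  move=> Cu hal; apply: cid.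
  by have [A A0 hA] := h2_bounded_segment Cu hal (lexx 0) TS; exists A.
have AF i := hb _ [::] _ (Cv i) (ltnW k3).
have AG i j := hb _ [:: j] _ (Cv i) k3.
have AH i := hb _ [::] _ (dv i).2 k1.
have AE i := hb _ [::] _ (CPi i) k1.
pose A := \sum_i sval (AF i) + \sum_i \sum_j sval (AG i j) + \sum_i sval (AH i) +
  \sum_i sval (AE i).
have leS (J : finType) (f : J -> R) j : (forall j, 0 <= f j) -> f j <= \sum_i f i.
  by move=> f0; rewrite (bigD1 j)//= lerDl sumr_ge0.
have pF i : 0 <= sval (AF i) by have [] := svalP (AF i).
have pG i j : 0 <= sval (AG i j) by have [] := svalP (AG i j).
have pH i : 0 <= sval (AH i) by have [] := svalP (AH i).
have pE i : 0 <= sval (AE i) by have [] := svalP (AE i).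
have sF : 0 <= \sum_i sval (AF i) by exact: sumr_ge0.
have sG : 0 <= \sum_i \sum_j sval (AG i j) by apply: sumr_ge0 => i _; exact: sumr_ge0.
have sH : 0 <= \sum_i sval (AH i) by exact: sumr_ge0.
have sE : 0 <= \sum_i sval (AE i) by exact: sumr_ge0.
have FA i : sval (AF i) <= A.
  by have := leS _ _ i pF; rewrite /A; lra.
have GA i j : sval (AG i j) <= A.
  have := leS _ _ j (pG i).
  have := leS _ (fun i => \sum_j sval (AG i j)) i (fun i => sumr_ge0 _ (fun j _ => pG i j)).
  by rewrite /A; lra.
have HA i : sval (AH i) <= A.
  by have := leS _ _ i pH; rewrite /A; lra.
have EA i : sval (AE i) <= A.
  by have := leS _ _ i pE; rewrite /A; lra.
pose th (b : bool) : R := if b then - (pi / 2) else 0.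
pose F i t (x : 'rV[R]_n) := v t x ord0 i.
pose a i k l t := pcoef (F i t) k l.
pose b i k l t := pcoef (vt i t) k l.
pose g k l t := if k == 0 then 0 else pcoef (Pi t) k l.
exists A, a, b, g, F, (fun i j t => weak_deriv [:: j] (F i t)), vt,
  (fun i t => weak_deriv [:: i] (Pi t)).
have sFt i t : 0 <= t <= T -> sobolev k (F i t) by move=> /It; exact: (Cv i).1.
have sHt i t : 0 <= t <= T -> sobolev k.-1 (vt i t) by move=> /It; exact: (dv i).2.1.
have sEt i t : 0 <= t <= T -> sobolev k.-1 (weak_deriv [:: i] (Pi t)).
  by move=> /It; exact: (CPi i).1.
have sPt t : 0 <= t <= T -> sobolev 1 (Pi t) by move=> /It; exact: sPi.
have cont m (u : R -> 'rV[R]_n -> R) k' b' : C_sobolev I m u ->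
    {within `[0, T], continuous (fun t => fcoef (u t) k' b')}.
  move=> Cu; apply/subspace_continuousP => t; rewrite /= in_itv/= => tT.
  move=> B /(@fcoef_continuous _ _ _ _ _ k' b' _ Cu (It _ tT)) hB.
  have {}hB : nbhs t (fun s => 0 <= s /\ (s%:E < S)%E -> B (fcoef (u s) k' b')) := hB.
  suff : nbhs t (fun s => s \in `[0, T] -> B (fcoef (u s) k' b')) by [].
  by apply: filterS hB => s hs; rewrite in_itv/= => /It; exact: hs.
(* Differentiation exchanges the parities, so the relation for [b'] is read off the coefficient
   [~~ b'] of the divergence, up to the factor [pi] or [- pi]. *)
have divF (k' : 'rV[int]_n) (b' : bool) (t : R) : 0 <= t /\ (t%:E < S)%E -> \sum_i (k' ord0 i)%:~R * a i k' b' t = 0.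
  move=> tI; have sF' i : sobolev k (F i t) by exact: (Cv i).1.
  pose c b := \sum_i dcoef i (pcoef (F i t)) k' b.
  have cE : forall b, c b = 0.
    move=> b1; rewrite /c.
    under eq_bigr do rewrite -(pcoef_weak_deriv _ _ _ (sF' _) kk).
    have LD i : L2 (weak_deriv [:: i] (F i t)).
      by have [] := sobolev_weak_deriv (sF' i) (kk : (size [:: i] <= k)%N).
    rewrite /pcoef /fcoef -Rintegral_sum//; last first.
      by move=> i; apply: fcoef_integrable; exact: L2_integrable.
    transitivity (\int[mu]_(x in torus n) (0 : R)); last by rewrite Rintegral_cst ?mul0r//.
    apply: eq_Rintegral_ae => //.
    - apply: measurable_sum => i; apply: measurable_funM; first by have [] := LD i.
      by apply: measurable_funTS; exact: measurable_ct.
    - apply: filterS (dfv t tI) => x hx Tx.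
      by rewrite -mulr_suml -/(dotv) hx ?mul0r.
  have := cE (~~ b'); rewrite /c /dcoef /a.
  move=> e; apply: (@mulfI _ (if b' then pi else - pi)).
    by case: (b'); rewrite ?oppr_eq0 gt_eqF// pi_gt0.
  transitivity (\sum_i dcoef i (pcoef (F i t)) k' (~~ b')); last by rewrite [LHS]e mulr0.
  rewrite mulr_sumr; apply: eq_bigr => i _; rewrite /dcoef.
  by case: (b'); rewrite /=; ring.
split => //.
- by rewrite !addr_ge0.
- move=> t tT; split => [i|i j|i|i].
  + split; first exact: sobolev_L2 (sFt i t tT).
    apply: h2_bounded_le (FA i) _; apply: h2_bounded_sobolev (sFt i t tT) _.
    by have [_] := svalP (AF i); exact.
  + split; first by have [] := sobolev_weak_deriv (sFt i t tT) (kk : (size [:: j] <= k)%N).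
    by apply: h2_bounded_le (GA i j) _; have [_] := svalP (AG i j); exact.
  + split; first exact: sobolev_L2 (sHt i t tT).
    apply: h2_bounded_le (HA i) _; apply: h2_bounded_sobolev (sHt i t tT) _.
    by have [_] := svalP (AH i); exact.
  + split; first exact: sobolev_L2 (sEt i t tT).
    apply: h2_bounded_le (EA i) _; apply: h2_bounded_sobolev (sEt i t tT) _.
    by have [_] := svalP (AE i); exact.
- move=> t tT; split => [//|i|//|i j k' b'|i k' b'].
  + exact: euler (It _ tT) i.
  + exact: pcoef_weak_deriv (sFt i t tT) kk.
  + rewrite (pcoef_weak_deriv _ _ _ (sPt t tT))// /dcoef /g; case: eqP => [->|//].
    by rewrite mxE mulr0z mulr0 !mul0r.
- move=> k' b' t tT; split; first by apply: divF; exact: It.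
  have [t0 tS] := It t tT.
  have PF := proper_within_dnbhs t0 tS.
  (* The relation for the time derivative is the limit of the one for the difference quotients of
     [a]. *)
  have c1 : \sum_i (k' ord0 i)%:~R * ((a i k' b' s - a i k' b' t) / (s - t))
     @[s --> within I (dnbhs t)] --> \sum_i (k' ord0 i)%:~R * b i k' b' t.
    apply: cvg_sumr => i; apply: cvgMr.
    exact: fcoef_time_deriv (Cv i) (dv i).2 (dv i).1 (It t tT).
  have c2 : \sum_i (k' ord0 i)%:~R * ((a i k' b' s - a i k' b' t) / (s - t))
     @[s --> within I (dnbhs t)] --> (0 : R).
    apply: (@cvg_near_cst R^o) => //.
    near=> s; have Is : I s by near: s; exact: withinT.
    under eq_bigr do rewrite mulrA mulrBr.
    by rewrite -mulr_suml sumrB !divF// subrr mul0r.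
  exact: (cvg_unique _ c1 c2).
- split => [i k' b'|i k' b' t /andP[t0 tT]|k' b'|b' t].
  + by split; [exact: cont (Cv i)|exact: cont (dv i).2].
  + have tI : 0 <= t <= T by rewrite !ltW.
    apply: (@is_derive_diff_quotient _ I).
      near=> s; apply: It; apply/andP; split; near: s.
        by apply: lt_le_nbhsr.
      by apply: lt_le_nbhsl.
    exact: fcoef_time_deriv (Cv i) (dv i).2 (dv i).1 (It t tI).
  + rewrite /g; case: (eqVneq k' 0) => [_|k'0]; first by move=> z; exact: cvg_cst.
    (* Continuity in time is given for the pressure gradient. Some component of [k'] is nonzero, and
       dividing the coefficient of that partial derivative by it recovers the coefficient of
       [Pi]. *)
    have [j kj] : exists j, k' ord0 j != 0.
      apply: contrapT => h; move/eqP: k'0; apply; apply/rowP => j; rewrite mxE.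
      by apply/eqP/negPn/negP => kj; apply: h; exists j.
    have c := cont _ _ k' (th b' - pi / 2) (CPi j).
    have e : {in `[0, T]%classic, (fun t => - (pi * (k' ord0 j)%:~R)^-1 *
        fcoef (weak_deriv [:: j] (Pi t)) k' (th b' - pi / 2)) =1 (fun t => pcoef (Pi t) k' b')}.
      move=> t; rewrite inE/= in_itv/= => tT.
      rewrite (fcoef_weak_deriv _ _ (sPt t tT))// /kfac big_seq1 expr1 mul1r subrK /pcoef.
      by rewrite mulN1r mulNr mulrNN mulKf// mulf_neq0// ?intr_eq0// gt_eqF// pi_gt0.
    apply: (subspace_eq_continuous e).
    by move=> z; apply: cvgMr; exact: c.
  + by rewrite /g eqxx.
Unshelve. all: by end_near.
Qed.

End kato.
Arguments fsum_const {R} n.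

(** * Smooth approximate solutions *)

Section kato_approximation.
Context {R : realType} {n : nat}.
Local Notation mu := (lebesgue_rV R n).
Let mT : measurable (torus n : set 'rV[R]_n) := @measurable_torus R n.

Lemma dcoef_eq0 (c : 'I_n -> 'rV[int]_n -> bool -> R) (k : 'rV[int]_n) (b : bool) :
  (forall b, \sum_i (k ord0 i)%:~R * c i k b = 0) -> \sum_i dcoef i (c i) k b = 0.
Proof.
move=> h; transitivity (pi * (if b then - 1 else 1) *
    \sum_i (k ord0 i)%:~R * c i k (~~ b)); last by rewrite h mulr0.
by rewrite mulr_sumr; apply: eq_bigr => i _; rewrite /dcoef; case: b; rewrite /=; ring.
Qed.

Lemma tpoly_sum0 s (c : 'I_n -> 'rV[int]_n -> bool -> R) (x : 'rV[R]_n) :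
  (forall k b, \sum_i c i k b = 0) -> \sum_i tpoly s (c i) x = 0.
Proof.
move=> h; rewrite /tpoly exchange_big/=; apply: big1 => k _.
by rewrite -mulr_sumr big_split/= -!mulr_suml !h; ring.
Qed.

(** For a solenoidal field, [U . grad Pi] is the divergence of [Pi U]. *)
Lemma tfun_div_integral0 (U : 'I_n -> R * 'rV[R]_n -> R) (Pi : R * 'rV[R]_n -> R) t :
  (forall i, tfun (U i)) -> tfun Pi -> (forall z, \sum_i dx i (U i) z = 0) ->
  \int[mu]_(x in torus n) (\sum_i U i (t, x) * dx i Pi (t, x)) = 0.
Proof.
move=> tU tP dU.
transitivity (\int[mu]_(x in torus n) \sum_i dx i (fun z => U i z * Pi z) (t, x)).
  apply: eq_Rintegral => x _; apply/eqP; rewrite eq_sym -subr_eq0 -sumrB; apply/eqP.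
  transitivity (\sum_i Pi (t, x) * dx i (U i) (t, x)); last by rewrite -mulr_sumr dU mulr0.
  apply: eq_bigr => i _.
  by rewrite tfun_dxM//; ring.
rewrite Rintegral_sum//; last first.
  by move=> i; apply: trig_sum_integrable; apply: tfun_trig_sum; apply: tfun_dx; exact: tfun_mul.
by apply: big1 => i _; apply: tfun_integral_dx; exact: tfun_mul.
Qed.

Lemma ae_forall_fin (I : finType) (P : I -> 'rV[R]_n -> Prop) :
  (forall i, {ae mu, forall x, P i x}) -> {ae mu, forall x, forall i, P i x}.
Proof.
move=> h; apply: filterS (filter_forall _ h) => x; exact.
Qed.

(** The parameters are fixed in the order: frequency box [K], then Bernstein degree [m], whose
    accuracy must beat the number of frequencies and the factor [pi * K] lost by a derivative. The
    coefficients of [U] are primitives of Bernstein polynomials of [b], starting from the exact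
    values at time 0. *)
Lemma kato_approx r v0 (S : \bar R) v (T : R) : (n <= 3)%N -> (3 <= r)%N -> 0 < T ->
  (T%:E < S)%E -> kato_solution r v0 S v ->
  exists2 M : R, 0 <= M & forall eta : R, 0 < eta ->
  exists (U : 'I_n -> R * 'rV[R]_n -> R) (Pi : R * 'rV[R]_n -> R),
  [/\ (forall i, tfun (U i)) /\ tfun Pi,
    (forall z, \sum_i dx i (U i) z = 0),
    (forall t x, 0 <= t <= T -> [/\ (forall i, `|U i (t, x)| <= M),
       (forall i j, `|dx j (U i) (t, x)| <= M) & (forall j, `|dx j Pi (t, x)| <= M)]),
    (forall t, 0 <= t <= T -> {ae mu, forall x, torus n x -> forall i,
       `|U i (t, x) - v t x ord0 i| <= eta /\
       `|dt (U i) (t, x) + \sum_j U j (t, x) * dx j (U i) (t, x) + dx i Pi (t, x)| <= eta}) &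
    (forall t, \int[mu]_(x in torus n) (\sum_i U i (t, x) * dx i Pi (t, x)) = 0 /\
      \int[mu]_(x in torus n) dt Pi (t, x) = 0 /\
      \int[mu]_(x in torus n) Pi (t, x) = 0)].
Proof.
move=> n3 k3 T0 TS hv.
have [A [a [b [g [F [G [H [E [A0 h2 eqs div [cab dab cg g0]]]]]]]]]] :=
  kato_fourier n3 k3 T0 TS hv.
(* The Fourier sums are bounded by [A * fsum_const n], and the approximation differs from them by at
   most [e <= 1]; hence [M] precedes [eta]. *)
pose M := A * fsum_const n + 1.
have M1 : 1 <= M by rewrite /M lerDr mulr_ge0// fsum_const_ge0.
have M0 : 0 <= M by rewrite (le_trans _ M1).
exists M => // eta eta0.
(* The residual consists of two linear terms and [n] products. A product costs [M] for its first
   factor and [M + 1] for the gradient of v. *)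
pose L := 2 + n%:R * (M + M + 1) : R.
have nM : 0 <= n%:R * (M + M + 1) :> R by rewrite mulr_ge0//; lra.
have L0 : 0 < L by rewrite /L; lra.
pose e := Num.min (1 : R) (Num.min (eta / 2) (eta / L / 2)).
have e0 : 0 < e by rewrite !lt_min ltr01 !divr_gt0.
have e1 : e <= 1 by rewrite /e ge_min lexx.
have eeta : e + e <= eta.
  have : e <= eta / 2 by rewrite /e !ge_min lexx !orbT.
  lra.
have eL : (e + e) * L <= eta.
  have : e <= eta / L / 2 by rewrite /e !ge_min lexx !orbT.
  rewrite -ler_pdivlMr//; lra.
have [K hK] : exists K, A * htail n K <= e.
  have : A * htail n K @[K --> \oo] --> A * (0 : R) by apply: cvgMr; exact: htail_cvg.
  rewrite mulr0 => /cvgrPdist_le/(_ _ e0)[K _ hK]; exists K.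
  by have := hK K (leqnn K); rewrite sub0r normrN; apply: le_trans; exact: ler_norm.
pose s := box n K.
pose B : R := (size s)%:R + 1.
have B0 : 0 < B by rewrite ltr_wpDl.
(* Dominates the losses on a coefficient: [T] for integration in time, [pi * K] for a space
   derivative, and their product. *)
pose Cd : R := (1 + T) * (1 + pi * K%:R).
have piK : 0 <= pi * K%:R :> R by rewrite mulr_ge0// pi_ge0.
have Cd0 : 0 < Cd by rewrite mulr_gt0// ltr_pwDl// ltW.
pose dl := e / (B * 2) / Cd.
have dl0 : 0 < dl by rewrite !divr_gt0// mulr_gt0.
have dlC : dl * Cd = e / (B * 2) by rewrite /dl divfK// gt_eqF.
have sB (y : R) : y <= dl * Cd -> (size s)%:R * (y + y) <= e.
  move=> yd; have sz : 0 <= (size s)%:R :> R by [].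
  apply: (@le_trans _ _ ((size s)%:R * (dl * Cd + dl * Cd))).
    by rewrite ler_wpM2l// lerD.
  rewrite dlC (_ : _ * _ = e * ((size s)%:R / B)); last by field; rewrite gt_eqF.
  by rewrite ler_piMr ?(ltW e0)// ler_pdivrMr// mul1r lerDl.
have TK : 0 <= T * (pi * K%:R) by rewrite mulr_ge0// ltW.
have CdE : Cd = 1 + T + pi * K%:R + T * (pi * K%:R) by rewrite /Cd; ring.
have dl1 : dl <= dl * Cd by rewrite ler_peMr ?(ltW dl0)// CdE; lra.
have dlT : dl * T <= dl * Cd by rewrite ler_wpM2l ?(ltW dl0)// CdE; lra.
have dlTK : pi * K%:R * (dl * T) <= dl * Cd.
  by rewrite mulrCA ler_wpM2l ?(ltW dl0)// CdE [_ * T]mulrC; lra.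
have dlK : pi * K%:R * dl <= dl * Cd.
  by rewrite mulrC ler_wpM2l ?(ltW dl0)// CdE; lra.
have [m hm] : exists m : nat, forall k, k \in s -> forall l t, 0 <= t <= T ->
    (forall i, `|tbern T m (b i k l) t - b i k l t| <= dl) /\
    `|tbern T m (g k l) t - g k l t| <= dl.
  suff h : \forall m \near \oo, forall k, k \in s -> forall l t, 0 <= t <= T ->
      (forall i, `|tbern T m (b i k l) t - b i k l t| <= dl) /\
      `|tbern T m (g k l) t - g k l t| <= dl by have [m hm] := filter_ex h; exists m.
  apply: near_seq => q.
  have nb : \forall m \near \oo, forall i l, forall t, 0 <= t <= T ->
      `|tbern T m (b i q l) t - b i q l t| <= dl.
    apply: filter_forall => i; apply: filter_forall => l.
    by apply: tbern_approx => //; exact: (cab i q l).2.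
  have ng : \forall m \near \oo, forall l, forall t, 0 <= t <= T ->
      `|tbern T m (g q l) t - g q l t| <= dl.
    by apply: filter_forall => l; apply: tbern_approx.
  apply: filterS2 nb ng => m hb1 hg1 l t tT; split; last exact: hg1.
  by move=> i; exact: hb1.
pose pb i k l := projT1 (cid (tbern_poly T m (b i k l))).
pose pg k l := projT1 (cid (tbern_poly T m (g k l))).
have pbE i k l t : (pb i k l).[t] = tbern T m (b i k l) t.
  exact: (projT2 (cid (tbern_poly T m (b i k l)))).
have pgE k l t : (pg k l).[t] = tbern T m (g k l) t.
  exact: (projT2 (cid (tbern_poly T m (g k l)))).
pose qa i k l := projT1 (cid (poly_primitive (pb i k l) (a i k l 0))).
have qaE i k l : [/\ smooth1 (qa i k l), (forall t : R, is_derive t 1 (qa i k l) (pb i k l).[t]) &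
    qa i k l 0 = a i k l 0].
  exact: (projT2 (cid (poly_primitive (pb i k l) (a i k l 0)))).
have qa_s i k l : smooth1 (qa i k l) by have [] := qaE i k l.
pose U i (z : R * 'rV[R]_n) := tpoly s (fun k l => qa i k l z.1) z.2.
pose Pi (z : R * 'rV[R]_n) := tpoly s (fun k l => (pg k l).[z.1]) z.2.
have tU i : tfun (U i) by exact: (@tfun_tpoly R n s (fun t k l => qa i k l t)).
have pg_s k l : smooth1 (horner (pg k l)) by constructor.
have tPi : tfun Pi by exact: (@tfun_tpoly R n s (fun t k l => (pg k l).[t])).
have dxU i j : dx j (U i) = fun z => tpoly s (dcoef j (fun k l => qa i k l z.1)) z.2.
  exact: (@dx_tpoly R n s (fun t k l => qa i k l t) j).
have dtU i : dt (U i) = fun z => tpoly s (fun k l => (pb i k l).[z.1]) z.2.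
  apply: (@dt_tpoly R n s (fun t k l => qa i k l t) (fun t k l => (pb i k l).[t])) => //.
  by move=> k' l t; have [_ + _] := qaE i k' l; exact.
have dxP j : dx j Pi = fun z => tpoly s (dcoef j (fun k l => (pg k l).[z.1])) z.2.
  exact: (@dx_tpoly R n s (fun t k l => (pg k l).[t]) j).
have dtP : dt Pi = fun z => tpoly s (fun k l => ((pg k l)^`()).[z.1]) z.2.
  apply: (@dt_tpoly R n s (fun t k l => (pg k l).[t]) (fun t k l => ((pg k l)^`()).[t])) => //.
  by move=> k' l t; exact: is_derive_poly.
have ae i k' l t : k' \in s -> 0 <= t <= T -> `|qa i k' l t - a i k' l t| <= dl * T.
  move=> ks; apply: (@mvt_bound _ T dl (fun t => qa i k' l t - a i k' l t)
    (fun t => (pb i k' l).[t] - b i k' l t)).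
  - move=> z; apply: cvgB; last exact: (cab i k' l).1.
    have cq : {within `[0, T], continuous (qa i k' l)} :=
      continuous_subspaceT (smooth1_continuous (qa_s i k' l)).
    exact: cq.
  - move=> u uT; have [_ dq _] := qaE i k' l.
    exact: (is_deriveB (dq u) (dab i k' l u uT)).
  - by move=> u uT; rewrite pbE; exact: (hm k' ks l u uT).1.
  - by have [_ _ ->] := qaE i k' l; rewrite subrr.
have close t x : 0 <= t <= T ->
    [/\ (forall i, `|U i (t, x) - fsum s (F i t) x| <= e),
      (forall i j, `|dx j (U i) (t, x) - fsum s (G i j t) x| <= e),
      (forall i, `|dt (U i) (t, x) - fsum s (H i t) x| <= e) &
      (forall i, `|dx i Pi (t, x) - fsum s (E i t) x| <= e)].
  move=> tT; have [LF LG LH LE] := h2 t tT; have [_ _ ab Gab Eg] := eqs t tT.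
  split => [i|i j|i|i].
  - rewrite fsum_tpoly; last exact: L2_integrable (LF i).1.
    apply: le_trans (tpoly_dist _ _) (sB _ dlT) => k' l ks.
    by rewrite (ab i k' l).1; exact: ae.
  - rewrite fsum_tpoly; last exact: L2_integrable (LG i j).1.
    rewrite dxU; apply: le_trans (tpoly_dist _ _) (sB _ dlTK) => k' l ks.
    by rewrite Gab; apply: dcoef_dist => // l'; exact: ae.
  - rewrite fsum_tpoly; last exact: L2_integrable (LH i).1.
    rewrite dtU; apply: le_trans (tpoly_dist _ _) (sB _ dl1) => k' l ks.
    by rewrite (ab i k' l).2 pbE; exact: (hm k' ks l t tT).1.
  - rewrite fsum_tpoly; last exact: L2_integrable (LE i).1.
    rewrite dxP; apply: le_trans (tpoly_dist _ _) (sB _ dlK) => k' l ks.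
    by rewrite Eg; apply: dcoef_dist => // l'; rewrite pgE; exact: (hm k' ks l' t tT).2.
have bd (u w : R) : `|u - w| <= e -> `|w| <= A * fsum_const n -> `|u| <= M.
  move=> uw wA; rewrite -(subrK w u); apply: (le_trans (ler_normD _ _)).
  by rewrite /M addrC lerD// (le_trans uw).
(* For each frequency, [f] is constant in time because its derivative is the Bernstein image of a
   vanishing relation; at time 0 its value is the exact one. *)
have divU z : \sum_i dx i (U i) z = 0.
  under eq_bigr do rewrite dxU.
  apply: tpoly_sum0 => k' l; apply: (@dcoef_eq0 (fun i k l => qa i k l z.1)) => l'.
  pose f t := \sum_i (k' ord0 i)%:~R * qa i k' l' t.
  have df (t : R) : is_derive t 1 f 0.
    have d : is_derive t 1 f (\sum_i (k' ord0 i)%:~R * (pb i k' l').[t]).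
      rewrite (_ : f = \sum_i (fun t => (k' ord0 i)%:~R * qa i k' l' t)); last first.
        by apply/funext => u; rewrite fct_sumE.
      apply: is_derive_sum => i; have [_ dq _] := qaE i k' l'.
      exact: is_deriveZ.
    apply: (is_derive_eq d); under eq_bigr do rewrite pbE.
    by apply: tbern_sum0 => // u uT; exact: (div k' l' u uT).2.
  rewrite -/(f z.1) (is_derive_0_is_cst z.1 0 df) /f.
  have q0 i : qa i k' l' 0 = a i k' l' 0 by have [] := qaE i k' l'.
    under eq_bigr do rewrite q0.
  by apply: (div k' l' 0 _).1; rewrite lexx ltW.
exists U, Pi; split => //.
- move=> t x tT; have [cU cdU _ cdP] := close t x tT.
  have [LF LG LH LE] := h2 t tT.
  split => [i|i j|j].
  + apply: bd (cU i) _; exact: fsum_box_bound n3 A0 (LF i).2.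
  + apply: bd (cdU i j) _; exact: fsum_box_bound n3 A0 (LG i j).2.
  + apply: bd (cdP j) _; exact: fsum_box_bound n3 A0 (LE j).2.
- move=> t tT; have [LF LG LH LE] := h2 t tT; have [FE eul _ _ _] := eqs t tT.
  have aeF f : L2 f /\ h2_bounded A f ->
      {ae mu, forall x, torus n x -> `|f x - fsum s f x| <= e}.
    move=> [Lf hf]; apply: filterS (fsum_box_approx n3 A0 Lf hf) => x hx Tx.
    exact: le_trans (hx Tx K) hK.
  have aF := ae_forall_fin (fun i => aeF _ (LF i)).
  have aG := ae_forall_fin (fun i => ae_forall_fin (fun j => aeF _ (LG i j))).
  have aH := ae_forall_fin (fun i => aeF _ (LH i)).
  have aE := ae_forall_fin (fun i => aeF _ (LE i)).
  have aeul := ae_forall_fin eul.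
  apply: filterS2 aeul (filterI (filterI aF aG) (filterI aH aE)).
  move=> x eulx [[hF hG] [hH hE]] Tx i.
  have [cU cdU cdt cdP] := close t x tT.
  have tri (u w f : R) : `|u - w| <= e -> `|f - w| <= e -> `|u - f| <= e + e.
    move=> h1 h3; have -> : u - f = (u - w) - (f - w) by ring.
    by apply: (le_trans (ler_normB _ _)); exact: lerD.
  have UF j : `|U j (t, x) - F j t x| <= e + e by exact: tri (cU j) (hF j Tx).
  have dUG j : `|dx j (U i) (t, x) - G i j t x| <= e + e by exact: tri (cdU i j) (hG i j Tx).
  have dtUH : `|dt (U i) (t, x) - H i t x| <= e + e by exact: tri (cdt i) (hH i Tx).
  have dPE : `|dx i Pi (t, x) - E i t x| <= e + e by exact: tri (cdP i) (hE i Tx).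
  have UM j : `|U j (t, x)| <= M by apply: bd (cU j) _; exact: fsum_box_bound n3 A0 (LF j).2.
  have GM j : `|G i j t x| <= M + 1.
    rewrite -(subrK (fsum s (G i j t) x) (G i j t x)) addrC.
    apply: (le_trans (ler_normD _ _)); rewrite lerD//; last exact: le_trans (hG i j Tx) e1.
    apply: (le_trans (fsum_box_bound _ _ n3 A0 (LG i j).2)).
    by rewrite /M lerDl.
  split; first by rewrite -FE; exact: le_trans (UF i) eeta.
  have -> : dt (U i) (t, x) + \sum_j U j (t, x) * dx j (U i) (t, x) + dx i Pi (t, x) =
    (dt (U i) (t, x) - H i t x) + (dx i Pi (t, x) - E i t x) +
    (\sum_j U j (t, x) * dx j (U i) (t, x) - \sum_j F j t x * G i j t x).
    have E0 := eulx i Tx.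
    transitivity (dt (U i) (t, x) + \sum_j U j (t, x) * dx j (U i) (t, x) + dx i Pi (t, x) -
      (H i t x + \sum_j F j t x * G i j t x + E i t x)); last by ring.
    by rewrite E0 subr0.
  apply: le_trans eL; apply: (le_trans (ler_normD _ _)).
  have -> : (e + e) * L = ((e + e) + (e + e)) + (e + e) * (n%:R * (M + M + 1)) by rewrite /L; ring.
  apply: lerD.
    by apply: (le_trans (ler_normD _ _)); exact: lerD.
  rewrite -sumrB; apply: (le_trans (ler_norm_sum _ _ _)).
  rewrite mulrCA mulr_natl -[n in leRHS]card_ord -sumr_const; apply: ler_sum => j _.
  have -> : U j (t, x) * dx j (U i) (t, x) - F j t x * G i j t x =
    U j (t, x) * (dx j (U i) (t, x) - G i j t x) + (U j (t, x) - F j t x) * G i j t x by ring.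
  apply: (le_trans (ler_normD _ _)); rewrite !normrM -addrA mulrDr; apply: lerD.
    by rewrite mulrC; apply: ler_pM.
  exact: ler_pM.
- move=> t; split; first exact: tfun_div_integral0.
  (* The normalization of the pressure to mean 0 survives the Bernstein operator, so both [Pi] and
     [dt Pi] have mean 0. *)
  have p0 l : horner (pg 0 l) = cst 0.
    apply/funext => u; rewrite pgE /tbern /bernstein big1// => j _.
    by rewrite g0 mul0r.
  split; last by rewrite /Pi/=; apply: tpoly_integral0 => l; rewrite p0.
  rewrite dtP /=; apply: tpoly_integral0 => l.
  have [_ <-] := is_derive_poly (pg 0 l) t.
  by rewrite p0 derive_cst.
Qed.

End kato_approximation.

(** * Pressure potential *)

Section pressure_potential_theory.
Context {R : realType}.
Variable p : R -> R.
Hypothesis hp : pressure_law p.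
Local Notation mu := (@lebesgue_measure R).

Let q (z : R) := p z / z ^+ 2.

Let dp (r : R) : 0 < r -> is_derive r 1 p (derive1 p r).
Proof. by case: hp => d _ _ _ r0; rewrite derive1E; apply: derivableP; exact: d. Qed.

Let cp (r : R) : 0 < r -> {for r, continuous p}.
Proof. by move=> r0; exact: is_derive_continuous (dp r0). Qed.

Let cq (r : R) : 0 < r -> {for r, continuous q}.
Proof.
move=> r0; apply: cvgM; first exact: cp.
apply: cvgV; first by rewrite gt_eqF// exprn_gt0.
by apply: exprn_continuous.
Qed.

Let iq (a b : R) : 0 < a -> mu.-integrable `[a, b] (EFin \o q).
Proof.
move=> a0; apply: continuous_compact_integrable; first exact: segment_compact.
apply: continuous_in_subspaceT => z; rewrite inE/= in_itv/= => /andP[az _].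
by apply: cq; exact: lt_le_trans az.
Qed.

Definition pressure_primitive (r : R) : R :=
  if 1 <= r then \int[mu]_(z in `[1, r]) (p z / z ^+ 2)
  else - \int[mu]_(z in `[r, 1]) (p z / z ^+ 2).
Local Notation J := pressure_primitive.

(** A common lower endpoint removes the case distinction at 1, after which the fundamental theorem
    of calculus applies. *)
Lemma pressure_primitiveE (c r : R) : 0 < c -> c <= 1 -> c <= r ->
  J r = \int[mu]_(z in `[c, r]) q z - \int[mu]_(z in `[c, 1]) q z.
Proof.
move=> c0 c1 cr.
have B (a b : R) : c <= a -> a <= b -> \int[mu]_(z in `[c, b]) q z - \int[mu]_(z in `[c, a]) q z =
    \int[mu]_(z in `[a, b]) q z.
  move=> ca ab; rewrite Rintegral_itvB ?bnd_simp//; last exact: iq.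
  rewrite Rintegral_itv_obnd_cbnd//; apply: integrableS (iq b c0) => //.
  by apply: subset_itv; rewrite bnd_simp.
rewrite /J -/q; case: ifPn => r1; first by rewrite -(B 1 r).
by rewrite -(B r 1)// ?opprB// ltW// ltNge.
Qed.

Lemma is_derive_pressure_primitive (r : R) : 0 < r -> is_derive r 1 J (p r / r ^+ 2).
Proof.
move=> r0; pose c := Num.min r 1 / 2.
have m0 : 0 < Num.min r 1 by rewrite lt_min r0 ltr01.
have c0 : 0 < c by rewrite divr_gt0.
have cm : c < Num.min r 1 by rewrite /c; lra.
have [cr c1] : c < r /\ c < 1 by move: cm; rewrite lt_min => /andP.
have r1 : r < r + 1 by rewrite ltrDl.
have [d1 d2] := @continuous_FTC1_closed _ q c r (r + 1) r1 (iq _ c0) cr (cq r0).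
apply: (@near_eq_is_derive _ _ _ (fun r => \int[mu]_(z in `[c, r]) q z - \int[mu]_(z in `[c, 1]) q z)).
  near=> s; rewrite (@pressure_primitiveE c)// ltW//.
  by near: s; exact: lt_nbhsr.
have d : is_derive r 1 (fun r => \int[mu]_(z in `[c, r]) q z) (q r).
  by split; [exact: d1|rewrite -derive1E d2].
have := is_deriveB d (is_derive_cst (\int[mu]_(z in `[c, 1]) q z) r 1).
by rewrite subr0.
Unshelve. all: by end_near.
Qed.

Lemma pressure_potential_posE (r : R) : pressure_potential_pos p r = r * J r.
Proof. by []. Qed.

Lemma pressure_potentialE (r : R) : 0 < r -> pressure_potential p r = r * J r.
Proof. by move=> r0; rewrite /pressure_potential r0. Qed.

(** The derivative of the potential. Its own derivative is [p' / r > 0], so the potential is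
    strictly convex. *)
Definition pressure_slope (r : R) : R := J r + p r / r.

Lemma is_derive_pressure_potential (r : R) : 0 < r ->
  is_derive r 1 (pressure_potential p) (pressure_slope r).
Proof.
move=> r0; have d := is_deriveM (is_derive_id r (1 : R)) (is_derive_pressure_primitive r0).
apply: near_eq_is_derive (is_derive_eq d _).
  by near=> s; rewrite pressure_potentialE//; near: s; exact: lt_nbhsr.
rewrite /pressure_slope /GRing.scale/=.
by field; rewrite gt_eqF.
Unshelve. all: by end_near.
Qed.

Lemma pressure_potential_derive1 (r : R) : 0 < r ->
  derive1 (pressure_potential p) r = pressure_slope r.
Proof. by move=> r0; rewrite derive1E; have [_ ->] := is_derive_pressure_potential r0. Qed.

Lemma is_derive_pressure_slope (r : R) : 0 < r ->
  is_derive r 1 pressure_slope (derive1 p r / r).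
Proof.
move=> r0.
have dV : is_derive r 1 (fun r : R => r^-1) (- r ^- 2 *: 1).
  by apply: is_deriveV; rewrite ?gt_eqF.
have d := is_deriveD (is_derive_pressure_primitive r0) (is_deriveM (dp r0) dV).
apply: (is_derive_eq d); rewrite /GRing.scale/=.
by field; rewrite gt_eqF.
Qed.

Lemma pos_mvt (f f' : R -> R) (a b : R) : 0 < a -> a < b ->
  (forall r : R, 0 < r -> is_derive r 1 f (f' r)) ->
  exists2 c, a < c < b & f b - f a = f' c * (b - a).
Proof.
move=> a0 ab df.
have [x||c] := @MVT R f f' a b ab.
- by rewrite in_itv/= => /andP[ax _]; apply: df; exact: lt_trans ax.
- apply: continuous_in_subspaceT => x; rewrite inE/= in_itv/= => /andP[ax _].
  by apply: is_derive_continuous (df x _); exact: lt_le_trans ax.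
- by rewrite in_itv/= => cab e; exists c.
Qed.

Lemma pressure_slope_lt (a b : R) : 0 < a -> a < b -> pressure_slope a < pressure_slope b.
Proof.
move=> a0 ab; rewrite -subr_gt0.
have [c /andP[ac cb] ->] := pos_mvt a0 ab is_derive_pressure_slope.
have c0 : 0 < c := lt_trans a0 ac.
rewrite mulr_gt0 ?subr_gt0// divr_gt0//.
by case: hp => _ _ _; exact.
Qed.

Lemma pressure_tangent_pos (a r : R) : 0 < a -> 0 < r ->
  pressure_potential p a + pressure_slope a * (r - a) <= pressure_potential p r.
Proof.
move=> a0 r0; rewrite -lerBrDl.
have [ra|ar|->] := ltgtP r a; last by rewrite !subrr mulr0.
- have [c /andP[ac cb]] := pos_mvt r0 ra is_derive_pressure_potential.
  have /ltW := pressure_slope_lt (lt_trans r0 ac) cb; nra.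
- have [c /andP[ac cb] ->] := pos_mvt a0 ar is_derive_pressure_potential.
  by have /ltW := pressure_slope_lt a0 ac; nra.
Qed.

Lemma pressure_ge0 (z : R) : 0 < z -> p 0 <= p z.
Proof.
move=> z0.
have [x||c] := @MVT R p (derive1 p) 0 z z0.
- by rewrite in_itv/= => /andP[ax _]; exact: dp.
- case: hp => _ _ cw _; apply: continuous_subspaceW cw => y /=.
  by rewrite !in_itv/= andbT => /andP[].
- rewrite in_itv/= => /andP[c0 _] e; rewrite -subr_ge0 e subr0 mulr_ge0// ltW//.
  by case: hp => _ _ _; exact.
Qed.

(** The value at 0 is a [lim], so existence of the limit is the point. Subtracting the slope at 1
    makes the potential nonincreasing on [(0, 1)] by convexity, and it remains to bound it from
    above. *)
Lemma pressure_potential_cvg0 : pressure_potential_pos p r @[r --> 0^'+] --> pressure_potential p 0.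
Proof.
rewrite /pressure_potential ltxx.
pose f r := pressure_potential_pos p r - pressure_slope 1 * r.
have fcv : cvg (f r @[r --> 0^'+]).
  apply/cvg_ex; eexists.
  apply: (@nonincreasing_at_right_cvgr _ _ _ (BLeft 1)); first by rewrite bnd_simp.
    move=> a b; rewrite !in_itv/= => /andP[a0 a1] /andP[b0 b1] ab.
    move: ab; rewrite le_eqVlt => /predU1P[->//|ab].
    rewrite /f -subr_ge0.
    have [c /andP[ac cb] e] := pos_mvt a0 ab is_derive_pressure_potential.
    move: e; rewrite !pressure_potentialE// !pressure_potential_posE => e.
    have /ltW := pressure_slope_lt (lt_trans a0 ac) (lt_trans cb b1); nra.
  exists (`|J 1 + p 0| + `|p 0| + `|pressure_slope 1|) => _ /= [r + <-]; rewrite in_itv/= => /andP[r0 r1].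
  (* [J z + p 0 / z] is nondecreasing because [p 0 <= p z]; comparing with its value at 1 bounds
     [r * J r]. *)
  have dG (z : R) : 0 < z -> is_derive z 1 (fun z => J z + p 0 * z^-1) ((p z - p 0) / z ^+ 2).
    move=> z0; have dV : is_derive z 1 (fun r : R => r^-1) (- z ^- 2 *: 1).
      by apply: is_deriveV; rewrite ?gt_eqF.
    have d := is_deriveD (is_derive_pressure_primitive z0) (is_deriveZ (p 0) dV).
    apply: (is_derive_eq d); rewrite /GRing.scale/=; field; exact: lt0r_neq0.
  have [c /andP[rc c1]] := pos_mvt r0 r1 dG.
  have c0 : 0 < c := lt_trans r0 rc.
  have pc := pressure_ge0 c0.
  have : 0 <= (p c - p 0) / c ^+ 2 by rewrite divr_ge0 ?subr_ge0// exprn_ge0// ltW.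
  set w := _ / c ^+ 2 => w0 e.
  have Jr : r * J r <= r * (J 1 + p 0) - p 0.
    rewrite -subr_ge0 (_ : _ - _ = r * (w * (1 - r))); last first.
      by rewrite -e invr1; field; rewrite gt_eqF.
    apply: mulr_ge0; first exact: ltW.
    by apply: mulr_ge0 => //; rewrite subr_ge0 ltW.
  have h1 : r * (J 1 + p 0) <= `|J 1 + p 0|.
    by rewrite (le_trans (ler_norm _))// normrM gtr0_norm// ler_piMl// ltW.
  have h2 : - (pressure_slope 1 * r) <= `|pressure_slope 1|.
    by rewrite (le_trans (ler_norm _))// normrN normrM (gtr0_norm r0) ler_piMr// ltW.
  have h3 : - p 0 <= `|p 0| by rewrite -normrN ler_norm.
  rewrite /f pressure_potential_posE; lra.
have h : f r + pressure_slope 1 * r @[r --> 0^'+] --> lim (f r @[r --> 0^'+]) + pressure_slope 1 * 0.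
  apply: cvgD => //; apply: cvgMr; apply: cvg_at_right_filter; exact: cvg_id.
have E : (fun r => f r + pressure_slope 1 * r) = pressure_potential_pos p.
  by apply/funext => r; rewrite /f subrK.
by rewrite E in h; apply: cvgP h.
Qed.

Lemma pressure_tangent (a r : R) : 0 < a -> 0 <= r ->
  pressure_potential p a + pressure_slope a * (r - a) <= pressure_potential p r.
Proof.
move=> a0; rewrite le_eqVlt => /predU1P[<-|r0]; last exact: pressure_tangent_pos.
have c1 : pressure_potential p a + pressure_slope a * (s - a) @[s --> 0^'+] -->
    pressure_potential p a + pressure_slope a * (0 - a).
  apply: cvgD; first exact: cvg_cst.
  apply: cvgMr; apply: cvgB; last exact: cvg_cst.
  by apply: cvg_at_right_filter; exact: cvg_id.
apply: (ler_cvg_to c1 pressure_potential_cvg0).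
near=> s; have s0 : 0 < s by near: s; exact: nbhs_right_gt.
by rewrite pressure_potential_posE -pressure_potentialE// pressure_tangent_pos.
Unshelve. all: by end_near.
Qed.

Variable rhob : R.
Hypothesis rhob0 : 0 < rhob.
Local Notation H := (rel_potential p rhob).

Lemma rel_potentialE r : H r = pressure_potential p r - pressure_slope rhob * (r - rhob) -
  pressure_potential p rhob.
Proof. by rewrite /rel_potential pressure_potential_derive1. Qed.

Lemma rel_potential_ge0 r : 0 <= r -> 0 <= H r.
Proof. by move=> r0; rewrite rel_potentialE; have := pressure_tangent rhob0 r0; lra. Qed.

(** Sum of the tangent inequality at [s] evaluated at [r] and the one at [rhob] evaluated at [s]. *)
Lemma rel_potential_slope s r : 0 < s -> 0 <= r ->
  (pressure_slope s - pressure_slope rhob) * (r - s) <= H r.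
Proof.
move=> s0 r0; have := pressure_tangent s0 r0; have := pressure_tangent rhob0 (ltW s0).
by rewrite rel_potentialE; lra.
Qed.

(** [rel_potential_slope] at [s = rhob + d] and at [s = rhob - d], where strict convexity makes the
    slope differences positive. *)
Lemma rel_potential_coercive (d : R) : 0 < d ->
  exists2 C : R, 0 <= C & forall r : R, 0 <= r -> `|r - rhob| <= d + C * H r.
Proof.
move=> d0.
have [C1 C10 h1] : exists2 C : R, 0 <= C & forall r : R, 0 <= r -> r - rhob <= d + C * H r.
  have s0 : 0 < rhob + d by exact: addr_gt0.
  have c0 : 0 < pressure_slope (rhob + d) - pressure_slope rhob.
    by rewrite subr_gt0 pressure_slope_lt//; lra.
  exists (pressure_slope (rhob + d) - pressure_slope rhob)^-1 => [|r r0].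
    by rewrite invr_ge0 ltW.
  rewrite -lerBlDl ler_pdivlMl//; have := rel_potential_slope s0 r0; lra.
have [C2 C20 h2] : exists2 C : R, 0 <= C & forall r : R, 0 <= r -> rhob - r <= d + C * H r.
  (* When [rhob - d] is not positive, the bound [rhob - r <= d] is automatic. *)
  have [s0|s0] := ltP 0 (rhob - d); last by exists 0 => // r r0; lra.
  have c0 : 0 < pressure_slope rhob - pressure_slope (rhob - d).
    by rewrite subr_gt0 pressure_slope_lt//; lra.
  exists (pressure_slope rhob - pressure_slope (rhob - d))^-1 => [|r r0].
    by rewrite invr_ge0 ltW.
  rewrite -lerBlDl ler_pdivlMl//; have := rel_potential_slope s0 r0; lra.
exists (C1 + C2) => [|r r0]; first exact: addr_ge0.
have H0 := rel_potential_ge0 r0.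
have a1 := h1 r r0; have a2 := h2 r r0.
have b1 : 0 <= C1 * H r by exact: mulr_ge0.
have b2 : 0 <= C2 * H r by exact: mulr_ge0.
by rewrite ler_norml mulrDl; apply/andP; split; lra.
Qed.

Lemma rel_potential_continuous : {within `[0, +oo[, continuous H}.
Proof.
have cP : {within `[0, +oo[, continuous (pressure_potential p)}.
  apply/continuous_within_itvcyP; split.
    move=> r; rewrite in_itv/= andbT => r0.
    exact: is_derive_continuous (is_derive_pressure_potential r0).
  apply: cvg_trans pressure_potential_cvg0; apply: near_eq_cvg.
  near=> s; have s0 : 0 < s by near: s; exact: nbhs_right_gt.
  by rewrite pressure_potential_posE pressure_potentialE.
have E : H = (fun r => pressure_potential p r + (- pressure_slope rhob * (r - rhob) -
    pressure_potential p rhob)).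
  by apply/funext => r; rewrite rel_potentialE; ring.
rewrite E => z; apply: cvgD; first exact: cP.
have c : continuous (fun r : R => - pressure_slope rhob * (r - rhob) - pressure_potential p rhob).
  move=> r; apply: cvgB; last exact: cvg_cst.
  by apply: cvgMr; apply: cvgB; [exact: cvg_id|exact: cvg_cst].
have c' : {within `[0, +oo[, continuous (fun r : R => - pressure_slope rhob * (r - rhob) -
  pressure_potential p rhob)} := continuous_subspaceT c.
exact: c'.
Unshelve. all: by end_near.
Qed.

End pressure_potential_theory.

(** * Moments of a Young measure *)

Section ae_monotone.
Local Open Scope ereal_scope.
Import HBNNSimple.
Context d (T : measurableType d) (R : realType) (mu : {measure set T -> \bar R}).

(* The integral of a nonnegative function is the supremum of the integrals of the
   simple functions below it, hence it is monotone on arbitrary functions. *)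
Lemma ae_ge0_le_integral_nonmeas (D : set T) (f g : T -> \bar R) : measurable D ->
  (forall x, D x -> 0 <= f x) -> (forall x, D x -> 0 <= g x) ->
  {ae mu, forall x, D x -> f x <= g x} ->
  \int[mu]_(x in D) f x <= \int[mu]_(x in D) g x.
Proof.
move=> mD f0 g0 [N [mN N0 fgN]]; rewrite [leLHS]ge0_integralE// [leRHS]ge0_integralE//.
apply: ge_ereal_sup => _ [h /= hf <-].
have mNC : measurable (~` N) by exact: measurableC.
apply: ereal_sup_ubound; exists (proj_nnsfun h mNC) => [x|].
  rewrite /= mindicE; have [xN|xN] := boolP (x \in ~` N); last first.
    rewrite mulr0 patchE; case: ifPn => // /set_mem Dx; exact: g0.
  rewrite mulr1 (le_trans (hf x))// !patchE; case: ifPn => // /set_mem Dx.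
  apply: contrapT => nfg; move/set_mem : xN; apply; apply: fgN => /= h'.
  by apply: nfg; exact: h'.
rewrite -!integralT_nnsfun.
apply: ae_eq_integral => //; try exact/measurable_EFinP.
exists N; split => // x /= hx; apply: contrapT => nx; apply: hx => _.
by rewrite mindicE mem_set ?mulr1.
Qed.

Lemma integral_fin_ae (D : set T) (f : T -> \bar R) : measurable D -> measurable_fun D f ->
  (forall x, D x -> 0 <= f x) -> \int[mu]_(x in D) f x < +oo ->
  {ae mu, forall x, D x -> f x \is a fin_num}.
Proof.
move=> mD mf f0 foo; apply: integrable_ae => //.
apply/integrableP; split => //; rewrite (eq_integral f)// => x /set_mem Dx.
by rewrite gee0_abs// f0.
Qed.

End ae_monotone.

(** * Fubini on rectangles *)

Section product_sections.
Context d1 d2 (T1 : measurableType d1) (T2 : measurableType d2) (R : realType).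
Variable m1 : {sigma_finite_measure set T1 -> \bar R}.
Variable m2 : {sigma_finite_measure set T2 -> \bar R}.

Lemma ae_section (P : T1 * T2 -> Prop) : {ae (m1 \x m2)%E, forall z, P z} ->
  {ae m1, forall x, {ae m2, forall y, P (x, y)}}.
Proof.
move=> [N [mN N0 PN]].
have : (\int[m1]_x (m2 (xsection N x)) = 0)%E by exact: N0.
have mx : measurable_fun setT (fun x => m2 (xsection N x)) := measurable_fun_xsection m2 mN.
rewrite (eq_integral (fun x => `|m2 (xsection N x)|%E)); last first.
  by move=> x _; rewrite gee0_abs.
move=> /(ae_eq_integral_abs m1 measurableT mx); apply: filterS => x /(_ I) /= x0.
exists (xsection N x); split => //; first exact: measurable_xsection.
by move=> y /= h; rewrite /xsection/= inE; apply: PN.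
Qed.

Variables (A : set T1) (B : set T2).
Hypotheses (mA : measurable A) (mB : measurable B).

Let patchX (V : Type) (c : V) (f : T1 * T2 -> V) x y : A x ->
  (fun z => if z \in A `*` B then f z else c) (x, y) = if y \in B then f (x, y) else c.
Proof.
move=> Ax; have -> // : ((x, y) \in A `*` B) = (y \in B).
by apply/idP/idP => [/set_mem[_ By]|/set_mem By]; apply/mem_set.
Qed.

Lemma measurable_section_integral (f : T1 * T2 -> \bar R) : measurable_fun (A `*` B) f ->
  (forall z, (A `*` B) z -> 0 <= f z)%E ->
  measurable_fun A (fun x => \int[m2]_(y in B) f (x, y))%E.
Proof.
move=> mf f0.
have mg : measurable_fun setT (f \_ (A `*` B)).
  by apply/(measurable_restrictT f) => //; exact: measurableX.
have g0 z : (0 <= (f \_ (A `*` B)) z)%E by rewrite patchE; case: ifPn => // /set_mem; exact: f0.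
have := measurable_fun_fubini_tonelli_F (m2 := m2) _ mg g0 => /(measurable_funS measurableT (@subsetT _ A)).
apply: eq_measurable_fun => x /set_mem Ax; rewrite /fubini_F [RHS]integral_mkcond.
by apply: eq_integral => y _; rewrite !patchE patchX.
Qed.

(** The real inner integral is [fine] of the extended one; the two agree where the latter is finite,
    hence almost everywhere, which transfers measurability and integrability. *)
Lemma integrable_section (f : T1 * T2 -> R) :
  (m1 \x m2)%E.-integrable (A `*` B) (EFin \o f) ->
  [/\ {ae m1, forall x, A x -> m2.-integrable B (EFin \o (fun y => f (x, y)))},
    m1.-integrable A (EFin \o (fun x => \int[m2]_(y in B) f (x, y))) &
    \int[(m1 \x m2)%E]_(z in A `*` B) f z = \int[m1]_(x in A) \int[m2]_(y in B) f (x, y)].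
Proof.
move=> intf; pose g := (EFin \o f) \_ (A `*` B).
have mAB : measurable (A `*` B) by exact: measurableX.
have intg : (m1 \x m2)%E.-integrable setT g by exact/(integrable_mkcond _ mAB).
have gE x y : A x -> g (x, y) = ((EFin \o (fun y => f (x, y))) \_ B) y.
  by move=> Ax; rewrite /g !patchE patchX.
have ae1 : {ae m1, forall x, A x -> m2.-integrable B (EFin \o (fun y => f (x, y)))}.
  apply: filterS (ae_integrable1 intg) => x ix Ax; apply/integrable_mkcond => //.
  apply: eq_integrable ix => // y _; exact: gE.
have iF := integrable_fubini_F intg.
have FE x : A x -> fubini_F m2 g x = (\int[m2]_(y in B) (f (x, y))%:E)%E.
  by move=> Ax; rewrite /fubini_F [RHS]integral_mkcond; apply: eq_integral => y _; exact: gE.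
have F0 x : ~ A x -> fubini_F m2 g x = 0%E.
  move=> nA; rewrite /fubini_F; apply: integral0_eq => y _.
  by rewrite /g patchE; case: ifPn => // /set_mem[].
have aeF : {ae m1, forall x, A x -> fubini_F m2 g x = (\int[m2]_(y in B) f (x, y))%:E}.
  apply: filterS (integrable_ae measurableT iF) => x /(_ I) fx Ax.
  by rewrite /Rintegral fineK -FE.
have mR : measurable_fun A (fun x => \int[m2]_(y in B) f (x, y)).
  apply: (eq_measurable_fun (fine \o fubini_F m2 g)).
    by move=> x /set_mem Ax /=; rewrite FE.
  apply: measurableT_comp => //; apply: measurable_funTS.
  exact: measurable_int iF.
have iR : m1.-integrable A (EFin \o (fun x => \int[m2]_(y in B) f (x, y))).
  have iFA : m1.-integrable A (fubini_F m2 g) by apply: integrableS iF.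
  apply/integrableP; split; first exact/measurable_EFinP.
  have /integrableP[_] := iFA; apply: le_lt_trans.
  apply: ae_ge0_le_integral_nonmeas => //.
  by apply: filterS aeF => x hx Ax; rewrite hx.
split => //.
rewrite /Rintegral; congr fine.
transitivity (\int[(m1 \x m2)%E]_z g z)%E; first by rewrite integral_mkcond.
rewrite -integral12_prod_meas1// [RHS]integral_mkcond.
apply: ae_eq_integral => //.
- exact: measurable_int iF.
- apply/(measurable_restrictT _ mA); apply/measurable_EFinP.
  exact: mR.
- apply: filterS aeF => x hx _; rewrite patchE; case: ifPn => [/set_mem Ax|/negP nA].
    exact: hx.
  by apply: F0 => Ax; apply: nA; exact: mem_set.
Qed.

End product_sections.

(** * Functions on the phase space *)

Section phase_functions.
Context {R : realType} {N : nat}.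
Local Notation Q := (R * 'rV[R]_N)%type.
Implicit Types (q : Q).

Lemma measurable_phase : measurable (phase N : set Q).
Proof.
have -> : (phase N : set Q) = `[0, +oo[%classic `*` setT.
  by apply/seteqP; split => q /=; rewrite /phase/= in_itv/= andbT; [split|case].
by apply: measurableX.
Qed.

Lemma measurable_phase_coord (i : 'I_N) : measurable_fun (setT : set Q) (fun q => q.2 ord0 i).
Proof.
by apply: (@measurableT_comp _ _ _ _ _ _ (fun x : 'rV[R]_N => x ord0 i)) => //; exact: measurable_coord.
Qed.

Lemma measurable_phase_sqr : measurable_fun (setT : set Q) (fun q => dotv q.2 q.2).
Proof.
by apply: measurable_sum => i; apply: measurable_funM => //; exact: measurable_phase_coord.
Qed.

Definition phase_size q : R := `|q.1| + \sum_i `|q.2 ord0 i|.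

Lemma phase_size_norm q : `|q| <= phase_size q.
Proof.
have s0 : 0 <= \sum_i `|q.2 ord0 i| by exact: sumr_ge0.
rewrite [`|q|]prod_normE ge_max /phase_size lerDl s0/=.
apply: (@rV_norm_le _ _ q.2) => [|i]; first by rewrite addr_ge0.
by rewrite ler_wpDl// (bigD1 i)//= lerDl sumr_ge0.
Qed.

Lemma cvg_phase_coord (i : 'I_N) q : (fun y : Q => y.2 ord0 i) @ q --> q.2 ord0 i.
Proof.
have h : y.2 @[y --> q] --> q.2 by case: q => a b; exact: cvg_snd.
exact: (@cvg_comp _ _ _ _ (fun x : 'rV[R]_N => x ord0 i) _ _ _ h (@coord_continuous _ _ _ ord0 i q.2)).
Qed.

Lemma cvg_phase_fst q : y.1 @[y --> q] --> q.1.
Proof. by case: q => a b; exact: cvg_fst. Qed.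

Lemma continuous_phase_size : continuous phase_size.
Proof.
move=> q; have FF : Filter (nbhs q) by exact: nbhs_filter.
apply: cvgD; first by apply: cvg_norm; exact: cvg_phase_fst.
by apply: cvg_sumr => i; apply: cvg_norm; exact: cvg_phase_coord.
Qed.

(** Weak-* measurability speaks of [C0_phase] functions only, whereas the energy is unbounded; these
    cut-offs increase to 1. *)
Definition phase_cutoff (n : nat) q : R := Num.max 0 (Num.min 1 (n%:R - phase_size q)).

Lemma phase_cutoff_bound n q : 0 <= phase_cutoff n q <= 1.
Proof.
by rewrite /phase_cutoff le_max lexx/= ge_max ler01/= ge_min lexx.
Qed.

Lemma phase_cutoff_out n q : n%:R <= phase_size q -> phase_cutoff n q = 0.
Proof.
by move=> h; apply/max_idPl; rewrite ge_min subr_le0 h orbT.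
Qed.

Lemma phase_cutoff_nd m n q : (m <= n)%N -> phase_cutoff m q <= phase_cutoff n q.
Proof.
move=> mn; have h : m%:R - phase_size q <= n%:R - phase_size q by rewrite lerD2r ler_nat.
rewrite /phase_cutoff ge_max le_max lexx/=.
by rewrite le_max; apply/orP; right; rewrite le_min !ge_min lexx/= h orbT.
Qed.

Lemma phase_cutoff_cvg q : \forall n \near \oo, phase_cutoff n q = 1.
Proof.
near=> n; rewrite /phase_cutoff.
have h : 1 <= n%:R - phase_size q.
  by rewrite lerBrDr; near: n; exact: nbhs_infty_ger.
by rewrite (min_idPl h); apply/max_idPr.
Unshelve. all: by end_near.
Qed.

Lemma continuous_phase_cutoff n : continuous (phase_cutoff n).
Proof.
move=> q; have FF : Filter (nbhs q) by exact: nbhs_filter.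
have h1 : n%:R - phase_size y @[y --> q] --> n%:R - phase_size q.
  by apply: cvgB; [exact: cvg_cst|exact: continuous_phase_size].
have h2 : Num.min 1 (n%:R - phase_size y) @[y --> q] --> Num.min 1 (n%:R - phase_size q).
  apply: (@cvg_comp _ _ _ (fun y => n%:R - phase_size y) (fun x => Num.min 1 x) _ _ _ h1).
  by apply: (@continuous_min _ _ (cst 1) id) => //; exact: cvg_cst.
apply: (@cvg_comp _ _ _ (fun y => Num.min 1 (n%:R - phase_size y)) (fun x => Num.max 0 x) _ _ _ h2).
by apply: (@continuous_max _ _ (cst 0) id) => //; exact: cvg_cst.
Qed.

Lemma measurable_phase_cutoff n : measurable_fun (setT : set Q) (phase_cutoff n).
Proof.
rewrite /phase_cutoff; apply: measurable_maxr => //; apply: measurable_minr => //.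
apply: measurable_funB => //; rewrite /phase_size; apply: measurable_funD => //.
  exact: measurableT_comp.
apply: measurable_sum => i; apply: measurableT_comp => //; exact: measurable_phase_coord.
Qed.

Variables (p : R -> R) (rhob eps : R).
Hypotheses (hp : pressure_law p) (rhob0 : 0 < rhob).
Local Notation H := (rel_potential p rhob).

Lemma measurable_phase_potential : measurable_fun (phase N : set Q) (fun q => H q.1).
Proof.
have h := @measurable_comp _ _ _ _ _ _ (`[0, +oo[%classic : set (measurableTypeR R)) H (phase N : set Q) (fst : Q -> R).
apply: h => //.
- by move=> _ [q /= h <-]; rewrite /= in_itv/= andbT.
- apply: subspace_continuous_measurable_fun => //; exact: rel_potential_continuous.
- by apply: measurable_funTS; exact: measurable_fst.
Qed.

(** Shifting [rho] by [1 / (n + 1)] makes the kinetic energy finite and continuous up to the vacuum.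
    The limit is monotone and reproduces the vacuum convention, including the infinite value. *)
Definition energy_approx (n : nat) q : R :=
  2^-1 * (dotv q.2 q.2 / (q.1 + n.+1%:R^-1)) + eps ^- 2 * H q.1.

Lemma dotv_ge0 (m : 'rV[R]_N) : 0 <= dotv m m.
Proof. by apply: sumr_ge0 => i _; exact: sqr_ge0. Qed.

Lemma dotv_eq0 (m : 'rV[R]_N) : dotv m m = 0 -> m = 0.
Proof.
move=> /eqP; rewrite psumr_eq0; last by move=> i _; exact: sqr_ge0.
move=> /allP h; apply/rowP => i; rewrite mxE; apply/eqP.
by have := h i (mem_index_enum i); rewrite mulf_eq0 orbb.
Qed.

Lemma energy_approx_ge0 n q : phase N q -> 0 <= energy_approx n q.
Proof.
move=> q0; rewrite addr_ge0//; last by rewrite mulr_ge0 ?rel_potential_ge0// invr_ge0 exprn_even_ge0.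
by rewrite mulr_ge0// mulr_ge0 ?dotv_ge0// invr_ge0 addr_ge0.
Qed.

Lemma energy_approx_nd m n q : phase N q -> (m <= n)%N -> energy_approx m q <= energy_approx n q.
Proof.
move=> q0 mn; rewrite lerD2r ler_wpM2l// ler_wpM2l ?dotv_ge0//.
rewrite lef_pV2 ?posrE ?ltr_wpDl//; first by rewrite lerD2l lef_pV2 ?posrE// ler_nat ltnS.
Qed.

Lemma energy_approx_cvg q : phase N q ->
  (energy_approx n q)%:E @[n --> \oo] --> energy p rhob eps q.
Proof.
move=> q0; rewrite /energy /m2_over_rho; case: eqVneq => [m0|m0].
  rewrite mule0 add0e; apply: cvg_near_cst; apply: nearW => n.
  rewrite /energy_approx m0 (_ : dotv _ _ = 0) ?mul0r ?mulr0 ?add0r//.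
  by apply: big1 => i _; rewrite mxE mul0r.
case: eqVneq => [r0|r0].
  rewrite mulry gtr0_sg ?invr_gt0// mul1e addye//.
  have s0 : 0 < dotv q.2 q.2.
    rewrite lt_neqAle dotv_ge0 andbT eq_sym; apply: contra_neq m0; exact: dotv_eq0.
  apply/cvgeryP/cvgryPge => A; near=> n.
  rewrite /energy_approx r0 add0r invrK -lerBlDr -ler_pdivrMl ?invr_gt0// invrK mulrC.
  rewrite -ler_pdivrMl//; apply: (@le_trans _ _ n%:R); last by rewrite ler_nat.
  by near: n; exact: nbhs_infty_ger.
have q1 : 0 < q.1 by rewrite lt_neqAle eq_sym r0.
rewrite -EFinM -EFinD; apply: cvg_EFin; first by near=> n.
apply: cvgD; last exact: cvg_cst.
apply: cvgMr; apply: cvgMr; apply: cvgV => //.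
rewrite -[X in _ --> X]addr0; apply: cvgD; first exact: cvg_cst.
exact: cvg_harmonic.
Unshelve. all: by end_near.
Qed.

Lemma measurable_energy_approx n : measurable_fun (phase N : set Q) (energy_approx n).
Proof.
apply: measurable_funD; last by apply: measurable_funM => //; exact: measurable_phase_potential.
apply: measurable_funM => //; apply: measurable_funM.
  by apply: measurable_funTS; exact: measurable_phase_sqr.
have h := @measurable_comp _ _ _ _ _ _ (`]0, +oo[%classic : set (measurableTypeR R)) (fun x : R => x^-1) (phase N : set Q)
  (fun q : Q => q.1 + n.+1%:R^-1).
apply: h => //.
- by move=> _ [q q0 <-]; rewrite /= in_itv/= andbT ltr_wpDl.
- apply: open_continuous_measurable_fun; first exact: interval_open.
  move=> x; rewrite inE/= in_itv/= andbT => x0; apply: inv_continuous.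
  by rewrite gt_eqF.
- by apply: measurable_funTS; apply: measurable_funD.
Qed.

Lemma energy_ge0 q : phase N q -> (0 <= energy p rhob eps q)%E.
Proof.
move=> q0; apply: (cvge_ge _ (energy_approx_cvg q0)).
by near=> n; rewrite lee_fin energy_approx_ge0.
Unshelve. all: by end_near.
Qed.

Lemma measurable_energy : measurable_fun (phase N : set Q) (energy p rhob eps).
Proof.
apply: (emeasurable_fun_cvg (fun n q => (energy_approx n q)%:E)) => [n|q q0].
  by apply/measurable_EFinP; exact: measurable_energy_approx.
exact: energy_approx_cvg.
Qed.

Lemma energy_approx_bounded n k : exists C, forall q, phase N q -> phase_size q <= k%:R ->
  energy_approx n q <= C.
Proof.
have cH : {within `[0, k%:R], continuous H}.
  apply: continuous_subspaceW (rel_potential_continuous hp rhob0) => x /=.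
  by rewrite !in_itv/= andbT => /andP[].
have [M [_ hM]] := compact_bounded (continuous_compact cH (@segment_compact R 0 k%:R)).
exists (2^-1 * (N%:R * k%:R ^+ 2 * n.+1%:R) + eps ^- 2 * (`|M| + 1)) => q q0 qk.
have s0 i : `|q.2 ord0 i| <= k%:R.
  apply: le_trans qk; rewrite /phase_size ler_wpDl// (bigD1 i)//= lerDl sumr_ge0//.
have e0 : 0 <= eps ^- 2 by rewrite invr_ge0 exprn_even_ge0.
apply: lerD; last first.
  rewrite ler_wpM2l// (le_trans (ler_norm _))//; apply: (hM (`|M| + 1)).
    by rewrite ltr_pwDr// ler_norm.
  exists q.1 => //=; rewrite in_itv/= q0/=; apply: le_trans qk.
  by rewrite /phase_size (le_trans (ler_norm _))// lerDl sumr_ge0.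
rewrite ler_wpM2l// ler_pM ?dotv_ge0//.
- by rewrite invr_ge0 addr_ge0.
- rewrite /dotv mulr_natl -[N in leRHS]card_ord -sumr_const; apply: ler_sum => i _.
  by rewrite -expr2 -real_normK ?num_real// lerXn2r// nnegrE.
- by rewrite invf_ple ?posrE ?ltr_wpDl// lerDr.
Qed.

Lemma C0_energy_approx n : C0_phase (fun q => phase_cutoff n q * energy_approx n q).
Proof.
split; last first.
  move=> e e0; exists n%:R => q q0 nq; rewrite phase_cutoff_out ?mul0r ?normr0//.
  by rewrite (le_trans (ltW nq))// phase_size_norm.
apply/subspace_continuousP => q q0.
have FF : Filter (nbhs q) by exact: nbhs_filter.
have F1 : Filter (within (phase N) (nbhs q)) by exact: within_filter.
have W (f : Q -> R) : f y @[y --> q] --> f q -> f y @[y --> within (phase N) (nbhs q)] --> f q.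
  by move=> h; apply: cvg_trans h; apply: cvg_app; exact: cvg_within.
apply: cvgM; first by apply: W; exact: continuous_phase_cutoff.
apply: cvgD.
  apply: cvgMr; apply: cvgM.
    apply: (W (fun q => dotv q.2 q.2)); apply: cvg_sumr => i; apply: cvgM; exact: cvg_phase_coord.
  apply: cvgV; first by rewrite gt_eqF// ltr_wpDl.
  by apply: (W (fun q => q.1 + n.+1%:R^-1)); apply: cvgD; [exact: cvg_phase_fst|exact: cvg_cst].
apply: cvgMr.
have q0' : `[0, +oo[%classic q.1 by rewrite /= in_itv/= andbT.
have h := (subspace_continuousP _ _).1 (rel_potential_continuous hp rhob0) _ q0'.
apply: (cvg_comp fst H) h => A.
move=> hA; have {}hA : nbhs q.1 (fun r => r \in `[0, +oo[ -> A r) := hA.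
have := cvg_phase_fst hA => {}hA; have {}hA : nbhs q (fun q => q.1 \in `[0, +oo[ -> A q.1) := hA.
suff : nbhs q (fun q => phase N q -> A q.1) by [].
by apply: filterS hA => y hy y0; apply: hy; rewrite in_itv/= andbT.
Qed.

(** Monotone convergence: the products [G n] of cut-off and approximate energy are [C0_phase]
    functions that increase to the energy. *)
Lemma measurable_young_energy d (X : measurableType d) (D : set X) (Y : X -> probability Q R) :
  measurable D -> (forall f, C0_phase f -> measurable_fun D (fun x => moment (Y x) f)) ->
  measurable_fun D (fun x => \int[Y x]_(q in phase N) energy p rhob eps q)%E.
Proof.
move=> mD hY; have mP := measurable_phase.
pose G n q := phase_cutoff n q * energy_approx n q.
have mG n : measurable_fun (phase N) (EFin \o G n).
  apply/measurable_EFinP; apply: measurable_funM; last exact: measurable_energy_approx.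
  by apply: measurable_funTS; exact: measurable_phase_cutoff.
have G0 n q : phase N q -> 0 <= G n q.
  by move=> q0; rewrite mulr_ge0 ?energy_approx_ge0//; case/andP: (phase_cutoff_bound n q).
have Gb n : exists C, forall q, phase N q -> G n q <= C.
  have [C hC] := energy_approx_bounded n n; exists `|C| => q q0.
  have /andP[c0 c1] := phase_cutoff_bound n q.
  have [qn|qn] := leP (phase_size q) n%:R; last first.
    by rewrite /G phase_cutoff_out ?mul0r// ltW.
  rewrite -[leRHS]mul1r ler_pM ?energy_approx_ge0//.
  by rewrite (le_trans (hC q q0 qn)) ?ler_norm.
have Gfin n x : (\int[Y x]_(q in phase N) (G n q)%:E \is a fin_num)%E.
  have [C hC] := Gb n.
  rewrite ge0_fin_numE; last by apply: integral_ge0 => q q0; rewrite lee_fin G0.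
  apply: (@le_lt_trans _ _ (\int[Y x]_(q in phase N) (C%:E))%E).
    apply: ge0_le_integral => //.
    - by move=> q q0; rewrite lee_fin G0.
    - exact: mG.
  have -> : (\int[Y x]_(q in phase N) C%:E = C%:E * Y x (phase N))%E := integral_cst (Y x) mP C%:E.
  rewrite ltey_eq fin_numM//.
  by rewrite fin_num_measure.
apply: (emeasurable_fun_cvg (fun n x => \int[Y x]_(q in phase N) (G n q)%:E)%E) => [n|x Dx].
  apply: (eq_measurable_fun (EFin \o (fun x => moment (Y x) (G n)))).
    by move=> x _; rewrite /= /moment /Rintegral (fineK (Gfin n x)).
  by apply/measurable_EFinP; apply: hY; exact: C0_energy_approx.
have -> : (\int[Y x]_(q in phase N) energy p rhob eps q =
    \int[Y x]_(q in phase N) limn (fun n => (G n q)%:E))%E.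
  apply: eq_integral => q /set_mem q0; apply/esym/cvg_lim => //.
  apply: cvg_trans (energy_approx_cvg q0); apply: near_eq_cvg.
  by apply: filterS (phase_cutoff_cvg q) => n c1; rewrite /G c1 mul1r.
apply: cvg_monotone_convergence => //.
- move=> q q0 m n mn; rewrite lee_fin; apply: ler_pM.
  + by case/andP: (phase_cutoff_bound m q).
  + exact: energy_approx_ge0.
  + exact: phase_cutoff_nd.
  + exact: energy_approx_nd.
Qed.

End phase_functions.
Lemma ae_le_Rintegral d (X : measurableType d) (R : realType) (mu : {measure set X -> \bar R})
    (D : set X) (f g : X -> R) : measurable D ->
  mu.-integrable D (EFin \o f) -> mu.-integrable D (EFin \o g) ->
  {ae mu, forall x, D x -> f x <= g x} ->
  \int[mu]_(x in D) f x <= \int[mu]_(x in D) g x.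
Proof.
move=> mD fi gi fg; rewrite -subr_ge0 -RintegralB//.
have mB : measurable_fun D (fun x => g x - f x).
  by apply: measurable_funB; apply: measurable_intR; eassumption.
rewrite (@eq_Rintegral_ae _ _ _ mu D _ (fun x => `|g x - f x|))//.
- by apply: Rintegral_ge0.
- exact: measurableT_comp.
- by apply: filterS fg => x h Dx; rewrite ger0_norm// subr_ge0 h.
Qed.

(** * Relative energy and relative stress of one measure *)

Section young_moments.
Context {R : realType} {N : nat}.
Local Notation Q := (R * 'rV[R]_N)%type.
Variables (p : R -> R) (rhob eps : R).
Hypotheses (hp : pressure_law p) (rhob0 : 0 < rhob).
Implicit Types (Y : probability Q R) (U V : 'rV[R]_N) (q : Q).
Local Notation H := (rel_potential p rhob).
Let mP := @measurable_phase R N.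

Definition young_energy Y : \bar R := (\int[Y]_(q in phase N) energy p rhob eps q)%E.
Definition mass Y : R := moment Y fst.
Definition momentum Y i : R := moment Y (fun q => q.2 ord0 i).
Definition stress Y i j : R := moment Y (mm_over_rho i j).
(** The integral of [rel_energy] with its square expanded; [integral_rel_energy] identifies the two
    when the energy and the first moments are finite. *)
Definition rel_young Y U : R :=
  fine (young_energy Y) - \sum_i momentum Y i * U ord0 i + 2^-1 * mass Y * dotv U U.
(** The moment of [(m - rho U) (x) (m - rho U) / rho], expanded. *)
Definition rel_stress Y U i j : R :=
  stress Y i j - momentum Y i * U ord0 j - momentum Y j * U ord0 i +
  mass Y * U ord0 i * U ord0 j.

Definition has_moments Y := [/\ Y (phase N) = 1%E,
  Y.-integrable (phase N) (EFin \o fst) &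
  forall i, Y.-integrable (phase N) (EFin \o (fun q => q.2 ord0 i))].

Lemma rel_energyE U q : rel_energy p rhob eps U q =
  (energy p rhob eps q + (- dotv q.2 U + 2^-1 * q.1 * dotv U U)%:E)%E.
Proof. by rewrite /rel_energy /energy -!addeA; congr (_ + _)%E; rewrite addeC. Qed.

Lemma eps2_ge0 : 0 <= eps ^- 2.
Proof. by rewrite invr_ge0 exprn_even_ge0. Qed.

Lemma kinetic_ge0 U q : phase N q ->
  (0 <= (2^-1)%:E * m2_over_rho q + (- dotv q.2 U + 2^-1 * q.1 * dotv U U)%:E)%E.
Proof.
move=> q0; rewrite /m2_over_rho; case: eqVneq => [m0|m0].
  rewrite mule0 add0e lee_fin m0 (_ : dotv 0 U = 0); last first.
    by apply: big1 => i _; rewrite mxE mul0r.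
  by rewrite oppr0 add0r mulr_ge0 ?dotv_ge0// mulr_ge0.
case: eqVneq => [r0|r0]; first by rewrite mulry gtr0_sg ?invr_gt0// mul1e addye.
have q1 : 0 < q.1 by rewrite lt_neqAle eq_sym r0.
rewrite -EFinM -EFinD lee_fin.
rewrite (_ : _ + _ = 2^-1 * (q.1 * \sum_i (q.2 ord0 i / q.1 - U ord0 i) ^+ 2)).
  by rewrite !mulr_ge0// ?invr_ge0// sumr_ge0// => i _; exact: sqr_ge0.
have -> : dotv q.2 q.2 / q.1 = \sum_i q.2 ord0 i ^+ 2 / q.1 by rewrite -mulr_suml.
rewrite /dotv -sumrN -mulrA !mulr_sumr -!big_split/=; apply: eq_bigr => i _.
by field.
Qed.

Lemma rel_energy_ge0 U q : phase N q -> (0 <= rel_energy p rhob eps U q)%E.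
Proof.
move=> q0; rewrite /rel_energy adde_ge0 ?kinetic_ge0// lee_fin.
by rewrite mulr_ge0 ?eps2_ge0// rel_potential_ge0.
Qed.

Lemma potential_le_rel_energy U q : phase N q ->
  ((eps ^- 2 * H q.1)%:E <= rel_energy p rhob eps U q)%E.
Proof. by move=> q0; rewrite /rel_energy leeDr// kinetic_ge0. Qed.

Section finite_energy.
Variable Y : probability Q R.
Hypothesis hY : has_moments Y.

Lemma integrable_young_linear U : Y.-integrable (phase N)
  (EFin \o (fun q => - dotv q.2 U + 2^-1 * q.1 * dotv U U)).
Proof.
have [_ i1 i2] := hY; apply: integrableRD => //.
  apply: integrableRN => //; apply: integrableR_sum => // i.
  by under eq_fun do rewrite mulrC; exact: integrableRZl.
by under eq_fun do rewrite mulrAC; exact: integrableRZl.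
Qed.

Lemma moment_linear U : \int[Y]_(q in phase N) (- dotv q.2 U + 2^-1 * q.1 * dotv U U) =
  - (\sum_i momentum Y i * U ord0 i) + 2^-1 * mass Y * dotv U U.
Proof.
have [_ i1 i2] := hY.
have iU i : Y.-integrable (phase N) (EFin \o (fun q => q.2 ord0 i * U ord0 i)).
  by under eq_fun do rewrite mulrC; exact: integrableRZl.
rewrite RintegralD//; first last.
- by under eq_fun do rewrite mulrAC; exact: integrableRZl.
- by apply: integrableRN => //; exact: integrableR_sum.
congr (_ + _).
  rewrite RintegralN//; last exact: integrableR_sum.
  congr (- _); rewrite /dotv Rintegral_sum//; apply: eq_bigr => i _.
  by rewrite RintegralZr.
under eq_Rintegral do rewrite mulrAC.
by rewrite RintegralZl// mulrAC.
Qed.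

Hypothesis fE : (young_energy Y < +oo)%E.

Lemma integrable_energy : Y.-integrable (phase N) (energy p rhob eps).
Proof.
apply/integrableP; split; first exact: measurable_energy.
rewrite (eq_integral (energy p rhob eps))// => q /set_mem q0.
by rewrite gee0_abs// energy_ge0.
Qed.

Lemma integrable_rel_energy U : Y.-integrable (phase N) (rel_energy p rhob eps U).
Proof.
apply: (eq_integrable _ (fun q => energy p rhob eps q +
    (- dotv q.2 U + 2^-1 * q.1 * dotv U U)%:E)%E) => //.
  by move=> q _; rewrite rel_energyE.
apply: integrableD => //; first exact: integrable_energy.
exact: integrable_young_linear.
Qed.

Lemma young_energy_fin : young_energy Y \is a fin_num.
Proof.
by rewrite ge0_fin_numE//; apply: integral_ge0 => q q0; exact: energy_ge0.
Qed.

Lemma integral_rel_energy U :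
  (\int[Y]_(q in phase N) rel_energy p rhob eps U q = (rel_young Y U)%:E)%E.
Proof.
rewrite (eq_integral (fun q => energy p rhob eps q +
    (- dotv q.2 U + 2^-1 * q.1 * dotv U U)%:E)%E); last by move=> q _; rewrite rel_energyE.
rewrite integralD//; last 2 first.
- exact: integrable_energy.
- exact: integrable_young_linear.
rewrite -/(young_energy Y) -(fineK young_energy_fin).
have -> : (\int[Y]_(q in phase N) (- dotv q.2 U + 2^-1 * q.1 * dotv U U)%:E =
    (- (\sum_i momentum Y i * U ord0 i) + 2^-1 * mass Y * dotv U U)%:E)%E.
  rewrite -moment_linear /Rintegral fineK//.
  exact: integrable_fin_num (integrable_young_linear U).
by rewrite -EFinD addrA.
Qed.

Lemma rel_young_ge0 U : 0 <= rel_young Y U.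
Proof.
rewrite -lee_fin -integral_rel_energy; apply: integral_ge0 => q; exact: rel_energy_ge0.
Qed.

Lemma mass_ge0 : 0 <= mass Y.
Proof. by apply: Rintegral_ge0 => q. Qed.

(** The difference of the two sides is exactly the relative energy with respect to [2 U - V]. *)
Lemma rel_young_change U V :
  rel_young Y V <= 2 * rel_young Y U + mass Y * \sum_i (U ord0 i - V ord0 i) ^+ 2.
Proof.
rewrite -subr_ge0.
have -> : 2 * rel_young Y U + mass Y * \sum_i (U ord0 i - V ord0 i) ^+ 2 - rel_young Y V =
    rel_young Y (2 *: U - V).
  rewrite /rel_young /dotv.
  have -> : \sum_i momentum Y i * (2 *: U - V) ord0 i =
      2 * (\sum_i momentum Y i * U ord0 i) - \sum_i momentum Y i * V ord0 i.
    by rewrite mulr_sumr -sumrB; apply: eq_bigr => i _; rewrite !mxE; ring.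
  have -> : \sum_i (2 *: U - V) ord0 i * (2 *: U - V) ord0 i =
      2 * (\sum_i U ord0 i * U ord0 i) + 2 * (\sum_i (U ord0 i - V ord0 i) ^+ 2) -
      \sum_i V ord0 i * V ord0 i.
    rewrite !mulr_sumr -big_split -sumrB/=; apply: eq_bigr => i _.
    by rewrite !mxE; ring.
  by field.
exact: rel_young_ge0.
Qed.

(** The relative energies with respect to plus and minus the i-th unit vector are nonnegative. *)
Lemma momentum_bound i : `|momentum Y i| <= fine (young_energy Y) + 2^-1 * mass Y.
Proof.
have h (s : R) : s ^+ 2 = 1 -> s * momentum Y i <= fine (young_energy Y) + 2^-1 * mass Y.
  move=> s2; have := rel_young_ge0 (s *: unitv i).
  rewrite /rel_young.
  have -> : \sum_j momentum Y j * (s *: unitv i) ord0 j = s * momentum Y i.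
    rewrite (bigD1 i)//= big1 ?addr0 => [|j ji]; first by rewrite !mxE !eqxx mulr1 mulrC.
    by rewrite !mxE eqxx/= eq_sym in ji *; rewrite (negbTE ji) !mulr0.
  have -> : dotv (s *: unitv i) (s *: unitv i) = 1.
    rewrite /dotv (bigD1 i)//= big1 ?addr0 => [|j ji]; first by rewrite !mxE !eqxx mulr1 -expr2.
    by rewrite !mxE eqxx/= (negbTE ji) !mulr0.
  by lra.
have h1 := h 1 (expr1n _ 2).
have h2 : - 1 * momentum Y i <= fine (young_energy Y) + 2^-1 * mass Y.
  by apply: h; rewrite sqrrN expr1n.
by rewrite ler_norml; apply/andP; split; lra.
Qed.

(** The potential enters the energy with weight [eps ^- 2], which is where the gain [eps ^+ 2] comes
    from. *)
Lemma mass_deviation d C U : 0 <= C -> 0 < eps ->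
  (forall r, 0 <= r -> `|r - rhob| <= d + C * H r) ->
  `|mass Y - rhob| <= d + C * eps ^+ 2 * rel_young Y U.
Proof.
move=> C0 e0 hC; have [Y1 i1 _] := hY.
have ic c : Y.-integrable (phase N) (EFin \o (fun=> c)).
  by apply: finite_measure_integrable_cst.
have icE c : \int[Y]_(q in phase N) c = c.
  rewrite /Rintegral; have -> : (\int[Y]_(q in phase N) c%:E = c%:E * Y (phase N))%E :=
    integral_cst Y mP c%:E.
  by rewrite Y1 mule1.
rewrite -{1}(icE rhob) /mass /moment -RintegralB//.
apply: (le_trans (le_normr_Rintegral _ _)) => //; first exact: integrableRB.
rewrite -lee_fin EFinD EFinM -integral_rel_energy.
have iN : Y.-integrable (phase N) (EFin \o (fun q => `|q.1 - rhob|)).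
  by apply: integrableR_norm => //; exact: integrableRB.
rewrite /Rintegral fineK; last exact: integrable_fin_num iN.
apply: (@le_trans _ _ (\int[Y]_(q in phase N) (d%:E +
    (C * eps ^+ 2)%:E * rel_energy p rhob eps U q))%E).
  apply: le_integral => //.
    apply: integrableD => //; first exact: ic.
    exact/integrableZl/integrable_rel_energy.
  move=> q /set_mem q0; apply: (@le_trans _ _ (d + C * H q.1)%:E).
    by rewrite lee_fin hC.
  rewrite EFinD leeD2l// (_ : C * H q.1 = C * eps ^+ 2 * (eps ^- 2 * H q.1)); last first.
    by field; rewrite gt_eqF.
  rewrite EFinM lee_wpmul2l// ?lee_fin ?mulr_ge0 ?exprn_ge0 ?(ltW e0)//.
  exact: potential_le_rel_energy.
rewrite integralD//; last 2 first.
- exact: ic.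
- exact/integrableZl/integrable_rel_energy.
rewrite integralZl//; last exact: integrable_rel_energy.
rewrite leeD2r//.
have -> : (\int[Y]_(q in phase N) d%:E = d%:E * Y (phase N))%E := integral_cst Y mP d%:E.
by rewrite Y1 mule1.
Qed.

Hypothesis im : Y.-integrable (phase N) m2_over_rho.
Hypothesis imm : forall i j, Y.-integrable (phase N) (EFin \o mm_over_rho i j).

(** [m2_over_rho] is infinite at vacuum points with momentum. Excluding them makes the conventional
    value of [mm_over_rho] there harmless. *)
Lemma young_vacuum : {ae Y, forall q, phase N q -> q.1 = 0 -> q.2 = 0}.
Proof.
have := integrable_ae mP im; apply: filterS => q h q0 r0; have := h q0.
by rewrite /m2_over_rho r0 eqxx; case: eqVneq.
Qed.

Lemma kinetic_le_energy : 2^-1 * \sum_i stress Y i i <= fine (young_energy Y).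
Proof.
have iS : Y.-integrable (phase N) (EFin \o (fun q => 2^-1 * \sum_i mm_over_rho i i q)).
  by apply: integrableRZl => //; exact: integrableR_sum.
rewrite -lee_fin (fineK young_energy_fin).
have -> : 2^-1 * \sum_i stress Y i i = \int[Y]_(q in phase N) (2^-1 * \sum_i mm_over_rho i i q).
  by rewrite RintegralZl ?Rintegral_sum//; exact: integrableR_sum.
rewrite /Rintegral fineK; last exact: integrable_fin_num iS.
apply: ae_ge0_le_integral_nonmeas => //.
- move=> q q0; rewrite lee_fin mulr_ge0// sumr_ge0// => i _.
  by rewrite /mm_over_rho mulr_ge0 ?invr_ge0// -expr2 sqr_ge0.
- by move=> q; exact: energy_ge0.
apply: filterS young_vacuum => q hq q0; rewrite /energy.
apply: (@le_trans _ _ ((2^-1)%:E * m2_over_rho q)%E); last first.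
  by rewrite leeDl// lee_fin mulr_ge0 ?eps2_ge0// rel_potential_ge0.
rewrite EFinM lee_wpmul2l ?lee_fin// /m2_over_rho.
have E : \sum_i mm_over_rho i i q = dotv q.2 q.2 / q.1 by rewrite /dotv mulr_suml.
case: eqVneq => [m0|m0].
  by rewrite E m0 lee_fin /dotv big1 ?mul0r// => i _; rewrite mxE mul0r.
case: eqVneq => [r0|r0]; last by rewrite E.
by exfalso; move/eqP: m0; apply; exact: hq.
Qed.

(** The difference of the two sides does not depend on [U], so [kinetic_le_energy] is the whole
    content. *)
Lemma rel_stress_trace U : 2^-1 * \sum_i rel_stress Y U i i <= rel_young Y U.
Proof.
have := kinetic_le_energy; rewrite -subr_ge0 => h; rewrite -subr_ge0.
suff -> : rel_young Y U - 2^-1 * \sum_i rel_stress Y U i i =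
  fine (young_energy Y) - 2^-1 * \sum_i stress Y i i by [].
rewrite /rel_young /rel_stress.
have -> : \sum_i (stress Y i i - momentum Y i * U ord0 i - momentum Y i * U ord0 i +
    mass Y * U ord0 i * U ord0 i) = \sum_i stress Y i i -
    2 * (\sum_i momentum Y i * U ord0 i) + mass Y * dotv U U.
  by rewrite /dotv !mulr_sumr -sumrB -big_split; apply: eq_bigr => i _ /=; ring.
by field.
Qed.

(** Away from the vacuum the integrand is [rho * x_i * x_j] with [x = m / rho - U], and [|x_i x_j|]
    is at most half the sum of the squares. *)
Lemma rel_stress_offdiag U i j :
  `|rel_stress Y U i j| <= 2^-1 * (rel_stress Y U i i + rel_stress Y U j j).
Proof.
have [_ i1 i2] := hY.
pose z i j q := mm_over_rho i j q - q.2 ord0 i * U ord0 j - q.2 ord0 j * U ord0 i +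
  q.1 * U ord0 i * U ord0 j.
have iU a b : Y.-integrable (phase N) (EFin \o (fun q => q.2 ord0 a * U ord0 b)).
  by under eq_fun do rewrite mulrC; exact: integrableRZl.
have i1U a b : Y.-integrable (phase N) (EFin \o (fun q => q.1 * U ord0 a * U ord0 b)).
  by under eq_fun do rewrite -mulrA mulrC; exact: integrableRZl.
have i3 a b : Y.-integrable (phase N) (EFin \o (fun q => mm_over_rho a b q - q.2 ord0 a * U ord0 b)).
  exact: integrableRB.
have i4 a b : Y.-integrable (phase N) (EFin \o (fun q => mm_over_rho a b q - q.2 ord0 a * U ord0 b -
    q.2 ord0 b * U ord0 a)) by exact: integrableRB.
have iz a b : Y.-integrable (phase N) (EFin \o z a b) by exact: integrableRD.
have zE a b : \int[Y]_(q in phase N) z a b q = rel_stress Y U a b.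
  rewrite /z RintegralD// !RintegralB// !RintegralZr//.
  by under eq_fun do rewrite mulrC; exact: integrableRZl.
have zq : {ae Y, forall q, phase N q -> `|z i j q| <= 2^-1 * (z i i q + z j j q)}.
  apply: filterS young_vacuum => q hq q0.
  have [r0|r0] := eqVneq q.1 0.
    have m0 := hq q0 r0.
    by rewrite /z /mm_over_rho r0 m0 !mxE !(mul0r, subr0, addr0) normr0 mulr0.
  have q1 : 0 < q.1 by rewrite lt_neqAle eq_sym r0.
  have E a b : z a b q = q.1 * ((q.2 ord0 a / q.1 - U ord0 a) * (q.2 ord0 b / q.1 - U ord0 b)).
    by rewrite /z /mm_over_rho; field.
  rewrite !E; set x := _ - U ord0 i; set y := _ - U ord0 j.
  rewrite normrM gtr0_norm// -mulrDr mulrCA ler_wpM2l ?(ltW q1)//.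
  rewrite ler_norml; have := sqr_ge0 (x + y); have := sqr_ge0 (x - y).
  have -> : (x - y) ^+ 2 = x * x - 2 * (x * y) + y * y by ring.
  have -> : (x + y) ^+ 2 = x * x + 2 * (x * y) + y * y by ring.
  by move=> a b; apply/andP; split; lra.
rewrite -!zE; apply: (le_trans (le_normr_Rintegral _ _)) => //.
rewrite -RintegralD// -RintegralZl//; last exact: integrableRD.
apply: ae_le_Rintegral => //; first exact: integrableR_norm.
by apply: integrableRZl => //; exact: integrableRD.
Qed.

(** Summing the off-diagonal bounds counts the trace [N] times, and the trace is at most twice the
    relative energy: hence [2 * N * M], the first part of the growth rate. *)
Lemma rel_stress_contract U (G : 'I_N -> 'I_N -> R) (M : R) :
  (forall i j, `|G i j| <= M) ->
  `|\sum_i \sum_j rel_stress Y U i j * G i j| <= 2 * N%:R * M * rel_young Y U.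
Proof.
move=> GM.
have h i j : `|rel_stress Y U i j * G i j| <=
    2^-1 * M * rel_stress Y U i i + 2^-1 * M * rel_stress Y U j j.
  rewrite normrM -mulrDr -mulrA mulrCA [leRHS]mulrC.
  by apply: ler_pM => //; exact: rel_stress_offdiag.
apply: (@le_trans _ _ (\sum_i \sum_j (2^-1 * M * rel_stress Y U i i + 2^-1 * M * rel_stress Y U j j))).
  apply: (le_trans (ler_norm_sum _ _ _)); apply: ler_sum => i _.
  by apply: (le_trans (ler_norm_sum _ _ _)); apply: ler_sum => j _.
have -> : \sum_i \sum_j (2^-1 * M * rel_stress Y U i i + 2^-1 * M * rel_stress Y U j j) =
    2 * N%:R * M * (2^-1 * \sum_i rel_stress Y U i i).
  under eq_bigr do rewrite big_split/= sumr_const card_ord -mulr_sumr.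
  rewrite big_split/= sumr_const card_ord sumrMnl -mulr_sumr.
  by rewrite -mulr_natl -[X in _ + X]mulr_natl; field.
have NM : 0 <= N%:R * M.
  case: (posnP N) => [->|N0]; first by rewrite mul0r.
  by rewrite mulr_ge0// (le_trans _ (GM (Ordinal N0) (Ordinal N0))).
by rewrite ler_wpM2l ?rel_stress_trace// -mulrA mulr_ge0.
Qed.

End finite_energy.
End young_moments.

(** * Defect measures, time cut-offs and Gronwall's inequality *)

Section charge_bound.
Context d (X : measurableType d) (R : realType).
Local Open Scope ereal_scope.

Lemma defect_variation_ge0 (I : finType) (mu : I -> {charge set X -> \bar R}) (A : set X) :
  0 <= Defs.total_variation mu A.
Proof.
apply: ereal_sup_ubound; exists 0%N, (fun=> set0); split; [by case|by move=> -[]|by rewrite big_ord0].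
Qed.

(** The two Hahn pieces of [A] are an admissible family in the supremum, and one component of a
    vector is at most its Euclidean norm. *)
Lemma jordan_le_total_variation (I : finType) (mu : I -> {charge set X -> \bar R}) (A : set X) i
    (P N : set X) (PN : hahn_decomposition (mu i) P N) : measurable A ->
  jordan_pos PN A + jordan_neg PN A <= Defs.total_variation mu A.
Proof.
move=> mA; have [[mP _] [mN _] _ PN0] := PN.
have EP : jordan_pos PN A = mu i (A `&` P) by rewrite jordan_posE cjordan_posE /crestr0 mem_set.
have EN : jordan_neg PN A = - mu i (A `&` N) by rewrite jordan_negE cjordan_negE /crestr0 mem_set.
have mAP : measurable (A `&` P) by exact: measurableI.
have mAN : measurable (A `&` N) by exact: measurableI.
have fP := fin_num_measure (mu i) _ mAP.
have fN := fin_num_measure (mu i) _ mAN.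
rewrite EP EN -(fineK fP) -(fineK fN) -EFinN -EFinD.
have sq B : (`|fine (mu i B)| <= Num.sqrt (\sum_j fine (mu j B) ^+ 2))%R.
  rewrite -sqrtr_sqr ler_wsqrtr// (bigD1 i)//= lerDl.
  by apply: sumr_ge0 => j _; exact: sqr_ge0.
apply: (@le_trans _ _ (\sum_(k < 2) Num.sqrt (\sum_j
    fine (mu j (if k == ord0 then A `&` P else A `&` N)) ^+ 2))%R%:E).
  rewrite lee_fin big_ord_recl big_ord1/= lerD//.
    exact: le_trans (ler_norm _) (sq _).
  by apply: le_trans (ler_norm _) _; rewrite normrN; exact: sq.
apply: ereal_sup_ubound; exists 2%N, (fun k => if k == ord0 then A `&` P else A `&` N).
split => //.
  by move=> k; case: ifP => _; split => //; exact: subIsetl.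
have D x : (A `&` P) x -> (A `&` N) x -> False.
  by move=> [_ Px] [_ Nx]; have : (P `&` N) x by []; rewrite PN0.
move=> k l _ _ [x []].
case: (eqVneq k ord0) => [->|k0]; case: (eqVneq l ord0) => [->|l0] //= h1 h2.
- by have := D x h1 h2.
- by have := D x h2 h1.
- apply/val_inj; move: k0 l0 {h1 h2}; rewrite -!val_eqE /=.
  by case: k l => [[|[|k]] ?] [[|[|l]] ?].
Qed.

Lemma Rintegral_bounded_support (mu : {finite_measure set X -> \bar R}) (A B : set X)
    (f : X -> R) (C : R) : measurable A -> measurable B -> B `<=` A ->
  measurable_fun setT f -> (0 <= C)%R -> (forall x, A x -> `|f x| <= C)%R ->
  (forall x, A x -> ~ B x -> f x = 0%R) ->
  (`|\int[mu]_(x in A) f x| <= C * fine (mu B))%R.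
Proof.
move=> mA mB BA mf C0 fC f0.
have iC : mu.-integrable A (EFin \o (fun x => C * \1_B x)%R).
  by apply: integrableRZl => //; exact: integrableS (integrable_indic mu mB).
have fle x : A x -> (`|f x| <= C * \1_B x)%R.
  move=> Ax; rewrite indicE; have [Bx|nB] := boolP (x \in B); first by rewrite mulr1 fC.
  by rewrite mulr0 f0 ?normr0// => Bx; move/negP: nB; apply; exact: mem_set.
have intf : mu.-integrable A (EFin \o f).
  by apply: (le_integrableR mA _ fle iC); exact: measurable_funTS.
apply: (le_trans (le_normr_Rintegral _ _)) => //.
apply: (@le_trans _ _ (\int[mu]_(x in A) (C * \1_B x))%R).
  by apply: ae_le_Rintegral => //; [exact: integrableR_norm|exact: nearW].
rewrite RintegralZl//; last exact: integrableS (integrable_indic mu mB).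
by rewrite /Rintegral integral_indic// (setIidl BA).
Qed.

(** The integrals run over [A], but only the variation on the smaller [B] appears. With [A] the
    whole cylinder and [B] its part up to [tau], this is what compatibility can control. *)
Lemma charge_integral_sum_bound (I : finType) (mu : I -> {charge set X -> \bar R})
    (A B : set X) (f : I -> X -> R) (C : R) : measurable A -> measurable B -> B `<=` A ->
  (forall i, measurable_fun setT (f i)) -> (0 <= C)%R ->
  (forall i x, A x -> `|f i x| <= C)%R -> (forall i x, A x -> ~ B x -> f i x = 0%R) ->
  Defs.total_variation mu B < +oo ->
  (`|\sum_i charge_integral (mu i) A (f i)| <= #|I|%:R * C * fine (Defs.total_variation mu B))%R.
Proof.
move=> mA mB BA mf C0 fC f0 tv.
apply: (le_trans (ler_norm_sum _ _ _)).
rewrite -mulrA mulr_natl -sumr_const; apply: ler_sum => i _.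
rewrite /charge_integral; set PN := projT2 _.
apply: (le_trans (ler_normB _ _)).
have h1 := @Rintegral_bounded_support (jordan_pos PN) A B (f i) C mA mB BA (mf i) C0 (fC i) (f0 i).
have h2 := @Rintegral_bounded_support (jordan_neg PN) A B (f i) C mA mB BA (mf i) C0 (fC i) (f0 i).
apply: (le_trans (lerD h1 h2)); rewrite -mulrDr ler_wpM2l//.
have fp := fin_num_measure (jordan_pos PN) _ mB.
have fn := fin_num_measure (jordan_neg PN) _ mB.
rewrite -lee_fin EFinD !fineK//.
  exact: jordan_le_total_variation.
by rewrite ge0_fin_numE// defect_variation_ge0.
Qed.

End charge_bound.

(** * Left Lebesgue points and time cut-offs *)

Section lebesgue_points.
Context {R : realType}.
Local Notation mu := (@lebesgue_measure R).

(** One-sided, because the cut-offs decrease from 1 to 0 inside [(tau - h, tau)]. *)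
Definition left_lebesgue_pt (f : R -> R) (tau : R) := forall e, 0 < e -> exists2 h0, 0 < h0 &
  forall h, 0 < h -> h < h0 -> \int[mu]_(z in `]tau - h, tau[) `|f z - f tau| <= e * h.

(** The moments are only integrable up to times [T' < T]; results on [(0, T)] are assembled from
    countably many such intervals. *)
Lemma itv_exhaustion (T : R) : 0 < T -> exists Tn : nat -> R,
  (forall n, 0 < Tn n < T) /\ forall t, t < T -> exists n, t < Tn n.
Proof.
move=> T0; exists (fun n => T * (1 - n.+2%:R^-1)); split => [n|t tT].
  have n21 : (n.+2%:R^-1 : R) < 1 by rewrite invf_lt1// ltr1n.
  by rewrite mulr_gt0 ?subr_gt0//= gtr_pMr// ltrBlDr ltrDl.
have dT : 0 < T - t by rewrite subr_gt0.
exists (Num.truncn (T / (T - t))); have := truncnS_gt (T / (T - t)); set n := Num.truncn _ => hn.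
rewrite mulrBr mulr1 ltrBrDr -ltrBrDl ltr_pdivrMr//.
move: hn; rewrite ltr_pdivrMr// mulrC => /lt_trans; apply.
by rewrite ltr_pM2l// ltr_nat.
Qed.

Lemma ae_itv_exhaust (T : R) (P : R -> Prop) : 0 < T ->
  (forall T', 0 < T' -> T' < T -> {ae mu, forall t : R, 0 < t < T' -> P t}) ->
  {ae mu, forall t : R, 0 < t < T -> P t}.
Proof.
move=> T0 h; have [Tn [Tn0 hTn]] := itv_exhaustion T0.
have : {ae mu, forall t, forall n, 0 < t < Tn n -> P t}.
  by apply/ae_foralln => n; have /andP[a b] := Tn0 n; exact: h.
move=> h'; apply: (@filterS _ _ (ae_filter_ringOfSetsType mu) _ _ _ h') => t ht /andP[t0 tT].
by have [n tn] := hTn _ tT; apply: (ht n); rewrite t0.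
Qed.

Lemma ae_left_lebesgue_pt (T : R) (f : R -> R) : 0 < T ->
  (forall T', 0 < T' -> T' < T -> mu.-integrable `]0, T'[ (EFin \o f)) ->
  {ae mu, forall tau : R, 0 < tau < T -> left_lebesgue_pt f tau}.
Proof.
move=> T0 intf.
have [Tn [TnI hTn]] := itv_exhaustion T0.
have Tn0 n : 0 < Tn n by have /andP[] := TnI n.
have TnT n : Tn n < T by have /andP[] := TnI n.
have h n : {ae mu, forall x, lebesgue_pt (f \_ `]0, Tn n[) x}.
  by apply/lebesgue_differentiation/integrable_locally_restrict => //; exact: intf.
have {}h : {ae mu, forall x, forall n, lebesgue_pt (f \_ `]0, Tn n[) x} by exact/ae_foralln.
apply: (@filterS _ _ (ae_filter_ringOfSetsType mu) _ _ _ h) => tau hl /andP[tau0 tauT] e e0.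
have [n tn] := hTn _ tauT.
have e20 : 0 < e / 2 by rewrite divr_gt0.
have /fine_cvgP[fin cv] := hl n.
have /cvgrPdist_lt/(_ _ e20) dist := cv.
have [d /= d0 hd] : \forall r \near (0 : R)^'+,
    davg (f \_ `]0, Tn n[) tau r \is a fin_num /\
    `|0 - fine (davg (f \_ `]0, Tn n[) tau r)| < e / 2 by exact: filterS2 fin dist.
(* Keeps the ball around [tau] inside [(0, Tn n)], where the restricted function agrees with [f]. *)
pose h0 := Num.min d (Num.min tau (Tn n - tau)).
exists h0 => [|r r0 rh0]; first by rewrite !lt_min d0 tau0 subr_gt0.
have [rd [rtau rT]] : r < d /\ r < tau /\ r < Tn n - tau.
  by move: rh0; rewrite !lt_min => /andP[-> /andP[-> ->]].
have b0r : ball (0 : R) d r by rewrite /ball/= sub0r normrN gtr0_norm.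
have [finr] := hd r b0r r0.
rewrite sub0r normrN => ltr_.
have ballI z : ball tau r z -> `]0, Tn n[%classic z.
  by rewrite /ball/= ltr_distlC in_itv/= => /andP[a b]; apply/andP; split; lra.
have gE z : ball tau r z -> (f \_ `]0, Tn n[) z = f z.
  by move=> /ballI zI; rewrite patchE mem_set.
have gtau : (f \_ `]0, Tn n[) tau = f tau.
  by rewrite patchE mem_set//= in_itv/= tau0.
have mball : measurable (ball tau r : set (measurableTypeR R)) by exact: measurable_ball.
have mf : measurable_fun (ball tau r : set (measurableTypeR R)) (fun z => (`|f z - f tau|)%:E).
  apply/measurable_EFinP; apply: measurableT_comp => //; apply: measurable_funB => //.
  apply: measurable_funS (ballI) _ => //.
  by have /integrableP[/measurable_EFinP] := intf _ (Tn0 n) (TnT n).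
pose I : \bar R := (\int[mu]_(z in ball tau r) (`|f z - f tau|)%:E)%E.
have I0 : (0 <= I)%E by apply: integral_ge0 => z _; rewrite lee_fin.
have dE : davg (f \_ `]0, Tn n[) tau r = ((r *+ 2)^-1%:E * I)%E.
  rewrite /davg /iavg (lebesgue_measure_ball _ (ltW r0))// inver mulrn_eq0/= (gt_eqF r0).
  by congr (_ * _)%E; apply: eq_integral => z /set_mem zb; rewrite /= gE// gtau.
have r20 : 0 < r *+ 2 by rewrite mulrn_wgt0.
have finI : I \is a fin_num.
  rewrite ge0_fin_numE//; move: finr; rewrite dE; case: I I0 {dE ltr_} => [x _ _|_|]//.
    exact: ltry.
  by rewrite mulry gtr0_sg ?invr_gt0// mul1e.
have leI : fine I <= e * r.
  move: ltr_; rewrite dE -(fineK finI) -EFinM /= ger0_norm; last first.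
    by rewrite mulr_ge0 ?invr_ge0 ?(ltW r20)// fine_ge0.
  rewrite ltr_pdivrMl// => /ltW; rewrite -mulr_natr => /le_trans; apply.
  by rewrite le_eqVlt; apply/orP; left; apply/eqP; field.
apply: le_trans leI; rewrite /Rintegral.
have sub : `]tau - r, tau[ `<=` (ball tau r : set R).
  move=> z /=; rewrite in_itv/= => /andP[a b]; rewrite /ball/= ltr_distlC.
  by apply/andP; split; lra.
have le1 : ((\int[mu]_(z in `](tau - r)%R, tau[) (`|f z - f tau|%R)%:E) <= I)%E.
  by apply: ge0_subset_integral => // z _; rewrite lee_fin.
apply: fine_le => //; rewrite ge0_fin_numE.
  by apply: le_lt_trans le1 _; rewrite -ge0_fin_numE.
by apply: integral_ge0 => z _; rewrite lee_fin.
Qed.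

(** [- s'] has integral 1 and size at most of order [1 / h] on an interval of length [h], so it
    recovers the value of [L] at a Lebesgue point. *)
Lemma cutoff_limit (tau : R) (L G : R -> R) : 0 < tau ->
  mu.-integrable `]0, tau[ (EFin \o L) -> mu.-integrable `]0, tau[ (EFin \o G) ->
  left_lebesgue_pt L tau -> left_lebesgue_pt G tau ->
  forall e, 0 < e -> exists s s' : R -> R,
  [/\ smooth1 s, (forall t : R, is_derive t 1 s (s' t)),
    (forall t, tau <= t -> s t = 0 /\ s' t = 0) /\ s 0 = 1, (forall t, 0 <= s t <= 1) &
    `|\int[mu]_(t in `]0, tau[) (s' t * L t) + L tau| <= e /\
    `|\int[mu]_(t in `]0, tau[) (s t * G t) - \int[mu]_(t in `]0, tau[) G t| <= e].
Proof.
move=> tau0 iL iG lL lG e e0; have [C hC] := @cutoff_exists R.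
pose C1 := `|C| + 1; have C10 : 0 < C1 by rewrite ltr_wpDl.
(* The slope is at most [C1 / h], so an oscillation integral of at most [(e / C1) * h] contributes
   at most [e]. *)
have [h1 h10 hL] := lL (e / C1) (divr_gt0 e0 C10).
(* [s G - G] lives on [(tau - h, tau)], where the integral of [|G|] is at most [(1 + |G tau|) * h],
   that is [K * h]. *)
have [h2 h20 hG] := lG 1 ltr01.
pose K := 1 + `|G tau|; have K0 : 0 < K by rewrite ltr_pwDl.
pose h := Num.min (tau / 2) (Num.min (h1 / 2) (Num.min (h2 / 2) (e / K))).
have h0 : 0 < h by rewrite !lt_min !divr_gt0.
have htau : h <= tau / 2 by rewrite /h ge_min lexx.
have hh1 : h < h1.
  have : h <= h1 / 2 by rewrite /h !ge_min lexx !orbT.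
  lra.
have hh2 : h < h2.
  have : h <= h2 / 2 by rewrite /h !ge_min lexx !orbT.
  lra.
have hK : K * h <= e.
  by rewrite -ler_pdivlMl// mulrC /h !ge_min lexx !orbT.
have [s [s' [ss ds [s0 s1] sb [[cs' bs'] s'0]]]] := hC tau h h0.
have s00 : s 0 = 1 by apply: s1; lra.
exists s, s'; split => //.
  split => // t tt; split; first exact: s0.
  by apply: s'0 => /andP[_]; rewrite ltNge tt.
have mI : measurable (`]0, tau[%classic : set (measurableTypeR R)) by [].
have mJ : measurable (`]tau - h, tau[%classic : set (measurableTypeR R)) by [].
have JI : `]tau - h, tau[ `<=` (`]0, tau[ : set R).
  by move=> t /=; rewrite !in_itv/= => /andP[a ->]; rewrite andbT; lra.
have mus : measurable_fun setT s by apply: continuous_measurable_fun; exact: smooth1_continuous.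
have mus' : measurable_fun setT s' by exact: continuous_measurable_fun.
have ic c : mu.-integrable `]0, tau[ (EFin \o (fun=> c)).
  apply: integrableS (continuous_compact_integrable (f := fun=> c) (@segment_compact R 0 tau) _) => //.
    exact: subset_itv_oo_cc.
  by apply: continuous_subspaceT => z; exact: cvg_cst.
have RJ f : (forall t, `]0, tau[%classic t -> ~ `]tau - h, tau[%classic t -> f t = 0) ->
    \int[mu]_(t in `]0, tau[) f t = \int[mu]_(t in `]tau - h, tau[) f t.
  move=> f0; rewrite /Rintegral; congr fine.
  rewrite integral_mkcond [RHS]integral_mkcond; apply: eq_integral => t _.
  rewrite !patchE; case: ifPn => [/set_mem tI|nI]; case: ifPn => [/set_mem tJ|nJ] //.
    by rewrite f0// => tJ; move/negP: nJ; apply; exact: mem_set.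
  by exfalso; move/negP: nI; apply; apply/mem_set; exact: JI.
have is' f : mu.-integrable `]0, tau[ (EFin \o f) -> mu.-integrable `]0, tau[ (EFin \o (fun t => s' t * f t)).
  move=> fi; rewrite (_ : (fun _ => _) = (fun t => f t * s' t)); last first.
    by apply/funext => t; rewrite mulrC.
  apply: (integrableR_bounded_mul mI fi (M := `|C / h|)); first exact: measurable_funTS.
  move=> t _; have /andP[b1 b2] := bs' t.
  by rewrite ler0_norm// lerNl (le_trans _ b1)// lerN2 ler_norm.
split.
  have Es' : \int[mu]_(t in `]0, tau[) s' t = - 1.
    rewrite Rintegral_itv_bndo_bndc; last by have := is' _ (ic 1); rewrite (_ : (fun _ => _) = s')//;
      apply/funext => t; rewrite mulr1.
    rewrite Rintegral_itv_obnd_cbnd; last first.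
      apply: integrableS (continuous_compact_integrable (f := s') (@segment_compact R 0 tau) _) => //.
        exact: subset_itv_oc_cc.
      exact: continuous_subspaceT.
    rewrite /Rintegral (@continuous_FTC2 _ s' s)//.
    - by rewrite (s0 _ (lexx tau)) s00 /= sub0r.
    - exact: continuous_subspaceT.
    - have cs : continuous s := smooth1_continuous ss.
      split; first by move=> t _; have [] := ds t.
        by apply: cvg_at_right_filter; exact: cs.
      by apply: cvg_at_left_filter; exact: cs.
    - by move=> t _; rewrite derive1E; have [_ ->] := ds t.
  have -> : L tau = - (\int[mu]_(t in `]0, tau[) (s' t * L tau)).
    by rewrite RintegralZr ?Es' ?mulN1r ?opprK//; have := is' _ (ic 1); rewrite (_ : (fun _ => _) = s')//; apply/funext => t; rewrite mulr1.
  rewrite -RintegralB//; last 2 first.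
  - exact: is'.
  - exact: is'.
  apply: (le_trans (le_normr_Rintegral _ _)) => //.
    by apply: integrableRB => //; exact: is'.
  under eq_Rintegral do rewrite -mulrBr normrM.
  rewrite RJ; last by move=> t _ nt; rewrite s'0 ?normr0 ?mul0r// => tt; apply: nt; rewrite /= in_itv.
  have iLJ : mu.-integrable `]tau - h, tau[ (EFin \o (fun t => `|L t - L tau|)).
    by apply: integrableR_norm => //; apply: integrableS (integrableRB mI iL (ic (L tau))).
  apply: (@le_trans _ _ (\int[mu]_(t in `]tau - h, tau[) (C1 / h * `|L t - L tau|))).
    apply: ae_le_Rintegral => //.
    - rewrite (_ : (fun _ => _) = (fun t => `|L t - L tau| * `|s' t|)); last first.
        by apply/funext => t; rewrite mulrC.
      apply: (integrableR_bounded_mul mJ iLJ (M := `|C / h|)).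
        by apply: measurable_funTS; exact: measurableT_comp.
      move=> t _; have /andP[b1 b2] := bs' t; rewrite normr_id.
      by rewrite ler0_norm// lerNl (le_trans _ b1)// lerN2 ler_norm.
    - exact: integrableRZl.
    - apply: nearW => t _; rewrite ler_wpM2r//; have /andP[b1 b2] := bs' t.
      rewrite ler0_norm// lerNl (le_trans _ b1)// lerN2 ler_wpM2r ?invr_ge0 ?(ltW h0)//.
      by rewrite /C1 ler_wpDr// ler_norm.
  rewrite RintegralZl//; apply: (@le_trans _ _ (C1 / h * (e / C1 * h))).
    by rewrite ler_wpM2l ?divr_ge0 ?(ltW C10) ?(ltW h0)// hL.
  have E (a b c : R) : a != 0 -> b != 0 -> a / b * (c / a * b) = c.
    by move=> a0 b0; field; rewrite a0 b0.
  by rewrite E// gt_eqF.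
have isG : mu.-integrable `]0, tau[ (EFin \o (fun t => s t * G t)).
  rewrite (_ : (fun _ => _) = (fun t => G t * s t)); last by apply/funext => t; rewrite mulrC.
  apply: (integrableR_bounded_mul mI iG (M := 1)); first exact: measurable_funTS.
  by move=> t _; have /andP[a b] := sb t; rewrite ger0_norm.
rewrite -RintegralB//; apply: (le_trans (le_normr_Rintegral _ _)) => //.
  exact: integrableRB.
have iGJ : mu.-integrable `]tau - h, tau[ (EFin \o (fun t => `|G t - G tau|)).
  by apply: integrableR_norm => //; apply: integrableS (integrableRB mI iG (ic (G tau))).
have icJ : mu.-integrable `]tau - h, tau[ (EFin \o (fun=> `|G tau|)).
  exact: integrableS (ic `|G tau|).
rewrite RJ; last first.
  move=> t tI nt; rewrite s1 ?mul1r ?subrr ?normr0//.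
  rewrite leNgt; apply/negP => tt; apply: nt.
  by move: tI; rewrite /= !in_itv/= tt => /andP[_ ->].
apply: le_trans hK.
apply: (@le_trans _ _ (\int[mu]_(t in `]tau - h, tau[) (`|G t - G tau| + `|G tau|))).
  apply: ae_le_Rintegral => //.
  - by apply: integrableR_norm => //; apply: integrableS (integrableRB mI isG iG).
  - exact: integrableRD.
  - apply: nearW => t _; have -> : s t * G t - G t = (s t - 1) * G t by ring.
    rewrite normrM distrC; have /andP[a b] := sb t.
    apply: (@le_trans _ _ `|G t|).
      by rewrite ler_piMl// ger0_norm ?subr_ge0// gerBl.
    by rewrite -{1}(subrK (G tau) (G t)) ler_normD.
rewrite RintegralD// /K mulrDl mul1r lerD//; first by rewrite -[leRHS]mul1r hG.
rewrite Rintegral_cst//= ler_wpM2l//.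
by rewrite lebesgue_measure_itv/= lte_fin ltrBlDr ltrDl h0 -EFinD /= opprB addrC subrK.
Qed.

End lebesgue_points.

(** * Gronwall's inequality with an integrable rate *)

Section gronwall.
Context {R : realType}.
Local Notation mu := (@lebesgue_measure R).

Lemma measurable_fun_itv_exhaust (T : R) (f : R -> R) : 0 < T ->
  (forall T', 0 < T' -> T' < T -> measurable_fun (`]0, T'[ : set (measurableTypeR R)) f) ->
  measurable_fun (`]0, T[ : set (measurableTypeR R)) f.
Proof.
move=> T0 mf.
have [Tn [TnI hTn]] := itv_exhaustion T0.
have -> : `]0, T[%classic = \bigcup_n `]0, Tn n[%classic.
  apply/seteqP; split => t /=; last first.
    move=> [n _] /=; rewrite !in_itv/= => /andP[-> tn]; apply: lt_trans tn _.
    by have /andP[] := TnI n.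
  rewrite in_itv/= => /andP[t0 tT]; have [n tn] := hTn _ tT.
  by exists n => //=; rewrite in_itv/= t0.
by apply/measurable_fun_bigcup => // n; have /andP[a b] := TnI n; exact: mf.
Qed.

Lemma ae_S (P Q : R -> Prop) : (forall t, P t -> Q t) ->
  {ae mu, forall t, P t} -> {ae mu, forall t, Q t}.
Proof. by move=> PQ h; apply: (@filterS _ _ (ae_filter_ringOfSetsType mu) _ _ _ h). Qed.

Lemma ae_S2 (P P' Q : R -> Prop) : (forall t, P t -> P' t -> Q t) ->
  {ae mu, forall t, P t} -> {ae mu, forall t, P' t} -> {ae mu, forall t, Q t}.
Proof. by move=> PQ h h'; apply: (@filterS2 _ _ (ae_filter_ringOfSetsType mu) _ _ _ _ h h'). Qed.

Lemma expR_integral_le (a tau : R) : 0 < a -> 0 < tau ->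
  mu.-integrable `]0, tau[ (EFin \o (fun t => expR (a * t))) /\
  \int[mu]_(t in `]0, tau[) expR (a * t) <= a^-1 * expR (a * tau).
Proof.
move=> a0 t0.
have dE (t : R) : is_derive t 1 (fun t => a^-1 * expR (a * t)) (expR (a * t)).
  have d1 : is_derive t 1 (fun t : R => a * t) a.
    have d0 := is_deriveZ a (is_derive_id t (1 : R)).
    by apply: (is_derive_eq d0); rewrite /GRing.scale /= mulr1.
  have d := @is_derive1_comp _ expR (fun t => a * t) t _ _ (is_derive_expR _) d1.
  apply: (is_derive_eq (is_deriveZ a^-1 d)); rewrite /GRing.scale/=.
  by field; rewrite gt_eqF.
have cE : continuous (fun t : R => expR (a * t)).
  move=> t; apply: continuous_comp; last exact: continuous_expR.
  by apply: cvgMr; exact: cvg_id.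
have cF : continuous (fun t : R => a^-1 * expR (a * t)).
  by move=> t; exact: is_derive_continuous (dE t).
have ic : mu.-integrable `[0, tau] (EFin \o (fun t => expR (a * t))).
  apply: continuous_compact_integrable; first exact: segment_compact.
  exact: continuous_subspaceT.
have io : mu.-integrable `]0, tau[ (EFin \o (fun t => expR (a * t))).
  by apply: integrableS ic => //; exact: subset_itv_oo_cc.
split => //.
rewrite Rintegral_itv_bndo_bndc// Rintegral_itv_obnd_cbnd; last first.
  by apply: integrableS ic => //; exact: subset_itv_oc_cc.
rewrite /Rintegral (@continuous_FTC2 _ _ (fun t => a^-1 * expR (a * t)))//=.
- by rewrite mulr0 expR0 mulr1 gerBl invr_ge0 ltW.
- exact: continuous_subspaceT.
- split; first by move=> t _; have [] := dE t.
    by apply: cvg_at_right_filter; exact: cF.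
  by apply: cvg_at_left_filter; exact: cF.
- by move=> t _; rewrite derive1E; have [_ ->] := dE t.
Qed.

Lemma truncation_tail (D : set (measurableTypeR R)) (k : R -> R) : measurable D ->
  mu.-integrable D (EFin \o k) -> forall e, 0 < e ->
  exists2 m : R, 1 <= m & \int[mu]_(t in D) Num.max (k t - m) 0 <= e.
Proof.
move=> mD ik e e0.
have mk := measurable_intR ik.
have c : \int[mu]_(t in D) Num.max (k t - n.+1%:R) 0 @[n --> \oo] --> \int[mu]_(t in D) (0 : R).
  apply: (Rintegral_dominated mD (g := fun t => `|k t|)).
  - by move=> n; apply: measurable_maxr => //; exact: measurable_funB.
  - by [].
  - move=> t _; apply: cvg_near_cst; near=> n.
    apply/max_idPr; rewrite subr_le0; apply: (@le_trans _ _ n%:R); last by rewrite ler_nat.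
    by near: n; exact: nbhs_infty_ger.
  - exact: integrableR_norm.
  - move=> n t _; rewrite ger0_norm ?le_max ?lexx ?orbT// ge_max normr_ge0 andbT.
    by rewrite lerBlDr ler_wpDr// ler_norm.
rewrite Rintegral_cst// mul0r in c.
have /cvgrPdist_le/(_ _ e0)[n _ hn] := c.
exists n.+1%:R; first by rewrite ler1n.
by have := hn n (leqnn n); rewrite /= sub0r normrN; apply: le_trans; exact: ler_norm.
Unshelve. all: by end_near.
Qed.

(* [kap] is at most a constant [m] up to a part of integral at most 1/2; in the
   norm weighted by e^(4 m t) the integral operator is then a contraction. *)
Lemma gronwall (T : R) (kap : R -> R) : 0 < T -> mu.-integrable `]0, T[ (EFin \o kap) ->
  (forall t, 0 < t < T -> 0 <= kap t) ->
  exists2 C, 0 <= C & forall (X : R -> R) (A B : R), 0 <= A ->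
    measurable_fun (`]0, T[ : set (measurableTypeR R)) X ->
    {ae mu, forall t : R, 0 < t < T -> 0 <= X t <= B} ->
    {ae mu, forall tau : R, 0 < tau < T -> X tau <= A + \int[mu]_(t in `]0, tau[) (kap t * X t)} ->
    {ae mu, forall tau : R, 0 < tau < T -> X tau <= C * A}.
Proof.
move=> T0 ik k0; have mI : measurable (`]0, T[%classic : set (measurableTypeR R)) by [].
have half0 : (0 : R) < 2^-1 by [].
have [m m1 hm] := truncation_tail mI ik half0.
have m0 : 0 < m by rewrite (lt_le_trans _ m1).
(* Then [m / a = 1/4]; with the 1/2 of the truncated part, one step contracts by [3/4]. *)
pose a := 4 * m; have a0 : 0 < a by rewrite mulr_gt0.
exists (5 * expR (a * T)) => [|X A B A0 mX Xb XA]; first by rewrite mulr_ge0// expR_ge0.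
pose k2 (t : R) : R := Num.max (kap t - m) 0.
have mk := measurable_intR ik.
have ik2 : mu.-integrable `]0, T[ (EFin \o k2).
  have mk2 : measurable_fun (`]0, T[ : set (measurableTypeR R)) k2.
    by apply: measurable_maxr => //; exact: measurable_funB.
  have bk2 (t : R) : `]0, T[%classic t -> `|k2 t| <= `|kap t|.
    move=> _; rewrite ger0_norm ?le_max ?lexx ?orbT// ge_max normr_ge0 andbT.
    by rewrite lerBlDr ler_wpDr ?ler_norm// ltW.
  exact: (le_integrableR mI mk2 bk2 (integrableR_norm ik)).
have k20 t : 0 <= k2 t by rewrite le_max lexx orbT.
have kk t : kap t <= m + k2 t by rewrite /k2 maxEge; case: ifPn => h; lra.
(* one step of the fixed point iteration improves the constant *)
have step b : 0 <= b -> {ae mu, forall t : R, 0 < t < T -> X t <= b * expR (a * t)} ->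
    {ae mu, forall t : R, 0 < t < T -> X t <= (A + 3 / 4 * b) * expR (a * t)}.
  move=> b0 hb.
  have hb' : {ae mu, forall t : R, 0 < t < T -> 0 <= X t <= b * expR (a * t)}.
    apply: ae_S2 Xb hb => t h1 h2 tT.
    by have /andP[-> _] := h1 tT; exact: h2.
  apply: (ae_S _ XA) => tau hX tauT; have /andP[tau0 tT] := tauT.
  have mJ : measurable (`]0, tau[%classic : set (measurableTypeR R)) by [].
  have JI : `]0, tau[ `<=` (`]0, T[ : set R).
    by move=> t /=; rewrite !in_itv/= => /andP[-> tt]; exact: lt_trans tt tT.
  have [ie le_e] := expR_integral_le a0 tau0.
  have ik2J : mu.-integrable `]0, tau[ (EFin \o k2) by apply: integrableS ik2.
  have ikJ : mu.-integrable `]0, tau[ (EFin \o kap) by apply: integrableS ik.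
  have ig : mu.-integrable `]0, tau[ (EFin \o (fun t => m * b * expR (a * t) + b * expR (a * tau) * k2 t)).
    by apply: integrableRD => //; exact: integrableRZl.
  have gX : {ae mu, forall t, `]0, tau[%classic t ->
      `|kap t * X t| <= m * b * expR (a * t) + b * expR (a * tau) * k2 t}.
    apply: (ae_S _ hb') => t ht /= tJ; move: (JI _ tJ) => /=; rewrite in_itv/= => tI.
    have /andP[X0 Xle] := ht tI; have kp := k0 _ tI.
    rewrite ger0_norm ?mulr_ge0//.
    apply: (@le_trans _ _ ((m + k2 t) * (b * expR (a * t)))); first by rewrite ler_pM.
    rewrite mulrDl mulrA lerD2l mulrC ler_wpM2r// ler_wpM2l// ler_expR ler_wpM2l ?(ltW a0)//.
    by move: tJ; rewrite in_itv/= => /andP[_ /ltW].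
  have ikX : mu.-integrable `]0, tau[ (EFin \o (fun t => kap t * X t)).
    apply/integrableP; split.
      apply/measurable_EFinP; apply: measurable_funM; first exact: measurable_intR ikJ.
      exact: measurable_funS mX.
    have /integrableP[_ gfin] := ig; apply: le_lt_trans gfin.
    apply: ae_ge0_le_integral_nonmeas => //.
    apply: (ae_S _ gX) => t ht tJ; rewrite /= lee_fin; apply: le_trans (ht tJ) _.
    exact: ler_norm.
  apply: (le_trans (hX tauT)).
  have h1 : \int[mu]_(t in `]0, tau[) (kap t * X t) <=
      \int[mu]_(t in `]0, tau[) (m * b * expR (a * t) + b * expR (a * tau) * k2 t).
    apply: ae_le_Rintegral => //; apply: (ae_S _ gX) => t ht tJ.
    exact: le_trans (ler_norm _) (ht tJ).
  rewrite RintegralD// in h1; last 2 first.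
  - exact: integrableRZl.
  - exact: integrableRZl.
  rewrite !RintegralZl// in h1.
  have h2 : \int[mu]_(t in `]0, tau[) k2 t <= 2^-1.
    apply: le_trans hm; rewrite /Rintegral; apply: fine_le.
    - exact: integrable_fin_num ik2J.
    - exact: integrable_fin_num ik2.
    - apply: ge0_subset_integral => //; first by have /integrableP[] := ik2.
      by move=> t _; rewrite lee_fin.
  have e1 : 1 <= expR (a * tau) by rewrite -expR0 ler_expR mulr_ge0// ltW.
  apply: (@le_trans _ _ (A + (m * b * (a^-1 * expR (a * tau)) + b * expR (a * tau) * 2^-1))).
    rewrite lerD2l; apply: (le_trans h1); apply: lerD.
      by rewrite ler_wpM2l// mulr_ge0// ltW.
    by rewrite ler_wpM2l// mulr_ge0// expR_ge0.
  rewrite (_ : m * b * (a^-1 * expR (a * tau)) = 4^-1 * b * expR (a * tau)); last first.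
    by rewrite /a; field; rewrite gt_eqF.
  have : A <= A * expR (a * tau) by rewrite ler_peMr.
  rewrite mulrDl; set y := expR _; lra.
(* The constants tend to the fixed point [4 * A]. *)
pose b := fix b n := if n is n'.+1 then A + 3 / 4 * b n' else Num.max B 0.
have b0 n : 0 <= b n.
  elim: n => [|n IH] /=; first by rewrite le_max lexx orbT.
  by rewrite addr_ge0// mulr_ge0.
have hb n : {ae mu, forall t : R, 0 < t < T -> X t <= b n * expR (a * t)}.
  elim: n => [|n IH] /=; last exact: step.
  apply: (ae_S _ Xb) => t h tT; have /andP[_ XB] := h tT.
  apply: (le_trans XB); apply: (@le_trans _ _ (Num.max B 0)); first by rewrite le_max lexx.
  rewrite ler_peMr ?le_max ?lexx ?orbT// -expR0 ler_expR mulr_ge0// ?ltW//.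
  by case/andP: tT.
have bE n : b n = 4 * A + (3 / 4) ^+ n * (b 0%N - 4 * A).
  by elim: n => [|n IH]; [rewrite expr0; ring|rewrite [LHS]/= IH exprS; field].
(* For [A > 0] a finite iterate falls below [5 * A], which explains the constant 5. For [A = 0] all
   iterates are used at once, outside a common null set. *)
have [Az|Ap] := eqVneq A 0; last first.
  have A1 : 0 < A by rewrite lt_neqAle eq_sym Ap.
  have [n hn] : exists n, b n <= 5 * A.
    have c : (3 / 4 : R) ^+ n * (b 0%N - 4 * A) @[n --> \oo] --> 0 * (b 0%N - 4 * A).
      by apply: cvgMl; apply: cvg_expr; rewrite ger0_norm//; lra.
    rewrite mul0r in c; have /cvgrPdist_le/(_ _ A1)[n _ hn] := c.
    exists n; rewrite bE; have := hn n (leqnn n); rewrite /= sub0r normrN => /(le_trans (ler_norm _)).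
    lra.
  apply: ae_S (hb n) => t ht tT; apply: (le_trans (ht tT)).
  have -> : 5 * expR (a * T) * A = 5 * A * expR (a * T) by ring.
  have le_e : expR (a * t) <= expR (a * T) by rewrite ler_expR ler_wpM2l ?(ltW a0)//; case/andP: tT => _ /ltW.
  by apply: ler_pM => //; rewrite ltW// expR_gt0.
have {}hb : {ae mu, forall t, forall n, 0 < t < T -> X t <= b n * expR (a * t)} by exact/ae_foralln.
apply: (ae_S _ hb) => t ht tT; rewrite Az mulr0.
have c : b n * expR (a * t) @[n --> \oo] --> 0 * expR (a * t).
  apply: cvgMl; rewrite (_ : b = fun n => (3 / 4) ^+ n * b 0%N); last first.
    by apply/funext => n; rewrite bE Az mulr0 add0r subr0.
  by rewrite -[X in _ --> X](mul0r (b 0%N)); apply: cvgMl; apply: cvg_expr; rewrite ger0_norm//; lra.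
rewrite mul0r in c; apply: (ler_cvg_to (cvg_cst (X t)) c).
by apply: nearW => n; exact: ht.
Qed.

End gronwall.

(** * Energies of a time slice *)

Section integral_tools.
Context d (X : measurableType d) (R : realType) (mu : {measure set X -> \bar R}).

Lemma integrable_ae_bounded_mul (D : set X) (f g : X -> R) (B : R) : measurable D ->
  mu.-integrable D (EFin \o f) -> measurable_fun D g ->
  {ae mu, forall x, D x -> `|g x| <= B} -> mu.-integrable D (EFin \o (fun x => f x * g x)).
Proof.
move=> mD intf mg gB; apply/integrableP; split.
  by apply/measurable_EFinP; apply: measurable_funM => //; exact: measurable_intR intf.
have ig : mu.-integrable D (EFin \o (fun x => B * f x)) by exact: integrableRZl.
have /integrableP[_ gfin] := ig; apply: le_lt_trans gfin.
apply: ae_ge0_le_integral_nonmeas => //.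
apply: filterS gB => x h Dx; have {}h := h Dx.
rewrite /= lee_fin !normrM mulrC ler_wpM2r//; exact: le_trans (ler_norm _).
Qed.

(* Applied to [h x] = the integral of a relative energy against Y_x, whose
   measurability in x is unknown. *)
Lemma ge0_integral_le_addR (D : set X) (f h : X -> \bar R) (g : X -> R) : measurable D ->
  measurable_fun D f -> (forall x, D x -> 0 <= f x)%E -> (forall x, D x -> 0 <= h x)%E ->
  mu.-integrable D (EFin \o g) -> (forall x, D x -> 0 <= g x) ->
  {ae mu, forall x, D x -> (f x <= h x + (g x)%:E)%E} ->
  (\int[mu]_(x in D) f x <= \int[mu]_(x in D) h x + (\int[mu]_(x in D) g x)%:E)%E.
Proof.
move=> mD mf f0 h0 ig g0 fhg.
have mg : measurable_fun D (EFin \o g) by have /integrableP[] := ig.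
pose f' x := maxe (f x - (g x)%:E)%E 0%E.
have mf' : measurable_fun D f'.
  by apply: measurable_maxe => //; exact: emeasurable_funB.
have f'0 x : D x -> (0 <= f' x)%E by rewrite /f' le_max lexx orbT.
apply: (@le_trans _ _ (\int[mu]_(x in D) (f' x + (g x)%:E))%E).
  apply: ge0_le_integral => //.
  - exact: emeasurable_funD.
  - by move=> x Dx; rewrite -leeBlDr// le_max lexx.
rewrite ge0_integralD//.
rewrite /Rintegral fineK; last exact: (integrable_fin_num mD ig).
apply: leeD => //; apply: ae_ge0_le_integral_nonmeas => //.
apply: filterS fhg => x hx Dx; rewrite /f' ge_max h0// andbT leeBlDr//; exact: hx.
Qed.

End integral_tools.

Section slices.
Context {R : realType} {N : nat}.
Local Notation Q := (R * 'rV[R]_N)%type.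
Local Notation mu := (lebesgue_rV R N).
Local Notation X := (torus N : set 'rV[R]_N).
Variables (p : R -> R) (rhob eps : R).
Hypotheses (hp : pressure_law p) (rhob0 : 0 < rhob) (eps0 : 0 < eps).
Local Notation H := (rel_potential p rhob).
Local Notation YE := (young_energy p rhob eps).
Local Notation RY := (rel_young p rhob eps).
Let mP := @measurable_phase R N.
Let mT : measurable X := @measurable_torus R N.

Definition slice_ok (y : 'rV[R]_N -> probability Q R) :=
  [/\ measurable_fun X (fun x => YE (y x)),
    {ae mu, forall x, X x -> has_moments (y x)},
    mu.-integrable X (EFin \o (fun x => mass (y x))),
    (forall i, mu.-integrable X (EFin \o (fun x => momentum (y x) i))) &
    (\int[mu]_(x in X) YE (y x) < +oo)%E].

Lemma YE_ge0 (Y : probability Q R) : (0 <= YE Y)%E.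
Proof. by apply: integral_ge0 => q q0; exact: energy_ge0. Qed.

Variable y : 'rV[R]_N -> probability Q R.
Hypothesis oky : slice_ok y.

Definition slice_energy := \int[mu]_(x in X) fine (YE (y x)).

Definition bounded_field (M : R) (U : 'I_N -> 'rV[R]_N -> R) :=
  forall i, measurable_fun X (U i) /\ forall x, X x -> `|U i x| <= M.

Definition field_at (U : 'I_N -> 'rV[R]_N -> R) (x : 'rV[R]_N) : 'rV[R]_N := \row_i U i x.

Definition slice_rel_energy U := \int[mu]_(x in X) RY (y x) (field_at U x).

Lemma slice_good : {ae mu, forall x, X x -> has_moments (y x) /\ (YE (y x) < +oo)%E}.
Proof.
have [mE hm _ _ fE] := oky.
have := integral_fin_ae mT mE (fun x _ => YE_ge0 (y x)) fE.
by apply: filterS2 hm => x h1 h2 Xx; split; [exact: h1|rewrite -ge0_fin_numE ?h2// YE_ge0].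
Qed.

Lemma slice_energy_ge0 : 0 <= slice_energy.
Proof. by apply: Rintegral_ge0 => x _; rewrite fine_ge0// YE_ge0. Qed.

Lemma integrable_slice_energy : mu.-integrable X (EFin \o (fun x => fine (YE (y x)))).
Proof.
have [mE _ _ _ fE] := oky; apply/integrableP; split.
  by apply/measurable_EFinP; exact: measurableT_comp.
apply: le_lt_trans fE; apply: ae_ge0_le_integral_nonmeas => //.
  by move=> x _; exact: YE_ge0.
apply: nearW => x _ /=; rewrite ger0_norm ?fine_ge0 ?YE_ge0//.
by have := YE_ge0 (y x); case: (YE (y x)).
Qed.

Lemma slice_energyE : (\int[mu]_(x in X) YE (y x) = slice_energy%:E)%E.
Proof.
have [mE _ _ _ fE] := oky; rewrite /slice_energy /Rintegral fineK; last first.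
  exact: (integrable_fin_num mT integrable_slice_energy).
apply: ae_eq_integral => //.
  by apply/measurable_EFinP; exact: measurableT_comp.
have := integral_fin_ae mT mE (fun x _ => YE_ge0 (y x)) fE.
by apply: filterS => x h Xx; rewrite fineK// h.
Qed.

Lemma slice_mass_ge0 : 0 <= \int[mu]_(x in X) mass (y x).
Proof. by apply: Rintegral_ge0 => x _; exact: mass_ge0. Qed.

Lemma torus_cst (c : R) : \int[mu]_(x in X) c = c * 2 ^+ N.
Proof.
rewrite Rintegral_cst//.
by rewrite -[2 ^+ N]/(fine (2 ^+ N)%:E); congr (_ * fine _); exact: lebesgue_rV_torus.
Qed.

Lemma integrable_torus_cst (c : R) : mu.-integrable X (EFin \o (fun=> c)).
Proof. by apply: (bounded_integrable_torus (M := `|c|)). Qed.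

Section deviation.
Variables (d C : R).
Hypotheses (C0 : 0 <= C) (hC : forall r, 0 <= r -> `|r - rhob| <= d + C * H r).

Lemma slice_deviation :
  \int[mu]_(x in X) `|mass (y x) - rhob| <= d * 2 ^+ N + C * eps ^+ 2 * slice_energy.
Proof.
have [_ _ im _ _] := oky; have iE := integrable_slice_energy.
rewrite -torus_cst -RintegralZl// -RintegralD//; last 2 first.
- exact: integrable_torus_cst.
- exact: integrableRZl.
apply: ae_le_Rintegral => //.
- apply: integrableR_norm; apply: integrableRB => //; exact: integrable_torus_cst.
- apply: integrableRD => //; [exact: integrable_torus_cst|exact: integrableRZl].
- apply: filterS slice_good => x h Xx; have [hm fE] := h Xx.
  apply: (le_trans (mass_deviation hp rhob0 hm fE 0 C0 eps0 hC)).
  rewrite lerD2l ler_wpM2l ?(mulr_ge0 C0 (sqr_ge0 _))//.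
  rewrite /rel_young (_ : dotv 0 0 = 0) ?mulr0 ?addr0; last by apply: big1 => i _; rewrite mxE mul0r.
  by rewrite big1 ?subr0// => i _; rewrite mxE mulr0.
Qed.

Lemma slice_mass_bound :
  \int[mu]_(x in X) mass (y x) <= rhob * 2 ^+ N + (d * 2 ^+ N + C * eps ^+ 2 * slice_energy).
Proof.
have [_ _ im _ _] := oky.
rewrite -lerBlDl; apply: le_trans slice_deviation.
rewrite -torus_cst -RintegralB//; last exact: integrable_torus_cst.
apply: le_trans (ler_norm _) _; apply: le_normr_Rintegral => //.
by apply: integrableRB => //; exact: integrable_torus_cst.
Qed.

End deviation.

Lemma slice_momentum_bound i :
  \int[mu]_(x in X) `|momentum (y x) i| <= slice_energy + 2^-1 * \int[mu]_(x in X) mass (y x).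
Proof.
have [_ _ im iM _] := oky; have iE := integrable_slice_energy.
rewrite -RintegralZl// -RintegralD//; last exact: integrableRZl.
apply: ae_le_Rintegral => //.
- by apply: integrableR_norm; exact: iM.
- by apply: integrableRD => //; exact: integrableRZl.
- apply: filterS slice_good => x h Xx; have [hm fE] := h Xx.
  exact: (momentum_bound hp rhob0 hm fE).
Qed.

Section field.
Variables (M : R) (U : 'I_N -> 'rV[R]_N -> R).
Hypothesis bU : bounded_field M U.

Lemma rel_young_field x : RY (y x) (field_at U x) = fine (YE (y x)) -
  \sum_i momentum (y x) i * U i x + mass (y x) * (2^-1 * \sum_i U i x ^+ 2).
Proof.
rewrite /rel_young /dotv.
under eq_bigr do rewrite mxE.
under [in X in _ + X]eq_bigr do rewrite mxE -expr2.
by rewrite mulrCA mulrA.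
Qed.

Lemma integrable_mass_mul (f : 'rV[R]_N -> R) B : measurable_fun X f ->
  (forall x, X x -> `|f x| <= B) -> mu.-integrable X (EFin \o (fun x => mass (y x) * f x)).
Proof. by have [_ _ im _ _] := oky => mf fB; exact: (integrableR_bounded_mul mT im mf fB). Qed.

Lemma integrable_momentum_mul i (f : 'rV[R]_N -> R) B : measurable_fun X f ->
  (forall x, X x -> `|f x| <= B) -> mu.-integrable X (EFin \o (fun x => momentum (y x) i * f x)).
Proof. by have [_ _ _ iM _] := oky => mf fB; exact: (integrableR_bounded_mul mT (iM i) mf fB). Qed.

Lemma sqr_field_bound x : X x -> \sum_i U i x ^+ 2 <= N%:R * M ^+ 2.
Proof.
move=> Xx; rewrite mulr_natl -[X in _ *+ X](card_ord N) -sumr_const; apply: ler_sum => i _.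
have [_ /(_ _ Xx) h] := bU i; rewrite -real_normK ?num_real// lerXn2r ?nnegrE//.
exact: le_trans h.
Qed.

Lemma measurable_sqr_field : measurable_fun X (fun x => \sum_i U i x ^+ 2).
Proof.
apply: measurable_sum => i; have [mU _] := bU i.
by under eq_fun do rewrite expr2; exact: measurable_funM.
Qed.

Lemma integrable_sqr_field : mu.-integrable X (EFin \o (fun x => mass (y x) * (2^-1 * \sum_i U i x ^+ 2))).
Proof.
apply: (integrable_mass_mul (B := 2^-1 * (N%:R * M ^+ 2))).
  by apply: measurable_funM => //; exact: measurable_sqr_field.
move=> x Xx; rewrite ger0_norm ?ler_wpM2l ?sqr_field_bound//.
by rewrite mulr_ge0// sumr_ge0// => i _; exact: sqr_ge0.
Qed.

Lemma integrable_momentum_field i : mu.-integrable X (EFin \o (fun x => momentum (y x) i * U i x)).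
Proof. by have [mU hU] := bU i; exact: (integrable_momentum_mul i mU hU). Qed.

Lemma integrable_slice_rel : mu.-integrable X (EFin \o (fun x => RY (y x) (field_at U x))).
Proof.
rewrite (_ : (fun x => RY (y x) (field_at U x)) = fun x => fine (YE (y x)) -
  \sum_i momentum (y x) i * U i x + mass (y x) * (2^-1 * \sum_i U i x ^+ 2)); last first.
  by apply/funext => x; exact: rel_young_field.
apply: integrableRD => //; last exact: integrable_sqr_field.
apply: integrableRB => //; first exact: integrable_slice_energy.
by apply: integrableR_sum => // i; exact: integrable_momentum_field.
Qed.

Lemma slice_rel_energyE : slice_rel_energy U = slice_energy +
  \int[mu]_(x in X) (mass (y x) * (2^-1 * \sum_i U i x ^+ 2) - \sum_i momentum (y x) i * U i x).
Proof.
have im : mu.-integrable X (EFin \o (fun x => \sum_i momentum (y x) i * U i x)).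
  by apply: integrableR_sum => // i; exact: integrable_momentum_field.
rewrite /slice_energy -RintegralD//; last 2 first.
- exact: integrable_slice_energy.
- by apply: integrableRB => //; exact: integrable_sqr_field.
by apply: eq_Rintegral => x _; rewrite rel_young_field addrA addrAC.
Qed.

Lemma slice_rel_energy_ge0 : 0 <= slice_rel_energy U.
Proof.
have -> : slice_rel_energy U = \int[mu]_(x in X) `|RY (y x) (field_at U x)|.
  have ir := integrable_slice_rel.
  apply: eq_Rintegral_ae => //; first exact: measurable_intR ir.
    by apply: measurable_intR; exact: integrableR_norm ir.
  apply: filterS slice_good => x h Xx; have [hm fE] := h Xx.
  by rewrite ger0_norm// (rel_young_ge0 hp rhob0 hm fE).
by apply: Rintegral_ge0.
Qed.

Lemma slice_rel_energy_le : slice_rel_energy U <=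
  2 * slice_energy + N%:R * M ^+ 2 * \int[mu]_(x in X) mass (y x).
Proof.
have [_ _ im _ _] := oky; have iE := integrable_slice_energy.
rewrite -!RintegralZl// -RintegralD//; try exact: integrableRZl.
apply: ae_le_Rintegral => //; first exact: integrable_slice_rel.
  by apply: integrableRD => //; exact: integrableRZl.
apply: filterS slice_good => x h Xx; have [hm fE] := h Xx.
apply: (le_trans (rel_young_change hp rhob0 hm fE 0 _)); apply: lerD.
  rewrite ler_wpM2l// /rel_young (_ : dotv 0 0 = 0) ?mulr0 ?addr0.
    by rewrite big1 ?subr0// => i _; rewrite mxE mulr0.
  by apply: big1 => i _; rewrite mxE mul0r.
rewrite mulrC ler_wpM2r ?mass_ge0//; apply: le_trans (sqr_field_bound Xx).
by apply: ler_sum => i _; rewrite !mxE sub0r sqrrN.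
Qed.

Section close_field.
Variables (V : 'rV[R]_N -> 'rV[R]_N) (eta : R).
Hypothesis UV : {ae mu, forall x, X x -> forall i, `|U i x - V x ord0 i| <= eta}.

Lemma sqr_close x : (forall i, `|U i x - V x ord0 i| <= eta) ->
  \sum_i (U i x - V x ord0 i) ^+ 2 <= N%:R * eta ^+ 2.
Proof.
move=> h; rewrite mulr_natl -[X in _ *+ X](card_ord N) -sumr_const; apply: ler_sum => i _.
rewrite -real_normK ?num_real// lerXn2r ?nnegrE//; exact: le_trans (h i).
Qed.

(** Replacing [U] by [V] costs a factor 2 and [eta ^+ 2] times the mass, by [rel_young_change]. *)
Lemma rel_energy_le_slice :
  (\int[mu]_(x in X) \int[y x]_(q in phase N) rel_energy p rhob eps (V x) q <=
   (2 * slice_rel_energy U + N%:R * eta ^+ 2 * \int[mu]_(x in X) mass (y x))%:E)%E.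
Proof.
have [_ _ im _ _] := oky; have ir := integrable_slice_rel.
pose g x := 2 * RY (y x) (field_at U x) + N%:R * eta ^+ 2 * mass (y x).
have ig : mu.-integrable X (EFin \o g) by apply: integrableRD => //; exact: integrableRZl.
have -> : 2 * slice_rel_energy U + N%:R * eta ^+ 2 * \int[mu]_(x in X) mass (y x) =
    \int[mu]_(x in X) `|g x|.
  rewrite -!RintegralZl// -RintegralD//; try exact: integrableRZl.
  apply: eq_Rintegral_ae => //; first exact: measurable_intR ig.
    by apply: measurable_intR; exact: integrableR_norm ig.
  apply: filterS slice_good => x h Xx; have [hm fE] := h Xx.
  rewrite ger0_norm// addr_ge0// mulr_ge0 ?(rel_young_ge0 hp rhob0 hm fE) ?mass_ge0//.
  by rewrite mulr_ge0 ?sqr_ge0.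
rewrite /Rintegral fineK; last first.
  by apply: (integrable_fin_num mT); exact: integrableR_norm ig.
apply: ae_ge0_le_integral_nonmeas => //.
  by move=> x Xx; apply: integral_ge0 => q q0; exact: rel_energy_ge0.
apply: filterS2 slice_good UV => x h hUV Xx; have [hm fE] := h Xx.
rewrite (integral_rel_energy hp rhob0 hm fE) lee_fin; apply: le_trans (ler_norm _).
apply: (le_trans (rel_young_change hp rhob0 hm fE (field_at U x) _)).
rewrite lerD2l mulrC ler_wpM2r ?mass_ge0//; apply: le_trans (sqr_close (hUV Xx)).
by under eq_bigr do rewrite mxE.
Qed.

(** The comparison in the other direction, for the initial time, where smallness is given for the
    relative energy against [V]. *)
Lemma slice_le_rel_energy :
  ((2^-1 * slice_rel_energy U)%:E <=
   \int[mu]_(x in X) \int[y x]_(q in phase N) rel_energy p rhob eps (V x) q +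
   (2^-1 * (N%:R * eta ^+ 2) * \int[mu]_(x in X) mass (y x))%:E)%E.
Proof.
have [_ _ im _ _] := oky; have ir := integrable_slice_rel.
rewrite -!RintegralZl//.
have iz : mu.-integrable X (EFin \o (fun x => 2^-1 * RY (y x) (field_at U x))) by exact: integrableRZl.
apply: (@le_trans _ _ (\int[mu]_(x in X) (`|2^-1 * RY (y x) (field_at U x)|)%:E)%E).
  have inz := integrableR_norm iz.
  have -> : (\int[mu]_(x in X) (`|2^-1 * RY (y x) (field_at U x)|)%:E =
      (\int[mu]_(x in X) `|2^-1 * RY (y x) (field_at U x)|)%R%:E)%E.
    by rewrite /Rintegral fineK// (integrable_fin_num mT inz).
  by rewrite lee_fin (le_trans (ler_norm _))// le_normr_Rintegral.
apply: ge0_integral_le_addR => //.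
- by apply/measurable_EFinP; apply: measurable_intR; exact: integrableR_norm iz.
- by move=> x Xx; apply: integral_ge0 => q q0; exact: rel_energy_ge0.
- exact: integrableRZl.
- by move=> x _; rewrite mulr_ge0 ?mass_ge0// mulr_ge0// mulr_ge0 ?sqr_ge0.
apply: filterS2 slice_good UV => x h hUV Xx; have [hm fE] := h Xx.
rewrite (integral_rel_energy hp rhob0 hm fE) -EFinD lee_fin.
rewrite ger0_norm; last by rewrite mulr_ge0// (rel_young_ge0 hp rhob0 hm fE).
rewrite -[X in _ <= X + _](mulKf (_ : 2 != 0)) ?pnatr_eq0// -mulrA -mulrDr ler_wpM2l//.
apply: (le_trans (rel_young_change hp rhob0 hm fE (V x) _)).
rewrite lerD2l mulrC ler_wpM2r ?mass_ge0//; apply: le_trans (sqr_close (hUV Xx)).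
by apply: ler_sum => i _; rewrite !mxE -sqrrN opprB.
Qed.

End close_field.
End field.
End slices.

(** * Finite energy of well-prepared data *)

Section initial_slice.
Context {R : realType} {N : nat}.
Local Notation Q := (R * 'rV[R]_N)%type.
Local Notation mu := (lebesgue_rV R N).
Local Notation X := (torus N : set 'rV[R]_N).
Variables (p : R -> R) (rhob eps : R).
Hypotheses (hp : pressure_law p) (rhob0 : 0 < rhob).
Local Notation YE := (young_energy p rhob eps).
Let mP := @measurable_phase R N.
Let mT : measurable X := @measurable_torus R N.

(** The kinetic parts differ by half of the nonnegative relative kinetic energy with velocity
    [2 *: V]. *)
Lemma half_energy_le (V : 'rV[R]_N) (q : Q) : phase N q ->
  ((2^-1)%:E * energy p rhob eps q <= rel_energy p rhob eps V q + (2^-1 * q.1 * dotv V V)%:E)%E.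
Proof.
move=> q0; have := kinetic_ge0 (2 *: V) q0.
have h0 : 0 <= eps ^- 2 * rel_potential p rhob q.1.
  by rewrite mulr_ge0 ?rel_potential_ge0// invr_ge0 exprn_even_ge0.
have d1 : dotv q.2 (2 *: V) = 2 * dotv q.2 V.
  by rewrite /dotv mulr_sumr; apply: eq_bigr => i _; rewrite mxE; ring.
have d2 : dotv (2 *: V) (2 *: V) = 4 * dotv V V.
  by rewrite /dotv mulr_sumr; apply: eq_bigr => i _; rewrite !mxE; ring.
rewrite d1 d2 /energy /rel_energy; move: h0; set h := _ * _.
case: (m2_over_rho q) => [k|h0 _|h0]; last by rewrite mulrNy gtr0_sg ?invr_gt0// mul1e addNye.
  by rewrite -!(EFinM, EFinD) !lee_fin => h0 h1; lra.
by rewrite mulry gtr0_sg ?invr_gt0// mul1e !addye// leey.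
Qed.

Lemma half_young_energy_le (Y : probability Q R) (V : 'rV[R]_N) : has_moments Y ->
  ((2^-1)%:E * YE Y <= \int[Y]_(q in phase N) rel_energy p rhob eps V q +
    (2^-1 * mass Y * dotv V V)%:E)%E.
Proof.
move=> hm; have [_ i1 _] := hm.
have mE := @measurable_energy R N p rhob eps hp rhob0.
have i1V : Y.-integrable (phase N) (EFin \o (fun q => 2^-1 * q.1 * dotv V V)).
  rewrite (_ : (fun _ => _) = (fun q => (2^-1 * dotv V V) * q.1)); first exact: integrableRZl.
  by apply/funext => q; ring.
have -> : 2^-1 * mass Y * dotv V V = \int[Y]_(q in phase N) (2^-1 * q.1 * dotv V V).
  transitivity (\int[Y]_(q in phase N) ((2^-1 * dotv V V) * q.1)).
    by rewrite RintegralZl// /mass /moment mulrAC.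
  by apply: eq_Rintegral => q _; ring.
have mr : measurable_fun (phase N) (rel_energy p rhob eps V).
  rewrite (_ : rel_energy p rhob eps V = fun q => (energy p rhob eps q +
      (- dotv q.2 V + 2^-1 * q.1 * dotv V V)%:E)%E); last by apply/funext => q; rewrite rel_energyE.
  by apply: emeasurable_funD => //; have /integrableP[] := integrable_young_linear hm V.
rewrite /Rintegral fineK; last exact: (integrable_fin_num mP i1V).
rewrite -ge0_integralZl//; last by move=> q; exact: energy_ge0.
have l0 q : phase N q -> (0 <= (2^-1 * q.1 * dotv V V)%:E :> \bar R)%E.
  by move=> q0; rewrite lee_fin mulr_ge0 ?dotv_ge0// mulr_ge0.
have ml : measurable_fun (phase N) (EFin \o (fun q => 2^-1 * q.1 * dotv V V)).
  by have /integrableP[] := i1V.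
rewrite -ge0_integralD//; last by move=> q; exact: rel_energy_ge0.
apply: ge0_le_integral => //.
- by move=> q q0; rewrite mule_ge0 ?energy_ge0// lee_fin.
- exact: measurable_funeM.
- by apply: emeasurable_funD => //; have /integrableP[] := i1V.
- by move=> q; exact: half_energy_le.
Qed.

Lemma halve_le (I J : \bar R) (c : R) : (0 <= J)%E -> 0 <= c ->
  ((2^-1)%:E * I <= J + (2^-1 * c)%:E)%E -> (I <= 2%:E * J + c%:E)%E.
Proof.
move=> J0 c0 h; have : (2%:E * ((2^-1)%:E * I) <= 2%:E * (J + (2^-1 * c)%:E))%E.
  by apply: lee_wpmul2l h; rewrite lee_fin.
rewrite muleA -EFinM divff// mul1e ge0_muleDr//; last by rewrite lee_fin mulr_ge0.
by rewrite -[X in (_ + X)%E]EFinM mulrA divff// mul1r.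
Qed.

(** Well-preparedness controls the relative energy, while the energy inequality needs the energy
    itself; a bounded [V] makes the difference a multiple of the mass. *)
Lemma slice_ok_of_rel_energy (y : 'rV[R]_N -> probability Q R) (V : 'rV[R]_N -> 'rV[R]_N) (B : R) :
  measurable_fun X (fun x => YE (y x)) ->
  {ae mu, forall x, X x -> has_moments (y x)} ->
  mu.-integrable X (EFin \o (fun x => mass (y x))) ->
  (forall i, mu.-integrable X (EFin \o (fun x => momentum (y x) i))) ->
  {ae mu, forall x, X x -> forall i, `|V x ord0 i| <= B} ->
  (\int[mu]_(x in X) \int[y x]_(q in phase N) rel_energy p rhob eps (V x) q < +oo)%E ->
  slice_ok p rhob eps y /\
  (\int[mu]_(x in X) YE (y x) <= 2%:E *
    (\int[mu]_(x in X) \int[y x]_(q in phase N) rel_energy p rhob eps (V x) q) +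
    (N%:R * B ^+ 2 * \int[mu]_(x in X) mass (y x))%:E)%E.
Proof.
move=> mE hm im iM VB; set J := (\int[mu]_(x in X) _)%E => Jfin.
have J0 : (0 <= J)%E.
  by apply: integral_ge0 => x Xx; apply: integral_ge0 => q; exact: rel_energy_ge0.
have E0 x : (0 <= YE (y x))%E by exact: YE_ge0.
have h : (\int[mu]_(x in X) ((2^-1)%:E * YE (y x)) <= J +
    (\int[mu]_(x in X) (2^-1 * (N%:R * B ^+ 2) * mass (y x)))%:E)%E.
  apply: ge0_integral_le_addR => //.
  - exact: measurable_funeM.
  - by move=> x _; rewrite mule_ge0// lee_fin.
  - by move=> x _; apply: integral_ge0 => q; exact: rel_energy_ge0.
  - exact: integrableRZl.
  - by move=> x _; rewrite mulr_ge0 ?mass_ge0// mulr_ge0// mulr_ge0 ?sqr_ge0.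
  apply: filterS2 hm VB => x h1 h2 Xx.
  apply: (le_trans (half_young_energy_le (V x) (h1 Xx))).
  rewrite leeD2l// lee_fin -mulrA -[leRHS]mulrA ler_wpM2l// mulrC ler_wpM2r ?mass_ge0//.
  rewrite mulr_natl -[X in _ *+ X](card_ord N) -sumr_const; apply: ler_sum => i _.
  rewrite -expr2 -real_normK ?num_real// lerXn2r ?nnegrE//; last exact: h2.
  by apply: le_trans (h2 Xx i).
have hZ : (\int[mu]_(x in X) ((2^-1)%:E * YE (y x)) = (2^-1)%:E * \int[mu]_(x in X) YE (y x))%E.
  by apply: ge0_integralZl => //; rewrite lee_fin.
have mass0 : 0 <= N%:R * B ^+ 2 * \int[mu]_(x in X) mass (y x).
  by rewrite mulr_ge0 ?slice_mass_ge0// mulr_ge0 ?sqr_ge0.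
rewrite hZ (RintegralZl _ mT im) -mulrA in h.
have h2 := halve_le J0 mass0 h; split; last exact: h2.
split; [exact: mE|exact: hm|exact: im|exact: iM|].
apply: (le_lt_trans h2); rewrite lte_add_pinfty ?ltry//.
by rewrite lte_mul_pinfty ?lee_fin.
Qed.

End initial_slice.

(** * Time slices of space-time integrals *)

Section time_sections.
Context {R : realType} {N : nat}.
Local Notation leb := (@lebesgue_measure R).
Local Notation mu := (lebesgue_rV R N).
Local Notation X := (torus N : set 'rV[R]_N).
Let mT : measurable X := @measurable_torus R N.
Let mI (t : R) : measurable (`]0, t[%classic : set (measurableTypeR R)).
Proof. by []. Qed.

Lemma measurable_cylinder (t : R) : measurable (cylinder N t).
Proof. exact: measurableX. Qed.

Lemma ae_cylinder_section (T : R) (P : measurableTypeR R * 'rV[R]_N -> Prop) :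
  {ae dxdt N, forall z, cylinder N T z -> P z} ->
  {ae leb, forall t : R, 0 < t < T -> {ae mu, forall x, X x -> P (t, x)}}.
Proof.
move=> h; have := ae_section (m1 := leb) (m2 := mu) h; apply: ae_S => t ht tT.
by apply: filterS ht => x hx Xx; apply: hx; split => //=; rewrite in_itv.
Qed.

Lemma ae_slice_integrable (T : R) (f : measurableTypeR R * 'rV[R]_N -> R) : 0 < T ->
  (forall T', 0 < T' -> T' < T -> (dxdt N).-integrable (cylinder N T') (EFin \o f)) ->
  {ae leb, forall t : R, 0 < t < T -> mu.-integrable X (EFin \o (fun x => f (t, x)))}.
Proof.
move=> T0 h; apply: ae_itv_exhaust => // T' T'0 T'T.
have [h1 _ _] := integrable_section (m1 := leb) (m2 := mu) (@mI T') mT (h T' T'0 T'T).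
by apply: ae_S h1 => t ht tT; apply: ht; rewrite /= in_itv.
Qed.

Lemma integral_cylinder_time (tau : R) (s : R -> R) (f : measurableTypeR R * 'rV[R]_N -> R) :
  continuous s -> (dxdt N).-integrable (cylinder N tau) (EFin \o f) ->
  \int[dxdt N]_(z in cylinder N tau) (s z.1 * f z) =
  \int[leb]_(t in `]0, tau[) (s t * \int[mu]_(x in X) f (t, x)).
Proof.
move=> cs fi.
have [M hM] : exists M, forall t, 0 <= t <= tau -> `|s t| <= M.
  have [M [_ hM]] := compact_bounded (continuous_compact (continuous_subspaceT cs) (@segment_compact R 0 tau)).
  exists (`|M| + 1) => t tt; apply: (hM (`|M| + 1)); first by rewrite ltr_pwDr// ler_norm.
  by exists t => //=; rewrite in_itv.
have ms : measurable_fun setT s by exact: continuous_measurable_fun.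
have sfi : (dxdt N).-integrable (cylinder N tau) (EFin \o (fun z => s z.1 * f z)).
  rewrite (_ : (fun z => _) = fun z => f z * s z.1); last by apply/funext => z; rewrite mulrC.
  apply: (integrableR_bounded_mul (measurable_cylinder tau) fi (M := M)).
    by apply: measurable_funTS; apply: (@measurableT_comp _ _ _ _ _ _ s).
  by move=> [t x] [/= + _]; rewrite in_itv/= => /andP[a b]; apply: hM; rewrite !ltW.
have [h1 h2 h3] := integrable_section (m1 := leb) (m2 := mu) (@mI tau) mT fi.
have [k1 k2 k3] := integrable_section (m1 := leb) (m2 := mu) (@mI tau) mT sfi.
rewrite [LHS]k3; apply: eq_Rintegral_ae => //.
- exact: measurable_intR k2.
- apply: measurable_funM; first exact: measurable_funTS.
  exact: measurable_intR h2.
- apply: ae_S h1 => t ht tI; by rewrite /= RintegralZl//; exact: ht.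
Qed.

Lemma integral_cylinder_shrink (tau T : R) (f : measurableTypeR R * 'rV[R]_N -> R) : tau <= T ->
  (forall t x, tau <= t -> f (t, x) = 0) ->
  \int[dxdt N]_(z in cylinder N T) f z = \int[dxdt N]_(z in cylinder N tau) f z.
Proof.
move=> tT f0; rewrite /Rintegral; congr fine.
rewrite integral_mkcond [RHS]integral_mkcond; apply: eq_integral => -[t x] _.
rewrite !patchE; case: ifPn => [/set_mem [/= tI Xx]|nI]; case: ifPn => [/set_mem [/= tJ Xx']|nJ] //.
  rewrite f0// leNgt; apply/negP => tt; move/negP: nJ; apply; apply/mem_set; split => //=.
  by move: tI; rewrite !in_itv/= tt => /andP[->].
exfalso; move/negP: nI; apply; apply/mem_set; split => //=.
by move: tJ; rewrite !in_itv/= => /andP[-> h]; exact: lt_le_trans h tT.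
Qed.

End time_sections.

(** * The relative energy inequality *)

Section kinetic_test_function.
Context {R : realType} {n : nat}.
Local Notation mu := (lebesgue_rV R n).
Local Notation X := (torus n : set 'rV[R]_n).

(** Pointwise algebra behind the relative energy: [r], [m], [S] are density, momentum and stress,
    [dU] and [dP] time derivatives of velocity and pressure, [P] the pressure gradient, and [G i j]
    the j-th derivative of [U i]. The right side separates the Euler residual, the pressure terms
    and the relative stress. *)
Lemma relative_flux_identity (r dP : R) (m U dU P : 'I_n -> R) (S G : 'I_n -> 'I_n -> R) :
  r * (\sum_i U i * dU i - dP) + \sum_i m i * (\sum_j U j * G j i - P i)
    - \sum_i m i * dU i - \sum_i \sum_j S i j * G i j =
  \sum_i (r * U i - m i) * (dU i + \sum_j U j * G i j + P i)
    - r * (\sum_i U i * P i + dP)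
    - \sum_i \sum_j (S i j - m i * U j - m j * U i + r * U i * U j) * G i j.
Proof.
have -> : \sum_i m i * (\sum_j U j * G j i - P i) =
    \sum_i \sum_j m j * U i * G i j - \sum_i m i * P i.
  rewrite exchange_big/= -sumrB; apply: eq_bigr => i _.
  by rewrite mulrBr mulr_sumr; congr (_ - _); apply: eq_bigr => j _; rewrite mulrA.
have -> : \sum_i \sum_j (S i j - m i * U j - m j * U i + r * U i * U j) * G i j =
    \sum_i \sum_j S i j * G i j - \sum_i m i * \sum_j U j * G i j
    - \sum_i \sum_j m j * U i * G i j + r * \sum_i U i * \sum_j U j * G i j.
  rewrite mulr_sumr -!sumrB -big_split; apply: eq_bigr => i _ /=.
  rewrite mulrA !mulr_sumr -!sumrB -big_split; apply: eq_bigr => j _ /=.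
  by ring.
have -> : \sum_i (r * U i - m i) * (dU i + \sum_j U j * G i j + P i) =
    r * (\sum_i U i * dU i) - \sum_i m i * dU i + r * (\sum_i U i * \sum_j U j * G i j)
    - \sum_i m i * (\sum_j U j * G i j) + r * (\sum_i U i * P i) - \sum_i m i * P i.
  rewrite !mulr_sumr -!sumrB -!big_split -!sumrB -big_split -sumrB; apply: eq_bigr => i _ /=.
  by ring.
by ring.
Qed.

Variables (U : 'I_n -> R * 'rV[R]_n -> R) (Pi : R * 'rV[R]_n -> R).
Hypotheses (tU : forall i, tfun (U i)) (tP : tfun Pi).

Definition kinetic_test (z : R * 'rV[R]_n) : R := 2^-1 * (\sum_i U i z * U i z) - Pi z.
Local Notation W := kinetic_test.

Lemma tfun_kinetic : tfun W.
Proof.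
apply: tfun_add; last exact: tfun_opp.
by apply: tfunZ; apply: tfun_sum => i; exact: tfun_mul.
Qed.

Lemma derive_kinetic v z : 'D_v W z = \sum_i U i z * 'D_v (U i) z - 'D_v Pi z.
Proof.
have tUU i : tfun (fun z => U i z * U i z) by exact: tfun_mul.
have ts : tfun (fun z => \sum_i U i z * U i z) by exact: tfun_sum.
have [_ ->] := is_deriveB (is_deriveZ 2^-1 (tfun_is_derive z v ts)) (tfun_is_derive z v tP).
congr (_ - _); rewrite tfun_derive_sum// /GRing.scale/= mulr_sumr; apply: eq_bigr => i _.
have [_ ->] := is_deriveM (tfun_is_derive z v (tU i)) (tfun_is_derive z v (tU i)).
by rewrite /GRing.scale/=; field.
Qed.

End kinetic_test_function.

(** * The weak equations tested with the approximate solution *)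

Section weak_formulation.
Context {R : realType} {N : nat}.
Local Notation leb := (@lebesgue_measure R).
Local Notation mu := (lebesgue_rV R N).
Local Notation X := (torus N : set 'rV[R]_N).
Variables (p : R -> R) (eps T : R) (Y : young R N) (Y0 : young0 R N)
  (muC : 'I_N -> defect R N) (muM : 'I_N * 'I_N -> defect R N).
Hypotheses (T0 : 0 < T) (wd : well_defined_moments p T Y Y0)
  (ceq : continuity_equation T Y Y0 muC) (meq : momentum_equation p eps T Y Y0 muM).
Variables (U : 'I_N -> R * 'rV[R]_N -> R) (Pi : R * 'rV[R]_N -> R) (M : R).
Hypotheses (tU : forall i, tfun (U i)) (tP : tfun Pi) (divU : forall z, \sum_i dx i (U i) z = 0)
  (M0 : 0 <= M)
  (hM : forall t x, 0 <= t <= T -> [/\ (forall i, `|U i (t, x)| <= M),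
       (forall i j, `|dx j (U i) (t, x)| <= M) & (forall j, `|dx j Pi (t, x)| <= M)]).
Let mT : measurable X := @measurable_torus R N.
Let mI (t : R) : measurable (`]0, t[%classic : set (measurableTypeR R)).
Proof. by []. Qed.

Local Notation W := (kinetic_test U Pi).
Local Notation r z := (mass (Y z.1 z.2)).
Local Notation m i z := (momentum (Y z.1 z.2) i).

(* [lam] is the density paired with the time derivative of the cut-off when the
   continuity equation is tested with W = |U|^2/2 - Pi and the momentum equation
   with U, and [gam] collects the remaining terms. *)
Definition lam (z : measurableTypeR R * 'rV[R]_N) : R := r z * W z - \sum_i m i z * U i z.

Definition gam (z : measurableTypeR R * 'rV[R]_N) : R :=
  r z * dt W z + \sum_i m i z * dx i W z - \sum_i m i z * dt (U i) z
  - \sum_i \sum_j stress (Y z.1 z.2) i j * dx j (U i) z.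

Definition lam0 (x : 'rV[R]_N) : R :=
  mass (Y0 x) * W (0, x) - \sum_i momentum (Y0 x) i * U i (0, x).

Lemma dx_kinetic i z : dx i W z = \sum_j U j z * dx i (U j) z - dx i Pi z.
Proof. exact: derive_kinetic. Qed.

Lemma dt_kinetic z : dt W z = \sum_i U i z * dt (U i) z - dt Pi z.
Proof. exact: derive_kinetic. Qed.

Lemma dx_kinetic_bound i t x : 0 <= t <= T -> `|dx i W (t, x)| <= N%:R * M ^+ 2 + M.
Proof.
move=> tT; have [h1 h2 h3] := hM x tT; rewrite dx_kinetic.
apply: (le_trans (ler_normB _ _)); apply: lerD; last exact: h3.
apply: (le_trans (ler_norm_sum _ _ _)).
rewrite mulr_natl -[X in _ *+ X](card_ord N) -sumr_const; apply: ler_sum => j _.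
by rewrite normrM expr2 ler_pM.
Qed.

Lemma integrable_cyl_mul (F : R * 'rV[R]_N -> R) (f : measurableTypeR R * 'rV[R]_N -> R) T' : T' <= T ->
  tfun f -> (dxdt N).-integrable (cylinder N T') (EFin \o F) ->
  (dxdt N).-integrable (cylinder N T') (EFin \o (fun z => F z * f z)).
Proof.
move=> TT tf Fi; have [B _ hB] := tfun_bounded 0 T tf.
apply: (integrableR_bounded_mul (measurable_cylinder T') Fi (M := B)).
  by apply: measurable_funTS; exact: tfun_measurable.
move=> [t x] [/= + _]; rewrite in_itv/= => /andP[a b]; apply: hB.
by rewrite (ltW a) (le_trans (ltW b)).
Qed.

Lemma integrable_cyl_moments T' : 0 < T' -> T' < T ->
  [/\ (dxdt N).-integrable (cylinder N T') (EFin \o (fun z => r z)),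
    (forall i, (dxdt N).-integrable (cylinder N T') (EFin \o (fun z => m i z))) &
    (forall i j, (dxdt N).-integrable (cylinder N T') (EFin \o (fun z => stress (Y z.1 z.2) i j)))].
Proof.
move=> a b; have [[[_ h1] _] h2 h3 _ _] := wd; split; first exact: h1.
- by move=> i; have [[_ h] _] := h2 i; exact: h.
- by move=> i j; have [_ h] := h3 i j; exact: h.
Qed.

Lemma integrable_lam T' : 0 < T' -> T' < T ->
  (dxdt N).-integrable (cylinder N T') (EFin \o lam).
Proof.
move=> a b; have [i1 i2 _] := integrable_cyl_moments a b.
have mc := @measurable_cylinder R N T'.
apply: integrableRB => //; first by apply: integrable_cyl_mul => //; [exact: ltW|exact: tfun_kinetic].
by apply: integrableR_sum => // i; apply: integrable_cyl_mul => //; exact: ltW.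
Qed.

Lemma integrable_gam T' : 0 < T' -> T' < T ->
  (dxdt N).-integrable (cylinder N T') (EFin \o gam).
Proof.
move=> a b; have [i1 i2 i3] := integrable_cyl_moments a b; have b' := ltW b.
have mc := @measurable_cylinder R N T'.
have tW := tfun_kinetic tU tP.
apply: integrableRB => //; last first.
  by apply: integrableR_sum => // i; apply: integrableR_sum => // j; apply: integrable_cyl_mul => //; exact: tfun_dx.
apply: integrableRB => //; last first.
  by apply: integrableR_sum => // i; apply: integrable_cyl_mul => //; exact: tfun_dt.
apply: integrableRD => //; first by apply: integrable_cyl_mul => //; exact: tfun_dt.
by apply: integrableR_sum => // i; apply: integrable_cyl_mul => //; exact: tfun_dx.
Qed.

Definition Lam (t : R) := \int[mu]_(x in X) lam (t, x).
Definition Gam (t : R) := \int[mu]_(x in X) gam (t, x).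
Definition Lam0 := \int[mu]_(x in X) lam0 x.

Lemma integrable_Lam_Gam T' : 0 < T' -> T' < T ->
  leb.-integrable `]0, T'[ (EFin \o Lam) /\ leb.-integrable `]0, T'[ (EFin \o Gam).
Proof.
move=> a b; split.
  by have [_ h _] := integrable_section (m1 := leb) (m2 := mu) (@mI T') mT (integrable_lam a b).
by have [_ h _] := integrable_section (m1 := leb) (m2 := mu) (@mI T') mT (integrable_gam a b).
Qed.

Section time_cutoff.
Variables (tau : R) (s s' : R -> R).
Hypotheses (tau0 : 0 < tau) (tauT : tau < T) (ss : smooth1 s)
  (ds : forall t : R, is_derive t 1 s (s' t)) (cs' : continuous s')
  (s0 : forall t, tau <= t -> s t = 0 /\ s' t = 0) (s1 : s 0 = 1) (sb : forall t, 0 <= s t <= 1).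

Definition defect_term : R :=
  \sum_i charge_integral (muC i) (ccylinder N T) (dx i (fun z => s z.1 * W z)) -
  \sum_i \sum_j charge_integral (muM (i, j)) (ccylinder N T) (dx j (fun z => s z.1 * U i z)).

Let ts : tfun (fun z : R * 'rV[R]_N => s z.1) := tfun_time ss.
Let tW : tfun W := tfun_kinetic tU tP.

Lemma dt_cutoff (f : R * 'rV[R]_N -> R) z : tfun f -> dt (fun z => s z.1 * f z) z = s z.1 * dt f z + s' z.1 * f z.
Proof. by move=> tf; rewrite tfun_dtM// (dt_time _ ds) [f z * _]mulrC. Qed.

Lemma dx_cutoff i (f : R * 'rV[R]_N -> R) z : tfun f -> dx i (fun z => s z.1 * f z) z = s z.1 * dx i f z.
Proof. by move=> tf; rewrite tfun_dxM// dx_time mulr0 addr0. Qed.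

Lemma test_cutoff f : tfun f -> test_cylinder N T (fun z => s z.1 * f z).
Proof.
move=> tf; apply: (tfun_test (T' := tau)) => //; first exact: tfun_mul.
by move=> t x tt /=; have [-> _] := s0 tt; rewrite mul0r.
Qed.

Lemma integrable_moment0 (F : 'rV[R]_N -> R) f : tfun f -> mu.-integrable X (EFin \o F) ->
  mu.-integrable X (EFin \o (fun x => F x * f (0, x))).
Proof.
move=> tf Fi; have [B _ hB] := tfun_bounded 0 0 tf.
apply: (integrableR_bounded_mul mT Fi (M := B)).
  by apply: measurable_funTS; exact: tfun_measurable_slice.
by move=> x _; apply: hB; rewrite lexx.
Qed.

(* In both equations the leading minus sign applies to the difference of the
   initial term and of the defect term. *)
Lemma weak_identity :
  \int[leb]_(t in `]0, tau[) (s' t * Lam t) + \int[leb]_(t in `]0, tau[) (s t * Gam t) =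
  - Lam0 + defect_term.
Proof.
have [[_ [_ i01]] i02 _ _ _] := wd.
have [i1 i2 i3] := integrable_cyl_moments tau0 tauT.
have mc := @measurable_cylinder R N tau.
have cs : continuous s := smooth1_continuous ss.
have il := integrable_lam tau0 tauT; have ig := integrable_gam tau0 tauT.
rewrite -!integral_cylinder_time//.
have C := ceq (test_cutoff tW).
have Mq := meq (fun i => test_cutoff (tU i)).
set fC := (fun z => _) in C.
pose gC (z : measurableTypeR R * 'rV[R]_N) := r z * (s z.1 * dt W z + s' z.1 * W z) +
  \sum_i m i z * (s z.1 * dx i W z).
pose gM (z : measurableTypeR R * 'rV[R]_N) := \sum_i m i z * (s z.1 * dt (U i) z + s' z.1 * U i z) +
  \sum_i \sum_j stress (Y z.1 z.2) i j * (s z.1 * dx j (U i) z).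
have EC : \int[dxdt N]_(z in cylinder N T) fC z = \int[dxdt N]_(z in cylinder N tau) gC z.
  rewrite (integral_cylinder_shrink (ltW tauT)); last first.
    move=> t x tt; have [a b] := s0 tt; rewrite /fC dt_cutoff//= a b !mul0r addr0 mulr0 add0r.
    by apply: big1 => i _; rewrite dx_cutoff//= a mul0r mulr0.
  apply: eq_Rintegral => z _; rewrite /fC /gC dt_cutoff//; congr (_ + _).
  by apply: eq_bigr => i _; rewrite dx_cutoff.
set fM := (fun z => _) in Mq.
have EM : \int[dxdt N]_(z in cylinder N T) fM z = \int[dxdt N]_(z in cylinder N tau) gM z.
  (* The pressure term carries [eps ^- 2]; it vanishes identically because [U] is exactly divergence
     free. *)
  have fME z : fM z = gM z.
    rewrite /fM [X in _ + X](_ : _ = 0) ?addr0; last first.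
      rewrite (eq_bigr (fun i => s z.1 * dx i (U i) z)); last by move=> i _; rewrite dx_cutoff.
      by rewrite -mulr_sumr divU !mulr0.
    congr (_ + _); first by apply: eq_bigr => i _; rewrite dt_cutoff.
    by apply: eq_bigr => i _; apply: eq_bigr => j _; rewrite dx_cutoff.
  rewrite (integral_cylinder_shrink (ltW tauT)); last first.
    move=> t x tt; have [a b] := s0 tt; rewrite fME /gM /= a b !big1 ?addr0// => i _.
      by apply: big1 => j _; rewrite mul0r mulr0.
    by rewrite !mul0r addr0 mulr0.
  by apply: eq_Rintegral => z _.
rewrite EC in C; rewrite EM in Mq.
have ts' (f : R * 'rV[R]_N -> R) F : tfun f -> (dxdt N).-integrable (cylinder N tau) (EFin \o F) ->
    (dxdt N).-integrable (cylinder N tau) (EFin \o (fun z => F z * (s' z.1 * f z))).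
  move=> tf Fi; have h := integrable_cyl_mul (ltW tauT) tf Fi.
  rewrite (_ : (fun z => _) = fun z => F z * f z * s' z.1); last first.
    by apply/funext => z; rewrite mulrCA mulrC.
  have [K [_ hK]] := compact_bounded (continuous_compact (continuous_subspaceT cs') (@segment_compact R 0 tau)).
  apply: (integrableR_bounded_mul mc h (M := `|K| + 1)).
    apply: measurable_funTS; apply: (@measurableT_comp _ _ _ _ _ _ s') => //.
    exact: continuous_measurable_fun.
  move=> [t x] [/= + _]; rewrite in_itv/= => /andP[a b].
  apply: (hK (`|K| + 1)); first by rewrite ltr_pwDr// ler_norm.
  by exists t => //=; rewrite in_itv/= !ltW.
have is_ (f : R * 'rV[R]_N -> R) F : tfun f -> (dxdt N).-integrable (cylinder N tau) (EFin \o F) ->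
    (dxdt N).-integrable (cylinder N tau) (EFin \o (fun z => F z * (s z.1 * f z))).
  move=> tf Fi; apply: (integrable_cyl_mul (ltW tauT)) => //; exact: tfun_mul.
have iss (f g : R * 'rV[R]_N -> R) F : tfun f -> tfun g -> (dxdt N).-integrable (cylinder N tau) (EFin \o F) ->
    (dxdt N).-integrable (cylinder N tau) (EFin \o (fun z => F z * (s z.1 * f z + s' z.1 * g z))).
  move=> tf tg Fi; under eq_fun do rewrite mulrDr.
  by apply: integrableRD => //; [exact: is_|exact: ts'].
have iC : (dxdt N).-integrable (cylinder N tau) (EFin \o gC).
  apply: integrableRD => //; first by apply: iss => //; exact: tfun_dt.
  by apply: integrableR_sum => // i; apply: is_ => //; exact: tfun_dx.
have iM : (dxdt N).-integrable (cylinder N tau) (EFin \o gM).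
  apply: integrableRD => //.
    by apply: integrableR_sum => // i; apply: iss => //; exact: tfun_dt.
  by apply: integrableR_sum => // i; apply: integrableR_sum => // j; apply: is_ => //; exact: tfun_dx.
have isl : (dxdt N).-integrable (cylinder N tau) (EFin \o (fun z => s' z.1 * lam z)).
  rewrite (_ : (fun z => _) = fun z => r z * (s' z.1 * W z) - \sum_i m i z * (s' z.1 * U i z)).
    apply: integrableRB => //; first exact: ts'.
    by apply: integrableR_sum => // i; exact: ts'.
  apply/funext => z; rewrite /lam mulrBr mulrCA mulr_sumr; congr (_ - _).
  by apply: eq_bigr => i _; rewrite mulrCA.
have isg : (dxdt N).-integrable (cylinder N tau) (EFin \o (fun z => s z.1 * gam z)).
  rewrite (_ : (fun z => _) = fun z => gam z * s z.1); last by apply/funext => z; rewrite mulrC.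
  exact: (integrable_cyl_mul (ltW tauT)).
rewrite -RintegralD//.
transitivity (\int[dxdt N]_(z in cylinder N tau) (gC z - gM z)).
  apply: eq_Rintegral => z _; rewrite /gC /gM /lam /gam.
  have -> : \sum_i m i z * (s z.1 * dx i W z) = s z.1 * \sum_i m i z * dx i W z.
    by rewrite mulr_sumr; apply: eq_bigr => i _; rewrite mulrCA.
  have -> : \sum_i m i z * (s z.1 * dt (U i) z + s' z.1 * U i z) =
      s z.1 * (\sum_i m i z * dt (U i) z) + s' z.1 * (\sum_i m i z * U i z).
    by rewrite !mulr_sumr -big_split; apply: eq_bigr => i _ /=; ring.
  have -> : \sum_i \sum_j stress (Y z.1 z.2) i j * (s z.1 * dx j (U i) z) =
      s z.1 * \sum_i \sum_j stress (Y z.1 z.2) i j * dx j (U i) z.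
    rewrite mulr_sumr; apply: eq_bigr => i _; rewrite mulr_sumr.
    by apply: eq_bigr => j _; rewrite mulrCA.
  by ring.
rewrite RintegralB// C Mq /defect_term.
have -> : Lam0 = \int[mu]_(x in X) (moment (Y0 x) fst * (s 0 * W (0, x))) -
    \int[mu]_(x in X) (\sum_i moment (Y0 x) (fun q => q.2 ord0 i) * (s 0 * U i (0, x))).
  rewrite s1 -RintegralB//.
  - by apply: eq_Rintegral => x _; rewrite /lam0 mul1r; congr (_ - _); apply: eq_bigr => i _; rewrite mul1r.
  - by under eq_fun do rewrite mul1r; exact: integrable_moment0.
  - apply: integrableR_sum => // i; under eq_fun do rewrite mul1r.
    by apply: integrable_moment0 => //; have [_ []] := i02 i.
by rewrite /=; ring.
Qed.

(** [N * M ^+ 2 + M] bounds the gradients of [W] and of [U]; [N] and [N * N] count the components of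
    the two defects. The cut-off confines everything to times up to [tau]. *)
Lemma defect_term_bound :
  (Defs.total_variation muC (ccylinder N tau) < +oo)%E ->
  (Defs.total_variation muM (ccylinder N tau) < +oo)%E ->
  `|defect_term| <= (N%:R + (N * N)%:R) * (N%:R * M ^+ 2 + M) *
    (fine (Defs.total_variation muC (ccylinder N tau)) + fine (Defs.total_variation muM (ccylinder N tau))).
Proof.
move=> fC fM; set B := _ + M; have B0 : 0 <= B by rewrite addr_ge0// mulr_ge0 ?sqr_ge0.
have mcc (t : R) : measurable (ccylinder N t) by exact: measurableX.
have sub : ccylinder N tau `<=` ccylinder N T.
  move=> [t x] [/= + Xx]; rewrite in_itv/= => /andP[a b]; split => //=.
  by rewrite in_itv/= a (le_trans b)// ltW.
have out (t x : _) (f : R * 'rV[R]_N -> R) i : tfun f -> ccylinder N T (t, x) ->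
    ~ ccylinder N tau (t, x) -> dx i (fun z => s z.1 * f z) (t, x) = 0.
  move=> tf [/= + Xx] nt; rewrite in_itv/= => /andP[a b].
  rewrite dx_cutoff//= (_ : s t = 0) ?mul0r//.
  have [tt|tt] := leP tau t; first by have [] := s0 tt.
  by exfalso; apply: nt; split => //=; rewrite in_itv/= a ltW.
have mdx f i : tfun f -> measurable_fun setT (dx i (fun z : R * 'rV[R]_N => s z.1 * f z)).
  move=> tf; apply: tfun_measurable; apply: tfun_dx; exact: tfun_mul.
have bd (t : R) x f i C : tfun f -> 0 <= C -> `|dx i f (t, x)| <= C ->
    `|dx i (fun z : R * 'rV[R]_N => s z.1 * f z) (t, x)| <= C.
  move=> tf C0 h; rewrite dx_cutoff//= normrM; have /andP[a b] := sb t.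
  by rewrite ger0_norm// -[leRHS]mul1r ler_pM.
have hC := @charge_integral_sum_bound _ _ R 'I_N muC (ccylinder N T) (ccylinder N tau)
  (fun i => dx i (fun z => s z.1 * W z)) B (mcc T) (mcc tau) sub (fun i => mdx _ i tW) B0.
have hM' := @charge_integral_sum_bound _ _ R ('I_N * 'I_N)%type muM (ccylinder N T) (ccylinder N tau)
  (fun ij => dx ij.2 (fun z => s z.1 * U ij.1 z)) B (mcc T) (mcc tau) sub (fun ij => mdx _ ij.2 (tU ij.1)) B0.
have {}hC := hC _ _ fC; have {}hM' := hM' _ _ fM.
rewrite /defect_term; apply: (le_trans (ler_normB _ _)).
rewrite pair_bigA/=.
have a1 : `|\sum_i charge_integral (muC i) (ccylinder N T) (dx i (fun z => s z.1 * W z))| <=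
    N%:R * B * fine (Defs.total_variation muC (ccylinder N tau)).
  move: hC; rewrite card_ord; apply.
    move=> i [t x] [/= + Xx]; rewrite in_itv/= => tT.
    by apply: bd => //; exact: dx_kinetic_bound.
  by move=> i [t x] h1 h2; exact: out.
have a2 : `|\sum_ij charge_integral (muM (ij.1, ij.2)) (ccylinder N T) (dx ij.2 (fun z => s z.1 * U ij.1 z))| <=
    (N * N)%:R * B * fine (Defs.total_variation muM (ccylinder N tau)).
  rewrite (eq_bigr (fun ij => charge_integral (muM ij) (ccylinder N T) (dx ij.2 (fun z => s z.1 * U ij.1 z)))); last by case.
  move: hM'; rewrite card_prod card_ord; apply.
    move=> [i j] [t x] [/= + Xx]; rewrite in_itv/= => tT.
    apply: bd => //; have [_ h _] := hM x tT; apply: (le_trans (h i j)).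
    by rewrite /B lerDr mulr_ge0 ?sqr_ge0.
  by move=> [i j] [t x] h1 h2; exact: out.
apply: (le_trans (lerD a1 a2)).
have v1 : 0 <= fine (Defs.total_variation muC (ccylinder N tau)) by apply: fine_ge0; exact: defect_variation_ge0.
have v2 : 0 <= fine (Defs.total_variation muM (ccylinder N tau)) by apply: fine_ge0; exact: defect_variation_ge0.
rewrite [leRHS]mulrDr; apply: lerD; rewrite ler_wpM2r// ler_wpM2r//.
  by rewrite lerDl.
by rewrite lerDr.
Qed.

End time_cutoff.
End weak_formulation.

(** * Zero-mean functions against the mass *)

Section mean_zero.
Context {R : realType} {N : nat}.
Local Notation Q := (R * 'rV[R]_N)%type.
Local Notation mu := (lebesgue_rV R N).
Local Notation X := (torus N : set 'rV[R]_N).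
Variables (p : R -> R) (rhob eps : R).
Hypotheses (hp : pressure_law p) (rhob0 : 0 < rhob) (eps0 : 0 < eps).
Let mT : measurable X := @measurable_torus R N.
Variable y : 'rV[R]_N -> probability Q R.
Hypothesis oky : slice_ok p rhob eps y.

(* Only the fluctuation of the mass sees a function of zero mean. *)
Lemma mass_mean_zero (f : 'rV[R]_N -> R) (B : R) : measurable_fun X f ->
  (forall x, X x -> `|f x| <= B) -> \int[mu]_(x in X) f x = 0 ->
  `|\int[mu]_(x in X) (mass (y x) * f x)| <= B * \int[mu]_(x in X) `|mass (y x) - rhob|.
Proof.
move=> mf fB f0; have [_ _ im _ _] := oky.
have iD : mu.-integrable X (EFin \o (fun x => mass (y x) - rhob)).
  by apply: integrableRB => //; exact: integrable_torus_cst.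
have fi : mu.-integrable X (EFin \o f) by exact: bounded_integrable_torus mf fB.
have iDf := integrableR_bounded_mul mT iD mf fB.
have -> : \int[mu]_(x in X) (mass (y x) * f x) = \int[mu]_(x in X) ((mass (y x) - rhob) * f x).
  transitivity (\int[mu]_(x in X) ((mass (y x) - rhob) * f x + rhob * f x)).
    by apply: eq_Rintegral => x _; ring.
  by rewrite RintegralD// ?RintegralZl// ?f0 ?mulr0 ?addr0//; exact: integrableRZl.
apply: (le_trans (le_normr_Rintegral mT iDf)).
rewrite -(RintegralZl _ mT (integrableR_norm iD)).
apply: ae_le_Rintegral => //; first exact: integrableR_norm iDf.
  by apply: integrableRZl => //; exact: integrableR_norm iD.
by apply: nearW => x Xx; rewrite normrM mulrC ler_wpM2r// fB.
Qed.

(** Relative energy minus energy equals the integral of the tested density except for the pressure,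
    whose integral against the mass is a deviation term by [mass_mean_zero]. *)
Lemma slice_rel_energy_lam (M C : R) (V : 'I_N -> 'rV[R]_N -> R) (P : 'rV[R]_N -> R) :
  bounded_field M V -> measurable_fun X P -> (forall x, X x -> `|P x| <= C) ->
  \int[mu]_(x in X) P x = 0 ->
  `|slice_rel_energy p rhob eps y V - slice_energy p rhob eps y -
    \int[mu]_(x in X) (mass (y x) * (2^-1 * (\sum_i V i x * V i x) - P x) - \sum_i momentum (y x) i * V i x)|
  <= C * \int[mu]_(x in X) `|mass (y x) - rhob|.
Proof.
move=> bV mP PC P0; rewrite (slice_rel_energyE hp rhob0 oky bV).
have sq x : \sum_i V i x ^+ 2 = \sum_i V i x * V i x by apply: eq_bigr => i _; rewrite expr2.
have iP := integrable_mass_mul oky mP PC.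
have i2 : mu.-integrable X (EFin \o (fun x => mass (y x) * (2^-1 * \sum_i V i x ^+ 2))).
  exact: (integrable_sqr_field oky bV).
have i3 : mu.-integrable X (EFin \o (fun x => \sum_i momentum (y x) i * V i x)).
  by apply: integrableR_sum => // i; exact: (integrable_momentum_field oky bV i).
have i23 := integrableRB mT i2 i3.
have i4 : mu.-integrable X (EFin \o (fun x => mass (y x) * (2^-1 * (\sum_i V i x * V i x) - P x) -
    \sum_i momentum (y x) i * V i x)).
  rewrite (_ : (fun x => _) = fun x => mass (y x) * (2^-1 * \sum_i V i x ^+ 2) -
    \sum_i momentum (y x) i * V i x - mass (y x) * P x); first exact: integrableRB.
  by apply/funext => x; rewrite sq; ring.
rewrite [_ + \int[mu]_(x in X) _]addrC addrK -RintegralB//.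
rewrite (_ : \int[mu]_(x in X) _ = \int[mu]_(x in X) (mass (y x) * P x)); first exact: mass_mean_zero.
by apply: eq_Rintegral => x _; rewrite sq; ring.
Qed.

End mean_zero.

Lemma ae_forall (R : realType) (I : finType) (P : I -> R -> Prop) :
  (forall i, {ae @lebesgue_measure R, forall t, P i t}) ->
  {ae @lebesgue_measure R, forall t, forall i, P i t}.
Proof.
move=> h; have := @filter_forall _ _ _ _ (ae_filter_ringOfSetsType (@lebesgue_measure R)) h.
by apply: ae_S => t ht i; exact: ht.
Qed.

Definition defect_constant {R : realType} (N : nat) (M : R) : R :=
  (N%:R + (N * N)%:R) * (N%:R * M ^+ 2 + M).

(** It depends on the approximation only through [M], so one Gronwall constant serves every accuracy
    and every [eps]. *)
Definition growth_rate {R : realType} (N : nat) (M : R) (xi : R -> R) (t : R) : R :=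
  2 * N%:R * M + defect_constant N M * `|xi t|.

Lemma measurable_section_Rintegral d1 d2 (T1 : measurableType d1) (T2 : measurableType d2)
    (R : realType) (m2 : {sigma_finite_measure set T2 -> \bar R}) (A : set T1) (B : set T2)
    (f : T1 * T2 -> R) : measurable A -> measurable B -> measurable_fun (A `*` B) f ->
  measurable_fun A (fun x => \int[m2]_(y in B) f (x, y)).
Proof.
move=> mA mB mf; have mf' : measurable_fun (A `*` B) (EFin \o f) by exact/measurable_EFinP.
rewrite /Rintegral; apply: measurableT_comp => //.
rewrite (_ : (fun x => _) = fun x => (\int[m2]_(y in B) (EFin \o f)^\+ (x, y) -
    \int[m2]_(y in B) (EFin \o f)^\- (x, y))%E); last first.
  apply/funext => x; rewrite [LHS]integralE.
  by congr (_ - _)%E; apply: eq_integral => y _; rewrite /= ?funeposE ?funenegE.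
apply: emeasurable_funB; apply: measurable_section_integral => //.
- exact: measurable_funepos.
- exact: measurable_funeneg.
Qed.

(** * Relative energy estimate for a fixed approximation *)

Section relative_energy_inequality.
Context {R : realType} {N : nat}.
Local Notation leb := (@lebesgue_measure R).
Local Notation mu := (lebesgue_rV R N).
Local Notation X := (torus N : set 'rV[R]_N).
Variables (p : R -> R) (rhob eps T : R) (Y : young R N) (Y0 : young0 R N) (D : R -> R)
  (muC : 'I_N -> defect R N) (muM : 'I_N * 'I_N -> defect R N) (xi : R -> R).
Hypotheses (hp : pressure_law p) (rhob0 : 0 < rhob) (eps0 : 0 < eps) (T0 : 0 < T)
  (sol : dmv_solution p rhob T eps Y Y0 D muC muM) (hxi : L1_interval T xi)
  (hcompat : compatibility T xi D muC muM) (ok0 : slice_ok p rhob eps Y0).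
Variables (U : 'I_N -> R * 'rV[R]_N -> R) (Pi : R * 'rV[R]_N -> R) (M eta C : R).
Hypotheses (tU : forall i, tfun (U i)) (tP : tfun Pi) (divU : forall z, \sum_i dx i (U i) z = 0)
  (M0 : 0 <= M) (eta0 : 0 <= eta) (C0 : 0 <= C)
  (hM : forall t x, 0 <= t <= T -> [/\ (forall i, `|U i (t, x)| <= M),
       (forall i j, `|dx j (U i) (t, x)| <= M) & (forall j, `|dx j Pi (t, x)| <= M)])
  (hR : forall t, 0 <= t <= T -> {ae mu, forall x, X x -> forall i,
     `|dt (U i) (t, x) + \sum_j U j (t, x) * dx j (U i) (t, x) + dx i Pi (t, x)| <= eta})
  (hI : forall t, \int[mu]_(x in X) (\sum_i U i (t, x) * dx i Pi (t, x)) = 0 /\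
      \int[mu]_(x in X) dt Pi (t, x) = 0 /\ \int[mu]_(x in X) Pi (t, x) = 0)
  (hC : forall t x, 0 <= t <= T -> `|Pi (t, x)| <= C /\ `|dt Pi (t, x)| <= C).
Variables (d Cd : R).
Hypotheses (Cd0 : 0 <= Cd) (hd : forall r, 0 <= r -> `|r - rhob| <= d + Cd * rel_potential p rhob r).
Let mT : measurable X := @measurable_torus R N.
Let mI (t : R) : measurable (`]0, t[%classic : set (measurableTypeR R)).
Proof. by []. Qed.
Local Notation E y := (slice_energy p rhob eps y).
Let wd : well_defined_moments p T Y Y0 := dmv_well_defined sol.
Local Notation Lam := (Lam Y U Pi).
Local Notation Gam := (Gam Y U Pi).
Local Notation Lam0 := (Lam0 Y0 U Pi).

Definition velocity_at (t : R) i (x : 'rV[R]_N) : R := U i (t, x).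
Definition rel_energy_at (t : R) : R := slice_rel_energy p rhob eps (Y t) (velocity_at t).
(** Bounds the [L^1] distance of the mass to [rhob] on every slice whose energy is at most the
    initial one; [2 ^+ N] is the volume of the torus. *)
Definition deviation : R := d * 2 ^+ N + Cd * eps ^+ 2 * E Y0.
Local Notation K := rel_energy_at.

Definition good_time (t : R) : Prop := [/\ slice_ok p rhob eps (Y t), 0 <= D t,
  E (Y t) + D t <= E Y0,
  (forall i j, mu.-integrable X (EFin \o (fun x => stress (Y t x) i j))) &
  {ae mu, forall x, X x -> (Y t x).-integrable (phase N) m2_over_rho /\
    forall i j, (Y t x).-integrable (phase N) (EFin \o mm_over_rho i j)}].

Lemma measurable_energy_cylinder : measurable_fun (cylinder N T)
  (fun z => young_energy p rhob eps (Y z.1 z.2)).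
Proof.
apply: measurable_young_energy => //; first exact: measurable_cylinder.
by have [_] := dmv_young sol.
Qed.

Lemma ae_good_time : {ae leb, forall t : R, 0 < t < T -> good_time t}.
Proof.
have [[[a1 b1] _] h2 h3 a4 _] := wd.
have [Y1 _] := dmv_young sol.
have s1 := ae_cylinder_section a1.
have s2 : {ae leb, forall (t : R) (i : 'I_N), 0 < t < T -> {ae mu, forall x, X x ->
    (Y t x).-integrable (phase N) (EFin \o (fun q : R * 'rV[R]_N => q.2 ord0 i))}}.
  by apply: ae_forall => i; have [[a _] _] := h2 i; exact: ae_cylinder_section a.
have s3 : {ae leb, forall t : R, forall ij : 'I_N * 'I_N, 0 < t < T -> {ae mu, forall x, X x ->
    (Y t x).-integrable (phase N) (EFin \o mm_over_rho ij.1 ij.2)}}.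
  by apply: ae_forall => -[i j]; have [a _] := h3 i j; exact: ae_cylinder_section a.
have s4 := ae_cylinder_section a4.
have i1 := ae_slice_integrable T0 b1.
have i2 : {ae leb, forall t : R, forall i, 0 < t < T -> mu.-integrable X (EFin \o (fun x => momentum (Y t x) i))}.
  by apply: ae_forall => i; have [[_ b] _] := h2 i; exact: ae_slice_integrable T0 b.
have i3 : {ae leb, forall t : R, forall ij : 'I_N * 'I_N, 0 < t < T ->
    mu.-integrable X (EFin \o (fun x => stress (Y t x) ij.1 ij.2))}.
  by apply: ae_forall => -[i j]; have [_ b] := h3 i j; exact: ae_slice_integrable T0 b.
have q1 := ae_S2 (fun _ x y => conj x y) s1 s2.
have q2 := ae_S2 (fun _ x y => conj x y) s3 s4.
have q3 := ae_S2 (fun _ x y => conj x y) i1 i2.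
have q4 := ae_S2 (fun _ x y => conj x y) i3 (dmv_energy sol).
have q5 := ae_S2 (fun _ x y => conj x y) q1 q2.
have q6 := ae_S2 (fun _ x y => conj x y) q3 q4.
have q7 := ae_S2 (fun _ x y => conj x y) q6 (dmv_defect_ge0 sol).
apply: ae_S2 q5 q7 => t [[+ +] [+ +]] [[[+ +] [+ +]] +] tT.
move=> /(_ tT) u1 u2 u3 /(_ tT) u4 /(_ tT) v1 v2 v3 en D0.
have tI : t \in `]0, T[ by rewrite in_itv.
have {}en := en tI; have {}D0 := D0 tI.
have me : measurable_fun X (fun x => young_energy p rhob eps (Y t x)).
  have h := @measurable_comp _ _ _ _ _ _ (cylinder N T) _ X (fun x : 'rV[R]_N => ((t, x) : measurableTypeR R * 'rV[R]_N))
    (measurable_cylinder T) _ measurable_energy_cylinder.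
  apply: h; last by apply: measurable_funTS; exact: measurable_pair1.
  by move=> _ [x Xx <-]; split.
have okt : slice_ok p rhob eps (Y t).
  split => //.
  - have u2' : {ae mu, forall x, forall i : 'I_N, X x -> (Y t x).-integrable (phase N) (EFin \o (fun q : R * 'rV[R]_N => q.2 ord0 i))}.
      by apply: ae_forall_fin => i; exact: u2 i tT.
    apply: filterS2 u1 u2' => x h1 h2' Xx; split => //; [exact: Y1|exact: h1|by move=> i; exact: h2'].
  - by move=> i; exact: v2 i tT.
  - have fin0 : (\int[mu]_(x in X) young_energy p rhob eps (Y0 x) < +oo)%E by have [] := ok0.
    apply: le_lt_trans fin0; apply: le_trans en; rewrite leeDl// lee_fin.
split => //.
- by move: en; rewrite (slice_energyE hp rhob0 okt) (slice_energyE hp rhob0 ok0) -EFinD lee_fin.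
- by move=> i j; exact: (v3 (i, j)).
- have u3' : {ae mu, forall x, forall ij : 'I_N * 'I_N, X x -> (Y t x).-integrable (phase N) (EFin \o mm_over_rho ij.1 ij.2)}.
    by apply: ae_forall_fin => i; exact: u3 i tT.
  by apply: filterS2 u3' u4 => x w1 w2 Xx; split => [|i j]; [exact: w2|exact: (w1 (i, j))].
Qed.

Lemma velocity_bounded t : 0 <= t <= T -> bounded_field M (velocity_at t).
Proof.
move=> tT i; split; first by apply: measurable_funTS; exact: tfun_measurable_slice.
by move=> x _; have [h _ _] := hM x tT; exact: h.
Qed.

Lemma slice_deviation_le y : slice_ok p rhob eps y -> E y <= E Y0 ->
  \int[mu]_(x in X) `|mass (y x) - rhob| <= deviation.
Proof.
move=> oky le; apply: (le_trans (slice_deviation hp rhob0 eps0 oky Cd0 hd)).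
by rewrite lerD2l ler_wpM2l// mulr_ge0 ?sqr_ge0.
Qed.

Lemma deviation_ge0 : 0 <= deviation.
Proof. by apply: le_trans (slice_deviation_le ok0 (lexx _)); exact: Rintegral_ge0. Qed.

Lemma rel_energy_Lam t : 0 < t < T -> good_time t ->
  `|K t - E (Y t) - Lam t| <= C * deviation.
Proof.
move=> /andP[t0 tT] [okt D0 en _ _]; have tI : 0 <= t <= T by rewrite !ltW.
have bV := velocity_bounded tI; have [_ [_ P0]] := hI t.
have le : E (Y t) <= E Y0 by apply: le_trans en; rewrite lerDl.
apply: le_trans (ler_wpM2l C0 (slice_deviation_le okt le)).
apply: slice_rel_energy_lam => //; first by apply: measurable_funTS; exact: tfun_measurable_slice.
by move=> x _; have [] := hC x tI.
Qed.

Lemma rel_energy_Lam0 :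
  `|slice_rel_energy p rhob eps Y0 (velocity_at 0) - E Y0 - Lam0| <= C * deviation.
Proof.
have tI : (0 : R) <= 0 <= T by rewrite lexx ltW.
have bV := velocity_bounded tI; have [_ [_ P0]] := hI 0.
apply: le_trans (ler_wpM2l C0 (slice_deviation_le ok0 (lexx _))).
apply: (slice_rel_energy_lam hp rhob0 ok0 bV) => //.
  by apply: measurable_funTS; exact: tfun_measurable_slice.
by move=> x _; have [] := hC x tI.
Qed.

(** First the residual [eta] times an [L^1] bound for [rho U - m], then the deviation times a bound
    for [U . grad Pi + dt Pi]. *)
Definition consistency_error : R :=
  eta * (N%:R * ((M + 1) * (rhob * 2 ^+ N + deviation) + E Y0)) + (N%:R * M ^+ 2 + C) * deviation.

Lemma Gam_bound t : 0 < t < T -> good_time t ->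
  `|Gam t| <= consistency_error + 2 * N%:R * M * K t.
Proof.
move=> /andP[t0 tT] [okt D0 en iS sS]; have tI : 0 <= t <= T by rewrite !ltW.
have bV := velocity_bounded tI; have [UP0 [dP0 _]] := hI t.
have [_ _ im iM _] := okt.
have le : E (Y t) <= E Y0 by apply: le_trans en; rewrite lerDl.
have dev := slice_deviation_le okt le.
have tf (f : R * 'rV[R]_N -> R) : tfun f -> measurable_fun X (fun x => f (t, x)) /\
    exists B, forall x, X x -> `|f (t, x)| <= B.
  move=> h; split; first by apply: measurable_funTS; exact: tfun_measurable_slice.
  by have [B _ hB] := tfun_bounded t t h; exists B => x _; apply: hB; rewrite lexx.
have imf f : tfun f -> mu.-integrable X (EFin \o (fun x => mass (Y t x) * f (t, x))).
  by move=> h; have [mf [B hB]] := tf f h; exact: (integrableR_bounded_mul mT im mf hB).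
have iMf i f : tfun f -> mu.-integrable X (EFin \o (fun x => momentum (Y t x) i * f (t, x))).
  by move=> h; have [mf [B hB]] := tf f h; exact: (integrableR_bounded_mul mT (iM i) mf hB).
have iSf i j f : tfun f -> mu.-integrable X (EFin \o (fun x => stress (Y t x) i j * f (t, x))).
  by move=> h; have [mf [B hB]] := tf f h; exact: (integrableR_bounded_mul mT (iS i j) mf hB).
pose res i z : R := dt (U i) z + \sum_j U j z * dx j (U i) z + dx i Pi z.
have tres i : tfun (res i).
  apply: tfun_add; last exact: tfun_dx.
  apply: tfun_add; first exact: tfun_dt.
  by apply: tfun_sum => j; apply: tfun_mul => //; exact: tfun_dx.
pose g z : R := \sum_i U i z * dx i Pi z + dt Pi z.
have tg : tfun g.
  apply: tfun_add; last exact: tfun_dt.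
  by apply: tfun_sum => i; apply: tfun_mul => //; exact: tfun_dx.
(* The three groups of [relative_flux_identity]: [t1] is small by the residual, [t2] by its zero
   mean factor, and [t3] is absorbed by the relative energy. *)
pose t1 x := \sum_i (mass (Y t x) * U i (t, x) - momentum (Y t x) i) * res i (t, x).
pose t2 x := mass (Y t x) * g (t, x).
pose t3 x := \sum_i \sum_j rel_stress (Y t x) (field_at (velocity_at t) x) i j * dx j (U i) (t, x).
have gE x : gam Y U Pi (t, x) = t1 x - t2 x - t3 x.
  rewrite /gam /= dt_kinetic//.
  have -> : \sum_i momentum (Y t x) i * dx i (kinetic_test U Pi) (t, x) =
      \sum_i momentum (Y t x) i * (\sum_j U j (t, x) * dx i (U j) (t, x) - dx i Pi (t, x)).
    by apply: eq_bigr => i _; rewrite dx_kinetic.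
  apply: (etrans (relative_flux_identity (mass (Y t x)) (dt Pi (t, x)) (fun i => momentum (Y t x) i)
    (fun i => U i (t, x)) (fun i => dt (U i) (t, x)) (fun i => dx i Pi (t, x))
    (fun i j => stress (Y t x) i j) (fun i j => dx j (U i) (t, x)))).
  congr (_ - _ - _); apply: eq_bigr => i _; apply: eq_bigr => j _.
  by rewrite /rel_stress /field_at /velocity_at !mxE.
have i1 : mu.-integrable X (EFin \o t1).
  apply: integrableR_sum => // i; under eq_fun do rewrite mulrBl -mulrA.
  have h := imf (fun z => U i z * res i z) (tfun_mul (tU i) (tres i)).
  exact: (integrableRB mT h (iMf i _ (tres i))).
have i2 : mu.-integrable X (EFin \o t2) by exact: imf.
have i3 : mu.-integrable X (EFin \o t3).
  apply: integrableR_sum => // i; apply: integrableR_sum => // j.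
  pose f1 (z : R * 'rV[R]_N) := U j z * dx j (U i) z.
  pose f2 (z : R * 'rV[R]_N) := U i z * dx j (U i) z.
  pose f3 (z : R * 'rV[R]_N) := U i z * U j z * dx j (U i) z.
  have td : tfun (dx j (U i)) by exact: tfun_dx.
  rewrite (_ : (fun x => _) = fun x => stress (Y t x) i j * dx j (U i) (t, x) -
    momentum (Y t x) i * f1 (t, x) - momentum (Y t x) j * f2 (t, x) + mass (Y t x) * f3 (t, x)).
    apply: integrableRD => //; last by apply: imf; do 2 apply: tfun_mul => //.
    apply: integrableRB => //; last by apply: iMf; exact: tfun_mul.
    by apply: integrableRB => //; [exact: iSf|apply: iMf; exact: tfun_mul].
  by apply/funext => x; rewrite /rel_stress /field_at /velocity_at !mxE /f1 /f2 /f3; ring.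
have -> : Gam t = \int[mu]_(x in X) t1 x - \int[mu]_(x in X) t2 x - \int[mu]_(x in X) t3 x.
  rewrite -RintegralB// -RintegralB//; last exact: integrableRB.
  by apply: eq_Rintegral => x _; rewrite gE.
have mass0 : 0 <= \int[mu]_(x in X) mass (Y t x) by exact: slice_mass_ge0.
have b1 : `|\int[mu]_(x in X) t1 x| <= eta * (N%:R * ((M + 1) * (rhob * 2 ^+ N + deviation) + E Y0)).
  have in_ i : mu.-integrable X (EFin \o (fun x => `|momentum (Y t x) i|)).
    exact: integrableR_norm (iM i).
  have iRHS : mu.-integrable X (EFin \o (fun x => \sum_i (M * mass (Y t x) + `|momentum (Y t x) i|))).
    by apply: integrableR_sum => // i; apply: integrableRD => //; exact: integrableRZl.
  apply: (le_trans (le_normr_Rintegral mT i1)).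
  apply: (@le_trans _ _ (\int[mu]_(x in X) (eta * \sum_i (M * mass (Y t x) + `|momentum (Y t x) i|)))).
    apply: ae_le_Rintegral => //; first exact: integrableR_norm i1.
      exact: integrableRZl.
    apply: filterS (hR tI) => x hx Xx; have [hU _ _] := hM x tI.
    apply: (le_trans (ler_norm_sum _ _ _)); rewrite mulr_sumr; apply: ler_sum => i _.
    rewrite normrM mulrC; apply: ler_pM => //; first exact: hx.
    apply: (le_trans (ler_normB _ _)); rewrite lerD2r normrM ger0_norm ?mass_ge0// mulrC.
    by rewrite ler_wpM2r ?mass_ge0.
  rewrite RintegralZl// ler_wpM2l//.
  rewrite Rintegral_sum//; last by move=> i; apply: integrableRD => //; exact: integrableRZl.
  rewrite mulr_natl -[X in _ *+ X](card_ord N) -sumr_const; apply: ler_sum => i _.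
  rewrite RintegralD// ?RintegralZl//; last exact: integrableRZl.
  have mb := slice_mass_bound hp rhob0 eps0 okt Cd0 hd.
  have mb' : \int[mu]_(x in X) mass (Y t x) <= rhob * 2 ^+ N + deviation.
    apply: (le_trans mb); rewrite lerD2l lerD2l ler_wpM2l// mulr_ge0 ?sqr_ge0//.
  have mo := slice_momentum_bound hp rhob0 okt i.
  have h1 : M * \int[mu]_(x in X) mass (Y t x) <= M * (rhob * 2 ^+ N + deviation) by rewrite ler_wpM2l.
  have := mass0; lra.
have b2 : `|\int[mu]_(x in X) t2 x| <= (N%:R * M ^+ 2 + C) * deviation.
  have B0 : 0 <= N%:R * M ^+ 2 + C by rewrite addr_ge0// mulr_ge0 ?sqr_ge0.
  apply: le_trans (ler_wpM2l B0 dev).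
  have [mg _] := tf g tg.
  apply: (mass_mean_zero okt mg).
    move=> x _; have [hU _ hP] := hM x tI; have [_ hdt] := hC x tI.
    apply: (le_trans (ler_normD _ _)); apply: lerD => //.
    apply: (le_trans (ler_norm_sum _ _ _)).
    rewrite mulr_natl -[X in _ *+ X](card_ord N) -sumr_const; apply: ler_sum => j _.
    by rewrite normrM expr2 ler_pM.
  have ti (f : R * 'rV[R]_N -> R) : tfun f -> mu.-integrable X (EFin \o (fun x => f (t, x))).
    by move=> h; exact: trig_sum_integrable (tfun_trig_sum t h).
  rewrite RintegralD ?UP0 ?dP0 ?addr0//; last by apply: ti; exact: tfun_dt.
  by apply: (ti (fun z => \sum_i U i z * dx i Pi z)); apply: tfun_sum => i; apply: tfun_mul => //; exact: tfun_dx.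
have b3 : `|\int[mu]_(x in X) t3 x| <= 2 * N%:R * M * K t.
  have iK := integrable_slice_rel hp rhob0 okt bV.
  apply: (le_trans (le_normr_Rintegral mT i3)); rewrite -(RintegralZl _ mT iK).
  apply: ae_le_Rintegral => //; [exact: integrableR_norm i3|exact: integrableRZl|].
  apply: filterS2 (slice_good hp rhob0 okt) sS => x h1 h2 Xx.
  have [hm fE] := h1 Xx; have [h3 h4] := h2 Xx.
  by apply: (rel_stress_contract hp rhob0 hm fE h3 h4) => i j; have [_ h _] := hM x tI; exact: h.
rewrite /consistency_error; apply: (le_trans (ler_normB _ _)); apply: lerD => //.
by apply: (le_trans (ler_normB _ _)); exact: lerD.
Qed.

Lemma energy_le_initial t : good_time t -> E (Y t) <= E Y0 /\ 0 <= D t <= E Y0.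
Proof.
move=> [okt D0 en _ _]; have E0 : 0 <= E (Y t) by exact: slice_energy_ge0.
by rewrite D0; split; [apply: le_trans en; rewrite lerDl|apply: le_trans en; rewrite lerDr].
Qed.

Lemma measurable_rel_energy_at : measurable_fun (`]0, T[ : set (measurableTypeR R)) K.
Proof.
apply: measurable_fun_itv_exhaust => // T' T'0 T'T.
have [i1 i2 _] := integrable_cyl_moments wd T'0 T'T.
apply: (measurable_section_Rintegral (f := fun z => rel_young p rhob eps (Y z.1 z.2)
  (field_at (velocity_at z.1) z.2)) mu (@mI T') mT).
rewrite (_ : (fun z => _) = fun z => fine (young_energy p rhob eps (Y z.1 z.2)) -
  \sum_i momentum (Y z.1 z.2) i * U i z + mass (Y z.1 z.2) * (2^-1 * \sum_i U i z ^+ 2)); last first.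
  by apply/funext => -[t x]; rewrite rel_young_field.
have mU (f : R * 'rV[R]_N -> R) : tfun f -> measurable_fun (`]0, T'[ `*` torus N : set (measurableTypeR R * 'rV[R]_N)) f.
  by move=> tf; apply: measurable_funTS; exact: tfun_measurable.
apply: measurable_funD; last first.
  apply: measurable_funM; first exact: measurable_intR i1.
  apply: (mU (fun z => 2^-1 * \sum_i U i z ^+ 2)); apply: tfunZ; apply: tfun_sum => i.
  by under eq_fun do rewrite expr2; exact: tfun_mul.
apply: measurable_funB.
  apply: measurableT_comp => //; apply: measurable_funS measurable_energy_cylinder.
    exact: measurable_cylinder.
  move=> [t x] [/= + Xx]; rewrite in_itv/= => /andP[a b]; split => //=.
  by rewrite in_itv/= a (lt_trans b).
by apply: measurable_sum => i; apply: measurable_funM; [exact: measurable_intR (i2 i)|exact: mU].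
Qed.

Definition rel_energy_bound : R :=
  2 * E Y0 + N%:R * M ^+ 2 * (rhob * 2 ^+ N + deviation).

Lemma slice_mass_le y : slice_ok p rhob eps y -> E y <= E Y0 ->
  \int[mu]_(x in X) mass (y x) <= rhob * 2 ^+ N + deviation.
Proof.
move=> oky le; apply: (le_trans (slice_mass_bound hp rhob0 eps0 oky Cd0 hd)).
by rewrite !lerD2l ler_wpM2l// mulr_ge0 ?sqr_ge0.
Qed.

Lemma rel_energy_at_bounds t : 0 < t < T -> good_time t -> 0 <= K t <= rel_energy_bound.
Proof.
move=> /andP[t0 tT] g; have [okt _ _ _ _] := g; have [le _] := energy_le_initial g.
have tI : 0 <= t <= T by rewrite !ltW.
rewrite (slice_rel_energy_ge0 hp rhob0 okt (velocity_bounded tI))/=.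
apply: (le_trans (slice_rel_energy_le hp rhob0 okt (velocity_bounded tI))).
apply: lerD; first by rewrite ler_wpM2l.
rewrite ler_wpM2l; first by [].
  by rewrite mulr_ge0 ?sqr_ge0.
exact: slice_mass_le.
Qed.

Lemma consistency_error_ge0 : 0 <= consistency_error.
Proof.
have dv := deviation_ge0.
have e0 : 0 <= E Y0 by exact: slice_energy_ge0.
have m1 : 0 <= rhob * 2 ^+ N + deviation by rewrite addr_ge0// mulr_ge0 ?(ltW rhob0)// exprn_ge0.
rewrite /consistency_error; apply: addr_ge0; apply: mulr_ge0 => //.
  by rewrite mulr_ge0// addr_ge0// mulr_ge0// addr_ge0.
by rewrite addr_ge0// mulr_ge0 ?sqr_ge0.
Qed.

Lemma integrable_xi_defect : leb.-integrable `]0, T[ (EFin \o (fun t => xi t * D t)).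
Proof.
apply: (integrable_ae_bounded_mul (B := E Y0) (@mI T) hxi); first exact: dmv_defect_measurable sol.
apply: ae_S ae_good_time => t ht tI; have [_ /andP[a b]] := energy_le_initial (ht tI).
by rewrite ger0_norm.
Qed.

Lemma total_variations_le : {ae leb, forall tau : R, 0 < tau < T ->
  [/\ (Defs.total_variation muC (ccylinder N tau) < +oo)%E,
    (Defs.total_variation muM (ccylinder N tau) < +oo)%E &
    fine (Defs.total_variation muC (ccylinder N tau)) +
    fine (Defs.total_variation muM (ccylinder N tau)) <= \int[leb]_(t in `]0, tau[) (xi t * D t)]}.
Proof.
apply: ae_S hcompat => tau h /andP[t0 tT].
have tI : tau \in `[0, T] by rewrite in_itv/= !ltW.
have {h} := h tI.
have ix : leb.-integrable `]0, tau[ (EFin \o (fun t => xi t * D t)).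
  apply: integrableS integrable_xi_defect => //.
  by move=> t /=; rewrite !in_itv/= => /andP[-> b]; rewrite (lt_trans b).
have -> : (\int[leb]_(t in `]0%R, tau[) (xi t * D t)%:E = (\int[leb]_(t in `]0, tau[) (xi t * D t))%R%:E)%E.
  by rewrite /Rintegral fineK//; exact: (integrable_fin_num (@mI tau) ix).
have a0 := defect_variation_ge0 muC (ccylinder N tau).
have b0 := defect_variation_ge0 muM (ccylinder N tau).
move: a0 b0; case: (Defs.total_variation muC _) => [a| |]//; case: (Defs.total_variation muM _) => [b| |]//=.
by rewrite -EFinD lee_fin !ltry.
Qed.

(** The weak identity with cut-offs shrinking to a common left Lebesgue point of [Lam] and [Gam];
    the bound on the defect does not depend on the cut-off. *)
Lemma Lam_increment : {ae leb, forall tau : R, 0 < tau < T ->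
  `|Lam tau - Lam0 - \int[leb]_(t in `]0, tau[) Gam t| <=
  defect_constant N M * \int[leb]_(t in `]0, tau[) (xi t * D t)}.
Proof.
have iLG T' := @integrable_Lam_Gam R N p T Y Y0 wd U Pi tU tP T'.
have pL := ae_left_lebesgue_pt T0 (fun T' a b => (iLG T' a b).1).
have pG := ae_left_lebesgue_pt T0 (fun T' a b => (iLG T' a b).2).
have pLG := ae_S2 (fun _ x y => conj x y) pL pG.
apply: ae_S2 pLG total_variations_le => tau [hL hG] tv tauT; have /andP[tau0 tT] := tauT.
have [iL iG] := iLG tau tau0 tT; have {}hL := hL tauT; have {}hG := hG tauT.
have [fC fM tvle] := tv tauT.
have c0 : 0 <= defect_constant N M by rewrite mulr_ge0 ?addr_ge0 ?mulr_ge0 ?sqr_ge0.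
apply: (@le_trans _ _ (defect_constant N M * (fine (Defs.total_variation muC (ccylinder N tau)) +
    fine (Defs.total_variation muM (ccylinder N tau))))); last by rewrite ler_wpM2l.
apply/ler_addgt0Pr => e e0; have e20 : 0 < e / 2 by rewrite divr_gt0.
have [s [s' [ss ds [s0 s1] sb [b1 b2]]]] := cutoff_limit tau0 iL iG hL hG e20.
have cs' : continuous s'.
  have [g sg dg] := smooth1_derive ss.
  rewrite (_ : s' = g); first exact: smooth1_continuous.
  by apply/funext => t; have [_ <-] := ds t; have [_ ->] := dg t.
have wi := weak_identity wd (dmv_continuity sol) (dmv_momentum sol) tU tP divU tau0 tT ss ds cs' s0 s1.
have db := defect_term_bound tU tP M0 hM tT ss s0 sb fC fM.
rewrite -/(defect_constant N M) in db.
move: b1 b2 db wi; set a := \int[_]_(_ in _) (s' _ * _); set b := \int[_]_(_ in _) (s _ * _).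
set G := \int[_]_(_ in _) Gam _; set df := defect_term _ _ _ _ _ _; set V := defect_constant N M * _.
move=> b1 b2 db wi.
(* The weak identity reads [a + b = - Lam0 + df]; the cut-off makes [a + Lam tau] and [b - G] at
   most [e / 2] each. *)
have -> : Lam tau - Lam0 - G = (a + Lam tau) + (b - G) - df by lra.
apply: (le_trans (ler_normB _ _)); rewrite addrC lerD//.
apply: (le_trans (ler_normD _ _)); lra.
Qed.

(** [2 * C * deviation] pays for exchanging [Lam] with the relative energy at [tau] and at 0, and
    [T * consistency_error] for the integral of [Gam]. *)
Definition initial_error : R := slice_rel_energy p rhob eps Y0 (velocity_at 0) +
  2 * C * deviation + T * consistency_error.

Theorem relative_energy_inequality : {ae leb, forall tau : R, 0 < tau < T ->
  K tau + D tau <= initial_error + \int[leb]_(t in `]0, tau[) (growth_rate N M xi t * (K t + D t))}.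
Proof.
have B0 : 0 <= rel_energy_bound.
  have e0 : 0 <= E Y0 by exact: slice_energy_ge0.
  have dv := deviation_ge0.
  have m1 : 0 <= rhob * 2 ^+ N + deviation by rewrite addr_ge0// mulr_ge0 ?(ltW rhob0)// exprn_ge0.
  by rewrite addr_ge0 ?mulr_ge0 ?sqr_ge0// mulr_ge0 ?sqr_ge0.
have c0 : 0 <= defect_constant N M by rewrite mulr_ge0 ?addr_ge0 ?mulr_ge0 ?sqr_ge0.
have gE := ae_good_time.
apply: ae_S2 gE Lam_increment => tau g inc tauT; have {}g := g tauT; have {}inc := inc tauT.
have /andP[tau0 tT] := tauT.
have JT : `]0, tau[ `<=` (`]0, T[ : set R).
  by move=> t /=; rewrite !in_itv/= => /andP[-> b]; rewrite (lt_trans b).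
have ic c : leb.-integrable `]0, tau[ (EFin \o (fun=> c)).
  apply: integrableS (continuous_compact_integrable (f := fun=> c) (@segment_compact R 0 tau) _) => //.
    exact: subset_itv_oo_cc.
  by apply: continuous_subspaceT => z; exact: cvg_cst.
have iG := (integrable_Lam_Gam wd tU tP tau0 tT).2.
have mK : measurable_fun (`]0, tau[ : set (measurableTypeR R)) K.
  by apply: measurable_funS measurable_rel_energy_at.
have mD : measurable_fun (`]0, tau[ : set (measurableTypeR R)) D.
  by apply: measurable_funS (dmv_defect_measurable sol).
have gJ : {ae leb, forall t, `]0, tau[%classic t -> [/\ 0 <= K t, K t <= rel_energy_bound, 0 <= D t & D t <= E Y0] /\
    `|Gam t| <= consistency_error + 2 * N%:R * M * K t}.
  apply: ae_S ae_good_time => t ht /JT /= tI; rewrite in_itv/= in tI.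
  have gt := ht tI; have [_ /andP[d0 d1]] := energy_le_initial gt.
  have /andP[k0 k1] := rel_energy_at_bounds tI gt; split => //; exact: Gam_bound.
have iK : leb.-integrable `]0, tau[ (EFin \o K).
  rewrite (_ : K = fun t => 1 * K t); last by apply/funext => t; rewrite mul1r.
  apply: (integrable_ae_bounded_mul (B := rel_energy_bound) (@mI tau) (ic 1) mK).
  by apply: ae_S gJ => t ht tJ; have [[a b _ _] _] := ht tJ; rewrite ger0_norm.
have ixD : leb.-integrable `]0, tau[ (EFin \o (fun t => xi t * D t)).
  exact: integrableS integrable_xi_defect.
have ik : leb.-integrable `]0, tau[ (EFin \o growth_rate N M xi).
  apply: integrableRD => //; apply: integrableRZl => //; apply: integrableR_norm.
  exact: integrableS hxi.
have iX : leb.-integrable `]0, tau[ (EFin \o (fun t => growth_rate N M xi t * (K t + D t))).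
  apply: (integrable_ae_bounded_mul (B := rel_energy_bound + E Y0) (@mI tau) ik).
    exact: measurable_funD.
  apply: ae_S gJ => t ht tJ; have [[a b c d'] _] := ht tJ.
  by rewrite ger0_norm ?addr_ge0// lerD.
have hG : `|\int[leb]_(t in `]0, tau[) Gam t| <= T * consistency_error +
    \int[leb]_(t in `]0, tau[) (2 * N%:R * M * K t).
  apply: (le_trans (le_normr_Rintegral (@mI tau) iG)).
  apply: (@le_trans _ _ (\int[leb]_(t in `]0, tau[) (consistency_error + 2 * N%:R * M * K t))).
    apply: ae_le_Rintegral => //; first exact: integrableR_norm iG.
      by apply: integrableRD => //; exact: integrableRZl.
    by apply: ae_S gJ => t ht tJ; have [_ h] := ht tJ.
  rewrite RintegralD//; last exact: integrableRZl.
  rewrite lerD2r Rintegral_cst// mulrC ler_wpM2r ?consistency_error_ge0//=.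
  by rewrite lebesgue_measure_itv/= lte_fin tau0 -EFinD /= subr0 ltW.
have hX : \int[leb]_(t in `]0, tau[) (2 * N%:R * M * K t) +
    defect_constant N M * \int[leb]_(t in `]0, tau[) (xi t * D t) <=
    \int[leb]_(t in `]0, tau[) (growth_rate N M xi t * (K t + D t)).
  rewrite -RintegralZl// -RintegralD//; last 2 first.
  - exact: integrableRZl.
  - exact: integrableRZl.
  apply: ae_le_Rintegral => //.
    by apply: integrableRD => //; exact: integrableRZl.
  apply: ae_S gJ => t ht tJ; have [[a b c d'] _] := ht tJ.
  rewrite /growth_rate [leRHS]mulrDl; apply: lerD.
    by rewrite ler_wpM2l ?lerDl// mulr_ge0// mulr_ge0.
  rewrite mulrA; apply: (@le_trans _ _ (defect_constant N M * `|xi t| * D t)).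
    by rewrite ler_wpM2r// ler_wpM2l// ler_norm.
  by rewrite ler_wpM2l ?lerDr// mulr_ge0.
(* [K - E - Lam] is small at [tau] and at 0, the increment of [Lam] is estimated above, and the
   energy inequality bounds [E (Y tau) + D tau] by [E Y0]; the claim is the sum of these. *)
have [_ _ en _ _] := g.
have k1 := rel_energy_Lam tauT g; have k0 := rel_energy_Lam0.
rewrite /initial_error.
move: k1 k0 inc hG hX; rewrite !ler_norml.
set G := \int[_]_(_ in _) Gam _; set I1 := \int[_]_(_ in _) (2 * _ * _ * _).
set I2 := defect_constant N M * _; set I3 := \int[_]_(_ in _) (growth_rate _ _ _ _ * _).
set Cd' := C * deviation; rewrite -[2 * C * deviation]mulrA -/Cd'.
move=> /andP[_ k1] /andP[k0 _] /andP[_ inc] /andP[_ hG] hX; lra.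
Qed.

End relative_energy_inequality.

Lemma initial_slice_estimate {R : realType} {N : nat} (p : R -> R) (rhob T eps : R)
    (Y : young R N) (Y0 : young0 R N) D muC muM (V : 'rV[R]_N -> 'rV[R]_N) (B : R) :
  pressure_law p -> 0 < rhob -> dmv_solution p rhob T eps Y Y0 D muC muM ->
  {ae lebesgue_rV R N, forall x, torus N x -> forall i, `|V x ord0 i| <= B} ->
  (\int[lebesgue_rV R N]_(x in torus N)
     \int[Y0 x]_(q in phase N) rel_energy p rhob eps (V x) q < +oo)%E ->
  slice_ok p rhob eps Y0 /\
  ((slice_energy p rhob eps Y0)%:E <= 2%:E * (\int[lebesgue_rV R N]_(x in torus N)
     \int[Y0 x]_(q in phase N) rel_energy p rhob eps (V x) q) +
   (N%:R * B ^+ 2 * \int[lebesgue_rV R N]_(x in torus N) mass (Y0 x))%:E)%E.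
Proof.
move=> hp rhob0 sol VB Jfin; have [Y1 Ym] := dmv_young0 sol.
have [[_ [a1 i1]] h2 _ _ _] := dmv_well_defined sol.
have a2 : {ae lebesgue_rV R N, forall x, forall i : 'I_N, torus N x ->
    (Y0 x).-integrable (phase N) (EFin \o (fun q : R * 'rV[R]_N => q.2 ord0 i))}.
  by apply: ae_forall_fin => i; have [_ []] := h2 i.
have hm : {ae lebesgue_rV R N, forall x, torus N x -> has_moments (Y0 x)}.
  apply: filterS2 a1 a2 => x b1 b2 Xx; split; [exact: Y1|exact: b1|by move=> i; exact: b2].
have mE : measurable_fun (torus N) (fun x => young_energy p rhob eps (Y0 x)).
  by apply: measurable_young_energy => //; exact: measurable_torus.
have i2 i : (lebesgue_rV R N).-integrable (torus N) (EFin \o (fun x => momentum (Y0 x) i)).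
  by have [_ []] := h2 i.
have [ok le] := slice_ok_of_rel_energy hp rhob0 mE hm i1 i2 VB Jfin.
by split => //; rewrite -(slice_energyE hp rhob0 ok).
Qed.

(** * Stability estimate after Gronwall's inequality *)

Section stability.
Context {R : realType} {N : nat}.
Local Notation leb := (@lebesgue_measure R).
Local Notation mu := (lebesgue_rV R N).
Local Notation X := (torus N : set 'rV[R]_N).
Variables (p : R -> R) (rhob eps T : R) (Y : young R N) (Y0 : young0 R N) (D : R -> R)
  (muC : 'I_N -> defect R N) (muM : 'I_N * 'I_N -> defect R N) (xi : R -> R).
Hypotheses (hp : pressure_law p) (rhob0 : 0 < rhob) (eps0 : 0 < eps) (T0 : 0 < T)
  (sol : dmv_solution p rhob T eps Y Y0 D muC muM) (hxi : L1_interval T xi)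
  (hcompat : compatibility T xi D muC muM) (ok0 : slice_ok p rhob eps Y0).
Variables (U : 'I_N -> R * 'rV[R]_N -> R) (Pi : R * 'rV[R]_N -> R) (M eta C : R).
Hypotheses (tU : forall i, tfun (U i)) (tP : tfun Pi) (divU : forall z, \sum_i dx i (U i) z = 0)
  (M0 : 0 <= M) (eta0 : 0 <= eta) (C0 : 0 <= C)
  (hM : forall t x, 0 <= t <= T -> [/\ (forall i, `|U i (t, x)| <= M),
       (forall i j, `|dx j (U i) (t, x)| <= M) & (forall j, `|dx j Pi (t, x)| <= M)])
  (hR : forall t, 0 <= t <= T -> {ae mu, forall x, X x -> forall i,
     `|dt (U i) (t, x) + \sum_j U j (t, x) * dx j (U i) (t, x) + dx i Pi (t, x)| <= eta})
  (hI : forall t, \int[mu]_(x in X) (\sum_i U i (t, x) * dx i Pi (t, x)) = 0 /\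
      \int[mu]_(x in X) dt Pi (t, x) = 0 /\ \int[mu]_(x in X) Pi (t, x) = 0)
  (hC : forall t x, 0 <= t <= T -> `|Pi (t, x)| <= C /\ `|dt Pi (t, x)| <= C).
Variables (d Cd : R).
Hypotheses (Cd0 : 0 <= Cd) (hd : forall r, 0 <= r -> `|r - rhob| <= d + Cd * rel_potential p rhob r).
Variables (v : R -> 'rV[R]_N -> 'rV[R]_N) (Cg : R).
Hypotheses (Uv : forall t, 0 <= t <= T -> {ae mu, forall x, X x -> forall i,
     `|U i (t, x) - v t x ord0 i| <= eta})
  (hCg : forall (Z : R -> R) (A B : R), 0 <= A ->
    measurable_fun (`]0, T[ : set (measurableTypeR R)) Z ->
    {ae leb, forall t : R, 0 < t < T -> 0 <= Z t <= B} ->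
    {ae leb, forall tau : R, 0 < tau < T ->
      Z tau <= A + \int[leb]_(t in `]0, tau[) (growth_rate N M xi t * Z t)} ->
    {ae leb, forall tau : R, 0 < tau < T -> Z tau <= Cg * A}).
Local Notation A := (initial_error p rhob eps T Y0 U M eta C d Cd).
Local Notation dev := (deviation p rhob eps Y0 d Cd).

Lemma initial_error_ge0 : 0 <= A.
Proof.
have dv : 0 <= dev by exact: (deviation_ge0 hp rhob0 eps0 ok0 Cd0 hd).
have ce := consistency_error_ge0 hp rhob0 eps0 ok0 M0 eta0 C0 Cd0 hd.
have tI : (0 : R) <= 0 <= T by rewrite lexx ltW.
have k0 := slice_rel_energy_ge0 hp rhob0 ok0 (velocity_bounded tU hM tI).
by rewrite addr_ge0 ?(mulr_ge0 (ltW T0) ce)// addr_ge0// mulr_ge0// mulr_ge0.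
Qed.

(** Gronwall is applied to the sum of the relative energy and the defect; both summands are
    nonnegative, so each inherits the bound. Only then is [U] exchanged for [v]. *)
Lemma stability_estimate : {ae leb, forall t : R, 0 < t < T -> 0 <= D t <= Cg * A /\
  (\int[mu]_(x in X) \int[Y t x]_(q in phase N) rel_energy p rhob eps (v t x) q <=
    (2 * (Cg * A) + N%:R * eta ^+ 2 * (rhob * 2 ^+ N + dev))%:E)%E}.
Proof.
have gt := ae_good_time hp rhob0 T0 sol ok0.
pose K := rel_energy_at p rhob eps Y U.
have mK : measurable_fun (`]0, T[ : set (measurableTypeR R)) K.
  exact: (measurable_rel_energy_at hp rhob0 T0 sol tU).
have mZ : measurable_fun (`]0, T[ : set (measurableTypeR R)) (fun t => K t + D t).
  by apply: measurable_funD => //; exact: dmv_defect_measurable sol.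
have bd : {ae leb, forall t : R, 0 < t < T ->
    0 <= K t + D t <= rel_energy_bound p rhob eps Y0 M d Cd + slice_energy p rhob eps Y0}.
  apply: ae_S gt => t g tT; have {}g := g tT.
  have [_ /andP[a b]] := energy_le_initial hp rhob0 g.
  have /andP[k0 k1] := rel_energy_at_bounds hp rhob0 eps0 tU hM Cd0 hd tT g.
  by rewrite addr_ge0//= lerD.
have Zle := hCg initial_error_ge0 mZ bd (relative_energy_inequality hp rhob0 eps0 T0 sol hxi hcompat ok0
  tU tP divU M0 eta0 C0 hM hR hI hC Cd0 hd).
apply: ae_S2 gt Zle => t g z tT; have {}g := g tT; have {}z := z tT.
have /andP[t0 t1] := tT; have tI : 0 <= t <= T by rewrite !ltW.
have [le /andP[a b]] := energy_le_initial hp rhob0 g.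
have /andP[k0 k1] := rel_energy_at_bounds hp rhob0 eps0 tU hM Cd0 hd tT g.
have [okt _ _ _ _] := g.
split; first by rewrite a /=; apply: le_trans z; rewrite lerDr.
apply: (le_trans (rel_energy_le_slice hp rhob0 okt (velocity_bounded tU hM tI) (Uv tI))).
rewrite lee_fin; apply: lerD; rewrite ler_wpM2l//.
- by apply: le_trans z; rewrite lerDl.
- by rewrite mulr_ge0 ?sqr_ge0.
- exact: (slice_mass_le hp rhob0 eps0 Cd0 hd okt le).
Qed.

End stability.

(** * The low Mach number limit *)

Section extended_limits.
Context {R : realType}.
Local Notation leb := (@lebesgue_measure R).

Lemma cvge0_squeeze (F : R -> \bar R) :
  (forall e : R, 0 < e -> \forall eps \near 0^'+, (0 <= F eps <= e%:E)%E) ->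
  F eps @[eps --> 0^'+] --> (0 : \bar R)%E.
Proof.
move=> h; apply/fine_cvgP; split.
  apply: filterS (h 1 ltr01) => eps /andP[a b].
  by rewrite ge0_fin_numE// (le_lt_trans b)// ltry.
apply/cvgrPdist_le => e e0; apply: filterS (h e e0) => eps /andP[a b] /=.
have f : F eps \is a fin_num by rewrite ge0_fin_numE// (le_lt_trans b)// ltry.
rewrite sub0r normrN ger0_norm ?fine_ge0//.
by rewrite -lee_fin fineK.
Qed.

Lemma near_sqr_le (a b : R) : 0 <= a -> 0 < b -> \forall eps \near (0 : R)^'+, a * eps ^+ 2 <= b.
Proof.
move=> a0 b0; have c0 : 0 < Num.min 1 (b / (a + 1)) by rewrite lt_min ltr01 divr_gt0// ltr_wpDl.
near=> eps.
have e0 : 0 < eps by near: eps; exact: nbhs_right_gt.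
have : eps < Num.min 1 (b / (a + 1)) by near: eps; exact: nbhs_right_lt.
rewrite lt_min => /andP[e1 eb].
have a1 : 0 < a + 1 by rewrite ltr_wpDl.
rewrite ltr_pdivlMr// in eb.
have : a * eps ^+ 2 <= a * eps by rewrite ler_wpM2l// expr2 -[leRHS]mul1r ler_wpM2r ?(ltW e0)// ltW.
by move=> /le_trans; apply; rewrite mulrDr mulr1 mulrC in eb; lra.
Unshelve. all: by end_near.
Qed.

Lemma ae_lebesgue_itv (T : R) (P : R -> Prop) : {ae leb, forall t : R, 0 < t < T -> P t} ->
  {ae lebesgue_itv T, forall t, P t}.
Proof.
move=> [A [mA A0 PA]]; exists (A `|` ~` `]0, T[%classic); split.
- by apply: measurableU => //; exact: measurableC.
- rewrite /lebesgue_itv /= /mrestr setIUl setICl setU0.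
  apply/eqP; rewrite eq_le measure_ge0 andbT -A0.
  by apply: le_measure; rewrite ?inE//; exact: measurableI.
- move=> t nP; have [tI|tI] := pselect (`]0, T[%classic t); last by right.
  left; apply: PA => h; apply: nP; apply: h.
  by move: tI; rewrite /= in_itv.
Qed.

Lemma lebesgue_itv_gt0 (T : R) : 0 < T -> (0 < lebesgue_itv T setT)%E.
Proof.
move=> T0; rewrite /lebesgue_itv /= /mrestr setTI lebesgue_measure_itv/= lte_fin T0.
by rewrite -EFinD lte_fin subr0.
Qed.

Lemma ess_sup_itv_bounds (T e : R) (f : R -> \bar R) : 0 < T -> (forall t, 0 <= f t)%E ->
  {ae leb, forall t : R, 0 < t < T -> (f t <= e%:E)%E} -> (0 <= ess_sup_itv T f <= e%:E)%E.
Proof.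
move=> T0 f0 fe; apply/andP; split.
  by apply: ess_sup_gee; [exact: lebesgue_itv_gt0|exact: nearW].
by apply/ess_supP; exact: ae_lebesgue_itv.
Qed.

Lemma Linfty_norm_bounds (T e : R) (f : R -> \bar R) : 0 < T ->
  {ae leb, forall t : R, 0 < t < T -> (0 <= f t <= e%:E)%E} -> (0 <= Linfty_norm T f <= e%:E)%E.
Proof.
move=> T0 fe; rewrite /Linfty_norm unlock /= lebesgue_itv_gt0//.
apply: ess_sup_itv_bounds => // [t|]; first exact: abse_ge0.
apply: ae_S fe => t h tT /=; by have /andP[a b] := h tT; rewrite gee0_abs.
Qed.

End extended_limits.
Theorem theorem3p1 (R : realType) (N : nat) (hN : N = 2%N \/ N = 3%N)
    (p : R -> R) (hp : pressure_law p)
    (rhob : R) (hrhob : 0 < rhob)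
    (k : nat) (hk : N%:R / 2 + 1 < k%:R :> R)
    (v0 : 'rV[R]_N -> 'rV[R]_N)
    (hv0 : forall i, sobolev k (fun x => v0 x ord0 i))
    (hdiv0 : divfree v0)
    (Tmax : \bar R) (v : R -> 'rV[R]_N -> 'rV[R]_N)
    (hv : maximal_kato_solution k v0 Tmax v)
    (T : R) (hT : 0 < T) (hTmax : (T%:E < Tmax)%E)
    (Y : R -> young R N) (Y0 : R -> young0 R N) (D : R -> R -> R)
    (muC : R -> 'I_N -> defect R N) (muM : R -> 'I_N * 'I_N -> defect R N)
    (hdmv : forall eps, 0 < eps ->
      dmv_solution p rhob T eps (Y eps) (Y0 eps) (D eps) (muC eps) (muM eps))
    (xi : R -> R) (hxi : L1_interval T xi)
    (hcompat : forall eps, 0 < eps ->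
      compatibility T xi (D eps) (muC eps) (muM eps))
    (hwell_prepared :
      (\int[lebesgue_rV R N]_(x in torus N)
         \int[Y0 eps x]_(q in phase N) rel_energy p rhob eps (v0 x) q)%E
        @[eps --> 0^'+] --> (0 : \bar R)%E) :
  Linfty_norm T (EFin \o D eps) @[eps --> 0^'+] --> (0 : \bar R)%E /\
  ess_sup_itv T (fun t => \int[lebesgue_rV R N]_(x in torus N)
       \int[Y eps t x]_(q in phase N) rel_energy p rhob eps (v t x) q)%E
    @[eps --> 0^'+] --> (0 : \bar R)%E.
Proof.
(* Both limits follow from one bound valid for almost every time. *)
suff main : forall e : R, 0 < e -> \forall eps \near 0^'+,
    {ae @lebesgue_measure R, forall t : R, 0 < t < T -> 0 <= D eps t <= e /\
      (\int[lebesgue_rV R N]_(x in torus N)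
         \int[Y eps t x]_(q in phase N) rel_energy p rhob eps (v t x) q <= e%:E)%E}.
  split; apply: cvge0_squeeze => e e0; apply: filterS (main e e0) => eps h.
    apply: Linfty_norm_bounds => //; apply: ae_S h => t ht tT; have [d1 _] := ht tT.
    by rewrite /= !lee_fin.
  apply: ess_sup_itv_bounds => // [t|].
    apply: integral_ge0 => x _; apply: integral_ge0 => q; exact: rel_energy_ge0.
  by apply: ae_S h => t ht tT; have [] := ht tT.
have n3 : (N <= 3)%N by case: hN => ->.
have k3 : (3 <= k)%N.
  rewrite leqNgt; apply/negP; rewrite ltnS => k2.
  have : k%:R <= 2 :> R by rewrite (ler_nat R k 2).
  by case: hN hk => ->; lra.
have [_ ks _] := hv.
have v00 : {ae lebesgue_rV R N, forall x, torus N x -> v 0 x = v0 x}.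
  by have [Pi [Pit [vt [_ _ _ _ [_ _ h]]]]] := ks.
have [M M0 happrox] := kato_approx n3 k3 hT hTmax ks.
have c0 : 0 <= defect_constant N M by rewrite mulr_ge0 ?addr_ge0 ?mulr_ge0 ?sqr_ge0.
have ikap : lebesgue_measure.-integrable `]0, T[ (EFin \o growth_rate N M xi).
  apply: integrableRD => //; last by apply: integrableRZl => //; exact: integrableR_norm hxi.
  apply: integrableS (continuous_compact_integrable (f := fun=> _) (@segment_compact R 0 T) _) => //.
    exact: subset_itv_oo_cc.
  by apply: continuous_subspaceT => z; exact: cvg_cst.
have kap0 t : 0 < t < T -> 0 <= growth_rate N M xi t.
  by move=> _; apply: addr_ge0; rewrite mulr_ge0// mulr_ge0.
(* Fixed before [e], since it depends on [T], [N], [M] and [xi] only. *)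
have [Cg Cg0 hCg] := gronwall hT ikap kap0.
have T01 : 0 <= (0 : R) <= T by rewrite lexx ltW.
(* Any approximation of accuracy 1 is bounded by [M] at time 0. *)
have vB : {ae lebesgue_rV R N, forall x, torus N x -> forall i, `|v0 x ord0 i| <= M + 1}.
  have [U [Pi [_ _ hM hv1 _]]] := happrox 1 ltr01.
  apply: filterS2 v00 (hv1 0 T01) => x h1 h2 Xx i; rewrite -h1//.
  have [h3 _] := h2 Xx i; have [h4 _ _] := hM 0 x T01.
  rewrite -[v 0 x ord0 i](subrK (U i (0, x))) addrC.
  by apply: (le_trans (ler_normD _ _)); rewrite lerD// distrC.
(* A first use of coercivity with tolerance 1 bounds the initial mass and energy uniformly in [eps];
   the fine tolerance [d] comes later. *)
have [C1 C10 hC1] := rel_potential_coercive hp hrhob ltr01.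
pose vol : R := 2 ^+ N; have vol0 : 0 < vol by rewrite exprn_gt0.
pose c : R := N%:R * (M + 1) ^+ 2; have cc0 : 0 <= c by rewrite mulr_ge0 ?sqr_ge0.
(* From [E0 <= 2 J + c m0] and [m0 <= (rhob + 1) vol + C1 eps^2 E0], with [J <= 1] and
   [c C1 eps^2 <= 1/2] so that half of [E0] is absorbed. *)
pose Ebar : R := 4 + 2 * (c * (rhob + 1) * vol).
have Ebar0 : 0 <= Ebar by rewrite addr_ge0// !mulr_ge0 ?addr_ge0 ?(ltW hrhob) ?(ltW vol0).
pose mbar : R := (rhob + 1) * vol + 1.
have mbar0 : 0 <= mbar by rewrite addr_ge0// mulr_ge0 ?addr_ge0 ?(ltW hrhob) ?(ltW vol0).
move=> e e0.
(* The final bound is at most [2 * Cg * 5 e' + e'], which the factor 8 in [e'] keeps below [e]. *)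
pose Q : R := 2 * Cg + 1; have Q0 : 0 < Q by rewrite ltr_wpDl// mulr_ge0.
pose e' := e / (8 * Q); have e'0 : 0 < e' by rewrite divr_gt0// mulr_gt0.
(* A bound for the total coefficient of [eta] in the initial error: exchange of [v0] for [U], and
   the residual integrated over [(0, T)]. *)
pose a1 : R := N%:R * mbar + T * (N%:R * ((M + 1) * mbar + Ebar)).
have a10 : 0 <= a1.
  have h : 0 <= (M + 1) * mbar + Ebar by rewrite addr_ge0// mulr_ge0// addr_ge0.
  by rewrite addr_ge0 ?mulr_ge0// ltW.
pose eta := Num.min 1 (e' / (a1 + 1)).
have a11 : 0 < a1 + 1 by rewrite ltr_wpDl.
have eta0 : 0 < eta by rewrite lt_min ltr01 divr_gt0.
have eta1 : eta <= 1 by rewrite ge_min lexx.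
have eta_a1 : eta * a1 <= e'.
  have : eta * (a1 + 1) <= e' by rewrite -ler_pdivlMr// ge_min lexx orbT.
  by move: eta0; rewrite mulrDr mulr1; clear; lra.
have [U [Pi [[tU tP] divU hM hv1 hI]]] := happrox eta eta0.
have [B1 B10 hB1] := tfun_bounded 0 T tP.
have [B2 B20 hB2] := tfun_bounded 0 T (tfun_dt tP).
pose C := B1 + B2; have C0 : 0 <= C by rewrite addr_ge0.
have hC t x : 0 <= t <= T -> `|Pi (t, x)| <= C /\ `|dt Pi (t, x)| <= C.
  move=> tT; split; first by apply: (le_trans (hB1 t x tT)); rewrite lerDl.
  by apply: (le_trans (hB2 t x tT)); rewrite lerDr.
(* The coefficient of the deviation in the initial error. It contains [C], hence depends on the
   chosen [U] and [Pi], so [d] is chosen after them. *)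
pose a2 : R := 2 * C + T * (N%:R * M ^+ 2 + C).
have a20 : 0 <= a2 by rewrite addr_ge0 ?mulr_ge0 ?addr_ge0 ?mulr_ge0 ?sqr_ge0 ?(ltW hT).
have a21 : 0 < a2 + 1 by rewrite ltr_wpDl.
pose d := Num.min 1 (e' / ((a2 + 1) * vol)).
have d0 : 0 < d by rewrite lt_min ltr01 divr_gt0// mulr_gt0.
have d1 : d <= 1 by rewrite ge_min lexx.
have d_a2 : a2 * (d * vol) <= e'.
  have : d * ((a2 + 1) * vol) <= e' by rewrite -ler_pdivlMr ?mulr_gt0// ge_min lexx orbT.
  have : 0 <= d * vol by rewrite mulr_ge0 ?ltW.
  have -> : d * ((a2 + 1) * vol) = a2 * (d * vol) + d * vol by ring.
  by clear; lra.
have [Cd Cd0 hd] := rel_potential_coercive hp hrhob d0.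
have m1 : 0 < Num.min 1 (d * vol) by rewrite lt_min ltr01 mulr_gt0.
have m2 : 0 < Num.min 1 e' by rewrite lt_min ltr01.
pose Jx (eps : R) : \bar R := (\int[lebesgue_rV R N]_(x in torus N)
         \int[Y0 eps x]_(q in phase N) rel_energy p rhob eps (v0 x) q)%E.
have [Jfin /cvgrPdist_le/(_ _ m2) Jle] := (fine_cvgP _ _).1 hwell_prepared.
have cC1 : 0 <= c * C1 by rewrite mulr_ge0.
have half0 : 0 < 2^-1 :> R by [].
near=> eps.
have eps0 : 0 < eps by near: eps; exact: nbhs_right_gt.
have n1 : c * C1 * eps ^+ 2 <= 2^-1 by near: eps; exact: near_sqr_le.
have n2 : Cd * Ebar * eps ^+ 2 <= Num.min 1 (d * vol).
  by near: eps; apply: near_sqr_le => //; rewrite mulr_ge0.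
have sol := hdmv eps eps0; have cmp := hcompat eps eps0.
have Jf : Jx eps \is a fin_num by near: eps; exact: Jfin.
have Jb : `|0 - fine (Jx eps)| <= Num.min 1 e' by near: eps; exact: Jle.
pose J := fine (Jx eps); have JE : Jx eps = J%:E by rewrite fineK.
have {Jb} [J1 Je] : J <= 1 /\ J <= e'.
  have : J <= Num.min 1 e' by rewrite (le_trans (ler_norm _))// -normrN -sub0r.
  by rewrite le_min => /andP[].
have Jfin' : (Jx eps < +oo)%E by rewrite JE ltry.
have [ok0 E0le] := initial_slice_estimate hp hrhob sol vB Jfin'.
rewrite -/(Jx eps) JE -EFinM -EFinD lee_fin in E0le.
set E0 := slice_energy p rhob eps (Y0 eps) in E0le.
have E00 : 0 <= E0 by exact: slice_energy_ge0.
have mass1 := slice_mass_bound hp hrhob eps0 ok0 C10 hC1.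
rewrite -/E0 -/vol mul1r in mass1.
set m0 := \int[_]_(_ in _) _ in E0le mass1.
(* Absorption: [n1] leaves only half of [E0] on the right. *)
have E0bar : E0 <= Ebar.
  have : c * m0 <= c * (rhob * vol + (vol + C1 * eps ^+ 2 * E0)) by rewrite ler_wpM2l.
  have : c * C1 * eps ^+ 2 * E0 <= 2^-1 * E0 by rewrite ler_wpM2r.
  move: E0le; rewrite -/c /Ebar.
  have -> : c * (rhob * vol + (vol + C1 * eps ^+ 2 * E0)) =
    c * (rhob + 1) * vol + c * C1 * eps ^+ 2 * E0 by ring.
  by move: J1; clear; lra.
pose dev := deviation p rhob eps (Y0 eps) d Cd.
have devE : dev = d * vol + Cd * eps ^+ 2 * E0 by [].
have CdE : Cd * eps ^+ 2 * E0 <= Num.min 1 (d * vol).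
  apply: le_trans n2; rewrite [leRHS]mulrAC ler_wpM2l// mulr_ge0 ?sqr_ge0//.
have [CdE1 CdE2] : Cd * eps ^+ 2 * E0 <= 1 /\ Cd * eps ^+ 2 * E0 <= d * vol.
  by move: CdE; rewrite le_min => /andP[].
have dev0 : 0 <= dev by rewrite devE addr_ge0// !mulr_ge0 ?sqr_ge0 ?(ltW d0) ?(ltW vol0).
have dev_a2 : a2 * dev <= 2 * e'.
  have : a2 * dev <= a2 * (2 * (d * vol)) by rewrite ler_wpM2l// devE; move: CdE2; clear; lra.
  have -> : a2 * (2 * (d * vol)) = 2 * (a2 * (d * vol)) by ring.
  by move: d_a2; clear; lra.
have mb : rhob * vol + dev <= mbar.
  have : d * vol <= 1 * vol by rewrite ler_wpM2r// ltW.
  by rewrite devE /mbar; move: CdE1; clear; lra.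
have m0b : m0 <= mbar.
  have := slice_mass_bound hp hrhob eps0 ok0 Cd0 hd; rewrite -/m0 -/E0 -/vol -devE.
  by move=> /le_trans; apply.
have m00 : 0 <= m0 by exact: slice_mass_ge0.
have Uv t : 0 <= t <= T -> {ae lebesgue_rV R N, forall x, torus N x -> forall i,
     `|U i (t, x) - v t x ord0 i| <= eta}.
  by move=> tT; apply: filterS (hv1 t tT) => x h Xx i; have [] := h Xx i.
have hR t : 0 <= t <= T -> {ae lebesgue_rV R N, forall x, torus N x -> forall i,
     `|dt (U i) (t, x) + \sum_j U j (t, x) * dx j (U i) (t, x) + dx i Pi (t, x)| <= eta}.
  by move=> tT; apply: filterS (hv1 t tT) => x h Xx i; have [] := h Xx i.
have Uv0 : {ae lebesgue_rV R N, forall x, torus N x -> forall i,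
     `|velocity_at U 0 i x - v0 x ord0 i| <= eta}.
  by apply: filterS2 (Uv 0 T01) v00 => x h1 h2 Xx i; rewrite -h2//; exact: h1.
have eta2 : eta ^+ 2 <= eta by rewrite expr2 -[leRHS]mulr1 ler_wpM2l// ltW.
have eta20 : 0 <= eta ^+ 2 by exact: sqr_ge0.
set K0 := slice_rel_energy p rhob eps (Y0 eps) (velocity_at U 0).
have K0le : K0 <= 2 * J + eta * (N%:R * mbar).
  have := slice_le_rel_energy hp hrhob ok0 (velocity_bounded tU hM T01) Uv0.
  rewrite -/(Jx eps) JE -EFinD lee_fin -/m0 -/K0.
  have : N%:R * eta ^+ 2 * m0 <= eta * (N%:R * mbar).
    rewrite [leRHS]mulrCA -mulrA ler_wpM2l//; exact: ler_pM.
  by rewrite -[2^-1 * _ * m0]mulrA; clear; lra.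
have est := stability_estimate hp hrhob eps0 hT sol hxi cmp ok0 tU tP divU M0 (ltW eta0) C0 hM hR hI hC
  Cd0 hd Uv hCg.
have A0 := initial_error_ge0 hp hrhob eps0 hT ok0 tU M0 (ltW eta0) C0 hM Cd0 hd.
set A := initial_error _ _ _ _ _ _ _ _ _ _ _ in est A0.
(* The five units: two from [2 * J], one from [eta * a1], two from [a2 * dev]. *)
have Ale : A <= 5 * e'.
  have -> : A = K0 + 2 * C * dev + T * (eta * (N%:R * ((M + 1) * (rhob * vol + dev) + E0)) +
    (N%:R * M ^+ 2 + C) * dev) by [].
  have h1 : (M + 1) * (rhob * vol + dev) + E0 <= (M + 1) * mbar + Ebar.
    by rewrite lerD// ler_wpM2l// addr_ge0.
  have h2 : T * (eta * (N%:R * ((M + 1) * (rhob * vol + dev) + E0))) <=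
      T * (eta * (N%:R * ((M + 1) * mbar + Ebar))).
    by rewrite ler_wpM2l ?(ltW hT)// ler_wpM2l ?(ltW eta0)// ler_wpM2l.
  have h3 : eta * a1 = eta * (N%:R * mbar) + T * (eta * (N%:R * ((M + 1) * mbar + Ebar))).
    by rewrite /a1; ring.
  have h4 : a2 * dev = 2 * C * dev + T * ((N%:R * M ^+ 2 + C) * dev) by rewrite /a2; ring.
  rewrite [T * (_ + _)]mulrDr; move: h2 h3 h4 K0le dev_a2 eta_a1 Je; clear; lra.
have CA : Cg * A <= Cg * (5 * e') by rewrite ler_wpM2l.
have CA0 : 0 <= Cg * e' by rewrite mulr_ge0// ltW.
have eQ : e = 16 * (Cg * e') + 8 * e'.
  by rewrite /e' /Q; field; move: Q0; rewrite /Q => /lt0r_neq0.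
have CA5 : Cg * (5 * e') = 5 * (Cg * e') by ring.
apply: ae_S est => t h tT; have [/andP[h1 h2] h3] := h tT; split.
  by rewrite h1 /=; apply: (le_trans h2); move: CA CA5 CA0 eQ e'0; clear; lra.
apply: (le_trans h3); rewrite lee_fin.
have h4 : N%:R * eta ^+ 2 * (rhob * 2 ^+ N + dev) <= eta * (N%:R * mbar).
  rewrite [leRHS]mulrCA -mulrA ler_wpM2l//; apply: ler_pM => //.
  by rewrite addr_ge0// mulr_ge0 ?(ltW hrhob) ?(ltW vol0).
have h5 : eta * (N%:R * mbar) <= eta * a1.
  rewrite ler_wpM2l ?(ltW eta0)// /a1 lerDl mulr_ge0 ?(ltW hT)// mulr_ge0//.
  by rewrite addr_ge0// mulr_ge0// addr_ge0.
by rewrite -/dev; move: h4 h5 eta_a1 CA CA5 CA0 eQ e'0; clear; lra.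
Unshelve. all: by end_near.
Qed.
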